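(* Let $M$ be an $n$-dimensional Cartan-Hadamard manifold whose sectional curvatures satisfy, for all $x\in M$ and all two-dimensional subspaces $\sigma\subset T_xM$, $\mathcal{K}(x;\sigma)\le -c_M<0$ for some constant $c_M>0$. Let $h:[0,\infty)\to[-\infty,\infty)$ be a non-decreasing lower semi-continuous function which satisfies either $$\limsup_{\theta\to0+}\left(h(\theta)-A_1\log\theta\right)<\infty\quad\text{for some } A_1>2n,$$ or $$\limsup_{\theta\to\infty}\left(h(\theta)-A_2\sqrt{c_M}\,\theta\right)<\infty\quad\text{for some } A_2<n-1.$$ Then the energy functional $E$ associated with $h$ admits no global minimizer in $\mathcal{P}_{ac}(M)$.
   Context: A Cartan-Hadamard manifold is a complete, simply connected Riemannian manifold with everywhere non-positive sectional curvature. $d$ denotes the geodesic distance on $M$, $\mathcal{K}(x;\sigma)$ the sectional curvature of $\sigma$ at $x$, and $\mathrm{d}x$ the Riemannian volume measure. $\mathcal{P}(M)$ is the set of Borel probability measures on $M$ and $\mathcal{P}_{ac}(M)\subset\mathcal{P}(M)$ the set of those absolutely continuous with respect to $\mathrm{d}x$, identified with their densities $\rho$. For $\rho\in\mathcal{P}_{ac}(M)$ the energy is $$E[\rho]=\int_M\rho(x)\log\rho(x)\,\mathrm{d}x+\frac12\iint_{M\times M}h(d(x,y))\rho(x)\rho(y)\,\mathrm{d}x\,\mathrm{d}y\in[-\infty,\infty].$$ A global minimizer of $E$ in $\mathcal{P}_{ac}(M)$ is understood to be a $\rho\in\mathcal{P}_{ac}(M)$ with finite energy such that $E[\rho]\le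 E[\sigma]$ for all $\sigma\in\mathcal{P}_{ac}(M)$; in particular, no global minimizer exists if $E$ is unbounded from below on $\mathcal{P}_{ac}(M)$. *)

(* Defs.v *)
From HB Require Import structures.
From mathcomp Require Import all_boot all_order all_algebra.
From mathcomp Require Import all_classical all_reals all_analysis.
Import Order.TTheory GRing.Theory Num.Theory.
Import numFieldNormedType.Exports.

Set Implicit Arguments.
Unset Strict Implicit.
Unset Printing Implicit Defensive.

Local Open Scope classical_set_scope.
Local Open Scope ring_scope.

Section Calculus.
Variables (R : realType) (n : nat).

Definition iterated_derive (W : normedModType R) (vs : seq 'rV[R]_n)
    (f : 'rV[R]_n -> W) : 'rV[R]_n -> W :=
  foldr (fun v g => 'D_v g) f vs.

(* C^oo on U; meant for open U, where only the restriction of f to U matters. *)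
Definition smooth_on (W : normedModType R) (U : set 'rV[R]_n)
    (f : 'rV[R]_n -> W) : Prop :=
  forall (vs : seq 'rV[R]_n) x, U x -> differentiable (iterated_derive vs f) x.

Definition partial (i : 'I_n) (f : 'rV[R]_n -> R) : 'rV[R]_n -> R :=
  'D_(delta_mx 0 i) f.

Definition bilin (G : 'M[R]_n) (u v : 'rV[R]_n) : R := (u *m G *m v^T) 0 0.

(* Gamma^k_{ij} *)
Definition christoffel (g : 'rV[R]_n -> 'M[R]_n) (k i j : 'I_n)
    (x : 'rV[R]_n) : R :=
  2^-1 * \sum_(l < n) invmx (g x) k l *
    (partial i (fun y => g y j l) x + partial j (fun y => g y i l) x
     - partial l (fun y => g y i j) x).

(* The l-th component of Rm(e_i, e_j) e_k, where
   Rm(X, Y) Z = D_X D_Y Z - D_Y D_X Z - D_[X, Y] Z. *)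
Definition riemann (g : 'rV[R]_n -> 'M[R]_n) (l i j k : 'I_n)
    (x : 'rV[R]_n) : R :=
  partial i (christoffel g l j k) x - partial j (christoffel g l i k) x
  + \sum_(m < n) (christoffel g m j k x * christoffel g l i m x
                  - christoffel g m i k x * christoffel g l j m x).

(* <Rm(u, v) v, u> / (|u|^2 |v|^2 - <u, v>^2) *)
Definition sectional (g : 'rV[R]_n -> 'M[R]_n) (x u v : 'rV[R]_n) : R :=
  (\sum_(l < n) \sum_(m < n) \sum_(i < n) \sum_(j < n) \sum_(k < n)
     g x l m * riemann g l i j k x * u 0 i * v 0 j * v 0 k * u 0 m)
  / (bilin (g x) u u * bilin (g x) v v - bilin (g x) u v ^+ 2).

End Calculus.

(* The integral over R^n with respect to Lebesgue measure, as an iterated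
   integral; only used for nonnegative Borel functions (Tonelli). *)
Fixpoint lebesgue_int (R : realType) (n : nat) :
    ('rV[R]_n -> \bar R) -> \bar R :=
  match n with
  | 0 => fun f => f 0
  | n'.+1 => fun f =>
      (\int[@lebesgue_measure R]_t
         lebesgue_int (fun y : 'rV[R]_n' => f (row_mx (t%:M : 'rV[R]_1) y)))%E
  end.

(* A smooth n-dimensional Riemannian manifold structure on M. The atlas
   consists of one chart [chart p] around every point p (no compatibility
   between the choices at different points is required beyond smoothness of
   the transition maps); [metric p] is the Gram matrix of the metric in the
   coordinates of [chart p]. Functions are total, but [chart p] is only
   meaningful on [chart_dom p], and [chart_inv p], [metric p] only on the image
   of [chart_dom p]. *)
Record riemannian (R : realType) (n : nat) (M : ptopologicalType) := Riemannian {
  chart_dom : M -> set M;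
  chart : M -> M -> 'rV[R]_n;
  chart_inv : M -> 'rV[R]_n -> M;
  metric : M -> 'rV[R]_n -> 'M[R]_n;
  manifold_hausdorff : hausdorff_space M;
  manifold_second_countable : @second_countable M;
  chart_dom_open : forall p, open (chart_dom p);
  chart_dom_center : forall p, chart_dom p p;
  chart_image_open : forall p, open (chart p @` chart_dom p);
  chartK : forall p q, chart_dom p q -> chart_inv p (chart p q) = q;
  chart_continuous : forall p, {within chart_dom p, continuous (chart p)};
  chart_inv_continuous : forall p,
    {within chart p @` chart_dom p, continuous (chart_inv p)};
  transition_smooth : forall p q,
    smooth_on (chart p @` (chart_dom p `&` chart_dom q))
              (chart q \o chart_inv p);
  metric_sym : forall p x, (chart p @` chart_dom p) x ->
    (metric p x)^T = metric p x;
  metric_pos : forall p x u, (chart p @` chart_dom p) x -> u != 0 ->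
    0 < bilin (metric p x) u u;
  metric_smooth : forall p i j,
    smooth_on (chart p @` chart_dom p) (fun x => metric p x i j : R);
  metric_compat : forall p q x u v,
    (chart p @` (chart_dom p `&` chart_dom q)) x ->
    let tau := chart q \o chart_inv p in
    bilin (metric p x) u v = bilin (metric q (tau x)) ('D_u tau x) ('D_v tau x)
}.

Section Geometry.
Variables (R : realType) (n : nat) (M : ptopologicalType).
Variable g : riemannian R n M.

(* The curve c, read in the chart around c t. *)
Definition local_rep (c : R -> M) (t : R) : R -> 'rV[R]_n := chart g (c t) \o c.

Definition C1_at (c : R -> M) (t : R) : Prop :=
  [/\ {for t, continuous c},
      \forall s \near t, derivable (local_rep c t) s 1 &
      {for t, continuous (derive1 (local_rep c t))}].

Definition speed (c : R -> M) (t : R) : R :=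
  let v := derive1 (local_rep c t) t in
  Num.sqrt (bilin (metric g (c t) (local_rep c t t)) v v).

(* [curve_length x y L]: some piecewise C^1 curve from x to y, i.e. a finite
   concatenation of curves that are C^1 on (a neighbourhood of) [0, 1], has
   length L. *)
Inductive curve_length : M -> M -> R -> Prop :=
| curve_length_nil x : curve_length x x 0
| curve_length_cons (c : R -> M) y L :
    (forall t : R, 0 <= t <= 1 -> C1_at c t) ->
    curve_length (c 1) y L ->
    curve_length (c 0) y
      (\int[@lebesgue_measure R]_(t in `[0, 1]) speed c t + L).

Definition geodesic_dist (x y : M) : R := inf [set L | curve_length x y L].

Definition complete_riemannian : Prop :=
  forall u : nat -> M,
    (forall e : R, 0 < e -> exists N : nat, forall i j : nat,
       (N <= i)%N -> (N <= j)%N -> geodesic_dist (u i) (u j) < e) ->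
    exists l : M, (fun k => geodesic_dist (u k) l) @ \oo --> (0 : R).

Definition simply_connected : Prop :=
  (forall x y : M, exists f : R -> M,
     [/\ {within `[0, 1], continuous f}, f 0 = x & f 1 = y]) /\
  (forall f : R -> M, {within `[0, 1], continuous f} -> f 0 = f 1 ->
     exists H : R * R -> M,
       [/\ {within (`[0, 1] `*` `[0, 1])%classic, continuous H},
           forall t : R, 0 <= t <= 1 -> H (t, 0) = f t,
           forall t : R, 0 <= t <= 1 -> H (t, 1) = f 0,
           forall s : R, 0 <= s <= 1 -> H (0, s) = f 0 &
           forall s : R, 0 <= s <= 1 -> H (1, s) = f 0]).

(* Sectional curvature at p of the plane spanned by the tangent vectors with
   coordinates u, v in the chart around p. *)
Definition sectional_curvature (p : M) (u v : 'rV[R]_n) : R :=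
  sectional (metric g p) (chart g p p) u v.

Definition sectional_curvature_le (k : R) : Prop :=
  forall (p : M) (u v : 'rV[R]_n),
    row_free (col_mx u v) -> sectional_curvature p u v <= k.

Definition cartan_hadamard : Prop :=
  [/\ complete_riemannian, simply_connected & sectional_curvature_le 0].

Local Notation borelM := (g_sigma_algebraType (@open M)).

(* mu is the Riemannian volume: dx = sqrt(det g) dx^1 ... dx^n in each chart.
   As countably many chart domains cover M, this determines mu. *)
Definition riemannian_volume (mu : set borelM -> \bar R) : Prop :=
  forall (p : M) (A : set borelM), measurable A -> A `<=` chart_dom g p ->
    mu A = lebesgue_int (fun x : 'rV[R]_n =>
             (Num.sqrt (\det (metric g p x)) * \1_(chart g p @` A) x)%:E).

End Geometry.

Section Energy.
Variables (R : realType) (n : nat) (M : ptopologicalType).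
Local Notation borelM := (g_sigma_algebraType (@open M)).
Variable g : riemannian R n M.
Variable mu : {sigma_finite_measure set borelM -> \bar R}.
Variable h : R -> \bar R.

Local Open Scope ereal_scope.

Definition ac_density (rho : borelM -> R) : Prop :=
  [/\ measurable_fun setT rho, forall x, (0 <= rho x)%R &
      \int[mu]_x (rho x)%:E = 1].

(* ln 0 = 0, hence 0 log 0 = 0 *)
Definition entropy_density (rho : borelM -> R) (x : borelM) : \bar R :=
  (rho x * ln (rho x))%:E.

Definition interaction_density (rho : borelM -> R) (z : borelM * borelM) :
    \bar R :=
  h (geodesic_dist g z.1 z.2) * (rho z.1 * rho z.2)%:E.

Definition energy (rho : borelM -> R) : \bar R :=
  \int[mu]_x entropy_density rho x
  + (2^-1)%:E * \int[mu \x mu]_z interaction_density rho z.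

Definition integral_defined d (T : measurableType d)
    (m : set T -> \bar R) (f : T -> \bar R) : Prop :=
  \int[m]_x f^\+ x < +oo \/ \int[m]_x f^\- x < +oo.

(* The library's integral and addition return -oo on oo - oo, so the densities
   whose energy is the indeterminate form oo - oo must be told apart from those
   whose energy really is -oo. *)
Definition energy_defined (rho : borelM -> R) : Prop :=
  [/\ integral_defined mu (entropy_density rho),
      integral_defined (mu \x mu) (interaction_density rho) &
      \int[mu]_x entropy_density rho x
      +? (2^-1)%:E * \int[mu \x mu]_z interaction_density rho z].

Definition global_minimizer (rho : borelM -> R) : Prop :=
  [/\ ac_density rho, energy_defined rho, energy rho \is a fin_num &
      forall sigma, ac_density sigma -> energy_defined sigma ->
        energy rho <= energy sigma].

End Energy.

(* Main.v *)
(* The uniform density on a set A of finite measure m, any two points of which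
   are at distance at most D, has energy at most - ln m + h(D) / 2; a minimizer
   would bound this from below over all such A. Under the first growth
   condition, take small geodesic balls: m is at least of order d^n and h(2d) is
   at most A1 ln d + C, so A1 > 2n drives the bound to -oo as d -> 0. Under the
   second one, a fixed small ball with D -> oo suffices if A2 < 0. Otherwise one
   needs a set of volume of order exp((n-1) sqrt(c) r) with D of order 2r, the
   Riemannian counterpart of a shell of a hyperbolic ball.

   Such a set is packed from disjoint small balls centred at a grid of polar
   coordinates around o. This uses that the exponential map e at o
   - exists on the whole tangent space, by completeness;
   - is radially isometric (Gauss lemma) and, transversally to the rays, expands
     at radius r at least like exp(sqrt(c) r) / r (Rauch comparison);
   - is a bijection: it expands lengths, so paths and homotopies lift, and M is
     simply connected.
   Hence the radius is essentially 1-Lipschitz and the angular coordinates are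
   Lipschitz with constant of order exp(- sqrt(c) r) at radius r, which keeps the
   balls around distinct grid points apart, while the triangle inequality through
   o bounds the diameter. *)

(* The obstacle in the last case is that the curvature has no lower bound: the radius below which
   balls have measure at least [kappa * d ^+ n] is bounded below on the ball of radius r around o
   only by compactness, without control in r. The grid is therefore scaled with the radius d of the
   small balls: its radial step is of order d, its angular step of order d exp(- sqrt(c) r). The
   number of grid points is then of order d^(-n) exp((n-1) sqrt(c) r), the powers of d cancel
   against the volume of one ball, and the packed set has measure at least a constant times
   exp((n-1) sqrt(c) r). As its diameter is at most 2r + 4, the energy bound is affine in r with
   slope (A2 - (n-1)) sqrt(c) < 0. Packing thus replaces a change of variables under the exponential
   map: only lower bounds for volumes of small balls enter. The analysis runs on maps with Lipschitz
   derivative. Stated by norm inequalities, this class is stable under composition and under flows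
   of differential equations, so the geodesic flow can be differentiated in the initial velocity;
   these derivatives are the Jacobi fields that obey the comparison estimates. *)
Require Import Defs.
From HB Require Import structures.
From mathcomp Require Import all_boot all_order all_algebra.
From mathcomp Require Import all_classical all_reals all_analysis.
From mathcomp Require Import ring lra measurable_realfun.
Import Order.TTheory GRing.Theory Num.Theory.
Import numFieldNormedType.Exports.

Set Implicit Arguments.
Unset Strict Implicit.
Unset Printing Implicit Defensive.

Local Open Scope classical_set_scope.
Local Open Scope ring_scope.

(** * Calculus of C^{1,1} maps *)

Section LinearCombinations.
Variables (R : comNzRingType) (V : lmodType R).

(* Identities between linear combinations, which [ring] does not handle, are decided by comparing
   coefficients. *)
Inductive lexp := LVar of nat | LZero | LAdd of lexp & lexp | LOpp of lexp
  | LScale of R & lexp.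

Fixpoint leval (vs : seq V) (e : lexp) : V := match e with
  | LVar i => nth 0 vs i
  | LZero => 0
  | LAdd a b => leval vs a + leval vs b
  | LOpp a => - leval vs a
  | LScale k a => k *: leval vs a
  end.

Fixpoint lcoef (e : lexp) (i : nat) : R := match e with
  | LVar j => if Nat.eqb i j then 1 else 0
  | LZero => 0
  | LAdd a b => lcoef a i + lcoef b i
  | LOpp a => - lcoef a i
  | LScale k a => k * lcoef a i
  end.

Fixpoint lcoef_eq (e f : lexp) (n : nat) : Prop := match n with
  | 0 => True
  | S m => lcoef e m = lcoef f m /\ lcoef_eq e f m
  end.

Lemma leval_lcoef vs e : leval vs e = \sum_(i < size vs) lcoef e i *: nth 0 vs i.
Proof.
elim: e => [j||a IHa b IHb|a IHa|k a IHa] /=; rewrite ?IHa ?IHb.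
- have [jlt|jge] := ltnP j (size vs).
    rewrite (bigD1 (Ordinal jlt)) //= PeanoNat.Nat.eqb_refl scale1r big1 ?addr0//.
    move=> i ij; case: (PeanoNat.Nat.eqb_spec i j) => [e|]; last by rewrite scale0r.
    by case/eqP: ij; apply: val_inj.
  rewrite nth_default// big1// => i _.
  case: (PeanoNat.Nat.eqb_spec i j) => [e|]; last by rewrite scale0r.
  by move: jge; rewrite -e leqNgt ltn_ord.
- by rewrite big1// => i _; rewrite scale0r.
- by rewrite -big_split; apply: eq_bigr => i _; rewrite scalerDl.
- by rewrite -sumrN; apply: eq_bigr => i _; rewrite scaleNr.
- by rewrite scaler_sumr; apply: eq_bigr => i _; rewrite scalerA.
Qed.

Lemma lcoef_eq_correct vs e f : lcoef_eq e f (size vs) -> leval vs e = leval vs f.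
Proof.
move=> ef; rewrite !leval_lcoef; apply: eq_bigr => i _; congr (_ *: _).
case: i => i /= il; elim: (size vs) il ef => // n IH; rewrite ltnS leq_eqVlt /=.
by case/orP => [/eqP-> []//|il [_ h]]; apply: IH.
Qed.

End LinearCombinations.

(** Atoms are identified up to conversion, but only after their algebraic and derivative heads
    match, so that conversion is tried on small subterms only. *)
Ltac lmod_unify x y := lazymatch x with
  | derive ?f ?a ?v => lazymatch y with
    | derive ?g ?b ?w => lmod_unify v w; unify f g; lmod_unify a b end
  | GRing.add ?a ?b => lazymatch y with
    | GRing.add ?c ?d => lmod_unify a c; lmod_unify b d end
  | GRing.opp ?a => lazymatch y with GRing.opp ?c => lmod_unify a c end
  | GRing.scale ?a ?b => lazymatch y with
    | GRing.scale ?c ?d => lmod_unify b d; unify a c end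
  | GRing.zero => lazymatch y with GRing.zero => idtac end
  | _ => lazymatch y with derive _ _ _ => fail | GRing.add _ _ => fail
     | GRing.opp _ => fail | GRing.scale _ _ => fail | GRing.zero => fail
     | _ => unify x y end
  end.
Ltac lmod_same x y := match constr:(Set) with
  | _ => let _ := match constr:(Set) with _ => constr_eq x y end in constr:(true)
  | _ => let _ := match constr:(Set) with _ => lmod_unify x y end in constr:(true)
  | _ => constr:(false) end.
Ltac lmod_find x vs := lazymatch vs with
  | (?y :: ?t) => lazymatch lmod_same x y with
     | true => constr:(0%nat)
     | false => let n := lmod_find x t in constr:(S n) end end.
Ltac lmod_mem x vs := lazymatch vs with
  | nil => constr:(false)
  | (?y :: ?t) => lazymatch lmod_same x y with
     | true => constr:(true) | false => lmod_mem x t end end.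
Ltac lmod_atoms t vs := lazymatch t with
  | GRing.zero => vs
  | GRing.add ?a ?b => let vs1 := lmod_atoms a vs in lmod_atoms b vs1
  | GRing.opp ?a => lmod_atoms a vs
  | GRing.scale _ ?a => lmod_atoms a vs
  | _ => lazymatch lmod_mem t vs with true => vs | false => constr:(t :: vs) end
  end.
Ltac lmod_reify R t vs := lazymatch t with
  | GRing.zero => constr:(@LZero R)
  | GRing.add ?a ?b => let x := lmod_reify R a vs in let y := lmod_reify R b vs in
      constr:(LAdd x y)
  | GRing.opp ?a => let x := lmod_reify R a vs in constr:(LOpp x)
  | GRing.scale ?k ?a => let x := lmod_reify R a vs in constr:(@LScale R k x)
  | _ => let n := lmod_find t vs in constr:(@LVar R n)
  end.
Ltac lmod R := cbv beta; lazymatch goal with |- @eq ?T ?l ?r =>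
  let vs1 := lmod_atoms l (@nil T) in
  let vs := lmod_atoms r vs1 in
  let x := lmod_reify R l vs in let y := lmod_reify R r vs in
  apply: (@lcoef_eq_correct R _ vs x y); cbn [lcoef lcoef_eq size Nat.eqb];
  repeat (apply: conj; [try ring|]); try exact: I end.

(** The decomposition [z = x + y] is left as a side goal, to be settled by [lmod]. *)
Lemma ler_norm_split (R : numDomainType) (W : normedZmodType R) (x y z : W)
  (a b c : R) : z = x + y -> `|x| <= a -> `|y| <= b -> a + b <= c -> `|z| <= c.
Proof.
by move=> -> xa yb; apply: le_trans; apply: le_trans (ler_normD _ _) (lerD xa yb).
Qed.

Section RealInduction.
Variable R : realType.

(** Below the infimum of the counterexamples there are none, so the hypothesis applies at the
    infimum and clears it together with an interval to its right. *)
Lemma real_induction (P : R -> Prop) :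
  (forall t : R, 0 <= t -> (forall s : R, 0 <= s -> s < t -> P s) ->
     exists2 d : R, 0 < d & forall s : R, t <= s -> s < t + d -> P s) ->
  forall t : R, 0 <= t -> P t.
Proof.
move=> step t1 t1ge0; apply: contrapT => nP.
pose S := [set s | 0 <= s /\ ~ P s].
have hS : has_inf S by split; [by exists t1; split|by exists 0 => s []].
have inf_ge0 : 0 <= inf S by apply: lb_le_inf; [by exists t1; split|by move=> s []].
have below s : 0 <= s -> s < inf S -> P s.
  move=> s0 sl; apply: contrapT => nPs.
  by move: sl; rewrite ltNge => /negP; apply; apply: ge_inf; [case: hS|].
have [d d0 Pd] := step _ inf_ge0 below.
have [s [s0 nPs] sd] := inf_adherent d0 hS.
apply: (nPs); apply: Pd => //; apply: ge_inf; first by case: hS.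
by split.
Qed.

End RealInduction.

Section DeriveEps.
Variables (R : realType) (V W : normedModType R).
Implicit Types (f : V -> W).

(** Without division by h and with h = 0 included, derivatives can be combined by plain norm
    estimates instead of punctured limits. *)
Lemma is_derive_eps f x v l : is_derive x v f l <->
  forall e : R, 0 < e -> exists2 d : R, 0 < d & forall h : R, `|h| < d ->
    `|f (x + h *: v) - f x - h *: l| <= e * `|h|.
Proof.
split.
- move=> [dv <-] e e0.
  have /cvgrPdist_le/(_ _ e0) := dv; rewrite near_withinE.
  move=> /nbhs_ballP[d/= d0 H]; exists d => // h hd.
  have [->|h0] := eqVneq h 0.
    by rewrite !scale0r addr0 subrr subr0 !normr0 mulr0.
  have := H h; rewrite /ball/= sub0r normrN => /(_ hd h0).
  rewrite distrC addrC -/('D_v f x) => Hh.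
  have -> : f (x + h *: v) - f x - h *: 'D_v f x =
     h *: (- 'D_v f x + h^-1 *: (f (h *: v + x) - f x)).
    by rewrite scalerDr scalerA divff// scale1r scalerN addrC [_ *: v + x]addrC.
  by rewrite normrZ mulrC ler_wpM2r.
- move=> H.
  have cv : (fun h => h^-1 *: ((f \o shift x) (h *: v) - f x)) @ 0^' --> l.
    apply/cvgrPdist_le => e e0; rewrite near_withinE.
    have [d d0 Hd] := H e e0.
    apply/nbhs_ballP; exists d => //= h; rewrite /ball/= sub0r normrN => hd h0.
    rewrite -(@ler_pM2l _ `|h|) ?normr_gt0// -normrZ scalerBr scalerA divff//.
    by rewrite scale1r distrC mulrC [_ *: v + x]addrC; exact: Hd.
  split; first by apply/cvg_ex; exists l.
  exact: cvg_lim cv.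
Qed.

Lemma is_derive_unique f x v l l' :
  is_derive x v f l -> is_derive x v f l' -> l = l'.
Proof. by move=> [_ <-] [_ <-]. Qed.

End DeriveEps.

Section MeanValue.
Variables (R : realType) (W : normedModType R).

(** Vector-valued functions have no intermediate point, so the bound with the slightly larger slope
    [K + e] is propagated by real induction. *)
Lemma mean_value (f df : R -> W) (a b K : R) : a <= b ->
  (forall t, a <= t <= b -> is_derive t 1 f (df t)) ->
  (forall t, a <= t <= b -> `|df t| <= K) ->
  `|f b - f a| <= K * (b - a).
Proof.
move=> ab fd dK; apply/ler_addgt0Pr => _/posnumP[e0].
have K0 : 0 <= K by apply: le_trans (dK a _); rewrite ?normr_ge0 ?lexx.
pose e := e0%:num / (b - a + 1).
have ba : 0 < b - a + 1 by lra.
have e_gt0 : 0 < e by rewrite divr_gt0.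
apply: (@le_trans _ _ ((K + e) * (b - a))); last first.
  rewrite mulrDl lerD2l /e mulrAC ler_pdivrMr// ler_wpM2l//; lra.
have H : forall s : R, 0 <= s -> s <= b - a -> `|f (a + s) - f a| <= (K + e) * s.
  apply: (@real_induction _ (fun s => s <= b - a -> _)) => t t0 Pt.
  have [tba|tba] := leP t (b - a); last by exists 1 => // s ts _; lra.
  have ta : a <= a + t <= b by lra.
  have /is_derive_eps /(_ e e_gt0) [d d0 Hd] := fd _ ta.
  have inc h : `|h| < d -> `|f (a + t + h) - f (a + t)| <= (K + e) * `|h|.
    move=> hd; have := Hd h hd; rewrite [h *: 1]mulr1 => Hh.
    rewrite -[X in `|X|](subrK (h *: df (a + t))).
    apply: le_trans (ler_normD _ _) _.
    rewrite mulrDl addrC lerD// normrZ mulrC ler_wpM2r//; exact: dK.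
  (* Real induction supplies the bound only before t; it reaches t itself from a point t - h inside
     the interval where the increment estimate holds. *)
  have Ptt : `|f (a + t) - f a| <= (K + e) * t.
    have [->|tn0] := eqVneq t 0; first by rewrite addr0 subrr normr0 mulr0.
    have tgt0 : 0 < t by rewrite lt_def tn0.
    pose h := Num.min (t / 2) (d / 2).
    have h0 : 0 < h by rewrite lt_min; apply/andP; split; lra.
    have ht : h <= t / 2 by rewrite ge_min lexx.
    have hd : h <= d / 2 by rewrite ge_min lexx orbT.
    have := inc (- h); rewrite normrN gtr0_norm// => /(_ ltac:(lra)).
    rewrite (_ : a + t - h = a + (t - h)); last by ring.
    move=> H1.
    have H2 := Pt (t - h) ltac:(lra) ltac:(lra) ltac:(lra).
    have -> : f (a + t) - f a =
        (f (a + (t - h)) - f a) - (f (a + (t - h)) - f (a + t)).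
      by lmod R.
    apply: le_trans (ler_normB _ _) _.
    apply: le_trans (lerD H2 H1) _; lra.
  exists d => // s ts sd sba.
  have hs : `|s - t| < d by rewrite ger0_norm; lra.
  have := inc _ hs.
  rewrite (_ : a + t + (s - t) = a + s); last by ring.
  rewrite ger0_norm; last lra.
  move=> H1; apply: (ler_norm_split _ H1 Ptt); [by lmod R|lra].
have := H (b - a); rewrite (_ : a + (b - a) = b); last by ring.
apply; lra.
Qed.

End MeanValue.

Section C11.
Variable R : realType.
Implicit Types V W U : normedModType R.

(** A quantitative substitute for smoothness near a point. The linear, bounded, Lipschitz
    differential and the quadratic Taylor remainder are what Picard iteration, the inverse function
    theorem and the chain rule consume. *)
Definition C11 V W (f : V -> W) (x0 : V) : Prop :=
  exists C r : R, [/\ 0 < C, 0 < r & forall x, `|x - x0| < r ->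
    [/\ linear (fun w => 'D_w f x), forall w, `|'D_w f x| <= C * `|w| &
      forall y, `|y - x0| < r ->
        `|f y - f x - 'D_(y - x) f x| <= C * `|y - x| ^+ 2 /\
        forall w, `|'D_w f y - 'D_w f x| <= C * `|y - x| * `|w| ]].

Lemma quad_is_derive V W (f : V -> W) (l : V -> W) (x : V) (C r : R) :
  0 < r -> scalable l -> (forall y, `|y - x| < r ->
    `|f y - f x - l (y - x)| <= C * `|y - x| ^+ 2) ->
  forall w, is_derive x w f (l w).
Proof.
move=> r0 lZ fl w; apply/is_derive_eps => e e0.
pose K := `|C| * `|w| ^+ 2 + 1; pose q := `|w| + 1.
have K0 : 0 < K by rewrite ltr_wpDl// mulr_ge0 ?exprn_ge0.
have q0 : 0 < q by rewrite ltr_wpDl.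
exists (Num.min (r / q) (e / K)); first by rewrite lt_min !divr_gt0.
move=> h; rewrite lt_min => /andP[hr he].
have hw : `|h *: w| < r.
  rewrite normrZ; apply: (@le_lt_trans _ _ (`|h| * q)).
    by rewrite ler_wpM2l// lerDl.
  by rewrite -ltr_pdivlMr.
have := fl (x + h *: w); rewrite addrAC subrr add0r => /(_ hw).
rewrite lZ => H; apply: le_trans H _.
rewrite normrZ exprMn.
apply: (@le_trans _ _ (`|h| * (`|h| * K))).
  rewrite [X in _ <= X]mulrA -expr2 mulrCA ler_wpM2l ?exprn_ge0//.
  rewrite /K; apply: ler_wpDr => //; apply: ler_wpM2r => //.
  exact: ler_norm.
by rewrite mulrC ler_wpM2r// -ler_pdivlMr// ltW.
Qed.

(** A candidate differential satisfying the estimates is forced to be the derivative by the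
    quadratic remainder, so later proofs only estimate explicit formulas. *)
Lemma C11_intro V W (f : V -> W) (df : V -> V -> W) (x0 : V) (C r : R) :
  0 <= C -> 0 < r ->
  (forall x, `|x - x0| < r ->
    [/\ linear (df x), forall w, `|df x w| <= C * `|w| &
      forall y, `|y - x0| < r ->
        `|f y - f x - df x (y - x)| <= C * `|y - x| ^+ 2 /\
        forall w, `|df y w - df x w| <= C * `|y - x| * `|w| ]) ->
  C11 f x0 /\ forall x, `|x - x0| < r -> forall w, is_derive x w f (df x w).
Proof.
move=> C0 r0 H.
have D x : `|x - x0| < r -> forall w, is_derive x w f (df x w).
  move=> xr; have [lx bx ex] := H x xr.
  apply: (@quad_is_derive _ _ _ _ _ C (r - `|x - x0|)); first by rewrite subr_gt0.
    by move=> k u; have := lx k u 0; rewrite addr0 => ->;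
       rewrite (_ : df x 0 = 0) ?addr0//;
       apply/eqP; rewrite -normr_le0; have := bx 0; rewrite normr0 mulr0.
  move=> y yx; apply: (ex y _).1.
  apply: (@le_lt_trans _ _ (`|y - x| + `|x - x0|)); last by rewrite -ltrBrDr.
  by rewrite -[y - x0](subrKA x) ler_normD.
split=> //; exists (C + 1), r; split => //; first lra.
have E x w : `|x - x0| < r -> 'D_w f x = df x w by move=> xr; have [_] := D x xr w.
have CC : C <= C + 1 by lra.
move=> x xr; have [lx bx ex] := H x xr; split.
- by rewrite (_ : (fun w => 'D_w f x) = df x)//; apply/funext => w; exact: E.
- by move=> w; rewrite E//; apply: le_trans (bx w) _; rewrite ler_wpM2r.
- move=> y yr; have [e1 e2] := ex y yr; split.
    by rewrite E//; apply: le_trans e1 _; rewrite ler_wpM2r// exprn_ge0.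
  by move=> w; rewrite !E//; apply: le_trans (e2 w) _; rewrite !ler_wpM2r.
Qed.

Lemma C11_near V W (f : V -> W) (x0 : V) : C11 f x0 ->
  exists2 r : R, 0 < r & forall x, `|x - x0| < r -> C11 f x.
Proof.
move=> [C [r [C0 r0 H]]]; exists r => // x xr.
exists C, (r - `|x - x0|); rewrite subr_gt0; split => //.
have near y : `|y - x| < r - `|x - x0| -> `|y - x0| < r.
  move=> yx; apply: (@le_lt_trans _ _ (`|y - x| + `|x - x0|)); last by rewrite -ltrBrDr.
  by rewrite -[y - x0](subrKA x) ler_normD.
move=> y yx; have [? ? e] := H y (near y yx); split => // z zx.
by apply: e; apply: near.
Qed.

Lemma C11_linear V W (f : V -> W) (x0 : V) : C11 f x0 -> linear (fun w => 'D_w f x0).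
Proof.
by move=> [C [r [C0 r0 H]]]; have [] := H x0 _; rewrite ?subrr ?normr0.
Qed.

Lemma C11_lipschitz V W (f : V -> W) (x0 : V) : C11 f x0 ->
  exists K r : R, [/\ 0 < K, 0 < r & forall x y, `|x - x0| < r -> `|y - x0| < r ->
    `|f y - f x| <= K * `|y - x|].
Proof.
move=> [C [r [C0 r0 H]]]; exists (C * (2 * r) + C), r; split => //.
  by rewrite addr_gt0// !mulr_gt0.
move=> x y xr yr; have [_ b e] := H x xr; have [e1 _] := e y yr.
apply: (ler_norm_split _ e1 (b (y - x))); first by lmod R.
have yx : `|y - x| <= 2 * r.
  apply: (ler_norm_split (x := y - x0) (y := - (x - x0)) _ (ltW yr)).
  - by lmod R.
  - by rewrite normrN; exact: (ltW xr).
  - lra.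
rewrite mulrDl lerD2r expr2 -mulrA ler_wpM2l ?(ltW C0)//.
by rewrite ler_wpM2r.
Qed.

Lemma C11_continuous V W (f : V -> W) (x0 : V) : C11 f x0 -> {for x0, continuous f}.
Proof.
move=> /C11_lipschitz [K [r [K0 r0 H]]]; apply/cvgrPdist_le => e e0.
apply/nbhs_ballP; exists (Num.min r (e / K)); first by rewrite /= lt_min r0 divr_gt0.
move=> y; rewrite -ball_normE /ball_ /= lt_min => /andP[yr ye].
rewrite distrC; apply: le_trans (H _ _ _ _) _; rewrite ?subrr ?normr0//.
  by rewrite distrC.
by rewrite distrC mulrC -ler_pdivlMr// ltW.
Qed.

Lemma C11_eq V W (f g : V -> W) (x0 : V) (r : R) : 0 < r ->
  (forall x, `|x - x0| < r -> f x = g x) -> C11 f x0 -> C11 g x0.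
Proof.
move=> r0 fg [C [s [C0 s0 H]]].
have rs0 : 0 < Num.min r s by rewrite lt_min r0.
apply: (@C11_intro _ _ _ (fun x w => 'D_w f x) _ C _ (ltW C0) rs0 _).1.
move=> x; rewrite lt_min => /andP[xr xs]; have [l b e] := H x xs; split => // y.
by rewrite lt_min => /andP[yr ys]; rewrite -!fg//; apply: e.
Qed.

(** The curve is merely differentiable at [t]: velocities of geodesics and lifted curves come with
    no more than this. *)
Lemma C11_comp_curve V W (f : V -> W) (c : R -> V) t c' :
  C11 f (c t) -> is_derive t 1 c c' -> is_derive t 1 (f \o c) ('D_c' f (c t)).
Proof.
move=> [C [r [C0 r0 H]]] /is_derive_eps dc.
have x00 : `|c t - c t| < r by rewrite subrr normr0.
have [l b e] := H _ x00.
apply/is_derive_eps => ep ep0.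
pose K := `|c'| + 1; have K0 : 0 < K by rewrite ltr_wpDl.
(* The error [ep] is shared equally: [m] controls the remainder of [c] seen through the differential
   of [f], and [d1] below the quadratic remainder of [f]. The minimum with 1 makes [c] Lipschitz at
   [t] with constant [K]. *)
pose m := Num.min 1 (ep / (2 * C)).
have m0 : 0 < m by rewrite lt_min ltr01/= divr_gt0// mulr_gt0.
have [d d0 Hd] := dc m m0.
pose d1 := Num.min (r / K) (ep / (2 * C * K ^+ 2)).
have d10 : 0 < d1 by rewrite lt_min !divr_gt0// !mulr_gt0 ?exprn_gt0.
exists (Num.min d d1); first by rewrite lt_min d0.
move=> h; rewrite !lt_min => /and3P[hd hr hK].
have h0 := normr_ge0 h.
have D1 := Hd h hd; rewrite [h *: 1]mulr1 in D1 *.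
have m1 : m <= 1 by rewrite ge_min lexx.
have me : C * m <= ep / 2.
  have : m <= ep / (2 * C) by rewrite ge_min lexx orbT.
  rewrite ler_pdivlMr ?mulr_gt0// => h1; rewrite ler_pdivlMr//; lra.
have cK : `|c (t + h) - c t| <= K * `|h|.
  apply: (ler_norm_split (x := c (t + h) - c t - h *: c') (y := h *: c') _ D1).
  - by lmod R.
  - exact: lexx.
  - by rewrite normrZ /K mulrDl mul1r addrC mulrC lerD2l ler_piMl.
have cr : `|c (t + h) - c t| < r.
  by apply: le_lt_trans cK _; rewrite mulrC -ltr_pdivlMr.
have [E1 _] := e _ cr.
have E2 := b (c (t + h) - c t - h *: c').
have lh : 'D_(c (t + h) - c t - h *: c') f (c t) =
   'D_(c (t + h) - c t) f (c t) - h *: 'D_c' f (c t).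
  rewrite (_ : c (t + h) - c t - h *: c' = (- h) *: c' + (c (t + h) - c t)).
    by rewrite l/= scaleNr addrC.
  by lmod R.
rewrite lh in E2; apply: (ler_norm_split _ E1 E2); first by rewrite /=; lmod R.
have A1 : `|c (t + h) - c t| ^+ 2 <= (K * `|h|) ^+ 2 by rewrite lerXn2r ?nnegrE ?mulr_ge0 ?(ltW K0).
have A2 : C * (K * `|h|) ^+ 2 <= ep / 2 * `|h|.
  rewrite exprMn [`|h| ^+ 2]expr2 !mulrA ler_wpM2r//.
  move: hK; rewrite ltr_pdivlMr ?mulr_gt0 ?exprn_gt0//; lra.
have A3 : C * `|c (t + h) - c t - h *: c'| <= ep / 2 * `|h|.
  apply: (@le_trans _ _ (C * (m * `|h|))); first by rewrite ler_wpM2l// ltW.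
  by rewrite mulrA ler_wpM2r.
apply: (@le_trans _ _ (ep / 2 * `|h| + ep / 2 * `|h|)); last lra.
by apply: lerD => //; apply: le_trans A2; rewrite ler_wpM2l// ltW.
Qed.

Lemma C11_comp V W U (f : W -> U) (g : V -> W) (x0 : V) :
  C11 g x0 -> C11 f (g x0) ->
  C11 (f \o g) x0 /\ forall w, 'D_w (f \o g) x0 = 'D_('D_w g x0) f (g x0).
Proof.
move=> Cg [C [r [C0 r0 Hf]]]; have [K [s1 [K0 s10 Lg]]] := C11_lipschitz Cg.
move: Cg => [D [s2 [D0 s20 Hg]]].
pose s := Num.min (Num.min s1 s2) (r / K).
have s0 : 0 < s by rewrite !lt_min s10 s20 divr_gt0.
have x00 : `|x0 - x0| < s by rewrite subrr normr0.
(* The three terms come from the remainder of [f], from the variation of [g] to next order seen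
   through the differential of [f], and from the variation of that differential. *)
pose E := C * K ^+ 2 + C * D + C * K * D.
have E0 : 0 <= E by rewrite /E !addr_ge0 ?mulr_ge0 ?exprn_ge0 ?ltW.
have [] := @C11_intro _ _ (f \o g) (fun x w => 'D_('D_w g x) f (g x)) x0 E s E0 s0 _; last first.
  by move=> ? H; split => // w; have [_] := H x0 x00 w.
have gr x : `|x - x0| < s -> [/\ `|x - x0| < s1, `|x - x0| < s2 & `|g x - g x0| < r].
  rewrite !lt_min -andbA => /and3P[h1 h2 h3]; split => //.
  apply: le_lt_trans (Lg x0 x _ h1) _; first by rewrite subrr normr0.
  by rewrite mulrC -ltr_pdivlMr.
move=> x xs; have [x1 x2 x3] := gr x xs.
have [lf bf ef] := Hf _ x3; have [lg bg eg] := Hg x x2.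
split.
- by move=> k u v /=; rewrite lg lf.
- move=> w; apply: le_trans (bf _) _; apply: (@le_trans _ _ (C * (D * `|w|))).
    by rewrite ler_wpM2l// ltW.
  rewrite mulrA ler_wpM2r// /E addrAC lerDr addr_ge0 ?mulr_ge0 ?exprn_ge0 ?ltW//.
- move=> y ys; have [y1 y2 y3] := gr y ys.
  have [ef1 ef2] := ef _ y3; have [eg1 eg2] := eg _ y2.
  have L := Lg x y x1 y1; split.
    have F := bf (g y - g x - 'D_(y - x) g x).
    have lh : 'D_(g y - g x - 'D_(y - x) g x) f (g x) =
      'D_(g y - g x) f (g x) - 'D_('D_(y - x) g x) f (g x).
      rewrite (_ : _ - _ - _ = (- 1) *: 'D_(y - x) g x + (g y - g x)).
        by rewrite lf/= scaleN1r addrC.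
      by lmod R.
    rewrite lh in F; apply: (ler_norm_split _ ef1 F); first by rewrite /=; lmod R.
    apply: (@le_trans _ _ (C * (K * `|y - x|) ^+ 2 + C * (D * `|y - x| ^+ 2))).
      apply: lerD; rewrite ler_wpM2l ?(ltW C0)//.
      by rewrite lerXn2r ?nnegrE ?mulr_ge0 ?(ltW K0).
    rewrite (_ : _ + _ = (C * K ^+ 2 + C * D) * `|y - x| ^+ 2); last by ring.
    by rewrite ler_wpM2r ?exprn_ge0// /E lerDl !mulr_ge0 ?ltW.
  move=> w; have F := bf ('D_w g y - 'D_w g x).
  have lh : 'D_('D_w g y - 'D_w g x) f (g x) = 'D_('D_w g y) f (g x) - 'D_('D_w g x) f (g x).
    rewrite (_ : _ - _ = (- 1) *: 'D_w g x + 'D_w g y); last by lmod R.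
    by rewrite lf/= scaleN1r addrC.
  rewrite lh in F; apply: (ler_norm_split _ (ef2 ('D_w g y)) F); first by lmod R.
  have [_ bgy _] := Hg y y2.
  apply: (@le_trans _ _ (C * (K * `|y - x|) * (D * `|w|) + C * (D * `|y - x| * `|w|))).
    apply: lerD; last by rewrite ler_wpM2l ?(ltW C0).
    apply: ler_pM => //; first by rewrite mulr_ge0// ltW.
    by rewrite ler_wpM2l ?(ltW C0).
  rewrite (_ : _ + _ = (C * K * D + C * D) * `|y - x| * `|w|); last by ring.
  rewrite -!mulrA ler_wpM2r ?mulr_ge0// /E.
  have : 0 <= C * K ^+ 2 by rewrite mulr_ge0 ?exprn_ge0 ?ltW.
  by rewrite mulrA; lra.
Qed.
End C11.
Section C11_closure. Variable R : realType. Implicit Types V W U : normedModType R.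
Lemma C11_bounded_linear V W (L : V -> W) (x0 : V) (K : R) : linear L ->
  (forall w, `|L w| <= K * `|w|) -> C11 L x0 /\ forall x w, is_derive x w L (L w).
Proof.
move=> lL bL; have L0 : L 0 = 0.
  by apply/eqP; rewrite -normr_le0; have := bL 0; rewrite normr0 mulr0.
have LB x y : L (y - x) = L y - L x.
  rewrite (_ : y - x = (-1) *: x + y); last by lmod R.
  by rewrite lL; lmod R.
have H x1 : C11 L x1 /\ forall x, `|x - x1| < 1 -> forall w, is_derive x w L (L w).
  apply: (@C11_intro _ _ _ L (fun _ => L) x1 (Num.max 0 K) 1) => //.
    by rewrite le_max lexx.
  move=> x _; split => //.
    by move=> w; apply: le_trans (bL w) _; rewrite ler_wpM2r// le_max lexx orbT.
  move=> y _; split.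
    by rewrite LB subrr normr0 mulr_ge0 ?exprn_ge0// le_max lexx.
  by move=> w; rewrite subrr normr0 !mulr_ge0// le_max lexx.
split; first by have [] := H x0.
by move=> x w; apply: (H x).2; rewrite subrr normr0.
Qed.

Lemma C11_cst V W (a : W) (x0 : V) : C11 (fun _ : V => a) x0.
Proof.
apply: (@C11_intro _ V W _ (fun _ _ => 0) x0 0 1 (lexx 0) ltr01 _).1.
move=> x _; split => [k u v|w|y _]; rewrite ?scaler0 ?addr0 ?normr0 ?mul0r//.
by split => [|w]; rewrite ?subrr ?subr0 ?normr0 ?mul0r.
Qed.

Lemma C11_pair V W U (f : V -> W) (g : V -> U) (x0 : V) :
  C11 f x0 -> C11 g x0 -> C11 (fun x => (f x, g x)) x0.
Proof.
move=> [C [r [C0 r0 Hf]]] [D [s [D0 s0 Hg]]].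
have m0 : 0 < Num.min r s by rewrite lt_min r0.
apply: (@C11_intro _ _ _ _ (fun x w => ('D_w f x, 'D_w g x)) x0 (C + D) _ _ m0 _).1.
  by rewrite addr_ge0// ltW.
move=> x; rewrite lt_min => /andP[xr xs].
have [lf bf ef] := Hf x xr; have [lg bg eg] := Hg x xs.
have N (a : W) (b : U) (c : R) : 0 <= c -> `|a| <= C * c -> `|b| <= D * c -> `|(a, b)| <= (C + D) * c.
  move=> c0 ac bc; rewrite prod_normE /= ge_max; apply/andP; split.
    by apply: le_trans ac _; rewrite ler_wpM2r// lerDl ltW.
  by apply: le_trans bc _; rewrite ler_wpM2r// lerDr ltW.
split.
- by move=> k u v; rewrite lf lg.
- by move=> w; apply: N.
- move=> y; rewrite lt_min => /andP[yr ys].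
  have [ef1 ef2] := ef y yr; have [eg1 eg2] := eg y ys; split.
    by apply: N; rewrite ?exprn_ge0.
  by move=> w; rewrite -mulrA; apply: N;
      [rewrite mulr_ge0|rewrite mulrA; exact: ef2|rewrite mulrA; exact: eg2].
Qed.

Lemma C11_add V W (f g : V -> W) (x0 : V) :
  C11 f x0 -> C11 g x0 -> C11 (fun x => f x + g x) x0.
Proof.
move=> Cf Cg.
have [||L _] := @C11_bounded_linear (W * W)%type W (fun p => p.1 + p.2) (f x0, g x0) 2; last first.
- by have [] := C11_comp (C11_pair Cf Cg) L.
- move=> [a b] /=; rewrite prod_normE /=; apply: le_trans (ler_normD _ _) _.
  by rewrite mulr_natl mulr2n lerD// le_max lexx ?orbT.
- by move=> k u v /=; lmod R.
Qed.

Lemma C11_scale V W (f : V -> W) (k : R) (x0 : V) :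
  C11 f x0 -> C11 (fun x => k *: f x) x0.
Proof.
move=> Cf.
have [||L _] := @C11_bounded_linear W W (fun p => k *: p) (f x0) `|k|; last first.
- by have [] := C11_comp Cf L.
- by move=> a; rewrite normrZ.
- by move=> a u v /=; lmod R.
Qed.

Lemma C11_opp V W (f : V -> W) (x0 : V) : C11 f x0 -> C11 (fun x => - f x) x0.
Proof.
move=> Cf; apply: (@C11_eq _ _ _ (fun x => -1 *: f x) _ _ 1) => //.
  by move=> x _; rewrite scaleN1r.
exact: C11_scale.
Qed.

Lemma C11_mul V (f g : V -> R) (x0 : V) :
  C11 f x0 -> C11 g x0 -> C11 (fun x => f x * g x) x0.
Proof.
move=> Cf Cg.
suff L : C11 (fun p : R * R => p.1 * p.2) (f x0, g x0) by have [] := C11_comp (C11_pair Cf Cg) L.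
move: (f x0) (g x0) => a b {Cf Cg f g x0}.
pose C := 2 * (`|a| + `|b| + 1) + 2.
have C0 : 0 <= C by rewrite /C !addr_ge0 ?mulr_ge0 ?addr_ge0.
apply: (@C11_intro _ (R * R)%type R _ (fun x w => x.1 * w.2 + w.1 * x.2) (a, b) C 1 C0 ltr01 _).1.
move=> [x1 x2]; rewrite prod_normE /= gt_max => /andP[xa xb].
have h1 : `|x1| <= `|a| + `|b| + 1.
  apply: (ler_norm_split (x := x1 - a) (y := a) _ (ltW xa) (lexx _)); first by ring.
  by have := normr_ge0 b; lra.
have h2 : `|x2| <= `|a| + `|b| + 1.
  apply: (ler_norm_split (x := x2 - b) (y := b) _ (ltW xb) (lexx _)); first by ring.
  by have := normr_ge0 a; lra.
split.
- by move=> k [u1 u2] [v1 v2] /=; rewrite /GRing.scale /=; ring.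
- move=> [w1 w2] /=; rewrite prod_normE /=.
  set m := Num.max _ _.
  have m1 : `|w1| <= m by rewrite le_max lexx.
  have m2 : `|w2| <= m by rewrite le_max lexx orbT.
  have m0 : 0 <= m := le_trans (normr_ge0 _) m1.
  apply: (@le_trans _ _ ((`|a| + `|b| + 1) * m + m * (`|a| + `|b| + 1))); last by rewrite /C; nra.
  apply: (ler_norm_split (erefl _) _ _ (lexx _)); rewrite normrM; apply: ler_pM => //.
- move=> [y1 y2]; rewrite prod_normE /= gt_max => /andP[ya yb].
  rewrite prod_normE /=; set m := Num.max _ _.
  have m1 : `|y1 - x1| <= m by rewrite le_max lexx.
  have m2 : `|y2 - x2| <= m by rewrite le_max lexx orbT.
  have m0 : 0 <= m := le_trans (normr_ge0 _) m1.
  have C1 : 2 <= C by rewrite /C lerDr mulr_ge0 ?addr_ge0.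
  split.
    rewrite (_ : _ - _ - _ = (y1 - x1) * (y2 - x2)); last by ring.
    rewrite normrM expr2 mulrA; apply: ler_pM => //.
    by apply: le_trans m1 _; rewrite ler_peMl//; lra.
  move=> [w1 w2]; rewrite prod_normE /=; set n := Num.max _ _.
  have n1 : `|w1| <= n by rewrite le_max lexx.
  have n2 : `|w2| <= n by rewrite le_max lexx orbT.
  have n0 : 0 <= n := le_trans (normr_ge0 _) n1.
  rewrite (_ : _ - _ = (y1 - x1) * w2 + w1 * (y2 - x2)); last by ring.
  apply: (@le_trans _ _ (m * n + n * m)).
    by apply: (ler_norm_split (erefl _) _ _ (lexx _)); rewrite normrM; apply: ler_pM.
  rewrite [n * m]mulrC -mulrDl ler_wpM2r//.
  by rewrite -mulr2n -mulr_natl ler_wpM2r.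
Qed.

Lemma C11_inv V (f : V -> R) (x0 : V) :
  C11 f x0 -> f x0 != 0 -> C11 (fun x => (f x)^-1) x0.
Proof.
move=> Cf f0.
suff L : C11 (fun p : R => p^-1) (f x0) by have [] := C11_comp Cf L.
move: (f x0) f0 => a a0 {Cf f x0}.
pose k := `|a| / 2; have k0 : 0 < k by rewrite divr_gt0 ?normr_gt0.
have ki0 : 0 <= k^-1 by rewrite invr_ge0 ltW.
have low x : `|x - a| < k -> k <= `|x|.
  move=> xa; have := ler_normD x (a - x); rewrite addrCA subrr addr0 distrC /k in xa *.
  rewrite /k; lra.
have ib x : `|x - a| < k -> `|x^-1| <= k^-1.
  by move=> xa; rewrite normfV lef_pV2 ?posrE//; [exact: low|exact: lt_le_trans (low x xa)].
pose C := k^-1 ^+ 2 + 2 * k^-1 ^+ 3.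
have C0 : 0 <= C by rewrite /C addr_ge0 ?mulr_ge0 ?exprn_ge0.
have nz x : `|x - a| < k -> x != 0.
  by move=> xa; rewrite -normr_gt0; apply: lt_le_trans (low x xa).
apply: (@C11_intro _ R R _ (fun x w => - (x^-1 ^+ 2 * w)) a C k C0 k0 _).1.
move=> x xa; have ix := ib x xa; have x0 := nz x xa.
have ix2 : `|x^-1 ^+ 2| <= k^-1 ^+ 2 by rewrite normrX lerXn2r ?nnegrE.
split.
- by move=> c u v; rewrite /GRing.scale /=; ring.
- move=> w; rewrite normrN normrM ler_wpM2r//; apply: le_trans ix2 _.
  by rewrite /C lerDl mulr_ge0 ?exprn_ge0.
- move=> y ya; have iy := ib y ya; have y0 := nz y ya; split.
    rewrite (_ : _ - _ - _ = (x^-1 ^+ 2 * y^-1) * (y - x) ^+ 2); last by field; rewrite x0 y0.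
    rewrite normrM [`|(y - x) ^+ 2|]normrX ler_wpM2r ?exprn_ge0// normrM.
    apply: (@le_trans _ _ (k^-1 ^+ 2 * k^-1)); first exact: ler_pM.
    rewrite -exprSr /C; apply: ler_wpDl; first exact: exprn_ge0.
    by rewrite ler_peMl ?exprn_ge0//; lra.
  move=> w; rewrite (_ : _ - _ = (x^-1 * y^-1 * (x^-1 + y^-1) * (y - x)) * w); last by field; rewrite x0 y0.
  rewrite normrM ler_wpM2r// normrM ler_wpM2r// !normrM.
  apply: (@le_trans _ _ ((k^-1 * k^-1) * (k^-1 + k^-1))).
    apply: ler_pM; rewrite ?mulr_ge0//; first exact: ler_pM.
    by apply: (ler_norm_split (erefl _) ix iy).
  rewrite /C; have := exprn_ge0 2 ki0; lra.
Qed.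

Lemma C11_sum V W (I : Type) (s : seq I) (P : pred I) (f : I -> V -> W) (x0 : V) :
  (forall i, P i -> C11 (f i) x0) -> C11 (fun x => \sum_(i <- s | P i) f i x) x0.
Proof.
move=> Cf; elim: s => [|i s IH].
  by under eq_fun do rewrite big_nil; exact: C11_cst.
case Pi : (P i).
  by under eq_fun do rewrite big_cons Pi; apply: C11_add => //; exact: Cf.
by under eq_fun do rewrite big_cons Pi.
Qed.

Lemma C11_prod V (I : Type) (s : seq I) (P : pred I) (f : I -> V -> R) (x0 : V) :
  (forall i, P i -> C11 (f i) x0) -> C11 (fun x => \prod_(i <- s | P i) f i x) x0.
Proof.
move=> Cf; elim: s => [|i s IH].
  by under eq_fun do rewrite big_nil; exact: C11_cst.
case Pi : (P i).
  by under eq_fun do rewrite big_cons Pi; apply: C11_mul => //; exact: Cf.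
by under eq_fun do rewrite big_cons Pi.
Qed.
End C11_closure.

Lemma near_normP (R : realType) (V : normedModType R) (x0 : V) (P : set V) :
  (\forall x \near x0, P x) <-> exists2 r : R, 0 < r & forall x, `|x - x0| < r -> P x.
Proof.
split.
  move=> /nbhs_ballP [r /= r0 H]; exists r => // x xr; apply: H.
  by rewrite -ball_normE /ball_/= distrC.
move=> [r r0 H]; apply/nbhs_ballP; exists r => //= x.
by rewrite -ball_normE /ball_/= distrC; exact: H.
Qed.

(** * Smooth maps on coordinate space: Lipschitz derivatives and symmetry of second derivatives *)

Section RowVectors.
Variables (R : realType) (n : nat).

Lemma coord_le_norm (w : 'rV[R]_n) i : `|w 0 i| <= `|w|.
Proof.
rewrite [X in _ <= X]/Num.norm /= mx_normrE.
by apply: (@le_bigmax _ _ _ 0 (fun ij : 'I_1 * 'I_n => `|w ij.1 ij.2|) (0, i)).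
Qed.

Lemma rV_norm_le (w : 'rV[R]_n) (c : R) : 0 <= c -> (forall i, `|w 0 i| <= c) -> `|w| <= c.
Proof.
move=> c0 H; rewrite /Num.norm /= mx_normrE; apply/bigmax_leP; split=> // -[i j] _ /=.
by rewrite (ord1 i).
Qed.

Lemma rV_sum_delta (w : 'rV[R]_n) : w = \sum_i w 0 i *: delta_mx 0 i.
Proof. exact: row_sum_delta. Qed.

Lemma norm_delta_le i : `|delta_mx 0 i : 'rV[R]_n| <= 1.
Proof.
by apply: rV_norm_le => // j; rewrite mxE; case: (_ && _); rewrite ?normr1 ?normr0.
Qed.

Lemma linear_rV_bound (W : normedModType R) (L : 'rV[R]_n -> W) (B : R) : linear L ->
  0 <= B -> (forall i, `|L (delta_mx 0 i)| <= B) -> forall w, `|L w| <= n%:R * B * `|w|.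
Proof.
move=> lL B0 LB w; have L0 : L 0 = 0.
  by have := lL (-1) 0 0; rewrite !scaleN1r addNr addNr.
have LS (I : Type) (s : seq I) (F : I -> 'rV[R]_n) (k : I -> R) :
    L (\sum_(i <- s) k i *: F i) = \sum_(i <- s) k i *: L (F i).
  by elim: s => [|i s IH]; rewrite ?big_nil// !big_cons lL IH.
rewrite {1}(rV_sum_delta w) LS; apply: le_trans (ler_norm_sum _ _ _) _.
apply: (@le_trans _ _ (\sum_(i < n) B * `|w|)).
  apply: ler_sum => i _; rewrite normrZ mulrC; apply: ler_pM => //.
  exact: coord_le_norm.
by rewrite sumr_const card_ord -mulrA mulr_natl.
Qed.

Lemma linear_rV_bounded (W : normedModType R) (L : 'rV[R]_n -> W) : linear L ->
  exists2 K : R, 0 < K & forall w, `|L w| <= K * `|w|.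
Proof.
move=> lL; pose B := \sum_i `|L (delta_mx 0 i)|.
have B0 : 0 <= B by apply: sumr_ge0.
exists (n%:R * B + 1); first by rewrite ltr_wpDl// mulr_ge0.
move=> w; apply: le_trans (linear_rV_bound lL B0 _ w) _.
  by move=> i; rewrite /B (bigD1 i)//= lerDl sumr_ge0.
by rewrite ler_wpM2r// lerDl.
Qed.

Lemma C11_coord (V : normedModType R) (f : V -> 'rV[R]_n) (x0 : V) i : C11 f x0 -> C11 (fun y => f y 0 i) x0.
Proof.
move=> Cf; have [||L _] := @C11_bounded_linear R 'rV[R]_n R (fun v => v 0 i) (f x0) 1; last first.
- by have [] := C11_comp Cf L.
- by move=> w; rewrite mul1r; exact: coord_le_norm.
- by move=> k u v; rewrite !mxE.
Qed.

Lemma C11_row (V : normedModType R) (f : V -> 'rV[R]_n) (x0 : V) :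
  (forall i, C11 (fun y => f y 0 i) x0) -> C11 f x0.
Proof.
move=> Cf; apply: (@C11_eq _ _ _ (fun y => \sum_i f y 0 i *: delta_mx 0 i) _ _ 1) => //.
  by move=> x _; rewrite -rV_sum_delta.
apply: C11_sum => i _.
have [||L _] := @C11_bounded_linear R R 'rV[R]_n (fun k => k *: delta_mx 0 i) (f x0 0 i) 1; last first.
- by have [] := C11_comp (Cf i) L.
- by move=> w; rewrite mul1r normrZ ler_piMr// norm_delta_le.
- by move=> k u v; rewrite scalerDl scalerA.
Qed.

Lemma smooth_on_derive (W : normedModType R) U (f : 'rV[R]_n -> W) (v : 'rV[R]_n) :
  smooth_on U f -> smooth_on U ('D_v f).
Proof. by move=> sf vs x Ux; have := sf (rcons vs v) x Ux; rewrite /iterated_derive foldr_rcons. Qed.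

Lemma derive_linear (V W : normedModType R) (f : V -> W) (x : V) : differentiable f x ->
  linear (fun w => 'D_w f x).
Proof. by move=> df k u v; rewrite !deriveE// linearP. Qed.

(** Second partial derivatives are continuous, hence bounded near [x0]. The mean value inequality
    along segments turns this into Lipschitz first derivatives and, applied once more, into the
    quadratic remainder. *)
Lemma smooth_on_C11 (W : normedModType R) (U : set 'rV[R]_n) (f : 'rV[R]_n -> W) (x0 : 'rV[R]_n) :
  open U -> U x0 -> smooth_on U f -> C11 f x0.
Proof.
move=> oU Ux0 sf.
have dF x : U x -> differentiable f x by move=> Ux; exact: (sf [::]).
pose e (i : 'I_n) : 'rV[R]_n := delta_mx 0 i.
have dD i x : U x -> differentiable ('D_(e i) f) x by move=> Ux; exact: (sf [:: e i]).
pose B : R := 1 + \sum_i \sum_j `|'D_(e j) ('D_(e i) f) x0|.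
have B0 : 0 <= B by rewrite /B addr_ge0// !sumr_ge0// => i _; rewrite sumr_ge0.
have T (i j : 'I_n) : `|'D_(e j) ('D_(e i) f) x0| <= \sum_i \sum_j `|'D_(e j) ('D_(e i) f) x0|.
  rewrite (bigD1 i)//=; apply: ler_wpDr.
    by apply: sumr_ge0 => k _; exact: sumr_ge0.
  by rewrite (bigD1 j)//=; apply: ler_wpDr; first exact: sumr_ge0.
have [r r0 Hr] : exists2 r : R, 0 < r & forall x, `|x - x0| < r -> U x /\
    forall i j, `|'D_(e j) ('D_(e i) f) x| <= B.
  apply/near_normP; near=> x; split; first by near: x; exact: open_nbhs_nbhs.
  near: x; apply: filter_forall => i0; apply: filter_forall => j0.
  have cD := differentiable_continuous (sf [:: e j0; e i0] x0 Ux0).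
  have /cvgrPdist_lt /(_ 1 ltr01) := cD; apply: filterS => x /ltW Hx.
  apply: (ler_norm_split (x := - ('D_(e j0) ('D_(e i0) f) x0 - 'D_(e j0) ('D_(e i0) f) x))
      (y := 'D_(e j0) ('D_(e i0) f) x0) (a := 1) _ _ (lexx _)).
  - by lmod R.
  - by rewrite normrN.
  by rewrite /B lerD2l; exact: T.
have seg x y (t : R) : `|x - x0| < r -> `|y - x0| < r -> 0 <= t <= 1 ->
    `|x + t *: (y - x) - x0| < r.
  move=> xr yr /andP[t0 t1].
  apply: (@le_lt_trans _ _ ((1 - t) * `|x - x0| + t * `|y - x0|)).
    apply: (ler_norm_split (x := (1 - t) *: (x - x0)) (y := t *: (y - x0)) _ _ _ (lexx _)).
    - by lmod R.
    - by rewrite normrZ ger0_norm ?subr_ge0.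
    - by rewrite normrZ ger0_norm.
  have [->|tn] := eqVneq t 0; first by rewrite subr0 mul1r mul0r addr0.
  have tp : 0 < t by rewrite lt_def tn.
  have h1 : (1 - t) * `|x - x0| <= (1 - t) * r by rewrite ler_wpM2l ?subr_ge0// ltW.
  have h2 : t * `|y - x0| < t * r by rewrite ltr_pM2l.
  lra.
have segD (g : 'rV[R]_n -> W) x y (t : R) : (forall z, U z -> differentiable g z) ->
    `|x - x0| < r -> `|y - x0| < r -> 0 <= t <= 1 ->
    is_derive t 1 (fun s : R => g (x + s *: (y - x))) ('D_(y - x) g (x + t *: (y - x))).
  move=> dg xr yr t01; have [Uz _] := Hr _ (seg x y t xr yr t01).
  have : is_derive (x + t *: (y - x)) (y - x) g ('D_(y - x) g (x + t *: (y - x))).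
    by split => //; apply: diff_derivable; exact: dg.
  move=> /is_derive_eps H; apply/is_derive_eps => ep ep0; have [d d0 Hd] := H ep ep0.
  exists d => // h hd; rewrite [h *: 1]mulr1.
  by have := Hd h hd; rewrite (_ : x + (t + h) *: (y - x) = x + t *: (y - x) + h *: (y - x))//; lmod R.
have lip1 i x y : `|x - x0| < r -> `|y - x0| < r ->
    `|'D_(e i) f y - 'D_(e i) f x| <= n%:R * B * `|y - x|.
  move=> xr yr.
  have := @mean_value R W _ _ 0 1 (n%:R * B * `|y - x|) ler01 (fun t => segD _ x y t (dD i) xr yr).
  rewrite scale1r scale0r addr0 subr0 mulr1 (_ : x + (y - x) = y); last by lmod R.
  apply => t t01.
  have [Uz Hz] := Hr _ (seg x y t xr yr t01).
  by apply: (linear_rV_bound (derive_linear (dD i _ Uz)) B0) => j; exact: Hz.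
pose S1 : R := 1 + \sum_i `|'D_(e i) f x0|.
have S10 : 0 <= S1 by rewrite /S1 addr_ge0// sumr_ge0.
have nB : 0 <= n%:R * (n%:R * B) by rewrite !mulr_ge0.
have nS : 0 <= n%:R * S1 by rewrite mulr_ge0.
have nBr : 0 <= n%:R * (n%:R * B * r) by rewrite !mulr_ge0// ltW.
pose C : R := n%:R * (n%:R * B) + (n%:R * S1 + n%:R * (n%:R * B * r)).
have C0 : 0 <= C by rewrite /C; lra.
have lip2 x y w : `|x - x0| < r -> `|y - x0| < r ->
    `|'D_w f y - 'D_w f x| <= n%:R * (n%:R * B) * `|y - x| * `|w|.
  move=> xr yr; have [Ux _] := Hr _ xr; have [Uy _] := Hr _ yr.
  have lL : linear (fun w => 'D_w f y - 'D_w f x).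
    move=> k u v; rewrite (derive_linear (dF _ Uy)) (derive_linear (dF _ Ux)) /=.
    by lmod R.
  have := @linear_rV_bound W _ (n%:R * B * `|y - x|) lL _ _ w.
  rewrite [n%:R * (_ * `|_|)]mulrA; apply; first by rewrite !mulr_ge0.
  by move=> i; exact: lip1.
apply: (@C11_intro R _ _ f (fun x w => 'D_w f x) x0 C r C0 r0 _).1 => x xr.
have [Ux _] := Hr _ xr.
have CL : n%:R * (n%:R * B) <= C by rewrite /C; lra.
have fe i : `|'D_(e i) f x| <= S1 + n%:R * B * r.
  apply: (ler_norm_split (x := 'D_(e i) f x0) (y := 'D_(e i) f x - 'D_(e i) f x0)
     (b := n%:R * B * r) _ (lexx _)).
  - by lmod R.
  - apply: le_trans (lip1 i _ _ _ xr) _; rewrite ?subrr ?normr0//.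
    by rewrite ler_wpM2l ?mulr_ge0// ltW.
  rewrite lerD2r /S1 (bigD1 i)//= addrCA lerDl addr_ge0//.
  exact: sumr_ge0.
split.
- exact: derive_linear (dF _ Ux).
- move=> w; apply: le_trans (linear_rV_bound (derive_linear (dF _ Ux)) _ fe w) _.
    by rewrite addr_ge0// !mulr_ge0// ltW.
  by rewrite ler_wpM2r// /C mulrDr; lra.
- move=> y yr; split; last first.
    move=> w; apply: le_trans (lip2 x y w xr yr) _.
    by rewrite !ler_wpM2r.
  (* Subtracting the linear term makes the derivative along the segment small of first order, so its
     integral, the Taylor remainder, is of second order. *)
  have dh (t : R) : 0 <= t <= 1 -> is_derive t 1 (fun s : R => f (x + s *: (y - x)) - s *: 'D_(y - x) f x)
      ('D_(y - x) f (x + t *: (y - x)) - 'D_(y - x) f x).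
    move=> t01; have := segD f x y t dF xr yr t01.
    move=> /is_derive_eps H; apply/is_derive_eps => ep ep0; have [d d0 Hd] := H ep ep0.
    exists d => // h hd; rewrite [h *: 1]mulr1; have := Hd h hd; rewrite [h *: 1]mulr1.
    by congr (`|_| <= _); lmod R.
  have := @mean_value R W _ _ 0 1 (C * `|y - x| ^+ 2) ler01 dh.
  rewrite !scale1r !scale0r addr0 !subr0 mulr1 (_ : x + (y - x) = y); last by lmod R.
  rewrite (_ : f y - 'D_(y - x) f x - f x = f y - f x - 'D_(y - x) f x); last by lmod R.
  apply => t t01; apply: le_trans (lip2 x _ (y - x) xr (seg x y t xr yr t01)) _.
  rewrite addrAC subrr add0r normrZ expr2 [X in _ <= X]mulrA ler_wpM2r//.
  have /andP[t0 t1] := t01; rewrite ger0_norm//.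
  apply: ler_pM => //; first by rewrite mulr_ge0.
  by rewrite ler_piMl.
Unshelve. all: by end_near. Qed.
End RowVectors.

Section Schwarz.
Variables (R : realType) (n : nat) (W : normedModType R).

(** The mean value inequality is applied in the direction [v] to the difference of two parallel
    lines a distance t [u] apart. The left-hand second difference is symmetric in [u] and [v]. *)
Let second_difference (f g : 'rV[R]_n -> W) (x u v : 'rV[R]_n) (r : R) : 0 < r ->
  (forall y, `|y - x| < r -> is_derive y v f (g y)) ->
  C11 g x -> exists K d : R, [/\ 0 <= K, 0 < d & forall t, 0 < t -> t < d ->
  `|f (x + t *: u + t *: v) - f (x + t *: u) - f (x + t *: v) + f x
    - t ^+ 2 *: 'D_u g x| <= K * t ^+ 3].
Proof.
move=> r0 df [C [s [C0 s0 H]]].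
pose q := `|u| + `|v| + 1.
have q0 : 0 < q by rewrite /q ltr_wpDl ?addr_ge0.
pose d := Num.min r s / q.
have d0 : 0 < d by rewrite divr_gt0// lt_min r0.
exists (C * (`|u| ^+ 2 + `|v| * `|u|)), d; split => //.
  by rewrite mulr_ge0 ?(ltW C0)// addr_ge0 ?exprn_ge0// mulr_ge0.
move=> t t0 td.
have tq : t * q < Num.min r s by rewrite -ltr_pdivlMr.
have small (a b : R) : 0 <= a <= t -> 0 <= b <= t -> `|x + a *: u + b *: v - x| < Num.min r s.
  move=> /andP[a0 at_] /andP[b0 bt]; apply: le_lt_trans tq.
  apply: (ler_norm_split (x := a *: u) (y := b *: v) (a := t * `|u|) (b := t * `|v|)).
  - by lmod R.
  - by rewrite normrZ ger0_norm// ler_wpM2r.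
  - by rewrite normrZ ger0_norm// ler_wpM2r.
  - by rewrite /q; nra.
have dline (a s1 : R) : 0 <= a <= t -> 0 <= s1 <= t ->
    is_derive s1 1 (fun z : R => f (x + a *: u + z *: v)) (g (x + a *: u + s1 *: v)).
  move=> at_ st; have := small a s1 at_ st; rewrite lt_min => /andP[xr _].
  have /is_derive_eps D := df _ xr.
  apply/is_derive_eps => ep ep0; have [dd dd0 Hd] := D ep ep0.
  exists dd => // h hd; rewrite [h *: 1]mulr1; have := Hd h hd.
  by congr (`|f _ - _ - _| <= _); lmod R.
have t00 : 0 <= (0:R) <= t by rewrite lexx ltW.
have tt : 0 <= t <= t by rewrite lexx ltW.
pose psi (z : R) := f (x + t *: u + z *: v) - f (x + 0 *: u + z *: v) - z *: (t *: 'D_u g x).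
have dpsi z : 0 <= z <= t -> is_derive z 1 psi
    (g (x + t *: u + z *: v) - g (x + 0 *: u + z *: v) - t *: 'D_u g x).
  move=> zt; rewrite /psi.
  have D1 := dline t z tt zt; have D2 := dline 0 z t00 zt.
  apply: is_deriveB; apply/is_derive_eps => ep ep0; exists 1 => // h _.
  rewrite [h *: 1]mulr1 (_ : _ - _ - _ = 0) ?normr0 ?mulr_ge0 ?(ltW ep0)//.
  by lmod R.
have Bd z : 0 <= z <= t ->
    `|g (x + t *: u + z *: v) - g (x + 0 *: u + z *: v) - t *: 'D_u g x| <=
     C * (`|u| ^+ 2 + `|v| * `|u|) * t ^+ 2.
  move=> zt; have := small t z tt zt; rewrite lt_min => /andP[_ x1].
  have := small 0 z t00 zt; rewrite lt_min => /andP[_ x2].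
  have [_ _ /(_ _ x1) [e1 _]] := H _ x2.
  have x00 : `|x - x| < s by rewrite subrr normr0.
  have [l0 _ /(_ _ x2) [_ /(_ (t *: u)) e2]] := H _ x00.
  have lin y : `|y - x| < s -> 'D_(t *: u) g y = t *: 'D_u g y.
    move=> ys; have [ly _ _] := H _ ys; have := ly t u 0; rewrite addr0 => ->.
    have [_ by_ _] := H _ ys.
    suff -> : 'D_0 g y = 0 by rewrite addr0.
    exact: derive0.
  rewrite (_ : x + t *: u + z *: v - (x + 0 *: u + z *: v) = t *: u) in e1; last by lmod R.
  rewrite (_ : x + 0 *: u + z *: v - x = z *: v) in e2; last by lmod R.
  rewrite !lin// in e1 e2.
  apply: (ler_norm_split _ e1 e2); first by lmod R.
  have /andP[z0 zt'] := zt.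
  rewrite !normrZ (ger0_norm z0) (ger0_norm (ltW t0)) exprMn.
  rewrite (_ : _ + _ = C * (t ^+ 2 * `|u| ^+ 2 + z * t * (`|v| * `|u|))); last by ring.
  rewrite (_ : C * _ * t ^+ 2 = C * (t ^+ 2 * `|u| ^+ 2 + t * t * (`|v| * `|u|))); last by ring.
  apply: ler_wpM2l; first exact: ltW.
  by rewrite lerD2l; apply: ler_wpM2r; rewrite ?mulr_ge0// ler_wpM2r// ltW.
have := mean_value (ltW t0) dpsi Bd.
rewrite /psi (_ : f _ - _ - _ - _ = f (x + t *: u + t *: v) - f (x + t *: u) - f (x + t *: v) + f x
    - t ^+ 2 *: 'D_u g x).
  by rewrite subr0 -mulrA -exprSr.
rewrite !scale0r !addr0 !subr0 opprB expr2 !addrA.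
by lmod R.
Qed.

(** Both mixed derivatives, times t^2, approximate the same second difference over a parallelogram
    up to order t^3. *)
Lemma smooth_on_schwarz (U : set 'rV[R]_n) (f : 'rV[R]_n -> W) (x u v : 'rV[R]_n) :
  open U -> U x -> smooth_on U f -> 'D_u ('D_v f) x = 'D_v ('D_u f) x.
Proof.
move=> oU Ux sf.
have /near_normP [r r0 Hr] : \forall y \near x, U y by exact: open_nbhs_nbhs.
have df w y : `|y - x| < r -> is_derive y w f ('D_w f y).
  by move=> /Hr Uy; split => //; apply: diff_derivable; exact: (sf [::]).
have C w : C11 ('D_w f) x.
  by apply: (smooth_on_C11 oU Ux); exact: smooth_on_derive.
have [K [d [K0 d0 H]]] := second_difference u r0 (df v) (C v).
have [K' [d' [K0' d0' H']]] := second_difference v r0 (df u) (C u).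
apply/eqP; rewrite -subr_eq0 -normr_le0; apply/ler_addgt0Pr => e e0; rewrite add0r.
pose t := Num.min (Num.min d d') (e / (K + K' + 1)) / 2.
have KK : 0 < K + K' + 1 by lra.
have m0 : 0 < Num.min (Num.min d d') (e / (K + K' + 1)) by rewrite !lt_min d0 d0' divr_gt0.
have t0 : 0 < t by rewrite divr_gt0.
have : t < Num.min (Num.min d d') (e / (K + K' + 1)) by rewrite /t; lra.
rewrite !lt_min -andbA => /and3P[td td' te].
have A := H t t0 td; have B := H' t t0 td'.
rewrite -normrN in B.
have : `|t ^+ 2 *: ('D_u ('D_v f) x - 'D_v ('D_u f) x)| <= (K + K') * t ^+ 3.
  rewrite -normrN mulrDl; apply: (ler_norm_split _ A B (lexx _)).
  by rewrite (_ : x + t *: v + t *: u = x + t *: u + t *: v); [lmod R|lmod R].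
have t2 : 0 < t ^+ 2 by rewrite exprn_gt0.
rewrite normrZ (ger0_norm (ltW t2)) => H2; rewrite -(ler_pM2l t2).
apply: le_trans H2 _; rewrite exprSr mulrCA ler_pM2l//.
move: te; rewrite ltr_pdivlMr// => te; lra.
Qed.
End Schwarz.

(** * Primitives and geometric limits in coordinate spaces *)

Section MeanValue0.
Variables (R : realType) (W : normedModType R).

Lemma mean_value0 (f df : R -> W) (t K : R) :
  (forall s : R, `|s| <= `|t| -> is_derive s 1 f (df s)) ->
  (forall s : R, `|s| <= `|t| -> `|df s| <= K) ->
  `|f t - f 0| <= K * `|t|.
Proof.
move=> fd dK; have [t0|t0] := leP 0 t.
  rewrite ger0_norm// in fd dK *.
  have := @mean_value R W f df 0 t K t0; rewrite subr0; apply => s /andP[s0 st].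
    by apply: fd; rewrite ger0_norm.
  by apply: dK; rewrite ger0_norm.
have nt : `|t| = - t by rewrite ltr0_norm.
rewrite distrC nt in fd dK *.
have := @mean_value R W f df t 0 K (ltW t0); rewrite sub0r; apply => s /andP[s0 st].
  by apply: fd; rewrite ler0_norm// lerN2.
by apply: dK; rewrite ler0_norm// lerN2.
Qed.

Lemma lipschitz_continuous (V : normedModType R) (f : V -> W) (K : R) :
  (forall x y, `|f x - f y| <= K * `|x - y|) -> continuous f.
Proof.
move=> H x; apply/cvgrPdist_le => e e0; apply/near_normP.
pose K' := `|K| + 1; have K0 : 0 < K' by rewrite /K' ltr_wpDl.
exists (e / K'); first by rewrite divr_gt0.
move=> y; rewrite ltr_pdivlMr// => h; apply: le_trans (H x y) _.
rewrite distrC mulrC; apply: le_trans (ltW h); rewrite ler_wpM2l//.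
by rewrite /K'; apply: le_trans (ler_norm _) _; rewrite lerDl.
Qed.

Lemma is_derive_continuous (f : R -> W) (t : R) l : is_derive t 1 f l ->
  {for t, continuous f}.
Proof.
by move=> [H _]; apply: differentiable_continuous; apply/derivable1_diffP.
Qed.

(* Cauchy problems are solved in spaces with antiderivatives and limits of
   geometrically convergent sequences; products of ['rV_n] qualify. *)
Definition antider := forall f : R -> W, continuous f ->
  exists2 A : R -> W, A 0 = 0 & forall t : R, is_derive t 1 A (f t).

Definition geo_complete := forall (u : nat -> W) (K : R),
  (forall k, `|u k.+1 - u k| <= K / 2 ^+ k) ->
  exists l, forall k, `|l - u k| <= 2 * K / 2 ^+ k.
End MeanValue0.

Section NiceR.
Variable R : realType.

(** The fundamental theorem gives a primitive on each bounded interval. Primitives vanishing at 0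
    agree where both are defined, so at t one may use the interval of radius |t| + 1. *)
Lemma antider_R : @antider R R.
Proof.
move=> f cf.
have AT (T : R) : 0 < T -> exists2 A : R -> R, A 0 = 0 &
    forall t : R, `|t| < T -> is_derive t 1 A (f t).
  move=> T0.
  pose F (x : R) := \int[lebesgue_measure]_(t in `[- T, x]) f t.
  exists (fun x => F x - F 0); first by rewrite subrr.
  move=> t; rewrite ltr_norml => /andP[Tt tT].
  have fi : lebesgue_measure.-integrable `[- T, T] (EFin \o f).
    apply: continuous_compact_integrable; first exact: segment_compact.
    exact: continuous_subspaceT.
  have [D1 D2] := @continuous_FTC1_closed R f (- T) t T tT fi Tt (cf t).
  rewrite -[f t]subr0; apply: is_deriveB.
  by rewrite derive1E in D2; exact: (DeriveDef D1 D2).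
have [A HA] := @choice {T : R | 0 < T} (R -> R) _ (fun T => let: ex_intro2 A h1 h2 := AT (sval T) (svalP T) in ex_intro _ A (conj h1 h2)).
have pos (t : R) : 0 < `|t| + 1 by rewrite ltr_wpDl.
pose pt (t : R) : {T : R | 0 < T} := exist (fun T : R => is_true (0 < T)) (`|t| + 1) (pos t).
pose B (t : R) := A (pt t).
have BB (t s : R) : `|s| < `|t| + 1 -> B t s = B s s.
  move=> st; have [a0 aD] := HA (pt t); have [b0 bD] := HA (pt s).
  rewrite /= in aD bD.
  have H : `|(B t s - B s s) - (B t 0 - B s 0)| <= 0 * `|s|.
    apply: (@mean_value0 R R (fun x => B t x - B s x) (fun=> 0)) => x xs; last by rewrite normr0.
    rewrite -[0 : R](subrr (f x)); apply: is_deriveB.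
      by apply: aD; apply: le_lt_trans st.
    by apply: bD; apply: le_lt_trans xs _; rewrite ltrDl.
  move: H; rewrite mul0r normr_le0 (_ : B t 0 = 0)// (_ : B s 0 = 0)// !subr0 subr_eq0.
  by move/eqP.
exists (fun t => B t t); first by have [] := HA (pt 0).
move=> t; have [_ aD] := HA (pt t); have /= := aD t.
rewrite ltrDl ltr01 => /(_ isT) /is_derive_eps D.
apply/is_derive_eps => e e0; have [d d0 Hd] := D e e0.
exists (Num.min d 1); first by rewrite lt_min d0 ltr01.
move=> h; rewrite lt_min => /andP[hd h1]; have := Hd h hd.
rewrite -/(B t) -(BB t (t + h *: 1))// [h *: 1]mulr1.
by apply: le_lt_trans (ler_normD _ _) _; rewrite ltrD2l.
Qed.

(** The limit is the supremum of the lower bounds [u k - 2 * K / 2 ^+ k], each of which lies below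
    all the upper bounds. *)
Lemma geo_complete_R : @geo_complete R R.
Proof.
move=> u K Hu.
have Hd k m : `|u (k + m)%N - u k| <= 2 * K / 2 ^+ k - 2 * K / 2 ^+ (k + m).
  elim: m => [|m IH]; first by rewrite addn0 !subrr normr0.
  have H1 := Hu (k + m)%N; rewrite addnS.
  apply: (ler_norm_split (x := u (k + m).+1 - u (k + m)%N) _ H1 IH); first by ring.
  rewrite exprSr invfM; have -> : 2 * K * ((2 ^+ (k + m))^-1 * 2^-1) = K / 2 ^+ (k + m).
    by field; rewrite expf_neq0.
  lra.
have K0 : 0 <= K by have := Hu 0%N; rewrite expr0 divr1; apply: le_trans.
have p2 k : 0 < (2 : R) ^+ k by rewrite exprn_gt0.
have Hb k m : `|u (k + m)%N - u k| <= 2 * K / 2 ^+ k.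
  by apply: le_trans (Hd k m) _; rewrite gerBl divr_ge0 ?mulr_ge0// ltW.
pose S := [set x | exists k, x = u k - 2 * K / 2 ^+ k].
have cmp k m : u k - 2 * K / 2 ^+ k <= u m + 2 * K / 2 ^+ m.
  have /orP[km|mk] := leq_total k m.
    have := Hb k (m - k)%N; rewrite subnKC// ler_norml => /andP[h _].
    have : 0 <= 2 * K / 2 ^+ m by rewrite divr_ge0 ?mulr_ge0// ltW.
    lra.
  have := Hb m (k - m)%N; rewrite subnKC// ler_norml => /andP[_ h].
  have : 0 <= 2 * K / 2 ^+ k by rewrite divr_ge0 ?mulr_ge0// ltW.
  lra.
have S0 : S !=set0 by exists (u 0%N - 2 * K / 2 ^+ 0); exists 0%N.
have hS : has_sup S by split => //; exists (u 0%N + 2 * K / 2 ^+ 0) => x [k ->]; exact: cmp.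
exists (sup S) => k; rewrite ler_distl; apply/andP; split.
  by apply: (ub_le_sup hS.2); exists k.
by apply: ge_sup => // x [m ->]; exact: cmp.
Qed.

Lemma antider_rV n : @antider R 'rV[R]_n.
Proof.
move=> f cf.
have cfi i : continuous (fun t => f t 0 i).
  by move=> t; apply: (@continuous_comp _ _ _ f (fun v : 'rV[R]_n => v 0 i)); [exact: cf|exact: coord_continuous].
have [A HA] := @choice 'I_n (R -> R) _ (fun i => let: ex_intro2 A h1 h2 := antider_R (cfi i) in ex_intro _ A (conj h1 h2)).
exists (fun t => \row_i A i t).
  by apply/rowP => i; rewrite !mxE; have [] := HA i.
move=> t; apply/is_derive_eps => e e0.
have near0 i : \forall h \near (0 : R), `|A i (t + h) - A i t - h * f t 0 i| <= e * `|h|.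
  have [_ /(_ t) /is_derive_eps /(_ e e0) [d d0 Hd]] := HA i.
  apply/near_normP; exists d => // h; rewrite subr0 => hd.
  by have := Hd h hd; rewrite [h *: 1]mulr1.
have /near_normP [d d0 Hd] : \forall h \near (0 : R), forall i, `|A i (t + h) - A i t - h * f t 0 i| <= e * `|h|.
  exact: (@filter_forall R 'I_n (fun i h => is_true (`|A i (t + h) - A i t - h * f t 0 i| <= e * `|h|)) (nbhs (0 : R)) _ near0).
exists d => // h hd; rewrite [h *: 1]mulr1; apply: rV_norm_le; first by rewrite mulr_ge0 ?(ltW e0).
by move=> i; rewrite !mxE; apply: Hd; rewrite subr0.
Qed.

Lemma geo_complete_rV n : @geo_complete R 'rV[R]_n.
Proof.
move=> u K Hu; have K0 : 0 <= K by have := Hu 0%N; rewrite expr0 divr1; apply: le_trans.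
have Hi i k : `|u k.+1 0 i - u k 0 i| <= K / 2 ^+ k.
  by apply: le_trans (Hu k); have := coord_le_norm (u k.+1 - u k) i; rewrite !mxE.
have [l Hl] := @choice 'I_n R _ (fun i => geo_complete_R (Hi i)).
exists (\row_i l i) => k; apply: rV_norm_le.
  by rewrite divr_ge0 ?mulr_ge0 ?exprn_ge0.
by move=> i; rewrite !mxE.
Qed.

Lemma antider_prod (V W : normedModType R) : @antider R V -> @antider R W -> @antider R (V * W)%type.
Proof.
move=> aV aW f cf.
have c1 : continuous (fst \o f) by move=> t; apply: continuous_comp; [exact: cf|exact: cvg_fst].
have c2 : continuous (snd \o f) by move=> t; apply: continuous_comp; [exact: cf|exact: cvg_snd].
have [A A0 DA] := aV _ c1; have [B B0 DB] := aW _ c2.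
exists (fun t => (A t, B t)); first by rewrite A0 B0.
move=> t; apply/is_derive_eps => e e0.
have /is_derive_eps /(_ e e0) [d d0 Hd] := DA t.
have /is_derive_eps /(_ e e0) [d' d0' Hd'] := DB t.
exists (Num.min d d'); first by rewrite lt_min d0.
move=> h; rewrite lt_min => /andP[h1 h2].
by rewrite prod_normE /= ge_max; apply/andP; split; [exact: Hd|exact: Hd'].
Qed.

Lemma geo_complete_prod (V W : normedModType R) :
  @geo_complete R V -> @geo_complete R W -> @geo_complete R (V * W)%type.
Proof.
move=> gV gW u K Hu.
have [|l Hl] := gV (fst \o u) K.
  by move=> k; apply: le_trans (Hu k); rewrite prod_normE le_max lexx.
have [|l' Hl'] := gW (snd \o u) K.
  by move=> k; apply: le_trans (Hu k); rewrite prod_normE le_max lexx orbT.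
by exists (l, l') => k; rewrite prod_normE /= ge_max; apply/andP; split; [exact: Hl|exact: Hl'].
Qed.
End NiceR.

Section Clamp.
Variable R : realType.
Implicit Types a b t x y : R.

Lemma dist_max_le a x y : `|Num.max a x - Num.max a y| <= `|x - y|.
Proof.
have h1 := ler_norm (x - y); have h2 := ler_norm (y - x); rewrite distrC in h2.
by rewrite ler_norml; case: (leP a x) => ?; case: (leP a y) => ?; lra.
Qed.

Lemma dist_min_le b x y : `|Num.min b x - Num.min b y| <= `|x - y|.
Proof.
have h1 := ler_norm (x - y); have h2 := ler_norm (y - x); rewrite distrC in h2.
by rewrite ler_norml; case: (leP b x) => ?; case: (leP b y) => ?; lra.
Qed.

Lemma max_min_continuous a b : continuous (fun x => Num.max a (Num.min b x)).
Proof.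
apply: (@lipschitz_continuous R R R _ 1) => x y; rewrite mul1r.
exact: le_trans (dist_max_le _ _ _) (dist_min_le _ _ _).
Qed.

(** Extends paths given on [0, 1] to the whole line without losing continuity, so that continuity
    never has to be taken within an interval. *)
Definition clamp01 t : R := Num.max 0 (Num.min 1 t).

Lemma clamp01_itv t : 0 <= clamp01 t <= 1.
Proof. by rewrite /clamp01 le_max lexx ge_max ler01 ge_min lexx. Qed.

Lemma clamp01_id t : 0 <= t <= 1 -> clamp01 t = t.
Proof. by move=> /andP[h1 h2]; rewrite /clamp01 min_r// max_r. Qed.

Lemma clamp01_continuous : continuous clamp01.
Proof. exact: max_min_continuous. Qed.
End Clamp.

(** * Ordinary differential equations *)

Section Picard.
Variables (R : realType) (W : normedModType R).
Hypotheses (aW : @antider R W) (gW : @geo_complete R W).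

(** On so short an interval the maximum of |D|, attained by compactness, is absorbed with factor 1/2
    by the mean value inequality; this stands in for the exponential in Gronwall's inequality. *)
Lemma gronwall_small (D D' : R -> W) (d L e : R) : 0 < d -> 0 <= L -> d * L <= 1 / 2 ->
  (forall t : R, `|t| <= d -> is_derive t 1 D (D' t)) ->
  (forall t : R, `|t| <= d -> `|D' t| <= L * `|D t| + e) ->
  forall t : R, `|t| <= d -> `|D t| <= 2 * (`|D 0| + d * e).
Proof.
move=> d0 L0 dL DD Db.
have e0 : 0 <= L * `|D 0| + e.
  by apply: le_trans (Db 0 _); rewrite ?normr0 ?(ltW d0).
have [c cI cM] : exists2 c : R, `|c| <= d & forall t : R, `|t| <= d -> `|D t| <= `|D c|.
  have [||c cI cM] := @EVT_max R (fun t => `|D t|) (- d) d.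
  - by lra.
  - apply: continuous_in_subspaceT => t; rewrite inE /= in_itv /= -ler_norml => td.
    apply: (@continuous_comp _ _ _ D (fun x => `|x|)); last exact: norm_continuous.
    exact: is_derive_continuous (DD t td).
  exists c; first by move: cI; rewrite in_itv /= -ler_norml.
  by move=> t td; apply: cM; rewrite in_itv /= -ler_norml.
have H : `|D c - D 0| <= (L * `|D c| + e) * `|c|.
  apply: (mean_value0 (df := D')) => s sc.
    by apply: DD; apply: le_trans cI.
  apply: le_trans (Db s (le_trans sc cI)) _.
  by rewrite lerD2r ler_wpM2l// cM// (le_trans sc).
move=> t td; apply: le_trans (cM t td) _.
have Dc : `|D c| <= `|D c - D 0| + `|D 0|.
  by
     rewrite -{1}[D c](subrK (D 0)); exact: ler_normD.
have le0 : 0 <= L * `|D c| + e.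
  by apply: le_trans e0 _; rewrite lerD2r ler_wpM2l// cM// normr0 ltW.
have H2 : (L * `|D c| + e) * `|c| <= (L * `|D c| + e) * d by rewrite ler_wpM2l.
have H3 : d * L * `|D c| <= 1 / 2 * `|D c| by rewrite ler_wpM2r.
lra.
Qed.

Definition clamp (d t : R) : R := Num.max (- d) (Num.min d t).

Lemma clamp_id d t : `|t| <= d -> clamp d t = t.
Proof. by rewrite ler_norml /clamp => /andP[h1 h2]; rewrite min_r// max_r. Qed.

Lemma clamp_le d t : 0 <= d -> `|clamp d t| <= d.
Proof.
move=> d0; rewrite ler_norml /clamp le_max lexx /= ge_max ge_min lexx /= andbT.
lra.
Qed.

Lemma clamp_continuous d : continuous (clamp d).
Proof. exact: max_min_continuous. Qed.

(** The field is only asked to turn continuous curves into continuous ones, so that it may depend on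
    time through another solution, as the linearized equation does. *)
Lemma picard (G : R -> W -> W) (a : W) (L d K : R) : 0 < d -> 0 <= L -> d * L <= 1 / 2 ->
  (forall y : R -> W, continuous y -> continuous (fun t => G t (y t))) ->
  (forall t x y, `|G t x - G t y| <= L * `|x - y|) ->
  (forall t, `|G t a| <= K) ->
  exists y : R -> W, [/\ y 0 = a, continuous y &
    forall t : R, `|t| <= d -> is_derive t 1 y (G t (y t))].
Proof.
move=> d0 L0 dL Gc GL Ga.
have intG (y : R -> W) : exists z : R -> W, continuous y ->
    [/\ z 0 = a, continuous z & forall t : R, is_derive t 1 z (G t (y t))].
  have [cy|ncy] := pselect (continuous y); last by exists (fun=> 0).
  have [A A0 DA] := aW (Gc y cy).
  have Dz (t : R) : is_derive t 1 (fun t => a + A t) (G t (y t)).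
    rewrite -[G t _]add0r; apply: is_deriveD; exact: DA.
  exists (fun t => a + A t) => _; split => //; first by rewrite A0 addr0.
  by move=> t; exact: is_derive_continuous (Dz t).
have [T HT] := choice intG.
pose y k := iter k T (fun=> a).
have yc k : continuous (y k).
  by elim: k => [|k IH]; [move=> t; exact: cvg_cst|have [] := HT _ IH].
have yS k : [/\ y k.+1 0 = a, continuous (y k.+1) &
    forall t : R, is_derive t 1 (y k.+1) (G t (y k t))] by exact: HT.
have y0 k : y k 0 = a by case: k => [//|k]; have [] := yS k.
have K0 : 0 <= K := le_trans (normr_ge0 _) (Ga 0).
have step k t : `|t| <= d -> `|y k.+1 t - y k t| <= (K * d) / 2 ^+ k.
  elim: k t => [|k IH] t td.
    have [z0 _ zD] := yS 0%N.
    have : `|y 1%N t - y 1%N 0| <= K * `|t|.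
      by apply: (@mean_value0 R W (y 1%N) (fun s => G s a)) => s _; first [exact: Ga|exact: zD].
    rewrite z0 expr0 divr1 => /le_trans; apply.
    by rewrite ler_wpM2l.
  have [z0 _ zD] := yS k; have [x0 _ xD] := yS k.+1.
  have : `|(y k.+2 t - y k.+1 t) - (y k.+2 0 - y k.+1 0)| <= L * ((K * d) / 2 ^+ k) * `|t|.
    apply: (@mean_value0 _ _ (fun s => y k.+2 s - y k.+1 s) (fun s => G s (y k.+1 s) - G s (y k s))) => s st.
    by apply: le_trans (GL _ _ _) _; rewrite ler_wpM2l// IH// (le_trans st).
  rewrite !y0 subrr subr0 => /le_trans; apply.
  have E0 : 0 <= K * d / 2 ^+ k by rewrite divr_ge0 ?mulr_ge0 ?exprn_ge0 ?(ltW d0).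
  apply: (@le_trans _ _ (L * (K * d / 2 ^+ k) * d)).
    by apply: ler_wpM2l => //; exact: mulr_ge0.
  have -> : K * d / 2 ^+ k.+1 = K * d / 2 ^+ k / 2 by rewrite exprSr invfM mulrA.
  by have := ler_wpM2l E0 dL; lra.
have lim t : exists l, `|t| <= d -> forall k, `|l - y k t| <= 2 * (K * d) / 2 ^+ k.
  have [td|] := boolP (`|t| <= d); last by exists 0.
  by have [l Hl] := gW (fun k => step k t td); exists l.
have [l Hl] := choice lim.
(* The iterates converge on [-d, d]; freezing time outside makes the limit continuous on the whole
   line, so that [T] applies to it. The solution is [T x], which agrees with [x] on [-d, d] and is
   differentiable at the endpoints too. *)
pose x t := l (clamp d t).
have cle t : `|clamp d t| <= d by apply: clamp_le; exact: ltW.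
have xy t k : `|x t - y k (clamp d t)| <= 2 * (K * d) / 2 ^+ k by exact: Hl.
have small (e : R) : 0 < e -> exists k, 2 * (K * d) / 2 ^+ k <= e.
  move=> e0; pose c := 2 * (K * d) / e.
  have c0 : 0 <= c by rewrite divr_ge0 ?mulr_ge0 ?(ltW d0) ?(ltW e0).
  pose m := (Num.truncn c).+1; exists m.
  have h : c < 2 ^+ m.
    by apply: lt_trans (truncnS_gt c) _; rewrite -natrX ltr_nat; exact: ltn_expl.
  rewrite ler_pdivrMr ?exprn_gt0//; move: (ltW h).
  by rewrite /c ler_pdivrMr// [2 ^+ m * e]mulrC.
have xc : continuous x.
  move=> t; apply/cvgrPdist_le => e e0.
  have [k Hk] := small (e / 3) ltac:(by rewrite divr_gt0).
  have ck : continuous (y k \o clamp d).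
    by move=> s; apply: continuous_comp; [exact: clamp_continuous|exact: yc].
  have /cvgrPdist_le /(_ (e / 3)) := ck t; rewrite divr_gt0// => /(_ isT).
  apply: filterS => s Hs.
  have A := le_trans (xy t k) Hk; have B := le_trans (xy s k) Hk.
  rewrite -normrN opprB in B.
  apply: (ler_norm_split (x := x t - y k (clamp d s)) _ _ B (c := e) (a := 2 * (e / 3))).
  - by lmod R.
  - by apply: (ler_norm_split _ A Hs); [rewrite /=; lmod R|lra].
  - lra.
have [X0 Xc XD] := HT _ xc; exists (T x); split => // t td.
suff -> : T x t = x t by exact: XD.
apply/eqP; rewrite -subr_eq0 -normr_le0; apply/ler_addgt0Pr => e e0; rewrite add0r.
have [k Hk] := small (e / 2) ltac:(by rewrite divr_gt0).
have [z0 _ zD] := yS k.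
have A : `|T x t - y k.+1 t| <= e / 4.
  have : `|(T x t - y k.+1 t) - (T x 0 - y k.+1 0)| <= L * (e / 2) * `|t|.
    apply: (@mean_value0 _ _ (fun s => T x s - y k.+1 s) (fun s => G s (x s) - G s (y k s))) => s st.
    apply: le_trans (GL _ _ _) _; rewrite ler_wpM2l//.
    have := xy s k; rewrite clamp_id ?(le_trans st)// => /le_trans; exact.
  rewrite X0 z0 subrr subr0 => /le_trans; apply.
  apply: (@le_trans _ _ (L * (e / 2) * d)); first by rewrite ler_wpM2l ?mulr_ge0 ?divr_ge0 ?(ltW e0).
  rewrite [X in X <= _](_ : _ = d * L * (e / 2)); last by ring.
  by rewrite (_ : e / 4 = 1 / 2 * (e / 2)); [rewrite ler_wpM2r// divr_ge0// ltW|field].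
have B := xy t k.+1; rewrite clamp_id// in B.
have B2 : `|x t - y k.+1 t| <= e / 4.
  apply: le_trans B _; have -> : 2 * (K * d) / 2 ^+ k.+1 = 2 * (K * d) / 2 ^+ k / 2.
    by rewrite exprSr invfM !mulrA.
  by lra.
rewrite -normrN opprB in B2.
by apply: (ler_norm_split _ A B2); [lmod R|lra].
Qed.
End Picard.
Section Flow.
Variables (R : realType) (W : normedModType R).
Hypotheses (aW : @antider R W) (gW : @geo_complete R W).

(** Radial retraction onto a closed ball. Composing with it makes a locally Lipschitz field globally
    Lipschitz, as [picard] demands, without changing it on the ball. *)
Definition retract (x0 : W) (r : R) (x : W) : W :=
  x0 + (r / Num.max r `|x - x0|) *: (x - x0).

Lemma retract_id x0 r x : 0 < r -> `|x - x0| <= r -> retract x0 r x = x.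
Proof.
by move=> r0 xr; rewrite /retract max_l// divff ?gt_eqF// scale1r addrC subrK.
Qed.

Lemma retract_ball x0 r x : 0 < r -> `|retract x0 r x - x0| <= r.
Proof.
move=> r0; rewrite /retract addrAC subrr add0r normrZ.
have m0 : 0 < Num.max r `|x - x0| by rewrite lt_max r0.
rewrite ger0_norm; last by rewrite divr_ge0 ?ltW.
by rewrite mulrAC ler_pdivrMr// ler_pM2l// le_max lexx orbT.
Qed.

Lemma retract_lipschitz x0 r x y : 0 < r ->
  `|retract x0 r x - retract x0 r y| <= 2 * `|x - y|.
Proof.
move=> r0; rewrite /retract; set u := x - x0; set v := y - x0.
have uv : x - y = u - v by rewrite /u /v; lmod R.
rewrite {}uv; set a := Num.max r `|u|; set b := Num.max r `|v|.
have a0 : 0 < a by rewrite lt_max r0.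
have b0 : 0 < b by rewrite lt_max r0.
have ra : r <= a by rewrite le_max lexx.
have vb : `|v| <= b by rewrite le_max lexx orbT.
have ab : `|b - a| <= `|u - v|.
  have h1 : `|u| <= `|u - v| + `|v| by have := ler_normD (u - v) v; rewrite subrK.
  have h2 : `|v| <= `|u - v| + `|u| by have := ler_normD (v - u) u; rewrite subrK (distrC v).
  rewrite /a /b; case: (leP r `|u|) => ?; case: (leP r `|v|) => ?;
    rewrite ler_norml; lra.
apply: (ler_norm_split (x := (r / a) *: (u - v)) (y := (r * (a^-1 - b^-1)) *: v)
  (a := `|u - v|) (b := `|u - v|)).
- by lmod R.
- rewrite normrZ ger0_norm ?divr_ge0 ?(ltW r0) ?(ltW a0)//.
  by rewrite ler_piMl// ler_pdivrMr// mul1r.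
- rewrite normrZ (_ : r * (a^-1 - b^-1) = (r / a) * ((b - a) / b)); last first.
    by field; rewrite !gt_eqF.
  rewrite !normrM !normfV (gtr0_norm r0) (gtr0_norm a0) (gtr0_norm b0).
  rewrite (_ : _ * `|v| = (r / a) * (`|v| / b) * `|b - a|); last by ring.
  apply: le_trans ab; rewrite ler_piMl// mulr_ile1 ?divr_ge0 ?(ltW r0) ?(ltW a0) ?(ltW b0)//.
    by rewrite ler_pdivrMr// mul1r.
  by rewrite ler_pdivrMr// mul1r.
- by rewrite mulr_natl mulr2n.
Qed.

(* Local flow of [y' = F y] near [x0], differentiable in the initial value, with derivative
   [Z] solving the linearized equation. *)
Lemma local_flow (F : W -> W) (x0 : W) : C11 F x0 ->
  exists (r d K : R) (phi : R -> W -> W) (Z : R -> W -> W -> W),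
  [/\ 0 < r, 0 < d, forall a : W, `|a - x0| < r -> phi 0 a = a,
   (forall (a : W) (t : R), `|a - x0| < r -> `|t| <= d ->
      [/\ is_derive t 1 (fun s => phi s a) (F (phi t a)),
          `|phi t a - a| <= K * `|t| &
          C11 F (phi t a)]) &
   (forall (a : W) (t : R), `|a - x0| < r -> `|t| <= d ->
      [/\ C11 (phi t) a, forall w, 'D_w (phi t) a = Z t a w,
      forall w, Z 0 a w = w & forall w, is_derive t 1 (fun s => Z s a w) ('D_(Z t a w) F (phi t a))]) ].
Proof.
move=> CF; have [rn rn0 Hn] := C11_near CF.
have [L [r1 [L0 r10 HL]]] := C11_lipschitz CF.
have [C [r2 [C0 r20 HC]]] := CF.
pose r3 := Num.min rn (Num.min r1 r2).
have r30 : 0 < r3 by rewrite !lt_min rn0 r10.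
pose rho := r3 / 2; have rho0 : 0 < rho by rewrite divr_gt0.
have inB x : `|x - x0| <= rho -> [/\ `|x - x0| < rn, `|x - x0| < r1 & `|x - x0| < r2].
  move=> h; have : `|x - x0| < r3 by rewrite /rho in h; lra.
  by rewrite !lt_min => /and3P[].
pose ret := retract x0 rho.
have retB x : `|ret x - x0| <= rho by exact: retract_ball.
have ret1 x := (inB _ (retB x)).
pose K := `|F x0| + L * rho + 1.
have K0 : 0 < K by rewrite /K ltr_wpDl// addr_ge0// mulr_ge0 ?ltW.
have FK x : `|F (ret x)| <= K.
  have [_ h _] := ret1 x; have x00 : `|x0 - x0| < r1 by rewrite subrr normr0.
  have := HL _ _ x00 h => h2.
  apply: (ler_norm_split (x := F (ret x) - F x0) (y := F x0) _ h2 (lexx _)); first by lmod R.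
  by have := ler_wpM2l (ltW L0) (retB x); rewrite /K; lra.
(* The three bounds serve, in order, the contraction for the retracted field, whose Lipschitz
   constant is 2 L, the contraction for the linearized equation, and the confinement of solutions to
   the ball of radius [rho], where the retraction is the identity. *)
pose d := Num.min (1 / (4 * L)) (Num.min (1 / (2 * C)) (rho / (4 * K))).
have d0 : 0 < d by rewrite !lt_min !divr_gt0 ?mulr_gt0.
have dL : d * (2 * L) <= 1 / 2.
  have : d <= 1 / (4 * L) by rewrite ge_min lexx.
  by rewrite ler_pdivlMr ?mulr_gt0//; lra.
have dC : d * C <= 1 / 2.
  have : d <= 1 / (2 * C) by rewrite !ge_min lexx orbT.
  by rewrite ler_pdivlMr ?mulr_gt0//; lra.
have dK : d * K <= rho / 4.
  have : d <= rho / (4 * K) by rewrite !ge_min lexx !orbT.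
  by rewrite ler_pdivlMr ?mulr_gt0//; lra.
have retL x y : `|ret x - ret y| <= 2 * `|x - y| by exact: retract_lipschitz.
have FL x y : `|F (ret x) - F (ret y)| <= 2 * L * `|x - y|.
  have [_ h _] := ret1 x; have [_ h' _] := ret1 y.
  apply: le_trans (HL _ _ h' h) _.
  by rewrite [2 * L]mulrC -mulrA ler_wpM2l ?(ltW L0).
have ret_cont : continuous ret by exact: lipschitz_continuous retL.
have FC : continuous (fun x => F (ret x)) by exact: lipschitz_continuous FL.
have sol a : exists y : R -> W, [/\ y 0 = a, continuous y &
    forall t : R, `|t| <= d -> is_derive t 1 y (F (ret (y t)))].
  apply: (@picard R W aW gW (fun _ x => F (ret x)) a (2 * L) d K) => //.
  - by rewrite mulr_ge0 ?(ltW L0).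
  - by move=> y cy t; apply: (@continuous_comp _ _ _ y (fun x => F (ret x))); [exact: cy|exact: FC].
have [phi Hphi] := choice sol.
have DF x : `|x - x0| <= rho -> [/\ linear (fun w => 'D_w F x), forall w, `|'D_w F x| <= C * `|w| &
    forall y, `|y - x0| <= rho -> `|F y - F x - 'D_(y - x) F x| <= C * `|y - x| ^+ 2 /\
        forall w, `|'D_w F y - 'D_w F x| <= C * `|y - x| * `|w|].
  move=> /inB [_ _ h]; have [h1 h2 h3] := HC _ h; split => // y /inB [_ _ h'].
  exact: h3.
have lB x u v : `|x - x0| <= rho -> 'D_(u - v) F x = 'D_u F x - 'D_v F x.
  move=> h; have [l _ _] := DF x h.
  by rewrite (_ : u - v = -1 *: v + u); [rewrite l/= scaleN1r addrC|lmod R].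
have solZ a w : exists z : R -> W, [/\ z 0 = w, continuous z &
    forall t : R, `|t| <= d -> is_derive t 1 z ('D_(z t) F (ret (phi a t)))].
  have [_ cphi _] := Hphi a.
  apply: (@picard R W aW gW (fun t x => 'D_x F (ret (phi a t))) w C d (C * `|w|)) => //.
  - exact: ltW.
  - move=> z cz t; apply/cvgrPdist_le => e e0.
    pose m := `|z t| + 1; have m0 : 0 < m by rewrite ltr_wpDl.
    have cr : continuous (fun s => ret (phi a s)).
      by move=> s; apply: (@continuous_comp _ _ _ (phi a) ret); [exact: cphi|exact: ret_cont].
    have /cvgrPdist_le /(_ (e / (2 * C * m))) := cr t.
    rewrite divr_gt0 ?mulr_gt0// => /(_ isT) H1.
    have /cvgrPdist_le /(_ (e / (2 * C))) := cz t.
    rewrite divr_gt0 ?mulr_gt0// => /(_ isT) H2.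
    near=> s.
    have A1 : `|ret (phi a t) - ret (phi a s)| <= e / (2 * C * m) by near: s; exact: H1.
    have A2 : `|z t - z s| <= e / (2 * C) by near: s; exact: H2.
    have [_ b1 _] := DF _ (retB (phi a s)).
    have [_ _ /(_ _ (retB (phi a t))) [_ b2]] := DF _ (retB (phi a s)).
    have B1 := b1 (z t - z s); rewrite lB// in B1.
    apply: (ler_norm_split (a := e / 2) (b := e / 2) _ (le_trans (b2 (z t)) _) (le_trans B1 _)).
    + by lmod R.
    + move: A1; rewrite ler_pdivlMr ?mulr_gt0// => A1.
      have zm : `|z t| <= m by rewrite lerDl.
      apply: (@le_trans _ _ (C * `|ret (phi a t) - ret (phi a s)| * m)); last by lra.
      by apply: ler_wpM2l => //; rewrite mulr_ge0// ltW.
    + by move: A2; rewrite ler_pdivlMr ?mulr_gt0//; lra.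
    + lra.
  - move=> t x y; have [_ b _] := DF _ (retB (phi a t)).
    by rewrite -lB.
  - by move=> t; have [_ b _] := DF _ (retB (phi a t)); exact: b.
have [Z HZ] : exists Z : W -> W -> R -> W, forall a w, [/\ Z a w 0 = w, continuous (Z a w) &
    forall t : R, `|t| <= d -> is_derive t 1 (Z a w) ('D_(Z a w t) F (ret (phi a t)))].
  have [Z' HZ'] := choice (fun p : W * W => solZ p.1 p.2).
  by exists (fun a w => Z' (a, w)) => a w; exact: HZ' (a, w).
have phiK a t : `|t| <= d -> `|phi a t - a| <= K * `|t|.
  move=> td; have [p0 _ pD] := Hphi a; rewrite -{2}p0.
  apply: (@mean_value0 R W (phi a) (fun s => F (ret (phi a s)))) => s st.
    by apply: pD; apply: le_trans td.
  exact: FK.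
have phiB a t : `|a - x0| < rho / 2 -> `|t| <= d -> `|phi a t - x0| <= rho.
  move=> ar td; apply: (ler_norm_split (x := phi a t - a) (y := a - x0) _ (phiK a t td) (ltW ar)).
    by lmod R.
  have : K * `|t| <= K * d by rewrite ler_wpM2l// ltW.
  lra.
have reta a t : `|a - x0| < rho / 2 -> `|t| <= d -> ret (phi a t) = phi a t.
  by move=> ar td; apply: retract_id => //; exact: phiB.
have pD a (t : R) : `|a - x0| < rho / 2 -> `|t| <= d -> is_derive t 1 (phi a) (F (phi a t)).
  by move=> ar td; have [_ _ /(_ t td)] := Hphi a; rewrite reta.
have zD a w (t : R) : `|a - x0| < rho / 2 -> `|t| <= d -> is_derive t 1 (Z a w) ('D_(Z a w t) F (phi a t)).
  by move=> ar td; have [_ _ /(_ t td)] := HZ a w; rewrite reta.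
have phiL a b (t : R) : `|a - x0| < rho / 2 -> `|b - x0| < rho / 2 -> `|t| <= d ->
    `|phi b t - phi a t| <= 2 * `|b - a|.
  move=> ar br td; have [a0 _ _] := Hphi a; have [b0 _ _] := Hphi b.
  have := @gronwall_small R W (fun t => phi b t - phi a t) (fun t => F (phi b t) - F (phi a t)) d (2 * L) 0
     d0 _ dL _ _ t td; rewrite a0 b0 mulr0 addr0; apply.
  - by rewrite mulr_ge0// ltW.
  - by move=> s sd; apply: is_deriveB; exact: pD.
  - by move=> s sd; rewrite addr0; have := FL (phi b s) (phi a s); rewrite !reta.
have Z2 a w (t : R) : `|a - x0| < rho / 2 -> `|t| <= d -> `|Z a w t| <= 2 * `|w|.
  move=> ar td; have [z0 _ _] := HZ a w.
  have := @gronwall_small R W (Z a w) (fun t => 'D_(Z a w t) F (phi a t)) d C 0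
     d0 (ltW C0) dC _ _ t td; rewrite z0 mulr0 addr0; apply.
  - by move=> s sd; exact: zD.
  - by move=> s sd; rewrite addr0; have [_ b _] := DF _ (phiB a s ar sd); exact: b.
have Zlin a (t : R) : `|a - x0| < rho / 2 -> `|t| <= d -> linear (fun w => Z a w t).
  move=> ar td k u v.
  have [c0 _ _] := HZ a (k *: u + v); have [u0 _ _] := HZ a u; have [v0 _ _] := HZ a v.
  have := @gronwall_small R W (fun t => Z a (k *: u + v) t - (k *: Z a u t + Z a v t))
    (fun t => 'D_(Z a (k *: u + v) t) F (phi a t) - (k *: 'D_(Z a u t) F (phi a t) + 'D_(Z a v t) F (phi a t)))
    d C 0 d0 (ltW C0) dC _ _ t td.
  rewrite c0 u0 v0 subrr normr0 mulr0 addr0 mulr0 => H.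
  apply/eqP; rewrite -subr_eq0 -normr_le0; apply: H.
  - move=> s sd; apply: is_deriveB; [exact: zD|apply: is_deriveD; [apply: is_deriveZ|]; exact: zD].
  - move=> s sd; rewrite addr0; have [l b _] := DF _ (phiB a s ar sd).
    have <- : 'D_(k *: Z a u s + Z a v s) F (phi a s) = k *: 'D_(Z a u s) F (phi a s) + 'D_(Z a v s) F (phi a s).
      by rewrite l.
    by rewrite -lB; [exact: b|exact: phiB].
(* The difference quotient error starts at 0 and obeys the linearized equation up to the Taylor
   error of [F], which is quadratic in b - a by [phiL]; Gronwall preserves this order. *)
have quad a b (t : R) : `|a - x0| < rho / 2 -> `|b - x0| < rho / 2 -> `|t| <= d ->
    `|phi b t - phi a t - Z a (b - a) t| <= 2 * (d * (C * 4)) * `|b - a| ^+ 2.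
  move=> ar br td; have [a0 _ _] := Hphi a; have [b0 _ _] := Hphi b.
  have [z0 _ _] := HZ a (b - a).
  have := @gronwall_small R W (fun t => phi b t - phi a t - Z a (b - a) t)
    (fun t => F (phi b t) - F (phi a t) - 'D_(Z a (b - a) t) F (phi a t)) d C (C * 4 * `|b - a| ^+ 2)
     d0 (ltW C0) dC _ _ t td.
  rewrite a0 b0 z0 subrr normr0 add0r => H; rewrite -mulrA -[d * _ * _]mulrA; apply: H.
  - move=> s sd; apply: is_deriveB; [apply: is_deriveB; exact: pD|exact: zD].
  - move=> s sd; have [_ bb /(_ _ (phiB b s br sd)) [e _]] := DF _ (phiB a s ar sd).
    have B := bb (phi b s - phi a s - Z a (b - a) s); rewrite lB in B; last exact: phiB.
    rewrite [X in _ <= X]addrC; apply: (ler_norm_split _ e B); first by lmod R.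
    rewrite lerD2r -mulrA ler_wpM2l ?(ltW C0)//.
    apply: (@le_trans _ _ ((2 * `|b - a|) ^+ 2)).
      by rewrite lerXn2r ?nnegrE ?mulr_ge0// phiL.
    by rewrite exprMn; lra.
have ZL a b w (t : R) : `|a - x0| < rho / 2 -> `|b - x0| < rho / 2 -> `|t| <= d ->
    `|Z b w t - Z a w t| <= 2 * (d * (C * 4)) * `|b - a| * `|w|.
  move=> ar br td; have [a0 _ _] := HZ a w; have [b0 _ _] := HZ b w.
  have := @gronwall_small R W (fun t => Z b w t - Z a w t)
    (fun t => 'D_(Z b w t) F (phi b t) - 'D_(Z a w t) F (phi a t)) d C (C * 4 * `|b - a| * `|w|)
     d0 (ltW C0) dC _ _ t td.
  rewrite a0 b0 subrr normr0 add0r => H.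
  rewrite (_ : _ * `|w| = 2 * (d * (C * 4 * `|b - a| * `|w|))); last by ring.
  apply: H.
  - by move=> s sd; apply: is_deriveB; exact: zD.
  - move=> s sd; have [_ bb /(_ _ (phiB b s br sd)) [_ e]] := DF _ (phiB a s ar sd).
    have B := bb (Z b w s - Z a w s); rewrite lB in B; last exact: phiB.
    rewrite [X in _ <= X]addrC; apply: (ler_norm_split _ (e (Z b w s)) B); first by lmod R.
    rewrite lerD2r.
    rewrite (_ : C * 4 * _ * _ = C * (2 * `|b - a|) * (2 * `|w|)); last by ring.
    apply: ler_pM; rewrite ?mulr_ge0 ?(ltW C0)//; last exact: Z2.
    by rewrite ler_wpM2l ?(ltW C0)// phiL.
have rho2 : 0 < rho / 2 by rewrite divr_gt0.
exists (rho / 2), d, K, (fun t a => phi a t), (fun t a w => Z a w t); split => //.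
- by move=> a _; have [] := Hphi a.
- move=> a t ar td; split; [exact: pD|exact: phiK|].
  by apply: Hn; have [] := inB _ (phiB a t ar td).
move=> a t ar td.
have s0 : 0 < rho / 2 - `|a - x0| by rewrite subr_gt0.
pose B := 2 * (d * (C * 4)) + 2.
have B0 : 0 <= 2 * (d * (C * 4)) by rewrite !mulr_ge0// ltW.
have near b : `|b - a| < rho / 2 - `|a - x0| -> `|b - x0| < rho / 2.
  move=> ba; apply: (@le_lt_trans _ _ (`|b - a| + `|a - x0|)); last by rewrite -ltrBrDr.
  by rewrite -[b - x0](subrKA a) ler_normD.
have [|CP DP] := @C11_intro R W W (phi^~ t) (fun b w => Z b w t) a B _ (addr_ge0 B0 (ler0n _ 2)) s0.
  move=> b /near br; split.
  - exact: Zlin.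
  - by move=> w; apply: le_trans (Z2 b w t br td) _; rewrite ler_wpM2r// /B lerDr.
  - move=> c /near cr; split.
      by apply: le_trans (quad b c t br cr td) _; rewrite ler_wpM2r ?exprn_ge0// lerDl.
    by move=> w; apply: le_trans (ZL b c w t br cr td) _; rewrite !ler_wpM2r// lerDl.
split => //.
- move=> w; have [|_] // := DP a _ w; first by rewrite subrr normr0.
- by move=> w; have [] := HZ a w.
- by move=> w; exact: zD.
Unshelve. all: by end_near. Qed.
End Flow.

(** * Inverse function theorem *)

Section InverseFunction.
Variables (R : realType) (n : nat).
Implicit Types f s : 'rV[R]_n -> 'rV[R]_n.

Lemma linear_inverse (A : 'rV[R]_n -> 'rV[R]_n) : linear A ->
  (forall w, A w = 0 -> w = 0) ->
  exists (B : 'rV[R]_n -> 'rV[R]_n) (K : R),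
    [/\ linear B, 0 < K, forall w, B (A w) = w, forall w, A (B w) = w &
      forall w, `|B w| <= K * `|w|].
Proof.
move=> lA iA; pose J := \matrix_i A (delta_mx 0 i).
have A0 : A 0 = 0.
  by have := lA (-1) 0 0; rewrite !scaleN1r addNr addNr.
have LS (s : seq 'I_n) (k : 'I_n -> R) :
    A (\sum_(i <- s) k i *: delta_mx 0 i) = \sum_(i <- s) k i *: A (delta_mx 0 i).
  by elim: s => [|i s IH]; rewrite ?big_nil// !big_cons lA IH.
have AJ w : A w = w *m J.
  rewrite {1}(rV_sum_delta w) LS mulmx_sum_row; apply: eq_bigr => i _.
  by rewrite rowK.
have uJ : J \in unitmx.
  rewrite -row_free_unit; apply/inj_row_free => v vJ.
  by apply: iA; rewrite AJ.
have lB : linear (fun w : 'rV[R]_n => w *m invmx J).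
  by move=> k u v; rewrite mulmxDl scalemxAl.
have [K K0 BK] := linear_rV_bounded lB.
exists (fun w => w *m invmx J), K; split => //.
- by move=> w; rewrite AJ mulmxK.
- by move=> w; rewrite AJ mulmxKV.
Qed.

(** Newton's iteration with the inverse [B] of the differential frozen at [x0]: the radius [rho] is
    chosen so that x - B (f x) contracts by 1/2 there. The same estimate bounds the inverse. *)
Lemma inverse_function f (x0 : 'rV[R]_n) : C11 f x0 ->
  (forall w, 'D_w f x0 = 0 -> w = 0) ->
  exists s (rho sig K : R), [/\ 0 < rho, 0 < sig, 0 < K,
    (forall y, `|y - f x0| < sig -> `|s y - x0| < rho /\ f (s y) = y) &
    (forall x x', `|x - x0| < rho -> `|x' - x0| < rho -> `|x - x'| <= K * `|f x - f x'|)].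
Proof.
move=> [C [r [C0 r0 H]]] iA.
have x00 : `|x0 - x0| < r by rewrite subrr normr0.
have [lA bA eA] := H _ x00.
have [B [K0 [lB K00 BA AB BK]]] := linear_inverse lA iA.
pose rho := Num.min r (1 / (8 * K0 * C)).
have rho0 : 0 < rho by rewrite lt_min r0 divr_gt0 ?mulr_gt0.
have rr : rho <= r by rewrite ge_min lexx.
have rK : K0 * C * rho <= 1 / 8.
  have : rho <= 1 / (8 * K0 * C) by rewrite ge_min lexx orbT.
  by rewrite ler_pdivlMr ?mulr_gt0//; lra.
have B0 : B 0 = 0 by have := lB (-1) 0 0; rewrite !scaleN1r addNr addNr.
have BB u v : B (u - v) = B u - B v.
  by rewrite (_ : u - v = -1 *: v + u); [rewrite lB scaleN1r addrC|lmod R].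
have key x x' : `|x - x0| < rho -> `|x' - x0| < rho ->
    `|x - x' - B (f x - f x')| <= 1 / 2 * `|x - x'|.
  move=> xr xr'; have xr1 := lt_le_trans xr rr; have xr1' := lt_le_trans xr' rr.
  have [_ _ /(_ x xr1) [e1 _]] := H _ xr1'.
  have [_ /(_ (x - x')) e2] := eA x' xr1'.
  rewrite -{1}(BA (x - x')) -BB; apply: le_trans (BK _) _.
  have E : `|'D_(x - x') f x0 - (f x - f x')| <= C * `|x - x'| ^+ 2 + C * `|x' - x0| * `|x - x'|.
    rewrite -normrN in e1; rewrite -normrN in e2.
    by apply: (ler_norm_split _ e1 e2 (lexx _)); lmod R.
  apply: (@le_trans _ _ (K0 * (C * `|x - x'| ^+ 2 + C * `|x' - x0| * `|x - x'|))).
    by rewrite ler_wpM2l// ltW.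
  clear e1 e2 E; have n0 := normr_ge0 (x - x').
  have h1 : `|x - x'| <= 2 * rho.
    apply: (ler_norm_split (x := x - x0) (y := - (x' - x0)) (b := rho) _ (ltW xr)).
    - by lmod R.
    - by rewrite normrN ltW.
    - by rewrite mulr_natl mulr2n.
  rewrite (_ : K0 * _ = (K0 * C * (`|x - x'| + `|x' - x0|)) * `|x - x'|); last by ring.
  rewrite ler_wpM2r//.
  apply: (@le_trans _ _ (K0 * C * (3 * rho))); last lra.
  by rewrite ler_wpM2l ?mulr_ge0 ?ltW//; lra.
pose sig := rho / (8 * K0); have sig0 : 0 < sig by rewrite divr_gt0 ?mulr_gt0.
have inj x x' : `|x - x0| < rho -> `|x' - x0| < rho -> `|x - x'| <= 2 * K0 * `|f x - f x'|.
  move=> xr xr'; have k := key _ _ xr xr'; have b := BK (f x - f x').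
  have : `|x - x'| <= 1 / 2 * `|x - x'| + K0 * `|f x - f x'|.
    by apply: (ler_norm_split _ k b (lexx _)); lmod R.
  lra.
have sol y : exists x, `|y - f x0| < sig -> `|x - x0| < rho /\ f x = y.
  have [ys|] := boolP (`|y - f x0| < sig); last by exists 0.
  pose T x := x - B (f x - y).
  pose u k := iter k T x0.
  pose E := K0 * sig.
  have E8 : E = rho / 8 by rewrite /E /sig; field; rewrite gt_eqF.
  have E0 : 0 <= E by rewrite E8 divr_ge0 ?ltW.
  have st k : `|u k.+1 - u k| <= E / 2 ^+ k /\ `|u k.+1 - x0| <= 2 * E - E / 2 ^+ k.
    have p2 j : 0 < (2 : R) ^+ j by rewrite exprn_gt0.
    elim: k => [|k [IH1 IH2]].
      have : `|u 1%N - x0| <= E.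
        rewrite /u /= /T (_ : x0 - _ - x0 = B (y - f x0)).
          by apply: le_trans (BK _) _; rewrite ler_wpM2l ?(ltW K00)// ltW.
        by rewrite !BB; lmod R.
      by rewrite expr0 divr1 => h; split => //; lra.
    have Ek : 0 <= E / 2 ^+ k by rewrite divr_ge0// ltW.
    have i1 : `|u k.+1 - x0| < rho by apply: le_lt_trans IH2 _; lra.
    have i0 : `|u k - x0| < rho.
      apply: (@le_lt_trans _ _ (2 * E)); last lra.
      apply: (ler_norm_split (x := u k.+1 - x0) (y := - (u k.+1 - u k)) _ IH2 (b := E / 2 ^+ k)).
      - by lmod R.
      - by rewrite normrN.
      - lra.
    have S1 : `|u k.+2 - u k.+1| <= E / 2 ^+ k.+1.
      have := key _ _ i1 i0.
      rewrite (_ : u k.+1 - u k - _ = u k.+2 - u k.+1).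
        move=> /le_trans; apply; rewrite exprSr invfM mulrA; lra.
      rewrite /u /= -/(u k) /T !BB; lmod R.
    split => //; apply: (ler_norm_split _ S1 IH2); first by lmod R.
    rewrite exprSr invfM mulrA; lra.
  have [x Hx] := @geo_complete_rV R n u E (fun k => (st k).1).
  exists x => _.
  have xr : `|x - x0| < rho.
    by have := Hx 0%N; rewrite expr0 divr1 /u /= => /le_lt_trans; apply; lra.
  have ur k : `|u k - x0| < rho.
    case: k => [|k]; first by rewrite /u /= subrr normr0.
    apply: le_lt_trans (st k).2 _.
    have : 0 <= E / 2 ^+ k by rewrite divr_ge0 ?exprn_ge0.
    lra.
  split => //; apply/eqP; rewrite -subr_eq0; apply/eqP.
  suff B00 : B (f x - y) = 0 by rewrite -[LHS]AB B00 derive0.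
  apply/eqP; rewrite -normr_le0; apply/ler_addgt0Pr => e e0; rewrite add0r.
  have [k Hk] : exists k, 2 * E / 2 ^+ k <= e / 4.
    pose c := 8 * E / e; pose m := (Num.truncn c).+1; exists m.
    have h : c < 2 ^+ m.
      by apply: lt_trans (truncnS_gt c) _; rewrite -natrX ltr_nat; exact: ltn_expl.
    rewrite ler_pdivrMr ?exprn_gt0//; move: (ltW h).
    by rewrite /c ler_pdivrMr//; lra.
  have a1 := le_trans (Hx k) Hk.
  have a2 : `|x - u k.+1| <= e / 4.
    apply: le_trans (Hx k.+1) _; apply: le_trans Hk.
    have : 0 <= 2 * E / 2 ^+ k by apply: divr_ge0; [apply: mulr_ge0|exact: exprn_ge0].
    rewrite exprSr invfM mulrA; lra.
  have a3 := key _ _ xr (ur k).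
  apply: (ler_norm_split (x := x - u k.+1) (y := - (x - u k - B (f x - f (u k)))) _ a2 (b := e / 8)).
  - rewrite [u k.+1]/(T (u k)) /T !BB; lmod R.
  - by rewrite normrN; lra.
  - lra.
have [s Hs] := choice sol.
exists s, rho, sig, (2 * K0); split => //.
by rewrite mulr_gt0.
Qed.

(** The inverse estimate makes the continuous lift [l] Lipschitz at [t], so the quadratic remainder
    of [f] along it is of order h^2 and the first-order expansion can be solved for the increment of
    [l]. *)
Lemma inverse_function_curve f (l : R -> 'rV[R]_n) (t : R) c' : C11 f (l t) ->
  (forall w, 'D_w f (l t) = 0 -> w = 0) ->
  {for t, continuous l} -> is_derive t 1 (f \o l) c' ->
  exists2 l', is_derive t 1 l l' & 'D_l' f (l t) = c'.
Proof.
move=> Cf iA cl dfl.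
have [s [rho [sig [K [rho0 sig0 K0 _ inj]]]]] := inverse_function Cf iA.
have [B [K1 [lB K10 BA AB BK]]] := linear_inverse (C11_linear Cf) iA.
have [C [r [C0 r0 /(_ (l t))]]] := Cf; rewrite subrr normr0 => /(_ r0) [lA _ eA].
have B0 : B 0 = 0 by have := lB (-1) 0 0; rewrite !scaleN1r addNr addNr.
have BB u v : B (u - v) = B u - B v.
  by rewrite (_ : u - v = -1 *: v + u); [rewrite lB scaleN1r addrC|lmod R].
have BZ (k : R) u : B (k *: u) = k *: B u by have := lB k u 0; rewrite B0 !addr0.
exists (B c'); last by rewrite AB.
apply/is_derive_eps => e e0.
have rr0 : 0 < Num.min r rho by rewrite lt_min r0.
move/cvgrPdist_lt/(_ _ rr0)/near_normP: cl => [d1 d10 Hd1].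
pose e1 := e / (2 * K1); have e10 : 0 < e1 by rewrite divr_gt0 ?mulr_gt0.
have /is_derive_eps D := dfl; have [d2 d20 Hd2] := D _ e10.
pose m := K * (e1 + `|c'|) + 1.
have m0 : 0 < m.
  rewrite /m ltr_wpDl//; apply: mulr_ge0; [exact: ltW|apply: addr_ge0 => //; exact: ltW].
pose d3 := e / (2 * K1 * C * m ^+ 2).
have d30 : 0 < d3 by rewrite divr_gt0// !mulr_gt0 ?exprn_gt0.
exists (Num.min d1 (Num.min d2 d3)); first by rewrite !lt_min d10 d20.
move=> h; rewrite !lt_min => /and3P[h1 h2 h3].
have := Hd2 h h2; rewrite [h *: 1]mulr1 => E1.
have := Hd1 (t + h); rewrite addrAC subrr add0r distrC => /(_ h1).
rewrite lt_min => /andP[lr lrho].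
have [e2 _] := eA _ lr.
have l00 : `|l t - l t| < rho by rewrite subrr normr0.
have I := inj _ _ lrho l00.
have hh := normr_ge0 h.
have fle : `|f (l (t + h)) - f (l t)| <= (e1 + `|c'|) * `|h|.
  apply: (ler_norm_split (y := h *: c') (b := `|h| * `|c'|) _ E1).
  - by rewrite /=; lmod R.
  - by rewrite normrZ.
  - lra.
have lm : `|l (t + h) - l t| <= m * `|h|.
  apply: le_trans I _; apply: (@le_trans _ _ (K * ((e1 + `|c'|) * `|h|))).
    by rewrite ler_wpM2l// ltW.
  by rewrite /m; lra.
rewrite (_ : l (t + h) - l t - h *: B c' = B ('D_(l (t + h) - l t) f (l t) - h *: c')); last first.
  by rewrite BB BA BZ.
apply: le_trans (BK _) _.
rewrite mulrC -ler_pdivlMr//.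
rewrite -normrN in e2.
apply: (ler_norm_split _ e2 E1); first by rewrite /=; lmod R.
have q : `|l (t + h) - l t| ^+ 2 <= (m * `|h|) ^+ 2.
  by rewrite lerXn2r ?nnegrE ?mulr_ge0 ?(ltW m0).
have q2 : C * `|l (t + h) - l t| ^+ 2 <= e1 * `|h|.
  apply: (@le_trans _ _ (C * (m * `|h|) ^+ 2)); first by rewrite ler_wpM2l// ltW.
  rewrite exprMn [`|h| ^+ 2]expr2 !mulrA ler_wpM2r//.
  move: h3; rewrite /d3 ltr_pdivlMr ?mulr_gt0 ?exprn_gt0// => h3.
  by rewrite /e1 ler_pdivlMr ?mulr_gt0//; lra.
rewrite [X in _ <= X](_ : _ = e1 * `|h| + e1 * `|h|); first lra.
by rewrite /e1; field; rewrite gt_eqF.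
Qed.
End InverseFunction.

(** * Christoffel symbols, geodesics and curvature in coordinates *)

Section Bilinear.
Variables (R : realType) (n : nat).
Implicit Types (G : 'M[R]_n) (u v w : 'rV[R]_n).

Lemma bilinE G u v : bilin G u v = \sum_i \sum_j u 0 i * G i j * v 0 j.
Proof.
rewrite /bilin mxE exchange_big /=; apply: eq_bigr => j _.
by rewrite !mxE mulr_suml.
Qed.

Lemma bilinDl G u u' v : bilin G (u + u') v = bilin G u v + bilin G u' v.
Proof. by rewrite /bilin !mulmxDl mxE. Qed.
Lemma bilinDr G u v v' : bilin G u (v + v') = bilin G u v + bilin G u v'.
Proof. by rewrite /bilin linearD /= mulmxDr mxE. Qed.
Lemma bilinZl G k u v : bilin G (k *: u) v = k * bilin G u v.
Proof. by rewrite /bilin -!scalemxAl mxE. Qed.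
Lemma bilinZr G k u v : bilin G u (k *: v) = k * bilin G u v.
Proof. by rewrite /bilin linearZ /= -scalemxAr mxE. Qed.
Lemma bilinNl G u v : bilin G (- u) v = - bilin G u v.
Proof. by rewrite -scaleN1r bilinZl mulN1r. Qed.
Lemma bilinNr G u v : bilin G u (- v) = - bilin G u v.
Proof. by rewrite -scaleN1r bilinZr mulN1r. Qed.
Lemma bilin0l G v : bilin G 0 v = 0.
Proof. by rewrite -(scale0r 0) bilinZl mul0r. Qed.
Lemma bilin0r G u : bilin G u 0 = 0.
Proof. by rewrite -(scale0r 0) bilinZr mul0r. Qed.
Lemma bilinC G u v : G^T = G -> bilin G u v = bilin G v u.
Proof.
move=> sG; rewrite !bilinE exchange_big; apply: eq_bigr => i _; apply: eq_bigr => j _ /=.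
by rewrite -[in RHS]sG mxE; ring.
Qed.

Definition bilinE_ := (bilinDl, bilinDr, bilinZl, bilinZr, bilinNl, bilinNr, bilin0l, bilin0r).

Lemma bilin_pos_inj G : (forall u, u != 0 -> 0 < bilin G u u) -> forall u,
  (forall w, bilin G u w = 0) -> u = 0.
Proof.
move=> pG u uw; apply/eqP/negPn/negP => /pG; rewrite uw ltxx //.
Qed.

Lemma bilin_ge0 G u : (forall u, u != 0 -> 0 < bilin G u u) -> 0 <= bilin G u u.
Proof.
by move=> pG; have [->|/pG/ltW//] := eqVneq u 0; rewrite bilin0l.
Qed.

Lemma bilin_unitmx G : G^T = G -> (forall u, u != 0 -> 0 < bilin G u u) -> G \in unitmx.
Proof.
move=> sG pG; rewrite -row_free_unit; apply/inj_row_free => v vG.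
by apply: (bilin_pos_inj pG) => w; rewrite /bilin vG mul0mx mxE.
Qed.

Lemma bilin_cauchy_schwarz G u v : G^T = G -> (forall u, u != 0 -> 0 < bilin G u u) ->
  bilin G u v ^+ 2 <= bilin G u u * bilin G v v.
Proof.
move=> sG pG; have [->|v0] := eqVneq v 0.
  by rewrite !bilin0r mulr0 expr0n.
have vv := pG v v0.
have := bilin_ge0 (bilin G v v *: u - bilin G u v *: v) pG.
rewrite !bilinE_ (bilinC v u sG) => h.
have : 0 <= bilin G v v * (bilin G u u * bilin G v v - bilin G u v ^+ 2) by move: h; congr (_ <= _); ring.
by rewrite pmulr_rge0// subr_ge0.
Qed.
End Bilinear.

Lemma is_derive_sum_fun (R : realType) (W : normedModType R) (n : nat)
  (F : 'I_n -> R -> W) (dF : 'I_n -> W) (t : R) :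
  (forall i, is_derive t 1 (F i) (dF i)) ->
  is_derive t 1 (fun s => \sum_i F i s) (\sum_i dF i).
Proof.
move=> H; have := is_derive_sum H.
by rewrite (_ : \sum_i F i = (fun s => \sum_i F i s))//; apply/funext => s; rewrite fct_sumE.
Qed.

Section Christoffel.
Variables (R : realType) (n : nat) (g : 'rV[R]_n -> 'M[R]_n) (x : 'rV[R]_n).
Hypothesis gC11 : forall i j, C11 (fun y => g y i j : R) x.
Hypothesis gsym : \forall y \near x, (g y)^T = g y.
Hypothesis gpos : forall u, u != 0 -> 0 < bilin (g x) u u.
Implicit Types u v w : 'rV[R]_n.

(** The Christoffel symbols as a bilinear map, so that index sums occur in a few lemmas only and
    later identities are linear algebra. *)
Definition chr (y : 'rV[R]_n) u v : 'rV[R]_n :=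
  \row_k \sum_i \sum_j christoffel g k i j y * u 0 i * v 0 j.

Definition dmetric w u v : R := \sum_i \sum_j u 0 i * 'D_w (fun y => g y i j : R) x * v 0 j.

Lemma derive_sum_coord (W : normedModType R) (f : 'rV[R]_n -> W) w : C11 f x ->
  'D_w f x = \sum_m w 0 m *: 'D_(delta_mx 0 m) f x.
Proof.
move=> Cf; have lf := C11_linear Cf.
rewrite {1}(rV_sum_delta w).
have LS (s : seq 'I_n) (k : 'I_n -> R) :
    'D_(\sum_(i <- s) k i *: delta_mx 0 i) f x = \sum_(i <- s) k i *: 'D_(delta_mx 0 i) f x.
  by elim: s => [|i s IH]; rewrite ?big_nil ?derive0// !big_cons lf IH.
exact: LS.
Qed.

Lemma dmetric_coord u v w : dmetric w u v = \sum_i \sum_j \sum_m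
  u 0 i * v 0 j * w 0 m * partial m (fun y => g y i j) x.
Proof.
apply: eq_bigr => i _; apply: eq_bigr => j _.
rewrite (derive_sum_coord _ (gC11 i j)) mulr_sumr mulr_suml; apply: eq_bigr => m _.
by rewrite /GRing.scale /= /partial; ring.
Qed.

Lemma derive_symmetric w i j : 'D_w (fun y => g y i j : R) x = 'D_w (fun y => g y j i : R) x.
Proof.
apply: near_eq_derive; near=> y; have sy : (g y)^T = g y by near: y.
by rewrite -[in LHS]sy mxE.
Unshelve. all: by end_near. Qed.

Lemma dmetricC w u v : dmetric w u v = dmetric w v u.
Proof.
rewrite /dmetric exchange_big; apply: eq_bigr => i _; apply: eq_bigr => j _ /=.
by rewrite derive_symmetric; ring.
Qed.

(** Koszul's formula in coordinates: pairing with the metric cancels the inverse matrix in the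
    symbols. *)
Lemma christoffel_metric u v w : 2 * bilin (g x) (chr x u v) w =
  dmetric u v w + dmetric v u w - dmetric w u v.
Proof.
have sg : (g x)^T = g x by apply: nbhs_singleton gsym.
have ug : g x \in unitmx by apply: bilin_unitmx.
have [P [PE dE]] : exists P : 'I_n -> 'I_n -> 'I_n -> R,
    (forall k i j, christoffel g k i j x =
      2^-1 * \sum_l invmx (g x) k l * (P i j l + P j i l - P l i j)) /\
    (forall u v w, dmetric w u v = \sum_i \sum_j \sum_m u 0 i * v 0 j * w 0 m * P m i j).
  by exists (fun m i j => partial m (fun y => g y i j) x); split => // *; exact: dmetric_coord.
pose S i j : 'cV[R]_n := \col_l (P i j l + P j i l - P l i j).
pose T : 'cV[R]_n := \sum_i \sum_j (u 0 i * v 0 j) *: S i j.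
have cT : chr x u v = 2^-1 *: (invmx (g x) *m T)^T.
  apply/rowP => k; rewrite !mxE /T.
  under [in RHS]eq_bigr => l _.
    rewrite summxE mulr_sumr.
    under eq_bigr => i _ do rewrite summxE mulr_sumr.
    over.
  rewrite [in RHS]exchange_big mulr_sumr; apply: eq_bigr => i _ /=.
  rewrite [in RHS]exchange_big mulr_sumr; apply: eq_bigr => j _ /=.
  rewrite PE -!mulrA; congr (_ * _); rewrite mulr_suml; apply: eq_bigr => l _.
  by rewrite !mxE; ring.
rewrite (bilinC _ _ sg) cT bilinZr mulrA divff// mul1r.
rewrite /bilin trmxK -mulmxA (mulmxA (g x)) mulmxV// mul1mx.
rewrite /T mulmx_sumr summxE !dE.
have e1 : \sum_i \sum_j \sum_m v 0 i * w 0 j * u 0 m * P m i j =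
   \sum_i \sum_j \sum_l u 0 i * v 0 j * w 0 l * P i j l.
  under eq_bigr => i _ do rewrite exchange_big.
  rewrite exchange_big; apply: eq_bigr => i _; apply: eq_bigr => j _.
  by apply: eq_bigr => m _; ring.
have e2 : \sum_i \sum_j \sum_m u 0 i * w 0 j * v 0 m * P m i j =
   \sum_i \sum_j \sum_l u 0 i * v 0 j * w 0 l * P j i l.
  apply: eq_bigr => i _; rewrite exchange_big; apply: eq_bigr => j _.
  by apply: eq_bigr => m _; ring.
rewrite e1 e2 -big_split -sumrB; apply: eq_bigr => i _ /=.
rewrite mulmx_sumr summxE -big_split -sumrB; apply: eq_bigr => j _ /=.
rewrite mxE -big_split -sumrB; apply: eq_bigr => l _ /=.
by rewrite !mxE; ring.
Qed.

(** In the sum of two instances of Koszul's formula, the terms differentiating in the directions [u]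
    and [v] cancel. *)
Lemma metric_compatible u v w : dmetric w u v =
  bilin (g x) (chr x w u) v + bilin (g x) u (chr x w v).
Proof.
have sg : (g x)^T = g x by apply: nbhs_singleton gsym.
rewrite (bilinC u _ sg).
have := christoffel_metric w u v; have := christoffel_metric w v u; rewrite (dmetricC w v u).
move: (dmetric w u v) (dmetric u w v) (dmetric v w u) (bilin _ _ _) (bilin _ _ _) => *; lra.
Qed.

Lemma chr_linearr y u : linear (fun v => chr y u v).
Proof.
move=> k v v'; apply/rowP => l; rewrite !mxE mulr_sumr -big_split; apply: eq_bigr => i _ /=.
rewrite mulr_sumr -big_split; apply: eq_bigr => j _ /=; rewrite !mxE; ring.
Qed.

Lemma is_derive_bilin (c X Y : R -> 'rV[R]_n) (t : R) c' X' Y' : c t = x ->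
  is_derive t 1 c c' -> is_derive t 1 X X' -> is_derive t 1 Y Y' ->
  is_derive t 1 (fun s => bilin (g (c s)) (X s) (Y s))
    (dmetric c' (X t) (Y t) + bilin (g x) X' (Y t) + bilin (g x) (X t) Y').
Proof.
move=> ctx dc dX dY.
have coord (Z : R -> 'rV[R]_n) Z' i : is_derive t 1 Z Z' -> is_derive t 1 (fun s => Z s 0 i) (Z' 0 i).
  move=> /is_derive_eps H; apply/is_derive_eps => e e0; have [d d0 Hd] := H e e0.
  exists d => // h hd; apply: le_trans (Hd h hd).
  by have := coord_le_norm (Z (t + h *: 1) - Z t - h *: Z') i; rewrite !mxE.
have dg i j : is_derive t 1 (fun s => g (c s) i j) ('D_c' (fun y => g y i j : R) x).
  have := @C11_comp_curve R _ _ (fun y => g y i j : R) c t c'; rewrite ctx; apply => //.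
under eq_fun do rewrite bilinE.
have D i j := is_deriveM (is_deriveM (coord _ _ i dX) (dg i j)) (coord _ _ j dY).
have D2 := is_derive_sum_fun (fun i => is_derive_sum_fun (fun j => D i j)).
apply: is_derive_eq D2 _ => {D}.
rewrite !bilinE /dmetric -!big_split; apply: eq_bigr => i _; rewrite -!big_split; apply: eq_bigr => j _ /=.
rewrite [X in X *: Y' 0 j](_ : _ = X t 0 i * g (c t) i j)// ctx.
by move: ('D_c' _ _) => e; rewrite /GRing.scale /=; ring.
Qed.
End Christoffel.

Section CurveRules.
Variables (R : realType) (n : nat).

Lemma is_derive_coord (Z : R -> 'rV[R]_n) (Z' : 'rV[R]_n) (t : R) i :
  is_derive t 1 Z Z' -> is_derive t 1 (fun s => Z s 0 i) (Z' 0 i).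
Proof.
move=> /is_derive_eps H; apply/is_derive_eps => e e0; have [d d0 Hd] := H e e0.
exists d => // h hd; apply: le_trans (Hd h hd).
by have := coord_le_norm (Z (t + h *: 1) - Z t - h *: Z') i; rewrite !mxE.
Qed.

Lemma is_derive_row (Z : R -> 'rV[R]_n) (Z' : 'rV[R]_n) (t : R) :
  (forall i, is_derive t 1 (fun s => Z s 0 i) (Z' 0 i)) -> is_derive t 1 Z Z'.
Proof.
move=> H; rewrite (rV_sum_delta Z') (_ : Z = fun s => \sum_i Z s 0 i *: delta_mx 0 i).
  apply: is_derive_sum_fun => i; have /is_derive_eps D := H i.
  apply/is_derive_eps => e e0; have [d d0 Hd] := D e e0; exists d => // h hd.
  rewrite scalerA -!scalerBl normrZ; apply: le_trans (Hd h hd).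
  by rewrite ler_piMr// norm_delta_le.
by apply/funext => s; exact: rV_sum_delta.
Qed.

Lemma is_derive_pairE (V W : normedModType R) (f : R -> V * W) (t : R) l :
  is_derive t 1 f l <-> is_derive t 1 (fst \o f) l.1 /\ is_derive t 1 (snd \o f) l.2.
Proof.
split.
  move=> /is_derive_eps H; split; apply/is_derive_eps => e e0; have [d d0 Hd] := H e e0;
    exists d => // h hd; apply: le_trans (Hd h hd); rewrite [X in _ <= X]prod_normE /=.
    by rewrite le_max lexx.
  by rewrite le_max lexx orbT.
move=> [/is_derive_eps H /is_derive_eps H']; apply/is_derive_eps => e e0.
have [d d0 Hd] := H e e0; have [d' d0' Hd'] := H' e e0.
exists (Num.min d d'); first by rewrite lt_min d0.
move=> h; rewrite lt_min => /andP[h1 h2]; rewrite prod_normE /= ge_max; apply/andP; split.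
  exact: Hd.
exact: Hd'.
Qed.

Lemma is_derive_line (V : normedModType R) (x w : V) (t : R) :
  is_derive t 1 (fun s : R => x + s *: w) w.
Proof.
apply/is_derive_eps => e e0; exists 1 => // h _.
rewrite [h *: 1]mulr1 (_ : _ - _ - _ = 0) ?normr0 ?mulr_ge0 ?(ltW e0)//; lmod R.
Qed.

Lemma is_derive_cst_fun (V : normedModType R) (a : V) (t : R) : is_derive t 1 (fun _ : R => a) 0.
Proof.
apply/is_derive_eps => e e0; exists 1 => // h _.
by rewrite subrr scaler0 subr0 normr0 mulr_ge0 ?(ltW e0).
Qed.

Lemma C11_line (V W : normedModType R) (f : V -> W) (x w : V) : C11 f x ->
  is_derive (0 : R) 1 (fun s : R => f (x + s *: w)) ('D_w f x).
Proof.
move=> Cf; have D := is_derive_line x w 0.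
have := @C11_comp_curve R V W f (fun s => x + s *: w) 0 w; rewrite scale0r addr0.
by move=> /(_ Cf D).
Qed.
End CurveRules.

Section MatrixC11.
Variables (R : realType) (V : normedModType R).

Lemma C11_det n (A : V -> 'M[R]_n) (x : V) :
  (forall i j, C11 (fun y => A y i j : R) x) -> C11 (fun y => \det (A y) : R) x.
Proof.
move=> CA; rewrite /determinant; apply: C11_sum => s _.
apply: C11_mul; first exact: C11_cst.
by apply: C11_prod => i _; exact: CA.
Qed.

Lemma C11_invmx n (A : V -> 'M[R]_n) (x : V) (r : R) : 0 < r ->
  (forall y, `|y - x| < r -> A y \in unitmx) ->
  (forall i j, C11 (fun y => A y i j : R) x) ->
  forall i j, C11 (fun y => invmx (A y) i j : R) x.
Proof.
move=> r0 uA CA i j.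
have x00 : `|x - x| < r by rewrite subrr normr0.
apply: (@C11_eq R _ _ (fun y => (\det (A y))^-1 * cofactor (A y) j i) _ x r) => //.
  by move=> y /uA yr; rewrite /invmx yr !mxE.
apply: C11_mul.
  apply: C11_inv; first exact: C11_det.
  by rewrite -unitfE -unitmxE uA.
rewrite /cofactor; apply: C11_mul; first exact: C11_cst.
by apply: C11_det => k l; under eq_fun do rewrite !mxE; exact: CA.
Qed.
End MatrixC11.

Section Spray.
Variables (R : realType) (n : nat) (g : 'rV[R]_n -> 'M[R]_n) (U : set 'rV[R]_n).
Hypothesis oU : open U.
Hypothesis gsm : forall i j, smooth_on U (fun y => g y i j : R).
Hypothesis gsym : forall y, U y -> (g y)^T = g y.
Hypothesis gpos : forall y, U y -> forall u, u != 0 -> 0 < bilin (g y) u u.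
Implicit Types u v w x y : 'rV[R]_n.

Lemma C11_metric x i j : U x -> C11 (fun y => g y i j : R) x.
Proof. by move=> Ux; apply: (smooth_on_C11 oU Ux). Qed.

Lemma near_metric_sym x : U x -> \forall y \near x, (g y)^T = g y.
Proof. by move=> Ux; apply: (filterS gsym); exact: open_nbhs_nbhs. Qed.

Lemma christoffelC x k i j : U x -> christoffel g k i j x = christoffel g k j i x.
Proof.
move=> Ux; rewrite /christoffel; congr (_ * _); apply: eq_bigr => l _.
congr (_ * _); rewrite /partial (derive_symmetric (near_metric_sym Ux) _ i j).
by congr (_ - _); rewrite addrC.
Qed.

Lemma C11_christoffel x k i j : U x -> C11 (christoffel g k i j : _ -> R) x.
Proof.
move=> Ux; rewrite /christoffel; apply: C11_mul; first exact: C11_cst.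
have /near_normP [r r0 Hr] : \forall y \near x, U y by exact: open_nbhs_nbhs.
apply: C11_sum => l _; apply: C11_mul.
  apply: (C11_invmx r0) => [y /Hr Uy|a b]; last exact: C11_metric.
  by apply: bilin_unitmx; [exact: gsym|exact: gpos].
have Cp (a b c : 'I_n) : C11 (fun y => partial a (fun y => g y b c : R) y : R) x.
  by apply: (smooth_on_C11 oU Ux); exact: (smooth_on_derive (delta_mx 0 a) (gsm b c)).
apply: C11_add; last exact: C11_opp.
exact: C11_add.
Qed.

Definition dchr x w u v : 'rV[R]_n :=
  \row_k \sum_i \sum_j 'D_w (christoffel g k i j) x * u 0 i * v 0 j.

Lemma is_derive_chr (c X Y : R -> 'rV[R]_n) (t : R) c' X' Y' : U (c t) ->
  is_derive t 1 c c' -> is_derive t 1 X X' -> is_derive t 1 Y Y' ->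
  is_derive t 1 (fun s => chr g (c s) (X s) (Y s))
    (dchr (c t) c' (X t) (Y t) + chr g (c t) X' (Y t) + chr g (c t) (X t) Y').
Proof.
move=> Uc dc dX dY; apply: is_derive_row => k.
have dg i j : is_derive t 1 (fun s => christoffel g k i j (c s)) ('D_c' (christoffel g k i j) (c t)).
  by apply: (@C11_comp_curve R _ _ (christoffel g k i j : _ -> R) c t c') => //; exact: C11_christoffel.
have D i j := is_deriveM (is_deriveM (dg i j) (is_derive_coord i dX)) (is_derive_coord j dY).
have D2 := is_derive_sum_fun (fun i => is_derive_sum_fun (fun j => D i j)).
rewrite (_ : (fun s => _) = (fun s => \sum_i \sum_j christoffel g k i j (c s) * X s 0 i * Y s 0 j)); last first.
  by apply/funext => s; rewrite mxE.
apply: is_derive_eq D2 _ => {D}.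
rewrite !mxE -!big_split; apply: eq_bigr => i _; rewrite -!big_split; apply: eq_bigr => j _ /=.
rewrite [X in X *: Y' 0 j](_ : _ = christoffel g k i j (c t) * X t 0 i)//.
by move: ('D_c' _ _) (christoffel _ _ _ _ _) => e e'; rewrite /GRing.scale /=; ring.
Qed.

(** The geodesic equation as an autonomous first-order system for position and velocity. *)
Definition spray (s : 'rV[R]_n * 'rV[R]_n) : 'rV[R]_n * 'rV[R]_n :=
  (s.2, - chr g s.1 s.2 s.2).

Lemma C11_fst (V W : normedModType R) (s : V * W) : C11 (fst : V * W -> V) s.
Proof.
have [||L _] := @C11_bounded_linear R (V * W)%type V fst s 1 => //.
by move=> w; rewrite mul1r [X in _ <= X]prod_normE le_max lexx.
Qed.

Lemma C11_snd (V W : normedModType R) (s : V * W) : C11 (snd : V * W -> W) s.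
Proof.
have [||L _] := @C11_bounded_linear R (V * W)%type W snd s 1 => //.
by move=> w; rewrite mul1r [X in _ <= X]prod_normE le_max lexx orbT.
Qed.

Lemma C11_spray s : U s.1 -> C11 spray s.
Proof.
move=> Us; apply: C11_pair; first exact: C11_snd.
apply: C11_opp; apply: C11_row => k; under eq_fun do rewrite mxE.
apply: C11_sum => i _; apply: C11_sum => j _.
have C2 a := C11_coord a (C11_snd s).
by apply: C11_mul; [apply: C11_mul|]; [have [] := C11_comp (C11_fst s) (C11_christoffel k i j Us)|exact: C2|exact: C2].
Qed.

Lemma chr_sym x u v : U x -> chr g x u v = chr g x v u.
Proof.
move=> Ux; apply/rowP => k; rewrite !mxE exchange_big; apply: eq_bigr => i _; apply: eq_bigr => j _ /=.
by rewrite christoffelC//; ring.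
Qed.

Lemma dchr_sym x w u v : U x -> dchr x w u v = dchr x w v u.
Proof.
move=> Ux; apply/rowP => k; rewrite !mxE exchange_big; apply: eq_bigr => i _; apply: eq_bigr => j _ /=.
suff -> : 'D_w (christoffel g k j i) x = 'D_w (christoffel g k i j) x by ring.
apply: near_eq_derive; near=> y; apply: christoffelC; near: y.
exact: open_nbhs_nbhs.
Unshelve. all: by end_near. Qed.

(** The right-hand side of the linearized geodesic equation, that is, the Jacobi equation in
    coordinates before it is written with covariant derivatives. *)
Lemma derive_spray s z : U s.1 ->
  'D_z spray s = (z.2, - (dchr s.1 z.1 s.2 s.2 + 2 *: chr g s.1 s.2 z.2)).
Proof.
move=> Us; have D := C11_line z (C11_spray Us).
have D1 := is_derive_line s.1 z.1 0; have D2 := is_derive_line s.2 z.2 0.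
have Us0 : U (s.1 + 0 *: z.1) by rewrite scale0r addr0.
have D3 := is_derive_chr Us0 D1 D2 D2.
rewrite !scale0r !addr0 in D3.
apply: (is_derive_unique D); apply/is_derive_pairE; split => /=; first exact: D2.
rewrite (_ : - _ = - (dchr s.1 z.1 s.2 s.2 + chr g s.1 z.2 s.2 + chr g s.1 s.2 z.2)).
  exact: is_deriveN.
by rewrite (chr_sym z.2)//; lmod R.
Qed.

Definition curv x u v : 'rV[R]_n :=
  \row_l \sum_i \sum_j \sum_k riemann g l i j k x * u 0 i * v 0 j * v 0 k.

Lemma derive_christoffel_coord x w k i j : U x -> 'D_w (christoffel g k i j) x =
  \sum_m w 0 m * partial m (christoffel g k i j) x.
Proof. by move=> Ux; rewrite (derive_sum_coord w (C11_christoffel k i j Ux)). Qed.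

(** The curvature in the form produced by a second covariant derivative of a Jacobi field. The proof
    matches the four index sums separately, with symbols and partial derivatives abstracted. *)
Lemma curv_chr x u v : U x -> curv x u v =
  dchr x u v v - dchr x v u v + chr g x u (chr g x v v) - chr g x v (chr g x u v).
Proof.
move=> Ux; apply/rowP => l; rewrite !mxE.
have [P PE] : exists P : 'I_n -> 'I_n -> 'I_n -> R,
  forall m i j, P m i j = partial m (christoffel g l i j) x.
  by exists (fun m i j => partial m (christoffel g l i j) x).
have [G GE] : exists G : 'I_n -> 'I_n -> 'I_n -> R, forall k i j, G k i j = christoffel g k i j x.
  by exists (fun k i j => christoffel g k i j x).
have e1 : \sum_i \sum_j 'D_u (christoffel g l i j) x * v 0 i * v 0 j =
    \sum_i \sum_j \sum_k P i j k * u 0 i * v 0 j * v 0 k.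
  rewrite [RHS]exchange_big; apply: eq_bigr => j _; rewrite [RHS]exchange_big; apply: eq_bigr => k _ /=.
  rewrite derive_christoffel_coord// !mulr_suml; apply: eq_bigr => m _; rewrite PE; ring.
have e2 : \sum_i \sum_j 'D_v (christoffel g l i j) x * u 0 i * v 0 j =
    \sum_i \sum_j \sum_k P j i k * u 0 i * v 0 j * v 0 k.
  apply: eq_bigr => i _; rewrite [RHS]exchange_big; apply: eq_bigr => k _ /=.
  rewrite derive_christoffel_coord// !mulr_suml; apply: eq_bigr => m _; rewrite PE; ring.
have e3 : \sum_i \sum_j christoffel g l i j x * u 0 i * (chr g x v v) 0 j =
    \sum_i \sum_j \sum_k (\sum_m G m j k * G l i m) * u 0 i * v 0 j * v 0 k.
  apply: eq_bigr => i _.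
  under [LHS]eq_bigr => m _.
    rewrite mxE mulr_sumr; under eq_bigr => j _ do rewrite mulr_sumr.
    over.
  rewrite exchange_big; apply: eq_bigr => j _; rewrite exchange_big; apply: eq_bigr => k _ /=.
  by rewrite !mulr_suml; apply: eq_bigr => m _; rewrite !GE; ring.
have e4 : \sum_i \sum_j christoffel g l i j x * v 0 i * (chr g x u v) 0 j =
    \sum_i \sum_j \sum_k (\sum_m G m i k * G l j m) * u 0 i * v 0 j * v 0 k.
  rewrite [RHS]exchange_big; apply: eq_bigr => j _.
  under [LHS]eq_bigr => m _.
    rewrite mxE mulr_sumr; under eq_bigr => i _ do rewrite mulr_sumr.
    over.
  rewrite [LHS]exchange_big; apply: eq_bigr => i _; rewrite [LHS]exchange_big; apply: eq_bigr => k _ /=.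
  by rewrite !mulr_suml; apply: eq_bigr => m _; rewrite !GE; ring.
rewrite e1 e2 e3 e4 -sumrB -big_split -sumrB; apply: eq_bigr => i _ /=.
rewrite -sumrB -big_split -sumrB; apply: eq_bigr => j _ /=.
rewrite -sumrB -big_split -sumrB; apply: eq_bigr => k _ /=.
rewrite /riemann -!PE sumrB.
have -> : \sum_m christoffel g m j k x * christoffel g l i m x = \sum_m G m j k * G l i m.
  by apply: eq_bigr => m _; rewrite !GE.
have -> : \sum_m christoffel g m i k x * christoffel g l j m x = \sum_m G m i k * G l j m.
  by apply: eq_bigr => m _; rewrite !GE.
by move: (\sum_m _) (\sum_m _) => a b; ring.
Qed.

Lemma sectional_curv x u v : sectional g x u v =
  bilin (g x) (curv x u v) u / (bilin (g x) u u * bilin (g x) v v - bilin (g x) u v ^+ 2).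
Proof.
rewrite /sectional; congr (_ / _); rewrite bilinE; apply: eq_bigr => l _; apply: eq_bigr => m _.
rewrite mxE !mulr_suml; apply: eq_bigr => i _; rewrite !mulr_suml; apply: eq_bigr => j _.
by rewrite !mulr_suml; apply: eq_bigr => k _; ring.
Qed.

(** The Riemann tensor is antisymmetric in the two indices that are contracted with the same
    vector. *)
Lemma curv_scale x k v : U x -> curv x (k *: v) v = 0.
Proof.
move=> Ux; have anti l i j m : riemann g l i j m x = - riemann g l j i m x.
  rewrite /riemann !sumrB; move: (\sum_m0 _) (\sum_m0 _) (partial _ _ _) (partial _ _ _) => *; ring.
apply/rowP => l; rewrite !mxE.
have H : \sum_i \sum_j \sum_m riemann g l i j m x * (k *: v) 0 i * v 0 j * v 0 m =
  - \sum_i \sum_j \sum_m riemann g l i j m x * (k *: v) 0 i * v 0 j * v 0 m.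
  rewrite {1}exchange_big -sumrN; apply: eq_bigr => i _; rewrite -sumrN; apply: eq_bigr => j _ /=.
  by rewrite -sumrN; apply: eq_bigr => m _; rewrite anti !mxE; ring.
lra.
Qed.
End Spray.

Lemma is_derive_near_eq (R : realType) (W : normedModType R) (f f' : R -> W) (t : R) (l : W) :
  (\forall s \near t, f s = f' s) -> is_derive t 1 f l -> is_derive t 1 f' l.
Proof.
move=> /near_normP [r r0 ff] /is_derive_eps H; apply/is_derive_eps => e e0.
have [d d0 Hd] := H e e0; exists (Num.min d r); first by rewrite lt_min d0.
move=> h; rewrite lt_min => /andP[hd hr]; rewrite -!ff; [exact: Hd| |].
  by rewrite subrr normr0.
by rewrite addrAC subrr add0r [h *: 1]mulr1.
Qed.

(** * Change of chart *)

Section TangentMap.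
Variables (R : realType) (n : nat) (tau : 'rV[R]_n -> 'rV[R]_n) (O : set 'rV[R]_n).
Hypothesis oO : open O.
Hypothesis tsm : smooth_on O tau.
Implicit Types u v w x y : 'rV[R]_n.

Definition tangent_map (s : 'rV[R]_n * 'rV[R]_n) : 'rV[R]_n * 'rV[R]_n :=
  (tau s.1, 'D_(s.2) tau s.1).

Lemma tangent_C11 x v : O x -> C11 ('D_v tau) x.
Proof. by move=> Ox; apply: (smooth_on_C11 oO Ox); exact: smooth_on_derive. Qed.

Lemma tangent_linear x : O x -> linear (fun v => 'D_v tau x).
Proof. by move=> Ox; apply: derive_linear; exact: (tsm [::]). Qed.

Lemma C11_tangent_map s : O s.1 -> C11 tangent_map s.
Proof.
move=> Os; have Ct : C11 tau s.1 by exact: (smooth_on_C11 oO Os).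
apply: C11_pair; first by have [] := C11_comp (C11_fst s) Ct.
have /near_normP [r r0 Hr] : \forall y \near s.1, O y by exact: open_nbhs_nbhs.
apply: (@C11_eq R _ _ (fun z : 'rV[R]_n * 'rV[R]_n => \sum_i z.2 0 i *: 'D_(delta_mx 0 i) tau z.1) _ s r r0).
  move=> z; rewrite prod_normE /= gt_max => /andP[/Hr Oz _].
  by rewrite -(derive_sum_coord z.2 (smooth_on_C11 oO Oz tsm)).
apply: C11_row => j; under eq_fun do rewrite summxE; apply: C11_sum => i _.
under eq_fun do rewrite mxE.
apply: C11_mul; first exact: (C11_coord i (C11_snd s)).
apply: (@C11_coord R n _ (fun z : 'rV[R]_n * 'rV[R]_n => 'D_(delta_mx 0 i) tau z.1)).
by have [] := C11_comp (C11_fst s) (tangent_C11 (delta_mx 0 i) Os).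
Qed.

Lemma is_derive_tangent (c X : R -> 'rV[R]_n) (t : R) c' X' : O (c t) ->
  is_derive t 1 c c' -> is_derive t 1 X X' ->
  is_derive t 1 (fun s => 'D_(X s) tau (c s)) ('D_c' ('D_(X t) tau) (c t) + 'D_X' tau (c t)).
Proof.
move=> Oc dc dX; have Ct := C11_tangent_map (s := (c t, X t)) Oc.
have dcX : is_derive t 1 (fun s => (c s, X s)) (c', X') by apply/is_derive_pairE.
have := @C11_comp_curve R _ _ tangent_map (fun s => (c s, X s)) t (c', X') Ct dcX.
move=> /is_derive_pairE [_ D]; apply: is_derive_eq D _.
have L := C11_linear Ct.
have D0 := C11_line (c', 0 : 'rV[R]_n) Ct; have D1 := C11_line (0 : 'rV[R]_n, X') Ct.
have -> : 'D_(c', X') tangent_map (c t, X t) =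
   'D_(c', 0) tangent_map (c t, X t) + 'D_(0, X') tangent_map (c t, X t).
  have := L 1 (c', 0) (0, X'); rewrite !scale1r /= => <-.
  by congr ('D_ _ _ _); rewrite /GRing.add /= /add_pair /= addr0 add0r.
move: D0 => /is_derive_pairE [_ D0]; move: D1 => /is_derive_pairE [_ D1].
congr (_ + _).
  apply: (is_derive_unique D0); have := C11_line c' (tangent_C11 (X t) Oc).
  by apply: is_derive_near_eq; near=> s => /=; rewrite scaler0 addr0.
apply: (is_derive_unique D1).
have lt := tangent_linear Oc.
apply/is_derive_eps => e e0; exists 1 => // h _.
rewrite [h *: 1]mulr1 /= !scaler0 !addr0 scale0r addr0 add0r.
rewrite (_ : X t + h *: X' = h *: X' + X t); last by rewrite addrC.
by rewrite lt (_ : _ - _ - _ = 0) ?normr0 ?mulr_ge0 ?(ltW e0)//=; lmod R.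
Unshelve. all: by end_near. Qed.

Lemma derive_tangent_map s z : O s.1 ->
  'D_z tangent_map s = ('D_(z.1) tau s.1, 'D_(z.1) ('D_(s.2) tau) s.1 + 'D_(z.2) tau s.1).
Proof.
move=> Os; have D := C11_line z (C11_tangent_map Os).
have D1 := is_derive_line s.1 z.1 0; have D2 := is_derive_line s.2 z.2 0.
have Os0 : O (s.1 + 0 *: z.1) by rewrite scale0r addr0.
have D3 := is_derive_tangent Os0 D1 D2; rewrite !scale0r !addr0 in D3.
apply: (is_derive_unique D); apply/is_derive_pairE; split => //=.
by have := C11_line z.1 (smooth_on_C11 oO Os tsm).
Qed.

End TangentMap.

Section ChangeOfChart.
Variables (R : realType) (n : nat) (g h : 'rV[R]_n -> 'M[R]_n) (U U' O : set 'rV[R]_n).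
Variable tau : 'rV[R]_n -> 'rV[R]_n.
Hypotheses (oU : open U) (oU' : open U') (oO : open O).
Hypothesis gsm : forall i j, smooth_on U (fun y => g y i j : R).
Hypothesis gsym : forall y, U y -> (g y)^T = g y.
Hypothesis gpos : forall y, U y -> forall u, u != 0 -> 0 < bilin (g y) u u.
Hypothesis hsm : forall i j, smooth_on U' (fun y => h y i j : R).
Hypothesis hsym : forall y, U' y -> (h y)^T = h y.
Hypothesis hpos : forall y, U' y -> forall u, u != 0 -> 0 < bilin (h y) u u.
Hypothesis tsm : smooth_on O tau.
Hypothesis OU : O `<=` U.
Hypothesis tO : forall y, O y -> U' (tau y).
Hypothesis compat : forall y u v, O y ->
  bilin (g y) u v = bilin (h (tau y)) ('D_u tau y) ('D_v tau y).
Implicit Types u v w x y : 'rV[R]_n.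

Lemma tangent_inj x w : O x -> 'D_w tau x = 0 -> w = 0.
Proof.
move=> Ox tw; apply/eqP/negPn/negP => /(gpos (OU Ox)).
by rewrite compat// tw bilin0l ltxx.
Qed.

(** The derivative of the compatibility identity along the line in direction [w]. *)
Lemma dmetric_transform x u v w : O x ->
  dmetric g x w u v =
    dmetric h (tau x) ('D_w tau x) ('D_u tau x) ('D_v tau x)
    + bilin (h (tau x)) ('D_w ('D_u tau) x) ('D_v tau x)
    + bilin (h (tau x)) ('D_u tau x) ('D_w ('D_v tau) x).
Proof.
move=> Ox; have D1 := is_derive_line x w 0.
have x0 : x + 0 *: w = x by rewrite scale0r addr0.
have Ux := OU Ox; have Uy := tO Ox.
have E1 := is_derive_bilin (fun i j => C11_metric oU gsm i j Ux) x0 D1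
  (is_derive_cst_fun u 0) (is_derive_cst_fun v 0).
rewrite bilin0l bilin0r !addr0 in E1.
apply: (is_derive_unique E1).
have Dt : is_derive (0 : R) 1 (fun s : R => tau (x + s *: w)) ('D_w tau x).
  exact: C11_line (smooth_on_C11 oO Ox tsm).
have tx0 : tau (x + 0 *: w) = tau x by rewrite x0.
have E2 := is_derive_bilin (fun i j => C11_metric oU' hsm i j Uy) tx0 Dt
  (C11_line w (tangent_C11 oO tsm u Ox)) (C11_line w (tangent_C11 oO tsm v Ox)).
rewrite !x0 in E2.
apply: is_derive_near_eq E2.
have : \forall s \near (0 : R), O (x + s *: w).
  have cl := is_derive_continuous D1.
  apply: cl; rewrite /= x0; exact: open_nbhs_nbhs.
by apply: filterS => s Os; rewrite -compat.
Qed.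

(** The transformation law of the Christoffel symbols. Both sides are paired with an arbitrary
    vector ['D_w tau x] and expanded by Koszul's formula; the surplus second derivatives of [tau]
    cancel by their symmetry. *)
Lemma chr_transform x u : O x ->
  'D_(chr g x u u) tau x = 'D_u ('D_u tau) x + chr h (tau x) ('D_u tau x) ('D_u tau x).
Proof.
have alg (p q r s s' a b f : R) : 2 * p = a + q + r + (a + q + r) - (b + s + s') ->
    2 * f = a + a - b -> s = s' -> s' = r -> p - (q + f) = 0 by lra.
move=> Ox; have Ux := OU Ox; have Uy := tO Ox.
pose T w := 'D_w tau x.
have lT : linear T by exact: (tangent_linear tsm Ox).
have [B [K [_ _ _ TB _]]] := linear_inverse lT (fun w => @tangent_inj x w Ox).
apply/eqP; rewrite -subr_eq0; apply/eqP.
apply: (bilin_pos_inj (hpos Uy)) => z; rewrite -[z]TB; move: (B z) => w {z}.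
have gC i j := C11_metric oU gsm i j Ux; have hC i j := C11_metric oU' hsm i j Uy.
have A := christoffel_metric gC (near_metric_sym oU gsym Ux) (gpos Ux) u u w.
have A' := christoffel_metric hC (near_metric_sym oU' hsym Uy) (hpos Uy) (T u) (T u) (T w).
rewrite compat// !(dmetric_transform _ _ _ Ox) in A.
rewrite -[chr h _ _ _]/(chr h (tau x) (T u) (T u)) -[X in bilin _ _ X]/(T w).
have sw : 'D_w ('D_u tau) x = 'D_u ('D_w tau) x by exact: (smooth_on_schwarz w u oO Ox tsm).
have sw2 : bilin (h (tau x)) ('D_w ('D_u tau) x) ('D_u tau x) = bilin (h (tau x)) ('D_u tau x) ('D_w ('D_u tau) x).
  exact: bilinC (hsym Uy).
have sw3 : bilin (h (tau x)) ('D_u tau x) ('D_w ('D_u tau) x) = bilin (h (tau x)) ('D_u tau x) ('D_u ('D_w tau) x).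
  exact: (congr1 (bilin (h (tau x)) ('D_u tau x)) sw).
by rewrite bilinDl bilinNl bilinDl; exact: (alg _ _ _ _ _ _ _ _ A A' sw2 sw3).
Qed.

Lemma spray_transform (y : R -> 'rV[R]_n * 'rV[R]_n) (t : R) : O (y t).1 ->
  is_derive t 1 y (spray g (y t)) ->
  is_derive t 1 (tangent_map tau \o y) (spray h (tangent_map tau (y t))).
Proof.
move=> Oy dy; have := @C11_comp_curve R _ _ (tangent_map tau) y t _ (C11_tangent_map oO tsm Oy) dy.
move=> D; apply: is_derive_eq D _; rewrite (derive_tangent_map oO tsm)// /spray /=; congr (_, _).
have lT := tangent_linear tsm Oy.
have -> : 'D_(- chr g (y t).1 (y t).2 (y t).2) tau (y t).1 = - 'D_(chr g (y t).1 (y t).2 (y t).2) tau (y t).1.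
  by have := lT (-1) (chr g (y t).1 (y t).2 (y t).2) 0; rewrite addr0 !scaleN1r derive0 addr0.
by rewrite chr_transform//; lmod R.
Qed.
End ChangeOfChart.

Section Propagation.
Variable R : realType.

(** The step says that [P] is locally constant on [0, T]. Being symmetric in s and s', it covers the
    open and the closed half of a connectedness argument at once. *)
Lemma real_propagation_on (T : R) (P : R -> Prop) : P 0 ->
  (forall t : R, 0 <= t <= T -> exists2 d : R, 0 < d & forall s s' : R,
     `|s - t| < d -> `|s' - t| < d -> 0 <= s <= T -> 0 <= s' <= T -> P s -> P s') ->
  forall t : R, 0 <= t <= T -> P t.
Proof.
move=> P0 step.
suff H : forall t : R, 0 <= t -> t <= T -> P t by move=> t /andP[]; exact: H.
apply: (@real_induction _ (fun t => t <= T -> P t)) => t t0 Pt.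
have [tT|tT] := leP t T; last by exists 1 => // s ts _ sT; lra.
have [|d d0 Hd] := step t; first by rewrite t0.
exists d => // s ts sd sT.
have s0 : 0 <= s by apply: le_trans ts.
have [t00|tn0] := eqVneq t 0.
  have s1 : `|s - t| < d by rewrite ger0_norm; lra.
  by apply: (Hd 0 s) => //; rewrite ?s0 ?lexx ?(le_trans t0 tT)// t00 subrr normr0.
have tgt0 : 0 < t by rewrite lt_def tn0.
pose u := Num.max 0 (t - d / 2).
have u0 : 0 <= u by rewrite le_max lexx.
have ut : u < t by rewrite gt_max tgt0 /=; lra.
have tu : t - d / 2 <= u by rewrite le_max lexx orbT.
have uT : u <= T by lra.
apply: (Hd u) => //; rewrite ?ltr_norml ?u0 ?s0//; [lra|lra|exact: Pt].
Qed.
End Propagation.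

Section OdeUnique.
Variables (R : realType) (W : normedModType R).

Lemma ode_local_unique (F : W -> W) (y1 y2 : R -> W) (t0 : R) :
  (\forall s \near t0, is_derive (s : R) 1 y1 (F (y1 s))) ->
  (\forall s \near t0, is_derive (s : R) 1 y2 (F (y2 s))) ->
  y1 t0 = y2 t0 -> C11 F (y1 t0) -> \forall s \near t0, y1 s = y2 s.
Proof.
move=> D1 D2 e CF; have [L [r [L0 r0 HL]]] := C11_lipschitz CF.
have c1 := is_derive_continuous (nbhs_singleton D1).
have c2 := is_derive_continuous (nbhs_singleton D2).
have /near_normP [d0 d00 Hd] : \forall s \near t0, [/\ is_derive (s : R) 1 y1 (F (y1 s)),
    is_derive (s : R) 1 y2 (F (y2 s)), `|y1 s - y1 t0| < r & `|y2 s - y1 t0| < r].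
  near=> s; split; [near: s|near: s|near: s|near: s] => //.
    by have /cvgrPdist_lt /(_ r r0) := c1; apply: filterS => s; rewrite distrC.
  by rewrite e; have /cvgrPdist_lt /(_ r r0) := c2; apply: filterS => s; rewrite distrC.
pose d := Num.min (d0 / 2) (1 / (2 * L)).
have dd0 : 0 < d by rewrite lt_min !divr_gt0 ?mulr_gt0.
have dd : d < d0 by rewrite (@le_lt_trans _ _ (d0 / 2)) ?ge_min ?lexx//; lra.
have dL : d * L <= 1 / 2.
  have : d <= 1 / (2 * L) by rewrite ge_min lexx orbT.
  by rewrite ler_pdivlMr ?mulr_gt0//; lra.
have sh (y : R -> W) (l : W) (s : R) : is_derive (t0 + s) 1 y l -> is_derive s 1 (fun s => y (t0 + s)) l.
  move=> /is_derive_eps H; apply/is_derive_eps => ep ep0; have [q q0 Hq] := H ep ep0.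
  by exists q => // h hq; rewrite addrA; exact: Hq.
apply/near_normP; exists d => // s sd; apply/eqP; rewrite -subr_eq0 -normr_le0.
have N t : `|t| <= d -> `|(t0 + t) - t0| < d0 by move=> td; rewrite addrAC subrr add0r; exact: le_lt_trans dd.
have := @gronwall_small R W (fun t => y1 (t0 + t) - y2 (t0 + t)) (fun t => F (y1 (t0 + t)) - F (y2 (t0 + t)))
  d L 0 dd0 (ltW L0) dL.
rewrite addr0 e subrr normr0 mulr0 addr0 mulr0 => H.
have := H _ _ (s - t0); rewrite (_ : t0 + (s - t0) = s); last by ring.
apply; last exact: ltW.
  move=> t td; have [h1 h2 _ _] := Hd _ (N t td).
  by apply: is_deriveB; apply: sh.
move=> t td; rewrite addr0; have [_ _ h1 h2] := Hd _ (N t td).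
exact: HL.
Unshelve. all: by end_near. Qed.

(** Uniqueness of solutions for the zero field. *)
Lemma zero_derive_near_cst (f : R -> W) (t0 : R) :
  (\forall s \near t0, is_derive (s : R) 1 f 0) -> \forall s \near t0, f s = f t0.
Proof.
move=> D; apply: (@ode_local_unique (fun=> 0) f (fun=> f t0)) => //.
- by near=> s; exact: is_derive_cst_fun.
- exact: C11_cst.
Unshelve. all: by end_near. Qed.

Lemma near_neq (y1 y2 : R -> W) (t : R) : {for t, continuous y1} -> {for t, continuous y2} ->
  y1 t <> y2 t -> \forall s \near t, y1 s != y2 s.
Proof.
move=> c1 c2 nes.
have cd : {for t, continuous (fun s => y1 s - y2 s)} by apply: continuousB.
have m0 : 0 < `|y1 t - y2 t| by rewrite normr_gt0 subr_eq0; apply/eqP.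
have /cvgrPdist_lt /(_ _ m0) := cd; apply: filterS => s Hs.
by apply/eqP => es; move: Hs; rewrite es subrr subr0 ltxx.
Qed.
End OdeUnique.

(** * Geodesics and curves on the manifold *)

Section Charts.
Variables (R : realType) (n : nat) (M : ptopologicalType) (g : riemannian R n M).
Implicit Types (p q : M) (x v w : 'rV[R]_n) (c : R -> M).
Local Notation V := 'rV[R]_n.

Definition chart_img p : set V := chart g p @` chart_dom g p.

Lemma chart_img_open p : open (chart_img p). Proof. exact: chart_image_open. Qed.

Lemma chart_img_chart p q : chart_dom g p q -> chart_img p (chart g p q).
Proof. by exists q. Qed.

Lemma chart_inv_dom p x : chart_img p x -> chart_dom g p (chart_inv g p x).
Proof. by move=> [q dq <-]; rewrite chartK. Qed.

Lemma chart_invK p x : chart_img p x -> chart g p (chart_inv g p x) = x.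
Proof. by move=> [q dq <-]; rewrite chartK. Qed.

Lemma chart_cont p q : chart_dom g p q -> {for q, continuous (chart g p)}.
Proof.
move=> dq; have := @chart_continuous R n M g p.
rewrite continuous_open_subspace; last exact: chart_dom_open.
by apply; rewrite inE.
Qed.

Lemma chart_inv_cont p x : chart_img p x -> {for x, continuous (chart_inv g p)}.
Proof.
move=> dq; have := @chart_inv_continuous R n M g p.
rewrite continuous_open_subspace; last exact: chart_image_open.
by apply; rewrite inE.
Qed.

Lemma chart_dom_nbhs p q : chart_dom g p q -> nbhs q (chart_dom g p).
Proof. by move=> dq; apply: open_nbhs_nbhs; split => //; exact: chart_dom_open. Qed.

Definition trans p q := chart g q \o chart_inv g p.
Definition trans_dom p q : set V := chart g p @` (chart_dom g p `&` chart_dom g q).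

Lemma trans_domE p q x : trans_dom p q x <-> chart_img p x /\ chart_dom g q (chart_inv g p x).
Proof.
split; first by move=> [z [d1 d2] <-]; rewrite chartK//; split => //; exists z.
move=> [dx dq]; exists (chart_inv g p x); last exact: chart_invK.
by split => //; exact: chart_inv_dom.
Qed.

Lemma trans_dom_open p q : open (trans_dom p q).
Proof.
rewrite openE => x /trans_domE [px qx]; rewrite /interior.
have c := chart_inv_cont px.
near=> y; apply/trans_domE; split.
  by near: y; apply: open_nbhs_nbhs; split => //; exact: chart_img_open.
by near: y; apply: c; exact: chart_dom_nbhs.
Unshelve. all: by end_near. Qed.

Lemma trans_dom_chart p q z : chart_dom g p z -> chart_dom g q z -> trans_dom p q (chart g p z).
Proof. by move=> pz qz; exists z. Qed.

Lemma transE p q z : chart_dom g p z -> trans p q (chart g p z) = chart g q z.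
Proof. by move=> pz; rewrite /trans /= chartK. Qed.

Lemma trans_img p q x : trans_dom p q x -> chart_img q (trans p q x).
Proof. by move=> /trans_domE [_ qx]; exact: chart_img_chart. Qed.

Lemma metric_inv_pos p x : chart_img p x -> forall u, u != 0 -> 0 < bilin (metric g p x) u u.
Proof. by move=> px u; exact: metric_pos. Qed.

Lemma bilin_trans p q x u v : trans_dom p q x -> bilin (metric g p x) u v =
  bilin (metric g q (trans p q x)) ('D_u (trans p q) x) ('D_v (trans p q) x).
Proof. exact: metric_compat. Qed.

Lemma trans_spray p q (y : R -> V * V) (t : R) : trans_dom p q (y t).1 ->
  is_derive t 1 y (spray (metric g p) (y t)) ->
  is_derive t 1 (tangent_map (trans p q) \o y) (spray (metric g q) (tangent_map (trans p q) (y t))).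
Proof.
apply: (@spray_transform R n (metric g p) (metric g q) (chart_img p) (chart_img q) (trans_dom p q) (trans p q)).
- exact: chart_img_open.
- exact: chart_img_open.
- exact: trans_dom_open.
- exact: metric_smooth.
- exact: Defs.metric_sym.
- exact: metric_inv_pos.
- exact: metric_smooth.
- exact: Defs.metric_sym.
- exact: metric_inv_pos.
- exact: transition_smooth.
- by move=> x /trans_domE [].
- exact: trans_img.
- by move=> x u v; exact: bilin_trans.
Qed.

Lemma C11_spray_chart p (s : V * V) : chart_img p s.1 -> C11 (spray (metric g p)) s.
Proof.
apply: C11_spray; [exact: chart_img_open|exact: metric_smooth|exact: Defs.metric_sym|exact: metric_inv_pos].
Qed.

Definition state p c (t : R) : V * V := (chart g p (c t), 'D_1 (chart g p \o c) t).

(** Asking for a neighbourhood of [t] makes the condition open in time and lets it pass to any other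
    chart around [c t]. *)
Definition geod_in p c (t : R) := \forall s \near t,
  chart_dom g p (c s) /\ is_derive (s : R) 1 (state p c) (spray (metric g p) (state p c s)).

Variant geod c (t : R) : Prop := Geod p of geod_in p c t.

Lemma chart_curve_cont p c (t : R) : chart_dom g p (c t) -> (\forall s \near t, chart_dom g p (c s)) ->
  {for t, continuous (chart g p \o c)} -> {for t, continuous c}.
Proof.
move=> pt near cc; have pi := chart_img_chart pt.
have H : {for t, continuous (chart_inv g p \o (chart g p \o c))}.
  apply: continuous_comp => //; exact: (chart_inv_cont pi).
have H' : (chart_inv g p \o (chart g p \o c)) s @[s --> t] --> c t.
  by rewrite -[c t](chartK pt); exact: H.
apply: cvg_trans H'; apply: near_eq_cvg; apply: filterS near => s ps.
by rewrite /= chartK.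
Qed.

Lemma geod_in_continuous p c (t : R) : geod_in p c t -> {for t, continuous c}.
Proof.
move=> H; have [pt D] := nbhs_singleton H.
have n1 : \forall s \near t, chart_dom g p (c s) by apply: filterS H => s [].
apply: (chart_curve_cont pt n1).
by have /is_derive_pairE [D1 _] := D; exact: (is_derive_continuous D1).
Qed.

Lemma geod_in_near p c (t : R) : geod_in p c t -> \forall s \near t, geod_in p c s.
Proof. by move=> H; apply: nbhs_interior. Qed.

Lemma derive_trans p q c (t : R) v : chart_dom g p (c t) -> chart_dom g q (c t) ->
  (\forall s \near t, chart_dom g p (c s)) ->
  is_derive t 1 (chart g p \o c) v ->
  is_derive t 1 (chart g q \o c) ('D_v (trans p q) (chart g p (c t))).
Proof.
move=> pt qt near D.
have Ct : C11 (trans p q) (chart g p (c t)).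
  apply: (@smooth_on_C11 R n _ (trans_dom p q)); [exact: trans_dom_open|exact: trans_dom_chart|exact: transition_smooth].
have := @C11_comp_curve R _ _ (trans p q) (chart g p \o c) t v Ct D.
apply: is_derive_near_eq; apply: filterS near => s ps.
exact: transE.
Qed.

Lemma state_trans p q c (t : R) : geod_in p c t -> chart_dom g q (c t) ->
  state q c t = tangent_map (trans p q) (state p c t).
Proof.
move=> H qt; have [pt D] := nbhs_singleton H.
have n1 : \forall s \near t, chart_dom g p (c s) by apply: filterS H => s [].
have /is_derive_pairE [D1 _] := D.
have D2 := derive_trans pt qt n1 D1.
have [_ e2] := D2; rewrite /tangent_map /state [X in (X, _) = _]/= [in RHS]/= e2.
by have e1 := transE q pt; rewrite e1.
Qed.

Lemma geod_in_change p q c (t : R) : geod_in p c t -> chart_dom g q (c t) -> geod_in q c t.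
Proof.
move=> H qt; have cc := geod_in_continuous H.
have nq : \forall s \near t, chart_dom g q (c s) by apply: cc; exact: chart_dom_nbhs.
have n2 := geod_in_near H.
have n3 : \forall s \near t, geod_in p c s /\ chart_dom g q (c s) by near=> s; split; near: s.
have n4 : \forall s \near t, \forall r \near s, geod_in p c r /\ chart_dom g q (c r).
  exact: nbhs_interior.
apply: filterS n4 => s Hs; have [Hps qs] := nbhs_singleton Hs; split => //.
have [ps D] := nbhs_singleton Hps.
rewrite (state_trans Hps qs).
have Os : trans_dom p q (state p c s).1 by exact: trans_dom_chart.
have := trans_spray Os D; apply: is_derive_near_eq.
by apply: filterS Hs => r [Hpr qr]; rewrite (state_trans Hpr qr).
Unshelve. all: by end_near. Qed.

Lemma geod_chart q c (t : R) : geod c t -> chart_dom g q (c t) -> geod_in q c t.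
Proof. by move=> [p H] qt; exact: (geod_in_change H qt). Qed.

Lemma geod_near c (t : R) : geod c t -> \forall s \near t, geod c s.
Proof. by move=> [p /geod_in_near]; apply: filterS => s H; exact: (Geod H). Qed.

Lemma geod_continuous c (t : R) : geod c t -> {for t, continuous c}.
Proof. by move=> [p H]; exact: (geod_in_continuous H). Qed.

Lemma geod_state_eq p q c1 c2 (t : R) : geod c1 t -> geod c2 t -> c1 t = c2 t ->
  chart_dom g p (c1 t) -> chart_dom g q (c1 t) ->
  state p c1 t = state p c2 t -> state q c1 t = state q c2 t.
Proof.
move=> G1 G2 e pt qt es; have := geod_chart G1 pt; have := geod_chart (q := p) G2.
rewrite -e => /(_ pt) H2 H1.
by rewrite (state_trans H1 qt) (state_trans H2) ?es// -e.
Qed.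

(** Agreement of position and velocity is locally constant in time. It spreads by uniqueness for the
    spray; disagreement persists nearby, by the Hausdorff property for points and by continuity for
    velocities. *)
Lemma geod_unique c1 c2 (T : R) : 0 <= T ->
  (forall t : R, 0 <= t <= T -> geod c1 t) -> (forall t : R, 0 <= t <= T -> geod c2 t) ->
  c1 0 = c2 0 -> state (c1 0) c1 0 = state (c1 0) c2 0 ->
  forall t : R, 0 <= t <= T -> c1 t = c2 t /\ state (c1 t) c1 t = state (c1 t) c2 t.
Proof.
move=> T0 G1 G2 e0 s0; apply: real_propagation_on; first by split.
move=> t tT; have g1 := G1 t tT; have g2 := G2 t tT.
suff /near_normP [d d0 Hd] : \forall s \near t,
    0 <= s <= T -> c1 s = c2 s /\ state (c1 s) c1 s = state (c1 s) c2 s ->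
    \forall s' \near t, c1 s' = c2 s' /\ state (c1 s') c1 s' = state (c1 s') c2 s'.
  have [[s [sd sT]]|nos] := pselect (exists s, `|s - t| < d /\ (0 <= s <= T /\ (c1 s = c2 s /\ state (c1 s) c1 s = state (c1 s) c2 s))).
    have [e es] := sT; have /near_normP [d' d0' Hd'] := Hd s sd e es.
    by exists d'; [exact: d0'|move=> r r' _ r'd _ _ _; exact: (Hd' r' r'd)].
  exists d; [exact: d0|move=> r r' rd _ rT _ Pr; exfalso; apply: nos; exists r].
  by split; [exact: rd|split; [exact: rT|exact: Pr]].
have [e|ne] := pselect (c1 t = c2 t); last first.
  have [[A B] /= [[oA cA] [oB cB]] AB] : exists2 AB, (open AB.1 /\ c1 t \in AB.1) /\ (open AB.2 /\ c2 t \in AB.2) & AB.1 `&` AB.2 == set0.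
    have H := manifold_hausdorff g; rewrite open_hausdorff in H.
    by have [|AB [h1 h2] [h3 h4 h5]] := H (c1 t) (c2 t); [exact/eqP|exists AB; [exact: conj (conj h3 h1) (conj h4 h2)|exact: h5]].
  have n1 : \forall s \near t, A (c1 s).
    by apply: (geod_continuous g1); apply: open_nbhs_nbhs; split => //; rewrite inE in cA.
  have n2 : \forall s \near t, B (c2 s).
    by apply: (geod_continuous g2); apply: open_nbhs_nbhs; split => //; rewrite inE in cB.
  near=> s => _ [es _]; exfalso.
  have : (A `&` B) (c1 s) by split; [near: s|rewrite es; near: s].
  by rewrite (eqP AB).
set p := c1 t; have pt : chart_dom g p (c1 t) by exact: chart_dom_center.
have pt2 : chart_dom g p (c2 t) by rewrite -e.
have H1 := geod_chart g1 pt; have H2 := geod_chart g2 pt2.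
have [_ D1] := nbhs_singleton H1; have [_ D2] := nbhs_singleton H2.
have [es|nes] := pselect (state p c1 t = state p c2 t).
  have CF : C11 (spray (metric g p)) (state p c1 t).
    by apply: C11_spray_chart; exact: chart_img_chart.
  have eq_near : \forall s \near t, state p c1 s = state p c2 s.
    apply: (ode_local_unique _ _ es CF).
      by apply: filterS H1 => s [].
    by apply: filterS H2 => s [].
  have E : \forall s \near t, c1 s = c2 s /\ state (c1 s) c1 s = state (c1 s) c2 s.
    apply: (filterS _ (filterI (filterI H1 H2) (filterI eq_near (filterI (geod_near g1) (geod_near g2))))).
    move=> s [[[p1 _] [p2 _]] [es' [gs1 gs2]]].
    have e1 : c1 s = c2 s.
      by rewrite -[c1 s](chartK p1) -[c2 s](chartK p2); have [-> _] := es'.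
    split; first exact: e1.
    exact: (geod_state_eq gs1 gs2 e1 p1 (chart_dom_center g (c1 s)) es').
  by apply: filterE => s _ _; exact: E.
have cne : \forall s \near t, state p c1 s != state p c2 s.
  exact: (near_neq (is_derive_continuous D1) (is_derive_continuous D2) nes).
apply: (filterS _ (filterI (filterI H1 cne) (filterI (geod_near g1) (geod_near g2)))).
move=> s [[[p1 _] /eqP ns] [gs1 gs2]] _ [es' Ps]; exfalso; apply: ns.
exact: (geod_state_eq gs1 gs2 es' (chart_dom_center g (c1 s)) p1 Ps).
Unshelve. all: by end_near. Qed.
End Charts.

Section Speed.
Variables (R : realType) (n : nat) (M : ptopologicalType) (g : riemannian R n M).
Implicit Types (p q : M) (x v w : 'rV[R]_n) (c : R -> M).
Local Notation V := 'rV[R]_n.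

Definition speed2 p (s : V * V) : R := bilin (metric g p s.1) s.2 s.2.

Lemma speed2_ge0 p s : chart_img g p s.1 -> 0 <= speed2 p s.
Proof. by move=> ps; apply: bilin_ge0; exact: (metric_inv_pos ps). Qed.

Lemma speed2_trans p q (s : V * V) : trans_dom g p q s.1 ->
  speed2 q (tangent_map (trans g p q) s) = speed2 p s.
Proof. by move=> ps; rewrite /speed2 (bilin_trans _ _ ps). Qed.

Lemma is_derive_ext (W : normedModType R) (f f' : R -> W) (t : R) (l l' : W) :
  (forall s, f s = f' s) -> l = l' -> is_derive t 1 f l -> is_derive t 1 f' l'.
Proof. by move=> /funext -> ->. Qed.

(** The product rule with covariant derivatives: compatibility of the metric absorbs the derivative
    of its coefficients. *)
Lemma is_derive_metric p (y X Y : R -> V) (t : R) (c' X' Y' : V) : chart_img g p (y t) ->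
  is_derive t 1 y c' -> is_derive t 1 X X' -> is_derive t 1 Y Y' ->
  is_derive t 1 (fun s => bilin (metric g p (y s)) (X s) (Y s))
    (bilin (metric g p (y t)) (X' + chr (metric g p) (y t) c' (X t)) (Y t)
     + bilin (metric g p (y t)) (X t) (Y' + chr (metric g p) (y t) c' (Y t))).
Proof.
move=> py Dc DX DY.
have oU := @chart_img_open R n M g p.
have gC i j : C11 (fun z => metric g p z i j : R) (y t).
  by apply: (C11_metric oU _ _ _ py); move=> ? ?; exact: metric_smooth.
have gs : \forall z \near y t, (metric g p z)^T = metric g p z.
  by apply: (near_metric_sym oU _ py) => z; exact: Defs.metric_sym.
have := is_derive_bilin gC (erefl (y t)) Dc DX DY.
rewrite (metric_compatible gC gs (metric_inv_pos py)).
by apply: is_derive_ext => //; rewrite !bilinE_; ring.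
Qed.

Lemma speed2_spray p (y : R -> V * V) (t : R) : chart_img g p (y t).1 ->
  is_derive t 1 y (spray (metric g p) (y t)) -> is_derive t 1 (speed2 p \o y) 0.
Proof.
move=> py /is_derive_pairE [D1 D2].
apply: (is_derive_ext _ _ (is_derive_metric py D1 D2 D2)); first by [].
by rewrite /spray /= addNr bilin0l bilin0r addr0.
Qed.

Definition gspeed2 c (t : R) := speed2 (c t) (state g (c t) c t).

Lemma gspeed2_chart p c (t : R) : geod g c t -> chart_dom g p (c t) ->
  gspeed2 c t = speed2 p (state g p c t).
Proof.
move=> G pt; have H := geod_chart G pt.
have ct := chart_dom_center g (c t).
rewrite /gspeed2 (state_trans H ct) speed2_trans//.
exact: trans_dom_chart.
Qed.

Lemma gspeed2_near c (t : R) : geod g c t -> \forall s \near t, gspeed2 c s = gspeed2 c t.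
Proof.
move=> G; have ct := chart_dom_center g (c t); have H := geod_chart G ct.
have D : \forall s \near t, is_derive (s : R) 1 (speed2 (c t) \o state g (c t) c) 0.
  apply: filterS H => s [ps Ds]; apply: speed2_spray => //; exact: chart_img_chart.
apply: (filterS _ (filterI (zero_derive_near_cst D) (filterI H (geod_near G)))).
by move=> s [e [[ps _] Gs]]; rewrite (gspeed2_chart Gs ps); exact: e.
Qed.

Lemma gspeed2_const c (T : R) : 
  (forall t : R, 0 <= t <= T -> geod g c t) -> 
  forall t : R, 0 <= t <= T -> gspeed2 c t = gspeed2 c 0.
Proof.
move=> G t /andP[t0 tT]; have T0 : 0 <= T by apply: le_trans tT.
have : 0 <= t <= T by rewrite t0.
move: t {t0 tT}; apply: real_propagation_on; first by [].
move=> t tT.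
have /near_normP [d d0 Hd] := gspeed2_near (G t tT).
by exists d; [exact: d0|move=> s s' sd sd' _ _ <-; rewrite (Hd s sd) (Hd s' sd')].
Qed.

Lemma geod_near_eq c1 c2 (t : R) : (\forall s \near t, c1 s = c2 s) -> geod g c1 t -> geod g c2 t.
Proof.
move=> e [p H]; apply: (@Geod _ _ _ _ _ _ p).
have e2 : \forall s \near t, \forall r \near s, c1 r = c2 r by exact: nbhs_interior.
apply: (filterS _ (filterI e2 (geod_in_near H))) => s [es Hs].
have [ps D] := nbhs_singleton Hs.
have st r : (\forall r' \near r, c1 r' = c2 r') -> state g p c1 r = state g p c2 r.
  move=> er; rewrite /state /= (nbhs_singleton er); congr (_, _).
  by apply: near_eq_derive; apply: filterS er => r' /= ->.
have esn := nbhs_singleton es; rewrite -[c2 s]esn -(st _ es); split; first exact: ps.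
apply: (is_derive_near_eq _ D).
have es2 : \forall r \near s, \forall r' \near r, c1 r' = c2 r' by exact: nbhs_interior.
by apply: filterS es2 => r; exact: st.
Qed.

Lemma state_near_eq p c1 c2 (t : R) : (\forall s \near t, c1 s = c2 s) -> state g p c1 t = state g p c2 t.
Proof.
move=> er; rewrite /state /= (nbhs_singleton er); congr (_, _).
by apply: near_eq_derive; apply: filterS er => r' /= ->.
Qed.

Lemma is_derive_affine (W : normedModType R) (f : R -> W) (k e t : R) l : is_derive (k * t + e) 1 f l ->
  is_derive t 1 (fun s => f (k * s + e)) (k *: l).
Proof.
move=> /is_derive_eps D; apply/is_derive_eps => ep ep0.
have [|d d0 Hd] := D (ep / (`|k| + 1)); first by rewrite divr_gt0// ltr_wpDl.
have k1 : 0 < `|k| + 1 by rewrite ltr_wpDl.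
exists (d / (`|k| + 1)); first by rewrite divr_gt0.
move=> h; rewrite ltr_pdivlMr// => hd.
have kh : `|k * h| <= `|h| * (`|k| + 1).
  by rewrite normrM mulrC ler_wpM2l// lerDl.
have := Hd (k * h) (le_lt_trans kh hd).
rewrite (_ : k * (t + h *: 1) + e = k * t + e + (k * h) *: 1); last by rewrite /GRing.scale /=; ring.
rewrite scalerA (mulrC h) => /le_trans; apply.
rewrite mulrAC ler_pdivrMr// -mulrA ler_wpM2l// ltW//.
Qed.

Lemma state_affine p c (k e t : R) : geod g c (k * t + e) -> chart_dom g p (c (k * t + e)) ->
  state g p (fun s => c (k * s + e)) t = ((state g p c (k * t + e)).1, k *: (state g p c (k * t + e)).2).
Proof.
move=> G pt; have [_ /is_derive_pairE [D1 _]] := nbhs_singleton (geod_chart G pt).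
have [_ e2] := is_derive_affine D1; rewrite /state; congr (_, _); exact: e2.
Qed.

Lemma near_affine (P : R -> Prop) (k e t : R) : (\forall s \near k * t + e, P s) -> \forall s \near t, P (k * s + e).
Proof.
move=> H; have c : {for t, continuous (fun s : R => k * s + e)}.
  by apply: cvgD; [apply: cvgM; [exact: cvg_cst|exact: cvg_id]|exact: cvg_cst].
exact: c.
Qed.

Lemma chr_scale (G : V -> 'M[R]_n) y (k l : R) u v : chr G y (k *: u) (l *: v) = (k * l) *: chr G y u v.
Proof.
apply/rowP => i; rewrite !mxE mulr_sumr; apply: eq_bigr => j _ /=.
by rewrite mulr_sumr; apply: eq_bigr => m _; rewrite !mxE; ring.
Qed.

Lemma geod_affine c (k e t : R) : geod g c (k * t + e) -> geod g (fun s => c (k * s + e)) t.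
Proof.
move=> G; pose p := c (k * t + e); have pt : chart_dom g p p by exact: chart_dom_center.
have H := geod_chart G pt.
apply: (@Geod _ _ _ _ _ _ p).
have H2 : \forall s \near k * t + e, geod g c s /\ geod_in g p c s.
  by apply: filterI; [exact: geod_near|exact: geod_in_near].
have st s : geod g c (k * s + e) /\ geod_in g p c (k * s + e) ->
   state g p (fun s => c (k * s + e)) s = ((state g p c (k * s + e)).1, k *: (state g p c (k * s + e)).2).
  move=> [Gs /nbhs_singleton [ps _]]; exact: (state_affine Gs ps).
have H3 : \forall s \near t, \forall r \near s, geod g c (k * r + e) /\ geod_in g p c (k * r + e).
  by apply: nbhs_interior; exact: (near_affine H2).
apply: filterS H3 => s Hs; have Hss := nbhs_singleton Hs.
have [Gs /nbhs_singleton [ps Ds]] := Hss; split; first exact: ps.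
have /is_derive_pairE [D1 D2] := Ds.
have : is_derive s 1 (fun s => ((state g p c (k * s + e)).1, k *: (state g p c (k * s + e)).2))
     (spray (metric g p) (state g p (fun s => c (k * s + e)) s)).
  rewrite (st s Hss) /spray.
  apply/is_derive_pairE; split.
    exact: (is_derive_affine D1).
  rewrite [in X in is_derive _ _ _ X]/=.
  apply: (is_derive_ext _ _ (is_deriveZ k (is_derive_affine D2))); first by move=> r.
  by rewrite /spray /= !scalerN chr_scale scalerA.
apply: is_derive_near_eq; apply: filterS Hs => r Hr; rewrite (st r Hr); reflexivity.
Qed.
End Speed.

Section Flow.
Variables (R : realType) (n : nat) (M : ptopologicalType) (g : riemannian R n M).
Implicit Types (p q : M) (x v : 'rV[R]_n) (c : R -> M).
Local Notation V := 'rV[R]_n.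

Lemma near_norm_lt (t d : R) : `|t| < d -> \forall s \near t, `|s| < d.
Proof.
move=> td; apply/near_normP; exists (d - `|t|); first lra.
move=> s; have := ler_normD (s - t) t; rewrite subrK; lra.
Qed.

Lemma near_lt (t d : R) : t < d -> \forall s \near t, s < d.
Proof.
move=> td; apply/near_normP; exists (d - t); first lra.
move=> s; have := ler_norm (s - t); lra.
Qed.

Lemma near_gt (t d : R) : d < t -> \forall s \near t, d < s.
Proof.
move=> td; apply/near_normP; exists (t - d); first lra.
move=> s; have := ler_norm (t - s); rewrite distrC; lra.
Qed.

(** The flow of the spray in the chart, shortened until it stays in the image of the chart and hence
    describes geodesics of [M]. The linearized flow [Z] will carry Jacobi fields. *)
Lemma flow_box p (a : V * V) (e : R) : chart_img g p a.1 -> 0 < e ->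
  exists (r d : R) (phi : R -> V * V -> V * V) (Z : R -> V * V -> V * V -> V * V),
  [/\ 0 < r, 0 < d, forall b w, `|b - a| < r -> phi 0 b = b /\ Z 0 b w = w &
   forall b (t : R), `|b - a| < r -> `|t| < d ->
    [/\ geod g (fun s => chart_inv g p (phi s b).1) t,
        chart_img g p (phi t b).1 /\ `|phi t b - a| < e,
        state g p (fun s => chart_inv g p (phi s b).1) t = phi t b,
        C11 (phi t) b &
        forall w, 'D_w (phi t) b = Z t b w /\
          is_derive t 1 (fun s => Z s b w) ('D_(Z t b w) (spray (metric g p)) (phi t b))]].
Proof.
move=> pa e0; have CF := C11_spray_chart pa.
have [r [d [K [phi [Z [r0 d0 phi0 H1 H2]]]]]] := local_flow (antider_prod (@antider_rV R n) (@antider_rV R n))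
  (geo_complete_prod (@geo_complete_rV R n) (@geo_complete_rV R n)) CF.
have /near_normP [e1 e10 He1] : \forall x \near a.1, chart_img g p x.
  by apply: open_nbhs_nbhs; split => //; exact: chart_img_open.
pose e2 := Num.min e1 e.
have e20 : 0 < e2 by rewrite lt_min e10.
pose r' := Num.min r (e2 / 2); pose d' := Num.min d (e2 / (2 * (`|K| + 1))).
have K1 : 0 < `|K| + 1 by rewrite ltr_wpDl.
have r'0 : 0 < r' by rewrite lt_min r0 divr_gt0.
have d'0 : 0 < d' by rewrite lt_min d0 divr_gt0// mulr_gt0.
have rr b : `|b - a| < r' -> `|b - a| < r by rewrite lt_min => /andP[].
have dd (t : R) : `|t| < d' -> `|t| <= d by rewrite lt_min => /andP[/ltW].
have close b (t : R) : `|b - a| < r' -> `|t| < d' -> `|phi t b - a| < e2.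
  move=> br td; have [_ Hk _] := H1 b t (rr _ br) (dd _ td).
  have b2 : `|b - a| < e2 / 2 by move: br; rewrite lt_min => /andP[].
  have t2 : K * `|t| <= e2 / 2.
    apply: (@le_trans _ _ ((`|K| + 1) * `|t|)); first by rewrite ler_wpM2r// ler_wpDr// ler_norm.
    have : `|t| < e2 / (2 * (`|K| + 1)) by move: td; rewrite lt_min => /andP[].
    by rewrite ltr_pdivlMr ?mulr_gt0// => /ltW; lra.
  have := ler_normD (phi t b - b) (b - a); rewrite subrKA; lra.
have img b (t : R) : `|b - a| < r' -> `|t| < d' -> chart_img g p (phi t b).1.
  move=> br td; apply: He1; apply: (@le_lt_trans _ _ `|phi t b - a|); last first.
    by apply: (lt_le_trans (close b t br td)); rewrite ge_min lexx.
  by rewrite prod_normE /= le_max lexx.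
have st b (t : R) : `|b - a| < r' -> `|t| < d' ->
    state g p (fun s => chart_inv g p (phi s b).1) t = phi t b.
  move=> br td; have [/is_derive_pairE [D1 _] _ _] := H1 b t (rr _ br) (dd _ td).
  have nt : \forall s \near t, `|s| < d' by exact: near_norm_lt.
  have D1' : is_derive t 1 (chart g p \o (fun s => chart_inv g p (phi s b).1)) (spray (metric g p) (phi t b)).1.
    apply: (is_derive_near_eq _ D1); apply: filterS nt => s sd.
    by rewrite /= chart_invK//; exact: img.
  rewrite /state /= chart_invK; last exact: img.
  have [_ ->] := D1'; rewrite /spray /=; by case: (phi t b).
exists r', d', phi, Z; split; [exact: r'0|exact: d'0| |].
  move=> b w br; split; first by exact: phi0 (rr _ br).
  have z0 : `|0 : R| < d' by rewrite normr0.
  by have [_ _ h _] := H2 b 0 (rr _ br) (dd 0 z0); exact: h.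
move=> b t br td; have [D _ _] := H1 b t (rr _ br) (dd _ td).
split.
- apply: (@Geod _ _ _ _ _ _ p).
  have nt : \forall s \near t, `|s| < d' by exact: near_norm_lt.
  have nnt : \forall s \near t, \forall s' \near s, `|s'| < d' by exact: nbhs_interior.
  apply: filterS nnt => s Hs; have sd := nbhs_singleton Hs.
  split; first by apply: chart_inv_dom; exact: img.
  rewrite (st b s br sd); have [Ds _ _] := H1 b s (rr _ br) (dd _ sd).
  apply: (is_derive_near_eq _ Ds); apply: filterS Hs => s' s'd.
  exact: (esym (st b s' br s'd)).
- split; first exact: img.
  by apply: (lt_le_trans (close b t br td)); rewrite ge_min lexx orbT.
- exact: st.
- by have [] := H2 b t (rr _ br) (dd _ td).
- by move=> w; have [_ h1 _ h2] := H2 b t (rr _ br) (dd _ td); split; [exact: h1|exact: h2].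
Qed.

Lemma geod_unique_local c1 c2 (t : R) : geod g c1 t -> geod g c2 t -> c1 t = c2 t ->
  state g (c1 t) c1 t = state g (c1 t) c2 t -> \forall s \near t, c1 s = c2 s.
Proof.
move=> g1 g2 e es; set p := c1 t; have pt : chart_dom g p (c1 t) by exact: chart_dom_center.
have pt2 : chart_dom g p (c2 t) by rewrite -e.
have H1 := geod_chart g1 pt; have H2 := geod_chart g2 pt2.
have CF : C11 (spray (metric g p)) (state g p c1 t) by apply: C11_spray_chart; exact: chart_img_chart.
have eq_near : \forall s \near t, state g p c1 s = state g p c2 s.
  apply: (ode_local_unique _ _ es CF); first by apply: filterS H1 => s [].
  by apply: filterS H2 => s [].
apply: (filterS _ (filterI (filterI H1 H2) eq_near)) => s [[[p1 _] [p2 _]] es'].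
by rewrite -[c1 s](chartK p1) -[c2 s](chartK p2); have [-> _] := es'.
Qed.

(** By local uniqueness the two geodesics agree on both sides of the junction, so near it the pasted
    curve is just [c1]. *)
Lemma geod_glue c1 c2 (s0 d : R) : 0 < d -> 0 <= s0 -> (forall s : R, 0 <= s <= s0 -> geod g c1 s) ->
  (forall s : R, `|s| < d -> geod g c2 s) -> c1 s0 = c2 0 ->
  state g (c1 s0) c1 s0 = state g (c1 s0) c2 0 ->
  exists2 c, (forall s : R, 0 <= s -> s < s0 + d -> geod g c s) & 
    (forall s, s <= s0 -> c s = c1 s) /\ (\forall s \near s0, c s = c1 s).
Proof.
move=> d0 s00 G1 G2 e es; pose c2' s := c2 (1 * s + (- s0)).
have G2' s : `|s - s0| < d -> geod g c2' s.
  by move=> sd; apply: geod_affine; apply: G2; rewrite mul1r.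
have e0 : c2 (1 * s0 + - s0) = c2 0 by rewrite mul1r subrr.
have nr : \forall s \near s0, c1 s = c2' s.
  apply: geod_unique_local; [apply: G1; rewrite s00 lexx//|apply: G2'; rewrite subrr normr0//|by rewrite /c2' e0|].
  have Gz : geod g c2 (1 * s0 - s0) by apply: G2; rewrite mul1r subrr normr0.
  rewrite es /c2' state_affine//; last by rewrite e0 -e; exact: chart_dom_center.
  by rewrite mul1r subrr scale1r; case: (state g (c1 s0) c2 0).
pose c s := if s <= s0 then c1 s else c2' s.
have nc : \forall s \near s0, c1 s = c s.
  by apply: filterS nr => s; rewrite /c; case: ifP.
exists c; last first.
  by split; [move=> s ss; rewrite /c ss|apply: filterS nc => s].
move=> s sge slt; have [ss|ss|ss] := ltgtP s s0.
- apply: (@geod_near_eq _ _ _ _ c1); last by apply: G1; rewrite sge ltW.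
  by apply: filterS (near_lt ss) => s' ss'; rewrite /c ltW.
- apply: (@geod_near_eq _ _ _ _ c2'); last by apply: G2'; rewrite gtr0_norm; lra.
  by apply: filterS (near_gt ss) => s' ss'; rewrite /c leNgt ss'.
- by rewrite ss; apply: (geod_near_eq nc); apply: G1; rewrite s00 lexx.
Qed.

Lemma short_geod p : exists r d : R, [/\ 0 < r, 0 < d & forall x v,
  `|x - chart g p p| < r -> `|v| < r ->
  exists c, [/\ forall t : R, `|t| < d -> geod g c t, c 0 = chart_inv g p x, chart_dom g p (c 0)
     & state g p c 0 = (x, v)]].
Proof.
have pa : chart_img g p (chart g p p, 0 : V).1 by apply: chart_img_chart; exact: chart_dom_center.
have [r [d [phi [Z [r0 d0 phi0 H]]]]] := flow_box pa ltr01.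
exists r, d; split => // x v xr vr.
have br : `|(x, v) - (chart g p p, 0 : V)| < r by rewrite prod_normE /= subr0 gt_max xr vr.
have [e0 _] := phi0 (x, v) 0 br.
exists (fun s => chart_inv g p (phi s (x, v)).1); split.
- by move=> t td; have [] := H _ t br td.
- by rewrite e0.
- have z0 : `|0 : R| < d by rewrite normr0.
  by have [_ [h _] _ _ _] := H _ 0 br z0; exact: (chart_inv_dom h).
- have z0 : `|0 : R| < d by rewrite normr0.
  by have [_ _ -> _ _] := H _ 0 br z0.
Qed.

(** Cauchy-Schwarz for [v] and the vector whose pairing with [v] is the i-th coordinate. *)
Lemma bilin_invmx_coord (G : 'M[R]_n) v i : G^T = G -> (forall u, u != 0 -> 0 < bilin G u u) ->
  v 0 i ^+ 2 <= invmx G i i * bilin G v v.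
Proof.
move=> sG pG; have uG := bilin_unitmx sG pG.
have e1 w : bilin G (delta_mx 0 i *m invmx G) w = w 0 i.
  by rewrite /bilin mulmxKV// -rowE !mxE.
have := bilin_cauchy_schwarz (delta_mx 0 i *m invmx G) v sG pG.
by rewrite !e1 -rowE mxE.
Qed.

(** The upper bound comes from the entries of the matrix, the lower one from the diagonal of its
    inverse by the preceding lemma; both are continuous, so no eigenvalues are involved. *)
Lemma metric_bounds p x : chart_img g p x -> exists r B : R, [/\ 0 < r, 0 < B &
  forall y, `|y - x| < r -> chart_img g p y /\ forall v,
    `|v| ^+ 2 <= B * bilin (metric g p y) v v /\ bilin (metric g p y) v v <= B * `|v| ^+ 2].
Proof.
move=> px; have oU := @chart_img_open R n M g p.
have gC i j : C11 (fun z => metric g p z i j : R) x.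
  by apply: (C11_metric oU _ _ _ px); move=> ? ?; exact: metric_smooth.
have /near_normP [r0 r00 Hr0] : \forall y \near x, chart_img g p y by apply: open_nbhs_nbhs.
have iC i j : C11 (fun y => invmx (metric g p y) i j : R) x.
  apply: (C11_invmx r00) => // y yr; have py := Hr0 y yr.
  by apply: bilin_unitmx; [exact: Defs.metric_sym|exact: metric_inv_pos].
have bnd (f : V -> R) : C11 f x -> \forall y \near x, `|f y| <= `|f x| + 1.
  move=> Cf; have /cvgrPdist_lt /(_ _ ltr01) := C11_continuous Cf.
  apply: filterS => y; have := ler_normD (f y - f x) (f x); rewrite subrK distrC; lra.
have N1 : \forall y \near x, forall i, `|invmx (metric g p y) i i| <= `|invmx (metric g p x) i i| + 1.
  by apply: (@filter_forall _ _ _ (nbhs x)) => i; exact: bnd.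
have N2 : \forall y \near x, forall i j, `|metric g p y i j| <= `|metric g p x i j| + 1.
  by apply: (@filter_forall _ _ _ (nbhs x)) => i; apply: (@filter_forall _ _ _ (nbhs x)) => j; exact: (bnd _ (gC i j)).
have /near_normP [r r1 Hr] : \forall y \near x,
    (forall i, `|invmx (metric g p y) i i| <= `|invmx (metric g p x) i i| + 1) /\
    (forall i j, `|metric g p y i j| <= `|metric g p x i j| + 1) by apply: filterI.
pose B1 := \sum_i (`|invmx (metric g p x) i i| + 1).
pose B2 := \sum_i \sum_j (`|metric g p x i j| + 1).
have B10 : 0 <= B1 by apply: sumr_ge0 => i _; rewrite addr_ge0.
have B20 : 0 <= B2 by apply: sumr_ge0 => i _; apply: sumr_ge0 => j _; rewrite addr_ge0.
exists (Num.min r0 r), (B1 + B2 + 1); split; [by rewrite lt_min r00|lra|].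
move=> y; rewrite lt_min => /andP[yr0 yr]; have py := Hr0 y yr0; have [h1 h2] := Hr y yr.
have sy := Defs.metric_sym py; have posy := metric_inv_pos py.
split => // v; have b0 := bilin_ge0 v posy; split.
  have Bv : 0 <= B1 * bilin (metric g p y) v v by apply: mulr_ge0.
  apply: (@le_trans _ _ (B1 * bilin (metric g p y) v v)); last by rewrite ler_wpM2r//; lra.
  rewrite -[leRHS]sqr_sqrtr//; rewrite ler_pXn2r ?nnegrE ?sqrtr_ge0//.
  apply: rV_norm_le; rewrite ?sqrtr_ge0// => i.
  rewrite -(@ler_pXn2r _ 2) ?nnegrE ?sqrtr_ge0// sqr_sqrtr// real_normK ?num_real//.
  apply: (le_trans (bilin_invmx_coord v i sy posy)); rewrite ler_wpM2r//.
  apply: (le_trans (ler_norm _)); apply: (le_trans (h1 i)).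
  rewrite /B1 (bigD1 i)//= lerDl; apply: sumr_ge0 => j _; by rewrite addr_ge0.
apply: (@le_trans _ _ (B2 * `|v| ^+ 2)); last by rewrite ler_wpM2r ?exprn_ge0//; lra.
rewrite bilinE /B2 mulr_suml; apply: ler_sum => i _; rewrite mulr_suml; apply: ler_sum => j _.
apply: (le_trans (ler_norm _)); rewrite !normrM (_ : _ * _ * _ = `|metric g p y i j| * (`|v 0 i| * `|v 0 j|)); last by ring.
apply: ler_pM => //.
by rewrite expr2; apply: ler_pM => //; exact: coord_le_norm.
Qed.
End Flow.

(** * Lengths of curves and gradient bounds *)

Section Curves.
Variables (R : realType) (n : nat) (M : ptopologicalType) (g : riemannian R n M).
Implicit Types (p q : M) (c : R -> M).
Local Notation V := 'rV[R]_n.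

Lemma derive_ge0_le (f df : R -> R) (a b : R) : a <= b ->
  (forall t : R, a <= t <= b -> is_derive t 1 f (df t)) ->
  (forall t : R, a <= t <= b -> 0 <= df t) -> f a <= f b.
Proof.
move=> ab fd d0.
have [z zab e] : exists2 z, z \in `[a, b] & f b - f a = df z * (b - a).
  apply: MVT_segment => //.
    by move=> t; rewrite in_itv /= => /andP[/ltW h1 /ltW h2]; apply: fd; rewrite h1.
  apply: continuous_in_subspaceT => t; rewrite inE /= in_itv /= => tab.
  exact: (is_derive_continuous (fd t tab)).
by rewrite -subr_ge0 e mulr_ge0 ?subr_ge0//; apply: d0; move: zab; rewrite in_itv.
Qed.

Lemma cont_near_eq (T U : topologicalType) (f f' : T -> U) (t : T) : (\forall s \near t, f s = f' s) ->
  {for t, continuous f} -> {for t, continuous f'}.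
Proof.
move=> e cf; have h : f x @[x --> t] --> f t by exact: cf.
suff h2 : f' x @[x --> t] --> f' t by exact: h2.
by rewrite -(nbhs_singleton e); apply: cvg_trans h; apply: near_eq_cvg.
Qed.

Lemma cont_pair (T W1 W2 : topologicalType) (f1 : T -> W1) (f2 : T -> W2) (t : T) :
  {for t, continuous f1} -> {for t, continuous f2} -> {for t, continuous (fun s => (f1 s, f2 s))}.
Proof. by move=> h1 h2; apply: cvg_pair. Qed.

Lemma C11_speed2 p (s : V * V) : chart_img g p s.1 -> C11 (speed2 g p) s.
Proof.
move=> ps; have oU := @chart_img_open R n M g p.
have gC i j : C11 (fun z => metric g p z i j : R) s.1.
  by apply: (C11_metric oU _ _ _ ps); move=> ? ?; exact: metric_smooth.
have C2 i : C11 (fun s : V * V => s.2 0 i : R) s.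
  exact: (C11_coord i (C11_snd s)).
rewrite (_ : speed2 g p = fun s : V * V => \sum_i \sum_j s.2 0 i * metric g p s.1 i j * s.2 0 j).
  apply: C11_sum => i _; apply: C11_sum => j _.
  apply: C11_mul => //; apply: C11_mul => //.
  by have [h _] := @C11_comp R _ _ _ (fun x : V => metric g p x i j : R) (@fst V V) s (C11_fst s) (gC i j); exact: h.
by apply/funext => s'; rewrite /speed2 bilinE.
Qed.

Lemma speed_chart p c (t : R) (v : V) : chart_dom g p (c t) -> {for t, continuous c} ->
  is_derive t 1 (chart g p \o c) v ->
  speed g c t = Num.sqrt (speed2 g p (chart g p (c t), v)).
Proof.
move=> pt cc D; have ct := chart_dom_center g (c t).
have nr : \forall s \near t, chart_dom g p (c s) by apply: cc; exact: chart_dom_nbhs.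
have [_ e] := derive_trans pt ct nr D.
rewrite /speed derive1E /local_rep e /speed2 /= (bilin_trans v v (trans_dom_chart pt ct)).
by rewrite (transE _ pt).
Qed.

(** [C1_at] speaks of the chart around [c t] only; computations with a fixed chart require the same
    regularity there, and differentiability near [t]. *)
Lemma C1_at_chart p c (t : R) : C1_at g c t -> chart_dom g p (c t) ->
  (\forall s \near t, chart_dom g p (c s) /\
     is_derive (s : R) 1 (chart g p \o c) ('D_1 (chart g p \o c) s) /\ {for s, continuous c}) /\
  {for t, continuous ('D_1 (chart g p \o c))}.
Proof.
move=> [cc dn dc] pt; set q := c t; have qt : chart_dom g q q by exact: chart_dom_center.
have nq : \forall s \near t, chart_dom g q (c s) by apply: cc; exact: chart_dom_nbhs.
have np : \forall s \near t, chart_dom g p (c s) by apply: cc; exact: chart_dom_nbhs.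
have dn' : \forall s \near t, is_derive (s : R) 1 (chart g q \o c) ('D_1 (chart g q \o c) s).
  by apply: filterS dn => s ds; exact: derivableP.
have N : \forall s \near t, \forall r \near s, [/\ chart_dom g q (c r), chart_dom g p (c r) &
    is_derive (r : R) 1 (chart g q \o c) ('D_1 (chart g q \o c) r)].
  by apply: nbhs_interior; apply: filterS (filterI (filterI nq np) dn') => s [[]].
have key s : (\forall r \near s, [/\ chart_dom g q (c r), chart_dom g p (c r) &
    is_derive (r : R) 1 (chart g q \o c) ('D_1 (chart g q \o c) r)]) ->
   is_derive s 1 (chart g p \o c) ('D_('D_1 (chart g q \o c) s) (trans g q p) (chart g q (c s))).
  move=> H; have [qs ps Ds] := nbhs_singleton H.
  by apply: (derive_trans qs ps _ Ds); apply: filterS H => r [].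
split.
  apply: filterS N => s H; have [qs ps Ds] := nbhs_singleton H.
  split; first exact: ps; split; first by have D := key s H; apply: derivableP; case: D.
  apply: (chart_curve_cont qs); first by apply: filterS H => r [].
  exact: (is_derive_continuous Ds).
pose f s := (tangent_map (trans g q p) (chart g q (c s), 'D_1 (chart g q \o c) s)).2.
have e : \forall s \near t, f s = 'D_1 (chart g p \o c) s.
  by apply: filterS N => s H; have [_ e1] := key s H; exact: esym e1.
have cf : {for t, continuous f}.
  have T := trans_dom_chart qt pt.
  have Ct : C11 (tangent_map (trans g q p)) (chart g q q, 'D_1 (chart g q \o c) t).
    by apply: (C11_tangent_map (@trans_dom_open R n M g q p)) => //; exact: transition_smooth.
  apply: (@continuous_comp _ _ _ (fun s => tangent_map (trans g q p) (chart g q (c s), 'D_1 (chart g q \o c) s)) snd).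
    apply: (@continuous_comp _ _ _ (fun s => (chart g q (c s), 'D_1 (chart g q \o c) s)) (tangent_map (trans g q p))).
      apply: cont_pair.
        exact: (is_derive_continuous (nbhs_singleton dn')).
      have e1 : derive1 (local_rep g c t) = 'D_1 (chart g q \o c) by apply/funext => s; exact: derive1E.
      by rewrite -e1; exact: dc.
    exact: (C11_continuous Ct).
  exact: cvg_snd.
exact: (cont_near_eq e cf).
Qed.

Lemma speed_continuous c (t : R) : C1_at g c t -> {for t, continuous (speed g c)}.
Proof.
move=> C; set p := c t; have pt : chart_dom g p p by exact: chart_dom_center.
have [nr cd] := C1_at_chart C pt.
pose f s := Num.sqrt (speed2 g p (chart g p (c s), 'D_1 (chart g p \o c) s)).
have e : \forall s \near t, f s = speed g c s.
  by apply: filterS nr => s [ps [Ds cs]]; rewrite (speed_chart ps cs Ds).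
have cf : {for t, continuous f}.
  apply: (@continuous_comp _ _ _ (fun s => speed2 g p (chart g p (c s), 'D_1 (chart g p \o c) s)) Num.sqrt).
    apply: (@continuous_comp _ _ _ (fun s => (chart g p (c s), 'D_1 (chart g p \o c) s)) (speed2 g p)).
      apply: cont_pair; last exact: cd.
      by have [_ [D _]] := nbhs_singleton nr; exact: (is_derive_continuous D).
    by apply: C11_continuous; apply: C11_speed2; exact: chart_img_chart.
  exact: sqrt_continuous.
exact: (cont_near_eq e cf).
Qed.

Lemma speed_ge0 c t : 0 <= speed g c t. Proof. exact: sqrtr_ge0. Qed.

(** Length becomes the increment of a primitive, so that comparisons with length reduce to
    monotonicity of differentiable functions. *)
Lemma speed_antiderivative c : (forall t : R, 0 <= t <= 1 -> C1_at g c t) ->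
  exists2 G : R -> R, (forall t : R, 0 <= t <= 1 -> is_derive t 1 G (speed g c t)) &
    \int[@lebesgue_measure R]_(t in `[0, 1]) speed g c t = G 1 - G 0.
Proof.
move=> C; have cf : continuous (speed g c \o @clamp01 R).
  by move=> t; apply: continuous_comp; [exact: clamp01_continuous|exact: (speed_continuous (C _ (clamp01_itv t)))].
have [G G0 HG] := antider_R cf.
have HG' (t : R) : 0 <= t <= 1 -> is_derive t 1 G (speed g c t).
  by move=> t01; have := HG t; rewrite /= clamp01_id.
exists G => //.
have Gc (t : R) : {for t, continuous G} by exact: (is_derive_continuous (HG t)).
have := @continuous_FTC2 R (speed g c) G 0 1 ltr01.
rewrite /Rintegral => ->; first by rewrite -EFinB.
- apply: continuous_in_subspaceT => t; rewrite inE /= in_itv /= => t01.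
  exact: (speed_continuous (C t t01)).
- split; first by move=> t _; case: (HG t).
    by apply: cvg_at_right_filter; exact: Gc.
  by apply: cvg_at_left_filter; exact: Gc.
- move=> t; rewrite in_itv /= => /andP[/ltW t0 /ltW t1].
  by rewrite derive1E; have [|_ ->] := HG' t; rewrite ?t0.
Qed.

(** The bound |grad f| <= k on P, tested on C^1 curves instead of through a gradient. *)
Definition speed_lip (P : M -> Prop) (k : R) (f : M -> R) := forall c (t : R),
  C1_at g c t -> P (c t) -> exists2 l, is_derive t 1 (f \o c) l & `|l| <= k * speed g c t.

Lemma curve_length_ge0 x y L : curve_length g x y L -> 0 <= L.
Proof.
elim=> // c z L' C _ L0; have [G HG ->] := speed_antiderivative C.
rewrite addr_ge0// subr_ge0; apply: (derive_ge0_le ler01 HG) => t _; exact: speed_ge0.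
Qed.

(** Since [f0] drops by at most the length travelled, a curve of length L that starts where f0 >= R0
    + L never leaves the region f0 >= R0, on which the gradient of [f] is controlled. *)
Lemma curve_lip (f f0 : M -> R) (k R0 : R) : 0 <= k -> speed_lip (fun=> True) 1 f0 ->
  speed_lip (fun x => R0 <= f0 x) k f ->
  forall x y L, curve_length g x y L -> R0 + L <= f0 x -> `|f x - f y| <= k * L.
Proof.
move=> k0 H0 Hf x y L; elim=> {x y L} [x|c y L C cl IH].
  by rewrite subrr normr0 mulr0.
have L0 := curve_length_ge0 cl.
have [G HG ->] := speed_antiderivative C => Rf.
have mono (t : R) : 0 <= t <= 1 -> G t <= G 1.
  move=> /andP[t0 t1]; apply: (derive_ge0_le t1 (df := speed g c)) => s /andP[ts s1].
    by apply: HG; rewrite s1 (le_trans t0).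
  exact: speed_ge0.
have lip (h : M -> R) (j b : R) : 0 <= b <= 1 -> 0 <= j ->
    (forall t : R, 0 <= t <= b -> exists2 l, is_derive t 1 (h \o c) l & `|l| <= j * speed g c t) ->
    `|h (c 0) - h (c b)| <= j * (G b - G 0).
  move=> /andP[b0 b1] j0 H.
  pose l t := 'D_1 (h \o c) t.
  have D (t : R) : 0 <= t <= b -> is_derive t 1 (h \o c) (l t) /\ `|l t| <= j * speed g c t.
    by move=> tb; have [l' D' Hl'] := H t tb; have [dd e'] := D'; rewrite /l e'; split.
  have Gb (t : R) : 0 <= t <= b -> is_derive t 1 G (speed g c t).
    by move=> /andP[t0 tb]; apply: HG; rewrite t0 (le_trans tb).
  have h1 : j * G 0 - h (c 0) <= j * G b - h (c b).
    apply: (@derive_ge0_le (fun t => j * G t - h (c t)) (fun t => j * speed g c t - l t) _ _ b0) => t tb.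
      by have [D1 _] := D t tb; apply: is_deriveB => //; apply: is_deriveZ; exact: Gb.
    by have [_] := D t tb; rewrite ler_norml => /andP[_]; lra.
  have h2 : j * G 0 + h (c 0) <= j * G b + h (c b).
    apply: (@derive_ge0_le (fun t => j * G t + h (c t)) (fun t => j * speed g c t + l t) _ _ b0) => t tb.
      by have [D1 _] := D t tb; apply: is_deriveD => //; apply: is_deriveZ; exact: Gb.
    by have [_] := D t tb; rewrite ler_norml => /andP[]; lra.
  by rewrite ler_norml; apply/andP; split; lra.
have f0t (t : R) : 0 <= t <= 1 -> R0 + L <= f0 (c t).
  move=> t01; have := lip f0 1 t t01 ler01.
  have h : forall s : R, 0 <= s <= t -> exists2 l, is_derive s 1 (f0 \o c) l & `|l| <= 1 * speed g c s.
    move=> s /andP[s0 st]; apply: H0 => //; apply: C; rewrite s0; case/andP: t01 => _; exact: le_trans.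
  by move=> /(_ h); have := mono t t01; rewrite ler_norml mul1r => ? /andP[_]; lra.
have h1 : `|f (c 0) - f (c 1)| <= k * (G 1 - G 0).
  apply: lip; rewrite ?ler01 ?lexx// => t t01; apply: Hf; first exact: C.
  by have := f0t t t01; lra.
have h2 : `|f (c 1) - f y| <= k * L by apply: IH; apply: f0t; rewrite ler01 lexx.
apply: (ler_norm_split _ h1 h2); first by rewrite subrKA.
by rewrite -mulrDr lexx.
Qed.

Lemma curve_lip_global (f : M -> R) (k : R) : 0 <= k -> speed_lip (fun=> True) k f ->
  forall x y L, curve_length g x y L -> `|f x - f y| <= k * L.
Proof.
move=> k0 Hf x y L cl; apply: (@curve_lip f (fun=> L) k 0) => //.
- by move=> c t _ _; exists 0; [exact: is_derive_cst_fun|rewrite normr0 mul1r speed_ge0].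
- by move=> c t C _; exact: Hf.
- by rewrite add0r.
Qed.

Lemma curve_length_cat x y z L L' : curve_length g x y L -> curve_length g y z L' ->
  curve_length g x z (L + L').
Proof.
elim=> [u|c u K C _ IH] H; first by rewrite add0r.
by rewrite -addrA; apply: curve_length_cons => //; exact: IH.
Qed.

Lemma geod_C1_at c (t : R) : geod g c t -> C1_at g c t.
Proof.
move=> G; have cc := geod_continuous G; set p := c t; have pt : chart_dom g p (c t) by exact: chart_dom_center.
have H := geod_chart G pt; split=> //.
  by apply: filterS H => s [_ /is_derive_pairE [[]]].
have [_ /is_derive_pairE [_ D2]] := nbhs_singleton H.
rewrite (_ : derive1 _ = snd \o state g p c); first exact: (is_derive_continuous D2).
by apply/funext => s; rewrite derive1E.
Qed.

Lemma geod_speed c (t : R) : geod g c t -> speed g c t = Num.sqrt (gspeed2 g c t).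
Proof. by move=> G; rewrite /speed derive1E. Qed.

Lemma geod_curve_length c (a b T : R) : (forall t : R, 0 <= t <= T -> geod g c t) ->
  0 <= a <= T -> 0 <= b <= T -> curve_length g (c a) (c b) (Num.sqrt (gspeed2 g c 0) * `|b - a|).
Proof.
move=> G a01 b01; pose c' s := c ((b - a) * s + a).
have ran (s : R) : 0 <= s <= 1 -> 0 <= (b - a) * s + a <= T.
  by move=> /andP[s0 s1]; move: a01 b01 => /andP[? ?] /andP[? ?]; apply/andP; split; nra.
have G' (s : R) : 0 <= s <= 1 -> geod g c' s by move=> /ran /G; exact: geod_affine.
have sp (s : R) : 0 <= s <= 1 -> speed g c' s = Num.sqrt (gspeed2 g c 0) * `|b - a|.
  move=> s01; have Gs := G _ (ran s s01).
  rewrite (geod_speed (G' s s01)) -(gspeed2_const G (ran s s01)).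
  rewrite /gspeed2 /c' (state_affine Gs); last exact: chart_dom_center.
  rewrite /speed2 [(_, _).1]/= [(_, _).2]/= bilinZl bilinZr mulrA -expr2 mulrC sqrtrM; last first.
    by apply: (@speed2_ge0 R n M g _ (state g _ c _)); apply: chart_img_chart; exact: chart_dom_center.
  by rewrite sqrtr_sqr.
have C : forall t : R, 0 <= t <= 1 -> C1_at g c' t by move=> t /G'; exact: geod_C1_at.
have := curve_length_cons C (curve_length_nil _ _).
rewrite /c' mulr0 add0r mulr1 subrK addr0; congr curve_length.
have -> : \int[@lebesgue_measure R]_(t in `[0, 1]) speed g c' t =
   \int[@lebesgue_measure R]_(t in `[0, 1]) cst (Num.sqrt (gspeed2 g c 0) * `|b - a|) t.
  by apply: eq_Rintegral => s; rewrite inE /= in_itv /= => /sp.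
rewrite Rintegral_cst; last exact: measurable_itv.
have -> : fine (lebesgue_measure (`[0, 1]%classic : set R)) = 1.
  by rewrite lebesgue_measure_itv /= lte_fin ltr01 oppr0 adde0.
by rewrite mulr1.
Qed.

Lemma chart_segment p (a b : V) (K : R) : 0 <= K ->
  (forall t : R, 0 <= t <= 1 -> chart_img g p (a + t *: (b - a)) /\
     bilin (metric g p (a + t *: (b - a))) (b - a) (b - a) <= K ^+ 2) ->
  exists2 L, curve_length g (chart_inv g p a) (chart_inv g p b) L & L <= K.
Proof.
move=> K0 H; pose y (t : R) := a + t *: (b - a); pose c t := chart_inv g p (y t).
have Dy (t : R) : is_derive t 1 y (b - a) by exact: is_derive_line.
have cy (t : R) : {for t, continuous y} by exact: (is_derive_continuous (Dy t)).
have img (t : R) : 0 <= t <= 1 -> chart_img g p (y t) by move=> /H [].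
have nimg (t : R) : 0 <= t <= 1 -> \forall s \near t, chart_img g p (y s).
  by move=> /img imt; apply: cy; apply: open_nbhs_nbhs; split => //; exact: chart_img_open.
have cc (t : R) : 0 <= t <= 1 -> {for t, continuous c}.
  by move=> /img imt; apply: continuous_comp; [exact: cy|exact: chart_inv_cont].
have Dc (t : R) : (\forall s \near t, chart_img g p (y s)) -> is_derive t 1 (chart g p \o c) (b - a).
  move=> nt; apply: (is_derive_near_eq _ (Dy t)); apply: filterS nt => s ys.
  by rewrite /= /c chart_invK.
have nnimg (t : R) : 0 <= t <= 1 -> \forall s \near t, \forall r \near s, chart_img g p (y r).
  by move=> /nimg; exact: nbhs_interior.
have C (t : R) : 0 <= t <= 1 -> C1_at g c t.
  move=> t01; have pt : chart_dom g p (c t) by apply: chart_inv_dom; exact: img.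
  have ct := chart_dom_center g (c t).
  have n1 : \forall s \near t, \forall r \near s, chart_img g p (y r) /\ chart_dom g (c t) (c r).
    apply: nbhs_interior; apply: filterI; first exact: nimg.
    by apply: (cc t t01); exact: chart_dom_nbhs.
  have D2 : \forall s \near t, is_derive (s : R) 1 (chart g (c t) \o c) ('D_(b - a) (trans g p (c t)) (chart g p (c s))).
    apply: filterS n1 => s Hs; have [ims qs] := nbhs_singleton Hs.
    apply: (derive_trans _ qs); first exact: chart_inv_dom.
      by apply: filterS Hs => r [/chart_inv_dom].
    by apply: Dc; apply: filterS Hs => r [].
  split; first exact: cc.
    by apply: filterS D2 => s [].
  pose f s := (tangent_map (trans g p (c t)) (y s, b - a)).2.
  have e : \forall s \near t, f s = derive1 (local_rep g c t) s.
    apply: filterS (filterI D2 (nimg t t01)) => s [[_ es] ims]; rewrite derive1E /local_rep es /f /=.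
    by rewrite /c chart_invK.
  have cf : {for t, continuous f}.
    have T : trans_dom g p (c t) (y t) by apply/trans_domE; split; [exact: img|].
    have Ct : C11 (tangent_map (trans g p (c t))) (y t, b - a).
      by apply: (C11_tangent_map (@trans_dom_open R n M g p (c t))) => //; exact: transition_smooth.
    apply: (@continuous_comp _ _ _ (fun s => tangent_map (trans g p (c t)) (y s, b - a)) snd).
      apply: (@continuous_comp _ _ _ (fun s => (y s, b - a)) (tangent_map (trans g p (c t)))).
        by apply: cont_pair; [exact: cy|exact: cvg_cst].
      exact: (C11_continuous Ct).
    exact: cvg_snd.
  exact: (cont_near_eq e cf).
have sp (t : R) : 0 <= t <= 1 -> speed g c t <= K.
  move=> t01; have [imt Hb] := H t t01; have pt : chart_dom g p (c t) by exact: chart_inv_dom.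
  rewrite (speed_chart pt (cc t t01) (Dc t (nimg t t01))) -(ger0_norm K0) -sqrtr_sqr ler_wsqrtr//.
  by rewrite /speed2 /= /c chart_invK.
have := curve_length_cons C (curve_length_nil _ _).
rewrite /c /y scale0r addr0 scale1r addrC subrK addr0 => cl.
exists (\int[@lebesgue_measure R]_(t in `[0, 1]) speed g c t) => //.
have [G HG ->] := speed_antiderivative C.
have : K * 0 - G 0 <= K * 1 - G 1.
  apply: (@derive_ge0_le (fun t => K * t - G t) (fun t => K * 1 - speed g c t) _ _ ler01) => t t01.
    by apply: (is_derive_ext _ _ (is_deriveB (is_deriveZ K (is_derive_id t 1)) (HG t t01))).
  by rewrite mulr1 subr_ge0; exact: sp.
by rewrite mulr0 mulr1; lra.
Qed.

Lemma dist_le x y L : curve_length g x y L -> geodesic_dist g x y <= L.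
Proof.
move=> cl; apply: ge_inf => //; exists 0 => z; exact: curve_length_ge0.
Qed.

Lemma dist_lt_curve x y (e : R) : (exists L, curve_length g x y L) -> geodesic_dist g x y < e ->
  exists2 L, curve_length g x y L & L < e.
Proof.
move=> ne d; have hi : has_inf [set L | curve_length g x y L].
  by split => //; exists 0 => z; exact: curve_length_ge0.
have [|L cl Le] := @inf_adherent R _ (e - geodesic_dist g x y) _ hi; first by rewrite subr_gt0.
by exists L => //; move: Le; rewrite addrC subrK.
Qed.
End Curves.

(** * Hopf-Rinow extension of geodesics *)

Section Completeness.
Variables (R : realType) (n : nat) (M : ptopologicalType) (g : riemannian R n M).
Implicit Types (p q : M) (c : R -> M).
Local Notation V := 'rV[R]_n.

Lemma is_derive_sqpos (a : R) :
  is_derive a 1 (fun u : R => (Num.max 0 u) ^+ 2) (2 * Num.max 0 a).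
Proof.
apply/is_derive_eps => e e0; exists e => // h he.
rewrite /GRing.scale /= mulr1.
apply: (@le_trans _ _ (h ^+ 2)); last by rewrite -real_normK ?num_real// expr2 ler_wpM2r// ltW.
clear he; case: (leP 0 (a + h)) => ?; case: (leP 0 a) => ?; rewrite ler_norml; apply/andP; split; nra.
Qed.

Lemma le_sqrt_sqr (a b : R) : 0 <= a -> a ^+ 2 <= b -> a <= Num.sqrt b.
Proof. by move=> a0 ab; rewrite -(ger0_norm a0) -sqrtr_sqr ler_wsqrtr. Qed.

(* The gradient bound for a bump function supported in U keeps short curves inside U. *)
Lemma short_curve_nbhs p (U : set M) : nbhs p U -> exists2 e : R, 0 < e &
  forall x L, curve_length g x p L -> L < e -> U x.
Proof.
move=> pU; set x0 := chart g p p; have pp := chart_dom_center g p.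
have ix0 : chart_img g p x0 by exact: chart_img_chart.
have [r [B [r0 B0 Hr]]] := metric_bounds ix0.
have /near_normP [r1 r10 Hr1] : \forall x \near x0, U (chart_inv g p x).
  by apply: (chart_inv_cont ix0); rewrite /x0 chartK.
pose rho := Num.min r r1 / 2.
have rho0 : 0 < rho by rewrite divr_gt0// lt_min r0.
have rhor x : `|x - x0| <= rho -> `|x - x0| < r /\ `|x - x0| < r1.
  have m0 : 0 < Num.min r r1 by rewrite lt_min r0.
  move=> h; have : `|x - x0| < Num.min r r1 by rewrite /rho in h; lra.
  by rewrite lt_min => /andP.
pose S := [set x : V | `|x - x0| <= rho]; pose K := chart_inv g p @` S.
have cS : compact S.
  apply: bounded_closed_compact.
    exists (`|x0| + rho); split; first by rewrite num_real.
    move=> m mm x xS /=; have := ler_normD (x - x0) x0; rewrite subrK.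
    by have : `|x - x0| <= rho := xS; lra.
  rewrite (_ : S = (fun x : V => `|x - x0|) @^-1` [set y : R | y <= rho])//.
  apply: (closed_comp _ (@closed_le _ rho)) => x _.
  apply: (@lipschitz_continuous R R V (fun x : V => `|x - x0|) 1) => y z; rewrite mul1r.
  apply: (le_trans (ler_dist_dist _ _)); rewrite (_ : _ - _ = y - z)//; last by lmod R.
have imS x : S x -> chart_img g p x by move=> /rhor [/Hr []].
have cK : closed K.
  apply: compact_closed; first exact: manifold_hausdorff g.
  apply: continuous_compact => //; apply: continuous_in_subspaceT => x; rewrite inE => /imS.
  exact: chart_inv_cont.
have KU x : K x -> U x by move=> [y /rhor [_ /Hr1 h] <-].
have Kdom x : K x -> chart_dom g p x by move=> [y /imS iy <-]; exact: chart_inv_dom.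
pose Q (x : V) := \sum_i (x 0 i - x0 0 i) ^+ 2.
have QS (x : V) : Q x <= rho ^+ 2 -> S x.
  move=> Qx; apply: rV_norm_le; first exact: ltW.
  move=> i; rewrite -(@ler_pXn2r _ 2) ?nnegrE ?(ltW rho0)// real_normK ?num_real//.
  apply: (le_trans _ Qx); rewrite !mxE /Q (bigD1 i)//= lerDl; apply: sumr_ge0 => j _; exact: sqr_ge0.
(* Squaring the positive part makes the function C^1 in the chart. As [K] is compact and [M] is
   Hausdorff, [K] is closed, so the extension by 0 is differentiable along curves leaving the chart
   as well. *)
pose f x := if `[<K x>] then (Num.max 0 (rho ^+ 2 - Q (chart g p x))) ^+ 2 else 0.
have fdom x : chart_dom g p x -> f x = (Num.max 0 (rho ^+ 2 - Q (chart g p x))) ^+ 2.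
  move=> px; rewrite /f; case: asboolP => // nK; rewrite max_l ?expr0n//.
  rewrite subr_le0 leNgt; apply/negP => /ltW /QS Sx; apply: nK.
  by exists (chart g p x) => //; exact: chartK.
have fp : f p = rho ^+ 4.
  rewrite fdom// /Q big1 => [|i _]; first by rewrite subr0 max_r ?exprn_ge0// ?ltW// -exprM.
  by rewrite subrr expr0n.
(* The outer derivative is at most 2 rho^2, each of the n coordinates contributes 2 rho |v|, and the
   chart norm of a velocity v is at most sqrt(B) times its speed. *)
pose k := 4 * rho ^+ 2 * (n%:R * rho) * Num.sqrt B.
have k0 : 0 <= k.
  have r0' := ltW rho0; apply: mulr_ge0; last exact: sqrtr_ge0.
  by apply: mulr_ge0; apply: mulr_ge0 => //; exact: exprn_ge0.
have fl : speed_lip g (fun=> True) k f.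
  move=> c t C _; have [cc _ _] := C.
  have [Kt|nKt] := pselect (K (c t)); last first.
    exists 0; last by rewrite normr0 mulr_ge0// speed_ge0.
    apply: (is_derive_near_eq _ (is_derive_cst_fun 0 t)).
    have : \forall s \near t, (~` K) (c s).
      by apply: cc; apply: open_nbhs_nbhs; split => //; exact: closed_openC.
    by apply: filterS => s nK; rewrite /= /f; case: asboolP.
  have pt := Kdom _ Kt; have [nr _] := C1_at_chart C pt.
  have [_ [D _]] := nbhs_singleton nr; set v := 'D_1 _ t in D.
  pose y := chart g p \o c.
  have DQ : is_derive t 1 (fun s => rho ^+ 2 - Q (y s)) (0 - \sum_i 2 * (y t 0 i - x0 0 i) * v 0 i).
    apply: is_deriveB; apply: is_derive_sum_fun => i.
    have Di : is_derive t 1 (fun s => y s 0 i - x0 0 i) (v 0 i - 0).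
      by apply: is_deriveB; exact: is_derive_coord.
    apply: (is_derive_ext _ _ (is_deriveM Di Di)); first by move=> s.
    by rewrite /GRing.scale /= subr0; ring.
  pose l := 2 * Num.max 0 (rho ^+ 2 - Q (y t)) * - \sum_i 2 * (y t 0 i - x0 0 i) * v 0 i.
  exists l.
    have := @is_derive1_comp R (fun u : R => (Num.max 0 u) ^+ 2) (fun s => rho ^+ 2 - Q (y s)) t _ _ (is_derive_sqpos (rho ^+ 2 - Q (y t))) DQ.
    move=> D2; have D3 : is_derive t 1 (fun s => (Num.max 0 (rho ^+ 2 - Q (y s))) ^+ 2) l.
      by apply: (is_derive_ext _ _ D2) => //; rewrite /l /GRing.scale /=; ring.
    by apply: (is_derive_near_eq _ D3); apply: filterS nr => s [ps _]; rewrite /= fdom.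
  rewrite (speed_chart pt cc D) /k /l normrM.
  set s2 := speed2 _ _ _.
  have St : S (y t) by case: Kt => z Sz ez; rewrite /y /= -ez chart_invK//; exact: imS.
  have vb : `|v| <= Num.sqrt B * Num.sqrt s2.
    rewrite -sqrtrM ?(ltW B0)//; apply: le_sqrt_sqr => //.
    by have [h _] := rhor _ St; have [_ /(_ v) []] := Hr _ h.
  rewrite (_ : _ * Num.sqrt s2 = (2 * rho ^+ 2) * (n%:R * (2 * (rho * (Num.sqrt B * Num.sqrt s2))))); last by ring.
  apply: ler_pM => //.
    have Q0 : 0 <= Q (y t) by apply: sumr_ge0 => i _; exact: sqr_ge0.
    have m0 : 0 <= rho ^+ 2 by rewrite exprn_ge0 ?ltW.
    rewrite normrM ger0_norm// ger0_norm ?le_max ?lexx// ler_wpM2l//.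
    by rewrite ge_max m0 /=; lra.
  rewrite normrN; apply: (le_trans (ler_norm_sum _ _ _)).
  have <- : \sum_(i < n) (2 * (rho * (Num.sqrt B * Num.sqrt s2))) = n%:R * (2 * (rho * (Num.sqrt B * Num.sqrt s2))).
    by rewrite sumr_const card_ord -[LHS]mulr_natl.
  apply: ler_sum => i _.
  rewrite !normrM (ger0_norm (ler0n _ 2)) -mulrA ler_wpM2l//; apply: ler_pM => //.
    have := coord_le_norm (y t - x0) i; rewrite !mxE => /le_trans; apply; exact: St.
  exact: le_trans (coord_le_norm v i) vb.
exists (rho ^+ 4 / (k + 1)); first by rewrite divr_gt0 ?exprn_gt0//; lra.
move=> x L cl; rewrite ltr_pdivlMr; last lra.
move=> Lk; apply: KU; apply: contrapT => nK.
have fx : f x = 0 by rewrite /f; case: asboolP.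
have := curve_lip_global k0 fl cl; rewrite fx fp sub0r normrN.
have := curve_length_ge0 cl; have := ler_norm (rho ^+ 4); nra.
Qed.

Lemma chart_ball_connected p : exists2 U : set M, nbhs p U &
  forall x y, U x -> U y -> exists L, curve_length g x y L.
Proof.
have pp := chart_dom_center g p; have ip := chart_img_chart pp.
have [r [B [r0 B0 Hr]]] := metric_bounds ip.
exists [set x | chart_dom g p x /\ `|chart g p x - chart g p p| < r].
  apply: filterI; first exact: chart_dom_nbhs.
  by have /cvgrPdist_lt /(_ r r0) := chart_cont pp; apply: filterS => x; rewrite distrC.
move=> x y [px xr] [py yr].
have [||L cl _] := @chart_segment R n M g p (chart g p x) (chart g p y)
    (Num.sqrt (B * `|chart g p y - chart g p x| ^+ 2)).
- exact: sqrtr_ge0.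
- move=> t /andP[t0 t1].
  have [|im Hb] := Hr (chart g p x + t *: (chart g p y - chart g p x)); last first.
    split => //; rewrite sqr_sqrtr ?mulr_ge0 ?exprn_ge0 ?(ltW B0)//.
    by have [] := Hb (chart g p y - chart g p x).
  set a := chart g p x in xr *; set b := chart g p y in yr *; set z := chart g p p in xr yr *.
  rewrite (_ : _ - z = (1 - t) *: (a - z) + t *: (b - z)); last by lmod R.
  apply: (le_lt_trans (ler_normD _ _)); rewrite !normrZ (ger0_norm t0) ger0_norm ?subr_ge0//.
  by have [->|tn] := eqVneq t 0; [lra|have : 0 < t by rewrite lt_def tn]; nra.
by exists L; move: cl; rewrite !chartK.
Qed.

(** A continuous path need not have a length; being reachable by a piecewise C^1 curve is propagated
    along it by straight segments in charts. *)
Lemma manifold_connected : simply_connected R M -> forall x y, exists L, curve_length g x y L.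
Proof.
move=> [pc _] x y; have [f [cf f0 f1]] := pc x y.
have cf' (t : R) : 0 <= t <= 1 -> f @ within `[0, 1] (nbhs t) --> f t.
  by move=> t01; move/subspace_continuousP: cf; apply; rewrite /= in_itv.
suff H : forall t : R, 0 <= t <= 1 -> exists L, curve_length g x (f t) L.
  by have := H 1; rewrite f1; apply; rewrite ler01 lexx.
apply: real_propagation_on; first by rewrite f0; exists 0; exact: curve_length_nil.
move=> t t01; have [U Up HU] := chart_ball_connected (f t).
have /near_normP [d d0 Hd] : \forall s \near t, `[0, 1]%classic s -> U (f s) by exact: (cf' t t01 _ Up).
exists d => // s s' sd s'd s01 s'01 [L cl].
have [||L' cl'] := HU (f s) (f s').
- by apply: Hd => //; rewrite /= in_itv.
- by apply: Hd => //; rewrite /= in_itv.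
by exists (L + L'); exact: (curve_length_cat cl cl').
Qed.

(** The spray is homogeneous, so rescaling time shows that the guaranteed lifespan is inversely
    proportional to the size of the velocity, uniformly for starting points near p. *)
Lemma short_geod_scaled p : exists r d : R, [/\ 0 < r, 0 < d & forall (x v : V),
  `|x - chart g p p| < r ->
  exists c, [/\ forall t : R, `|t| * (`|v| + 1) < d -> geod g c t, c 0 = chart_inv g p x, chart_dom g p (c 0)
     & state g p c 0 = (x, v)]].
Proof.
have [r [d [r0 d0 H]]] := short_geod g p.
exists r, (d * r / 2); split => // [|x v xr]; first by rewrite divr_gt0 ?mulr_gt0.
pose k := r / (2 * (`|v| + 1)); have v1 : 0 < `|v| + 1 by rewrite ltr_wpDl.
have k0 : 0 < k by rewrite divr_gt0// mulr_gt0.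
have kv : k * (`|v| + 1) = r / 2 by rewrite /k; field; rewrite gt_eqF.
have vr : `|k *: v| < r.
  by rewrite normrZ gtr0_norm//; have := normr_ge0 v; nra.
have [c [Hc c0 pc sc]] := H x (k *: v) xr vr.
have kz : k^-1 * 0 + 0 = 0 :> R by rewrite mulr0 addr0.
exists (fun t => c (k^-1 * t + 0)); split.
- move=> t td; apply: geod_affine; apply: Hc; rewrite addr0 normrM gtr0_norm ?invr_gt0//.
  rewrite mulrC ltr_pdivrMr//; rewrite -(ltr_pM2r v1) (lt_le_trans td)//.
  by rewrite -[leRHS]mulrA kv mulrA.
- by rewrite kz.
- by rewrite kz.
- have G0 : geod g c (k^-1 * 0 + 0) by rewrite kz; apply: Hc; rewrite normr0.
  rewrite (state_affine G0) kz// sc /= scalerA mulVf ?scale1r// gt_eqF//.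
Qed.

Lemma geod_state_eq2 p q c1 c2 (t1 t2 : R) : geod g c1 t1 -> geod g c2 t2 -> c1 t1 = c2 t2 ->
  chart_dom g p (c1 t1) -> chart_dom g q (c1 t1) ->
  state g p c1 t1 = state g p c2 t2 -> state g q c1 t1 = state g q c2 t2.
Proof.
move=> G1 G2 e pt qt es; have H1 := geod_chart G1 pt.
have pt2 : chart_dom g p (c2 t2) by rewrite -e.
have qt2 : chart_dom g q (c2 t2) by rewrite -e.
have H2 := geod_chart G2 pt2.
by rewrite (state_trans H1 qt) (state_trans H2 qt2) es.
Qed.

Section Extension.
Hypotheses (cpl : complete_riemannian g) (conn : forall x y, exists L, curve_length g x y L).
Variables (o : M) (v : V).

Let init c := c 0 = o /\ state g o c 0 = (chart g o o, v).
Let until (T : R) c := (forall t : R, 0 <= t <= T -> geod g c t) /\ init c.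

Let until_unique (T T' : R) c c' : 0 <= T -> T <= T' -> until T c -> until T' c' ->
  c T = c' T.
Proof.
move=> T0 TT [G [c0 s0]] [G' [c0' s0']].
have G'' (t : R) : 0 <= t <= T -> geod g c' t.
  by move=> /andP[t0 tT]; apply: G'; rewrite t0 (le_trans tT).
have e0 : c 0 = c' 0 by rewrite c0 c0'.
have es : state g (c 0) c 0 = state g (c 0) c' 0 by rewrite c0 s0 s0'.
have TT' : 0 <= T <= T by rewrite T0 lexx.
by have [h _] := geod_unique T0 G G'' e0 es TT'.
Qed.

Let gspeed2_init c : init c -> gspeed2 g c 0 = speed2 g o (chart g o o, v).
Proof. by move=> [c0 s0]; rewrite /gspeed2 c0 s0. Qed.

(** Geodesics have constant speed, so the positions at times [s k] tending to t form a Cauchy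
    sequence; completeness gives a limit l. Near l velocities are bounded in the chart by [W], hence
    lifespans are at least d / W, and a restart at some [s k] within d / W of t passes beyond t. *)
Let geod_step (t : R) : 0 < t -> (forall s : R, 0 <= s -> s < t -> exists c, until s c) ->
  exists2 d : R, 0 < d & forall s : R, t <= s -> s < t + d -> exists c, until s c.
Proof.
move=> t0 Hs.
have [C HC] : {C : R -> R -> M & forall s, 0 <= s -> s < t -> until s (C s)}.
  apply: (@choice _ _ (fun s c => 0 <= s -> s < t -> until s c)) => s.
  have [st|st] := pselect (0 <= s /\ s < t); last by exists (fun=> o) => h1 h2; exfalso; apply: st.
  by case: st => h1 h2; have [c Hc] := Hs s h1 h2; exists c.
pose s k : R := t - t / k.+1%:R.
have k1 k : 0 < k.+1%:R :> R by rewrite ltr0n.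
have s0 k : 0 <= s k by rewrite subr_ge0 ler_pdivrMr// ler_peMr ?(ltW t0)// ler1n.
have sE k : t - s k = t / k.+1%:R by rewrite /s; ring.
have st k : s k < t by rewrite ltrBlDr ltrDl divr_gt0.
pose u k := C (s k) (s k).
pose rho := Num.sqrt (speed2 g o (chart g o o, v)).
have rho0 : 0 <= rho by exact: sqrtr_ge0.
have small (e : R) : 0 < e -> exists N : nat, forall k, (N <= k)%N -> t / k.+1%:R < e.
  move=> e0; exists (Num.trunc (t / e)) => k Nk.
  rewrite ltr_pdivrMr// mulrC -ltr_pdivrMr//.
  have := truncnS_gt (t / e) => /lt_le_trans; apply.
  by rewrite ler_nat ltnS.
have len a b : s a <= s b -> geodesic_dist g (u a) (u b) <= rho * `|s b - s a| /\
     geodesic_dist g (u b) (u a) <= rho * `|s b - s a|.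
  move=> ab; have ea : u a = C (s b) (s a).
    by apply: (until_unique (s0 a) ab); apply: HC.
  have [G I] := HC _ (s0 b) (st b).
  rewrite ea /u -/(s b) /rho -(gspeed2_init I); split.
    by apply: dist_le; apply: (geod_curve_length G); rewrite s0 ?lexx ?ab.
  by rewrite distrC; apply: dist_le; apply: (geod_curve_length G); rewrite s0 ?lexx ?ab.
have [l ul] : exists l, (fun k => geodesic_dist g (u k) l) @ \oo --> (0 : R).
  apply: cpl => e e0; have [|N HN] := small (e / (rho + 1)); first by rewrite divr_gt0//; lra.
  have sb k : (N <= k)%N -> (rho + 1) * (t - s k) < e.
    move=> /HN; rewrite ltr_pdivlMr; last lra.
    by rewrite sE mulrC.
  exists N => i j Ni Nj; have := sb i Ni; have := sb j Nj; have := st i; have := st j.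
  move=> tj ti bj bi.
  have [ij|ij] := leP (s i) (s j).
    have [h _] := len i j ij; apply: (le_lt_trans h); rewrite ger0_norm; [nra|lra].
  have [_ h] := len j i (ltW ij); apply: (le_lt_trans h); rewrite ger0_norm; [nra|lra].
have near_l (U : set M) : nbhs l U -> exists N : nat, forall k, (N <= k)%N -> U (u k).
  move=> Ul; have [e e0 He] := short_curve_nbhs Ul.
  have /cvgrPdist_lt /(_ e e0) [N _ HN] := ul.
  exists N => k Nk; have := HN k Nk; rewrite /= sub0r normrN => dk.
  have [L cl Le] := dist_lt_curve (conn (u k) l) (le_lt_trans (ler_norm _) dk).
  exact: (He _ _ cl Le).
have ll := chart_dom_center g l; have il := chart_img_chart ll.
have [r1 [B [r10 B0 HB]]] := metric_bounds il.
have [r [d [r0 d0 Hsh]]] := short_geod_scaled l.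
pose W := Num.sqrt (B * rho ^+ 2) + 1; have W0 : 0 < W by rewrite ltr_wpDl// sqrtr_ge0.
have [N1 HN1] := small (d / W) (divr_gt0 d0 W0).
have [N2 HN2] : exists N : nat, forall k, (N <= k)%N ->
    chart_dom g l (u k) /\ `|chart g l (u k) - chart g l l| < Num.min r r1.
  apply: (near_l [set x | chart_dom g l x /\ `|chart g l x - chart g l l| < Num.min r r1]).
  apply: filterI; first exact: chart_dom_nbhs.
  have rr : 0 < Num.min r r1 by rewrite lt_min r0.
  by have /cvgrPdist_lt /(_ _ rr) := chart_cont ll; apply: filterS => x; rewrite distrC.
pose k := maxn N1 N2.
have [lu] := HN2 k (leq_maxr _ _); rewrite lt_min => /andP[ur ur1].
have tk : t - s k < d / W.
  by have := HN1 k (leq_maxl _ _); rewrite -sE.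
have [G I] := HC _ (s0 k) (st k); set c1 := C (s k) in G I lu ur ur1 *.
have G1 : geod g c1 (s k) by apply: G; rewrite s0 lexx.
have lu' : chart_dom g l (c1 (s k)) by [].
set vk := (state g l c1 (s k)).2.
have vkW : `|vk| + 1 <= W.
  rewrite lerD2r; apply: le_sqrt_sqr => //.
  have [_ /(_ vk) [h _]] := HB _ ur1; apply: (le_trans h); rewrite ler_wpM2l ?(ltW B0)//.
  rewrite sqr_sqrtr; last by apply: speed2_ge0; apply: chart_img_chart; exact: chart_dom_center.
  have sk : 0 <= s k <= s k by rewrite s0 lexx.
  have e1 := gspeed2_const G sk; have e2 := gspeed2_chart G1 lu'; have e3 := gspeed2_init I.
  apply: (@le_trans _ _ (speed2 g l (state g l c1 (s k)))); first exact: lexx.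
  by rewrite -e2 e1 e3 lexx.
have [c2 [Hc2 c20 lc2 sc2]] := Hsh (chart g l (u k)) vk ur.
have e12 : c1 (s k) = c2 0 by rewrite c20 chartK.
have G2 (x : R) : `|x| < d / W -> geod g c2 x.
  move=> xd; apply: Hc2; apply: (@le_lt_trans _ _ (`|x| * W)); first by rewrite ler_wpM2l.
  by rewrite -ltr_pdivlMr.
have G20 : geod g c2 0 by apply: G2; rewrite normr0 divr_gt0.
have es : state g (c1 (s k)) c1 (s k) = state g (c1 (s k)) c2 0.
  by apply: (geod_state_eq2 G1 G20 e12 lu' (chart_dom_center g _)); rewrite sc2.
have [c Gc [ec nc]] := geod_glue (divr_gt0 d0 W0) (s0 k) G G2 e12 es.
exists (s k + d / W - t); first lra.
move=> s' ts' s'd; exists c; split.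
  by move=> x /andP[x0 xs]; apply: Gc => //; lra.
have n0 : \forall x \near (0 : R), c1 x = c x.
  have [e0|en] := eqVneq (s k) 0; first by rewrite -e0; apply: filterS nc => x.
  have sk0 : 0 < s k by rewrite lt_def en s0.
  by apply: filterS (near_lt sk0) => x xs; rewrite ec// ltW.
by case: I => I1 I2; split; [rewrite -(nbhs_singleton n0)|rewrite -(state_near_eq g o n0)].
Qed.

Lemma complete_geod (T : R) : 0 <= T -> exists c, [/\ forall t : R, 0 <= t <= T -> geod g c t,
  c 0 = o & state g o c 0 = (chart g o o, v)].
Proof.
move=> T0; suff [c [h1 [h2 h3]]] : exists c, until T c by exists c.
move: T T0; apply: real_induction => t t0 Hs.
have [e|tn] := eqVneq t 0; last by apply: geod_step => //; rewrite lt_def tn.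
have [r [d [r0 d0 Hsh]]] := short_geod_scaled o.
have [|c [Hc c0 oc sc]] := Hsh (chart g o o) v; first by rewrite subrr normr0.
have v1 : 0 < `|v| + 1 by rewrite ltr_wpDl.
exists (d / (`|v| + 1)); first by rewrite divr_gt0.
move=> s _; rewrite e add0r ltr_pdivlMr// => sd; exists c; split.
  move=> x /andP[x0 xs]; apply: Hc; rewrite ger0_norm//; apply: le_lt_trans sd.
  by rewrite ler_wpM2r// ltW.
by split => //; rewrite c0 chartK//; exact: chart_dom_center.
Qed.
End Extension.
End Completeness.

(** * The exponential map and Jacobi fields *)

Section Exponential.
Variables (R : realType) (n : nat) (M : ptopologicalType) (g : riemannian R n M).
Implicit Types (p q : M) (c : R -> M).
Local Notation V := 'rV[R]_n.

Lemma pair_scale_inj (k : R) (x y : V * V) : k != 0 -> (x.1, k *: x.2) = (y.1, k *: y.2) -> x = y.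
Proof.
case: x y => [x1 x2] [y1 y2] k0 /= [-> /(congr1 (fun z => k^-1 *: z))].
by rewrite !scalerA mulVf// !scale1r => ->.
Qed.

Lemma dist_lt_trans (W : normedModType R) (x y z : W) (r : R) : `|x - y| < r - `|y - z| -> `|x - z| < r.
Proof. by move=> h; apply: (le_lt_trans (ler_distD y _ _)); lra. Qed.

Lemma convex_dist (s s' t x e : R) : 0 <= x <= 1 -> `|s - t| < e -> `|s' - t| < e ->
  `|(s' - s) * x + s - t| < e.
Proof.
move=> /andP[x0 x1] h1 h2; rewrite (_ : _ - t = (1 - x) * (s - t) + x * (s' - t)); last by ring.
apply: (le_lt_trans (ler_normD _ _)); rewrite !normrM (ger0_norm x0) ger0_norm ?subr_ge0//.
by have [->|xn] := eqVneq x 0; [lra|have : 0 < x by rewrite lt_def xn]; nra.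
Qed.

Lemma norm_le_shift (x t : R) : `|x - t| < 1 / 2 -> `|t| <= 3 / 2 -> `|x| <= 2.
Proof. by move=> h1 h2; have := ler_normD (x - t) t; rewrite subrK; lra. Qed.

(** Uniqueness between two times in either order, which parametrizing the time segment affinely by
    [0, 1] reduces to [geod_unique]. *)
Lemma geod_unique_seg p c1 c2 (a b : R) : (forall s : R, 0 <= s <= 1 -> geod g c1 ((b - a) * s + a)) ->
  (forall s : R, 0 <= s <= 1 -> geod g c2 ((b - a) * s + a)) -> c1 a = c2 a -> chart_dom g p (c1 a) ->
  state g p c1 a = state g p c2 a ->
  c1 b = c2 b /\ forall q, chart_dom g q (c1 b) -> state g q c1 b = state g q c2 b.
Proof.
move=> G1 G2 e pt es.
have e0 : (b - a) * 0 + a = a by ring.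
have e1 : (b - a) * 1 + a = b by ring.
have z01 : 0 <= (0 : R) <= 1 by rewrite lexx ler01.
have o01 : 0 <= (1 : R) <= 1 by rewrite lexx ler01.
have Ga1 : geod g c1 a by rewrite -e0; apply: G1.
have Ga2 : geod g c2 a by rewrite -e0; apply: G2.
have Gb1 : geod g c1 b by rewrite -e1; apply: G1.
have Gb2 : geod g c2 b by rewrite -e1; apply: G2.
have [ba|ba] := eqVneq b a.
  by rewrite ba; split; [exact: e|move=> q qt; exact: (geod_state_eq Ga1 Ga2 e pt qt es)].
pose c1' s := c1 ((b - a) * s + a); pose c2' s := c2 ((b - a) * s + a).
have H1 (s : R) : 0 <= s <= 1 -> geod g c1' s by move=> /G1; exact: geod_affine.
have H2 (s : R) : 0 <= s <= 1 -> geod g c2' s by move=> /G2; exact: geod_affine.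
have c0 : c1' 0 = c2' 0 by rewrite /c1' /c2' e0.
have E0 : state g (c1' 0) c1' 0 = state g (c1' 0) c2' 0.
  have ea : c1' 0 = c1 a by rewrite /c1' e0.
  have ca : chart_dom g (c1 a) (c1 a) by exact: chart_dom_center.
  have ca2 : chart_dom g (c1 a) (c2 a) by rewrite -e.
  have d1 : chart_dom g (c1 a) (c1 ((b - a) * 0 + a)) by rewrite e0.
  have d2 : chart_dom g (c1 a) (c2 ((b - a) * 0 + a)) by rewrite e0.
  have L1 := state_affine (G1 0 z01) d1; have L2 := state_affine (G2 0 z01) d2.
  rewrite e0 in L1 L2; rewrite (geod_state_eq Ga1 Ga2 e pt ca es) in L1.
  rewrite ea; exact: (etrans L1 (esym L2)).
have [h1 h2] := geod_unique ler01 H1 H2 c0 E0 o01.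
have eb : c1 b = c2 b by move: h1; rewrite /c1' /c2' e1.
have cb : chart_dom g (c1' 1) (c1 b) by rewrite /c1' e1; exact: chart_dom_center.
split; [exact: eb|move=> q qt; apply: (geod_state_eq Gb1 Gb2 eb cb qt)].
have cb2 : chart_dom g (c1' 1) (c2 b) by rewrite -eb.
have d1 : chart_dom g (c1' 1) (c1 ((b - a) * 1 + a)) by rewrite e1.
have d2 : chart_dom g (c1' 1) (c2 ((b - a) * 1 + a)) by rewrite e1.
have L1 := state_affine (G1 1 o01) d1; have L2 := state_affine (G2 1 o01) d2.
rewrite e1 in L1 L2; have ne : b - a != 0 by rewrite subr_eq0.
exact: (pair_scale_inj ne (etrans (esym L1) (etrans h2 L2))).
Qed.

Lemma near_continuous_lt (T : topologicalType) (W : normedModType R) (f : T -> W) (t : T) (e : R) :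
  {for t, continuous f} -> 0 < e -> \forall s \near t, `|f s - f t| < e.
Proof. by move=> /cvgrPdist_lt cf e0; apply: filterS (cf e e0) => s; rewrite distrC. Qed.

Lemma C11_near_eq (W W' : normedModType R) (f f' : W -> W') (x : W) :
  (\forall y \near x, f y = f' y) -> C11 f x -> C11 f' x.
Proof. by move=> /near_normP [r r0 Hr]; apply: (C11_eq r0). Qed.

Lemma C11_id (x : V) : C11 (fun y : V => y) x.
Proof. by have [||h _] := @C11_bounded_linear R V V id x 1 => // w; rewrite mul1r. Qed.

Section Dependence.
(** Geodesics are demanded on [-2, 2] although the exponential map is read off at time 1, so that
    two-sided neighbourhoods of 0 and 1 are available for derivatives. *)
Variables (o : M) (geo : V -> R -> M).
Hypotheses (geo_geod : forall v (t : R), `|t| <= 2 -> geod g (geo v) t) (geo0 : forall v, geo v 0 = o)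
  (geo_state0 : forall v, state g o (geo v) 0 = (chart g o o, v)).

Lemma geo_gspeed2 v (t : R) : 0 <= t <= 2 -> gspeed2 g (geo v) t = bilin (metric g o (chart g o o)) v v.
Proof.
move=> t02; have G (s : R) : 0 <= s <= 2 -> geod g (geo v) s.
  by move=> /andP[s0 s2]; apply: geo_geod; rewrite ger0_norm.
by rewrite (gspeed2_const G t02) /gspeed2 geo0 geo_state0.
Qed.

Lemma geo_scale v (s t : R) : 0 <= s <= 1 -> 0 <= t <= 1 -> geo (s *: v) t = geo v (s * t).
Proof.
move=> /andP[s0 s1] t01.
have G1 (r : R) : 0 <= r <= 1 -> geod g (geo (s *: v)) r.
  by move=> /andP[r0 r1]; apply: geo_geod; rewrite ger0_norm; lra.
have G2 (r : R) : 0 <= r <= 1 -> geod g (geo v) (s * r + 0).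
  by move=> /andP[r0 r1]; apply: geo_geod; rewrite addr0 ger0_norm ?mulr_ge0//; nra.
have G2' (r : R) : 0 <= r <= 1 -> geod g (fun r => geo v (s * r + 0)) r by move=> /G2; exact: geod_affine.
have s00 : s * 0 + 0 = 0 by rewrite mulr0 addr0.
have c0 : geo (s *: v) 0 = geo v (s * 0 + 0) by rewrite s00 !geo0.
have z01 : 0 <= (0 : R) <= 1 by rewrite lexx ler01.
have oo := chart_dom_center g o.
have E : state g (geo (s *: v) 0) (geo (s *: v)) 0 = state g (geo (s *: v) 0) (fun r => geo v (s * r + 0)) 0.
  rewrite geo0 (state_affine (G2 0 z01)); last by rewrite s00 geo0.
  by rewrite s00 !geo_state0.
by have [-> _] := geod_unique ler01 G1 G2' c0 E t01; rewrite addr0.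
Qed.

Variable v0 : V.

(** Quantifying over all charts builds the change of chart into the property that is propagated in
    time. *)
Definition smooth_dep (s : R) := forall p, chart_dom g p (geo v0 s) ->
  (\forall v \near v0, chart_dom g p (geo v s)) /\ C11 (fun v => state g p (geo v) s) v0.

Lemma smooth_dep0 : smooth_dep 0.
Proof.
move=> p; rewrite geo0 => po; split; first by apply: filterE => v; rewrite geo0.
have oo := chart_dom_center g o.
have e : (fun v => state g p (geo v) 0) = tangent_map (trans g o p) \o (fun v => (chart g o o, v)).
  apply/funext => v /=; rewrite -geo_state0.
  have G : geod g (geo v) 0 by apply: geo_geod; rewrite normr0.
  by rewrite (state_trans (geod_chart (q := o) G _)) ?geo0.
rewrite e; have T := trans_dom_chart oo po.
have Ct : C11 (tangent_map (trans g o p)) (chart g o o, v0).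
  by apply: (C11_tangent_map (@trans_dom_open R n M g o p)) => //; exact: transition_smooth.
have Cp : C11 (fun v : V => (chart g o o, v)) v0 by apply: C11_pair; [exact: C11_cst|exact: C11_id].
by have [] := C11_comp Cp Ct.
Qed.

(** One flow box serves all times near t: for every v near [v0], the states at two such times s and
    s' are related by the same flow map for time s' - s, by uniqueness of geodesics. *)
Lemma dep_step p (t : R) : `|t| <= 3 / 2 -> chart_dom g p (geo v0 t) ->
  exists (d : R) (phi : R -> V * V -> V * V) (Z : R -> V * V -> V * V -> V * V), 0 < d /\
  forall s : R, `|s - t| < d -> smooth_dep s ->
    chart_dom g p (geo v0 s) /\ (forall w, Z 0 (state g p (geo v0) s) w = w) /\
    forall s' : R, `|s' - t| < d ->
    [/\ \forall v \near v0, chart_dom g p (geo v s') /\ state g p (geo v) s' = phi (s' - s) (state g p (geo v) s),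
       C11 (phi (s' - s)) (state g p (geo v0) s) &
       forall w, 'D_w (phi (s' - s)) (state g p (geo v0) s) = Z (s' - s) (state g p (geo v0) s) w /\
         is_derive (s' - s) 1 (fun r => Z r (state g p (geo v0) s) w)
           ('D_(Z (s' - s) (state g p (geo v0) s) w) (spray (metric g p)) (phi (s' - s) (state g p (geo v0) s)))].
Proof.
move=> t32 pt.
have Gt : geod g (geo v0) t by apply: geo_geod; lra.
have pa : chart_img g p (state g p (geo v0) t).1 by exact: chart_img_chart.
have [r [d [phi [Z [r0 d0 phi0 H]]]]] := flow_box pa ltr01.
have H1 := geod_chart Gt pt; have [_ Dst] := nbhs_singleton H1.
have /near_normP [d1 d10 Hd1] : \forall s \near t, chart_dom g p (geo v0 s) /\
    `|state g p (geo v0) s - state g p (geo v0) t| < r.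
  apply: filterI; first by apply: filterS H1 => s [].
  exact: (near_continuous_lt (is_derive_continuous Dst) r0).
pose d' := Num.min d1 (Num.min (d / 2) (1 / 2)).
have d'0 : 0 < d' by rewrite !lt_min d10 !divr_gt0.
exists d', phi, Z; split; [exact: d'0|move=> s sd Qs].
have [sd1 sd2 sd3] : [/\ `|s - t| < d1, `|s - t| < d / 2 & `|s - t| < 1 / 2].
  by move: sd; rewrite !lt_min => /and3P[].
have [ps sr] := Hd1 s sd1; split; first exact: ps.
split; first by move=> w; have [] := phi0 _ w sr.
move=> s' s'd.
have [s'd2 s'd3] : `|s' - t| < d / 2 /\ `|s' - t| < 1 / 2.
  by move: s'd; rewrite !lt_min => /and3P[].
have ss' : `|s' - s| < d by move: sd2 s'd2; rewrite !ltr_norml; lra.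
have [dom Cst] := Qs p ps.
split; last 2 first.
- by have [_ _ _ h _] := H _ _ sr ss'; exact: h.
- by have [_ _ _ _ h] := H _ _ sr ss'; exact: h.
have nr : \forall v \near v0, `|state g p (geo v) s - state g p (geo v0) t| < r.
  have e0 : 0 < r - `|state g p (geo v0) s - state g p (geo v0) t| by rewrite subr_gt0.
  have := near_continuous_lt (C11_continuous Cst) e0; apply: filterS => v; exact: dist_lt_trans.
apply: (filterS _ (filterI nr dom)) => v [vr pv].
have [phi0v _] := phi0 _ 0 vr.
pose c r' := chart_inv g p (phi r' (state g p (geo v) s)).1.
pose c2 x := c (1 * x + - s).
have c2G (x : R) : `|x - s| < d -> geod g c2 x.
  by move=> xs; apply: geod_affine; rewrite mul1r; have [h _ _ _ _] := H _ _ vr xs.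
have seg (x : R) : 0 <= x <= 1 -> `|(s' - s) * x| < d.
  move=> /andP[x0 x1]; rewrite normrM (ger0_norm x0); apply: le_lt_trans ss'.
  by rewrite ler_piMr.
have ez : 1 * s + - s = 0 by ring.
have z0 : `|0 : R| < d by rewrite normr0.
have Gc0 : geod g c (1 * s + - s) by rewrite ez; have [h _ _ _ _] := H _ _ vr z0.
have ec : geo v s = c2 s by rewrite /c2 ez /c phi0v /state /= chartK.
have st2 (x : R) : `|x - s| < d -> state g p c2 x = phi (x - s) (state g p (geo v) s).
  move=> xs; have [h1 [h2 _] h3 _ _] := H _ _ vr xs.
  rewrite /c2 state_affine; last 2 first.
  - by rewrite mul1r.
  - by rewrite mul1r; exact: chart_inv_dom.
  by rewrite mul1r scale1r -[RHS]h3; case: (state g p _ _).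
have [|||h1 h2] := @geod_unique_seg p (geo v) c2 s s' _ _ ec pv.
- move=> x x01; apply: geo_geod; have h := convex_dist x01 sd3 s'd3.
  exact: (norm_le_shift h t32).
- by move=> x x01; apply: c2G; rewrite addrK; exact: seg.
- by rewrite st2 ?subrr ?phi0v.
have p1 : chart_dom g p (geo v s').
  rewrite h1 /c2 mul1r; have [_ [h _] _ _ _] := H _ _ vr ss'; exact: chart_inv_dom.
by split => //; rewrite h2// st2.
Qed.

Lemma smooth_dep_step (t : R) : 0 <= t <= 1 -> exists2 d : R, 0 < d &
  forall s s' : R, `|s - t| < d -> `|s' - t| < d -> smooth_dep s -> smooth_dep s'.
Proof.
move=> t01; set p := geo v0 t; have pt : chart_dom g p (geo v0 t) by exact: chart_dom_center.
have t32 : `|t| <= 3 / 2 by move: t01 => /andP[? ?]; rewrite ger0_norm//; lra.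
have [d [phi [Z [d0 H]]]] := dep_step t32 pt.
exists (Num.min d (1 / 2)); first by rewrite lt_min d0 divr_gt0.
move=> s s'; rewrite !lt_min => /andP[sd _] /andP[s'd s'd2] Qs q qs'.
have [ps [_ /(_ s' s'd) [nr Cphi _]]] := H s sd Qs.
have [_ Cst] := Qs p ps.
have Cp : C11 (fun v => state g p (geo v) s') v0.
  have [C _] := C11_comp Cst Cphi; apply: (C11_near_eq _ C).
  by apply: filterS nr => v [_ ->].
have [ps' _] := nbhs_singleton nr.
have cx : {for v0, continuous (fun v => geo v s')}.
  have h : {for v0, continuous (chart_inv g p \o (fun v => (state g p (geo v) s').1))}.
    apply: continuous_comp; last by apply: chart_inv_cont; exact: chart_img_chart.
    by apply: continuous_comp; [exact: (C11_continuous Cp)|exact: cvg_fst].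
  apply: (cont_near_eq _ h); apply: filterS nr => v [pv _].
  by rewrite /= chartK.
have nq : \forall v \near v0, chart_dom g q (geo v s') by apply: cx; exact: chart_dom_nbhs.
split; first exact: nq.
have T := trans_dom_chart ps' qs'.
have Ct : C11 (tangent_map (trans g p q)) (state g p (geo v0) s').
  by apply: (C11_tangent_map (@trans_dom_open R n M g p q)) => //; exact: transition_smooth.
have [C _] := C11_comp Cp Ct; apply: (C11_near_eq _ C).
apply: (filterS _ (filterI nr nq)) => v [[pv _] qv].
have Gv : geod g (geo v) s'.
  by apply: geo_geod; move: t01 s'd2 => /andP[? ?]; rewrite ler_norml ltr_norml => /andP[? ?]; apply/andP; split; lra.
by rewrite /= (state_trans (geod_chart Gv pv) qv).
Qed.

Lemma smooth_dep_all (t : R) : 0 <= t <= 1 -> smooth_dep t.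
Proof.
move: t; apply: real_propagation_on; first exact: smooth_dep0.
move=> t t01; have [d d0 Hd] := smooth_dep_step t01.
by exists d; [exact: d0|move=> s s' sd s'd _ _; exact: (Hd s s' sd s'd)].
Qed.

Lemma smooth_dep_near (t : R) : 0 <= t <= 1 -> \forall s \near t, smooth_dep s.
Proof.
move=> t01; have [d d0 Hd] := smooth_dep_step t01.
apply/near_normP; exists d; first exact: d0.
move=> s sd; have tt : `|t - t| < d by rewrite subrr normr0.
exact: (Hd t s tt sd (smooth_dep_all t01)).
Qed.

(* The Jacobi field with J 0 = 0 and J' 0 = w, together with its derivative, read in the chart around p. *)
Definition jacobi p (w : V) (t : R) : V * V := 'D_w (fun v => state g p (geo v) t) v0.

(** By the chain rule through the flow box, the field at time s is the linearized flow for time s -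
    t applied to the field at t, and that solves the linearized equation. *)
Lemma is_derive_jacobi p (w : V) (t : R) : `|t| <= 3 / 2 -> smooth_dep t -> chart_dom g p (geo v0 t) ->
  is_derive t 1 (jacobi p w) ('D_(jacobi p w t) (spray (metric g p)) (state g p (geo v0) t)).
Proof.
move=> t01 Qt pt.
have [d [phi [Z [d0 H]]]] := dep_step t01 pt.
have tt : `|t - t| < d by rewrite subrr normr0.
have [_ [Z0 Ht]] := H t tt Qt.
have [_ Cst] := Qt p pt.
pose b := state g p (geo v0) t.
have e (s : R) : `|s - t| < d -> jacobi p w s = Z (s - t) b (jacobi p w t).
  move=> sd; have [nr Cphi HD] := Ht s sd.
  have [_ D] := C11_comp Cst Cphi.
  have [<- _] := HD (jacobi p w t); rewrite -D.
  by apply: near_eq_derive; apply: filterS nr => v [_ ->].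
have [nr _ HD] := Ht t tt.
have [_ Dz] := HD (jacobi p w t).
have De : is_derive t 1 (fun s => Z (1 * s + - t) b (jacobi p w t))
   (1 *: 'D_(Z (t - t) b (jacobi p w t)) (spray (metric g p)) (phi (t - t) b)).
  have Dz' : is_derive (1 * t + - t) 1 (fun r => Z r b (jacobi p w t))
      ('D_(Z (t - t) b (jacobi p w t)) (spray (metric g p)) (phi (t - t) b)) by rewrite mul1r.
  exact: (is_derive_affine Dz').
have [_ eb] := nbhs_singleton nr.
have De2 : is_derive t 1 (jacobi p w) (1 *: 'D_(Z (t - t) b (jacobi p w t)) (spray (metric g p)) (phi (t - t) b)).
  apply: (is_derive_near_eq _ De); apply/near_normP; exists d => // s sd.
  by rewrite mul1r; exact: (esym (e s sd)).
apply: (is_derive_ext _ _ De2) => //.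
by rewrite scale1r -eb subrr Z0.
Qed.

Lemma jacobi0 w : jacobi o w 0 = (0, w).
Proof.
have e : (fun v => state g o (geo v) 0) = (fun v => (chart g o o, v)) by apply/funext => v; exact: geo_state0.
rewrite /jacobi e.
have [_ ->] : is_derive v0 w (fun v : V => (chart g o o, v)) (0, w); last by [].
apply/is_derive_eps => ep ep0; exists 1 => // h _.
have -> : (chart g o o, v0 + h *: w) - (chart g o o, v0) - h *: (0, w) = 0 :> V * V.
  by apply: injective_projections => /=; lmod R.
by rewrite normr0 mulr_ge0// ltW.
Qed.

Lemma jacobi_fst p w (t : R) : smooth_dep t -> chart_dom g p (geo v0 t) ->
  C11 (fun v => chart g p (geo v t)) v0 /\ (jacobi p w t).1 = 'D_w (fun v => chart g p (geo v t)) v0.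
Proof.
move=> t01 pt; have [_ C] := t01 p pt.
have [||CL DL] := @C11_bounded_linear R (V * V)%type V fst (state g p (geo v0) t) 1.
- by move=> k x y.
- by move=> x; rewrite mul1r [X in _ <= X]prod_normE le_max lexx.
have [C2 D2] := C11_comp C CL; split; first exact: C2.
by rewrite (D2 w); have [_ ->] := DL (state g p (geo v0) t) (jacobi p w t).
Qed.

Lemma jacobi_trans p q w (t : R) : smooth_dep t -> chart_dom g p (geo v0 t) -> chart_dom g q (geo v0 t) ->
  (jacobi q w t).1 = 'D_((jacobi p w t).1) (trans g p q) (chart g p (geo v0 t)).
Proof.
move=> t01 pt qt; have [_ e2] := jacobi_fst w t01 qt; have [C e1] := jacobi_fst w t01 pt.
have Ct : C11 (trans g p q) (chart g p (geo v0 t)).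
  apply: (@smooth_on_C11 R n _ (trans_dom g p q)); [exact: trans_dom_open|exact: trans_dom_chart|exact: transition_smooth].
have [_ D] := C11_comp C Ct; have [np _] := t01 p pt.
have e3 := congr1 (fun z => 'D_z (trans g p q) (chart g p (geo v0 t))) e1.
have e4 : 'D_w (fun v => chart g q (geo v t)) v0 = 'D_w (trans g p q \o (fun v => chart g p (geo v t))) v0.
  by apply: near_eq_derive; apply: filterS np => v pv; exact: esym (transE q pv).
exact: (etrans e2 (etrans e4 (etrans (D w) (esym e3)))).
Qed.
End Dependence.
End Exponential.

(** * Rauch comparison *)

Section RauchOde.
Variable R : realType.

(* Optimizing over l, the differential inequality says (sqrt q)'' >= mu^2 sqrt q, without dividing
   by sqrt q, which vanishes at 0. *)
Lemma rauch_growth (q q1 q2 : R -> R) (mu k0 : R) : 0 <= mu ->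
  (forall t : R, 0 <= t <= 1 -> is_derive t 1 q (q1 t)) ->
  (forall t : R, 0 <= t <= 1 -> is_derive t 1 q1 (q2 t)) ->
  (forall t l : R, 0 <= t <= 1 -> 2 * l * q1 t - 2 * l ^+ 2 * q t + 2 * mu ^+ 2 * q t <= q2 t) ->
  (forall t : R, 0 <= t <= 1 -> 0 <= q t) -> q 0 = 0 -> q1 0 = 0 -> q2 0 = 2 * k0 ->
  k0 <= q 1 /\ (1 <= mu -> k0 * expR (2 * mu - 2) <= mu ^+ 2 * q 1).
Proof.
move=> mu0 D1 D2 Hq qpos q00 q10 q20.
have z01 : 0 <= (0 : R) <= 1 by rewrite lexx ler01.
have near0 (e : R) : 0 < e -> exists d : R, [/\ 0 < d, d <= 1 & forall s : R, 0 <= s -> s < d ->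
    `|q1 s - 2 * k0 * s| <= e * s /\ `|q s - k0 * s ^+ 2| <= e * s * s].
  move=> e0; have /is_derive_eps /(_ e e0) [d d0 Hd] := D2 0 z01.
  have H1 (s : R) : 0 <= s -> s < d -> `|q1 s - 2 * k0 * s| <= e * s.
    move=> s0 sd; have := Hd s; rewrite ger0_norm// => /(_ sd).
    by rewrite add0r q10 subr0 q20 /GRing.scale /= mulr1 (mulrC s).
  exists (Num.min d 1); split; [by rewrite lt_min d0 ltr01|by rewrite ge_min lexx orbT|].
  move=> s s0; rewrite lt_min => /andP[sd s1]; split; first exact: H1.
  have := @mean_value R R (fun r => q r - k0 * r ^+ 2) (fun r => q1 r - 2 * k0 * r) 0 s (e * s) s0.
  rewrite q00 expr0n /= mulr0 subrr !subr0; apply.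
    move=> t /andP[t0 ts]; have t01 : 0 <= t <= 1 by apply/andP; split; lra.
    apply: (is_derive_ext _ _ (is_deriveB (D1 t t01) (is_deriveZ k0 (is_deriveM (is_derive_id t 1) (is_derive_id t 1))))).
      by move=> r; rewrite expr2.
    by rewrite /GRing.scale /=; ring.
  move=> t /andP[t0 ts]; apply: (le_trans (H1 t t0 _)); first exact: le_lt_trans sd.
  by rewrite ler_wpM2l// ltW.
have Dinv (t : R) : 0 < t -> is_derive t 1 (fun s : R => s^-1) (- (t^-1 * t^-1)).
  move=> t0; have t00 : t != 0 by rewrite gt_eqF.
  apply: (is_derive_ext _ _ (is_deriveV t00 (is_derive_id t 1))) => //.
  by rewrite /GRing.scale /= mulr1 -exprVn expr2.
(* The inequality with l = 1 / r. As this monotone quantity tends to 0 at 0, it is nonnegative,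
   which in turn makes q / r^2 nondecreasing, with limit [k0] at 0. *)
have mono1 (s t : R) : 0 < s -> s <= t -> t <= 1 -> q1 s - 2 * (q s * s^-1) <= q1 t - 2 * (q t * t^-1).
  move=> s0 st t1.
  apply: (@derive_ge0_le R (fun r => q1 r - 2 * (q r * r^-1))
    (fun r => q2 r - 2 * (q1 r * r^-1 - q r * (r^-1 * r^-1))) _ _ st).
    move=> r /andP[sr rt]; have r0 : 0 < r by exact: lt_le_trans sr.
    have r01 : 0 <= r <= 1 by apply/andP; split; lra.
    apply: (is_derive_ext _ _ (is_deriveB (D2 r r01) (is_deriveZ 2 (is_deriveM (D1 r r01) (Dinv r r0))))).
      by [].
    by rewrite /GRing.scale /=; ring.
  move=> r /andP[sr rt]; have r0 : 0 < r by exact: lt_le_trans sr.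
  have r01 : 0 <= r <= 1 by apply/andP; split; lra.
  have := Hq r r^-1 r01; have := qpos r r01 => Q0 h.
  have m0 : 0 <= 2 * mu ^+ 2 * q r by rewrite !mulr_ge0.
  have -> : q2 r - 2 * (q1 r * r^-1 - q r * (r^-1 * r^-1)) =
    q2 r - (2 * r^-1 * q1 r - 2 * r^-1 ^+ 2 * q r + 2 * mu ^+ 2 * q r) + 2 * mu ^+ 2 * q r by ring.
  by rewrite addr_ge0// subr_ge0.
have ineq1 (t : R) : 0 < t -> t <= 1 -> 2 * q t <= q1 t * t.
  move=> t0 t1; suff : 0 <= q1 t - 2 * (q t * t^-1).
    move=> /(mulr_ge0 (ltW t0)).
    rewrite (_ : t * _ = q1 t * t - 2 * q t); last by field; rewrite gt_eqF.
    by rewrite subr_ge0.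
  apply/ler_addgt0Pr => _/posnumP[e]; rewrite -lerBlDr sub0r.
  have e3 : 0 < e%:num / 3 by rewrite divr_gt0.
  have [d [d0 d1 Hd]] := near0 _ e3.
  pose s := Num.min (d / 2) t; have s0 : 0 < s by rewrite lt_min t0 divr_gt0.
  have sd : s < d by rewrite (@le_lt_trans _ _ (d / 2)) ?ge_min ?lexx//; lra.
  have st : s <= t by rewrite ge_min lexx orbT.
  apply: le_trans (mono1 s t s0 st t1).
  have [h1 h2] := Hd s (ltW s0) sd.
  have h3 : q s * s^-1 <= (k0 + e%:num / 3) * s.
    rewrite ler_pdivrMr//; move: h2; rewrite ler_norml => /andP[_]; nra.
  have s1 : s <= 1 by lra.
  by move: h1; rewrite ler_norml => /andP[h1 _]; have := gt0 e; nra.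
have mono2 (s t : R) : 0 < s -> s <= t -> t <= 1 -> q s * (s^-1 * s^-1) <= q t * (t^-1 * t^-1).
  move=> s0 st t1.
  apply: (@derive_ge0_le R (fun r => q r * (r^-1 * r^-1))
    (fun r => (q1 r * r - 2 * q r) * (r^-1 * r^-1 * r^-1)) _ _ st).
    move=> r /andP[sr rt]; have r0 : 0 < r by exact: lt_le_trans sr.
    have r01 : 0 <= r <= 1 by apply/andP; split; lra.
    apply: (is_derive_ext _ _ (is_deriveM (D1 r r01) (is_deriveM (Dinv r r0) (Dinv r r0)))).
      by [].
    rewrite [LHS](_ : _ = q r * (r^-1 * - (r^-1 / r) + r^-1 * - (r^-1 / r)) + (r^-1 * r^-1) * q1 r); last by [].
    by field; rewrite gt_eqF.
  move=> r /andP[sr rt]; have r0 : 0 < r by exact: lt_le_trans sr.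
  by rewrite mulr_ge0 ?mulr_ge0 ?invr_ge0 ?(ltW r0)// subr_ge0 ineq1// (le_trans rt).
have ineq2 (t : R) : 0 < t -> t <= 1 -> k0 * t ^+ 2 <= q t.
  move=> t0 t1; suff : k0 <= q t * (t^-1 * t^-1).
    move=> h; rewrite -ler_pdivlMr ?exprn_gt0//.
    by rewrite (_ : _ / _ = q t * (t^-1 * t^-1))//; field; rewrite gt_eqF.
  apply/ler_addgt0Pr => _/posnumP[e].
  have [d [d0 d1 Hd]] := near0 _ (gt0 e).
  pose s := Num.min (d / 2) t; have s0 : 0 < s by rewrite lt_min t0 divr_gt0.
  have sd : s < d by rewrite (@le_lt_trans _ _ (d / 2)) ?ge_min ?lexx//; lra.
  have st : s <= t by rewrite ge_min lexx orbT.
  rewrite -lerBlDr; apply: le_trans (mono2 s t s0 st t1).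
  have [_ h2] := Hd s (ltW s0) sd.
  rewrite (_ : q s * _ = q s / (s * s)); last by field; rewrite gt_eqF.
  rewrite ler_pdivlMr ?mulr_gt0//; move: h2; rewrite ler_norml => /andP[h2 _]; nra.
have k01 : k0 <= q 1 by have := ineq2 1 ltr01 (lexx 1); rewrite expr1n mulr1.
split => // mu1.
have mug : 0 < mu by lra.
(* Exponential growth is started at time 1 / mu, where the first part already gives mu^2 q >= k0 and
   q1 >= 2 mu q. *)
pose s := mu^-1; have s0 : 0 < s by rewrite invr_gt0.
have s1 : s <= 1 by rewrite invf_le1.
have ms : mu * s = 1 by rewrite mulfV// gt_eqF.
have Dexp (k t : R) : is_derive t 1 (fun r : R => expR (k * r)) (k * expR (k * t)).
  apply: (is_derive_ext _ _ (@is_derive1_comp R expR (fun r => k * r) t _ _ (is_derive_expR (k * t)) (is_deriveZ k (is_derive_id t 1)))) => //.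
  by rewrite /GRing.scale /=; ring.
(* The inequality with l = mu: the terms in q cancel and leave q2 >= 2 mu q1. *)
have grow (t : R) : s <= t -> t <= 1 -> q1 s * expR (- (2 * mu) * s) <= q1 t * expR (- (2 * mu) * t).
  move=> st t1.
  apply: (@derive_ge0_le R (fun r => q1 r * expR (- (2 * mu) * r))
    (fun r => (q2 r - 2 * mu * q1 r) * expR (- (2 * mu) * r)) _ _ st).
    move=> r /andP[sr rt]; have r01 : 0 <= r <= 1 by apply/andP; split; lra.
    apply: (is_derive_ext _ _ (is_deriveM (D2 r r01) (Dexp (- (2 * mu)) r))); first by [].
    by rewrite /GRing.scale /=; ring.
  move=> r /andP[sr rt]; have r01 : 0 <= r <= 1 by apply/andP; split; lra.
  by rewrite mulr_ge0 ?expR_ge0// subr_ge0; have := Hq r mu r01; lra.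
pose A := q1 s * expR (- (2 * mu) * s).
have AE (t : R) : s <= t -> t <= 1 -> A * expR (2 * mu * t) <= q1 t.
  move=> st t1; have := grow t st t1; rewrite -/A => h.
  have := ler_wpM2r (expR_ge0 (2 * mu * t)) h.
  by rewrite -[X in _ <= X -> _]mulrA -expRD mulNr addNr expR0 mulr1.
have qs0 : 0 <= q s by apply: qpos; rewrite ltW.
have q1s : 2 * mu * q s <= q1 s.
  have := ineq1 s s0 s1; have := qs0; move=> ? h.
  have := ler_wpM2l mu0 h; rewrite (_ : mu * (q1 s * s) = q1 s * (mu * s)); last by ring.
  by rewrite ms; lra.
have fin : A / (2 * mu) * expR (2 * mu * s) - q s >= A / (2 * mu) * expR (2 * mu * 1) - q 1.
  rewrite -subr_ge0 (_ : _ - _ = (q 1 - A / (2 * mu) * expR (2 * mu * 1)) - (q s - A / (2 * mu) * expR (2 * mu * s))); last by ring.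
  rewrite subr_ge0.
  apply: (@derive_ge0_le R (fun r => q r - A / (2 * mu) * expR (2 * mu * r))
    (fun r => q1 r - A * expR (2 * mu * r)) _ _ s1).
    move=> r /andP[sr rt]; have r01 : 0 <= r <= 1 by apply/andP; split; lra.
    apply: (is_derive_ext _ _ (is_deriveB (D1 r r01) (is_deriveZ (A / (2 * mu)) (Dexp (2 * mu) r)))); first by [].
    by rewrite /GRing.scale /=; field; rewrite gt_eqF.
  by move=> r /andP[sr rt]; rewrite subr_ge0; exact: AE.
pose E := expR (2 * mu - 2); have E1 : 1 <= E by rewrite -expR0 ler_expR; lra.
have e1 : A * expR (2 * mu * s) = q1 s.
  by rewrite /A -mulrA -expRD mulNr addNr expR0 mulr1.
have e2 : A * expR (2 * mu * 1) = q1 s * E.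
  rewrite /A -mulrA -expRD; congr (_ * expR _).
  by rewrite mulNr -[2 * mu * s]mulrA ms; ring.
have fin2 : q1 s * (E - 1) <= 2 * mu * (q 1 - q s).
  have := fin; rewrite (_ : A / (2 * mu) * expR (2 * mu * s) = (A * expR (2 * mu * s)) / (2 * mu)); last by ring.
  rewrite (_ : A / (2 * mu) * expR (2 * mu * 1) = (A * expR (2 * mu * 1)) / (2 * mu)); last by ring.
  rewrite e1 e2 => h.
  have : (q1 s * E / (2 * mu) - q1 s / (2 * mu)) <= q 1 - q s by lra.
  rewrite -mulrBl ler_pdivrMr ?mulr_gt0//; lra.
have fin3 : q s * E <= q 1.
  have h1 : 2 * mu * q s * (E - 1) <= 2 * mu * (q 1 - q s).
    by apply: le_trans fin2; rewrite ler_wpM2r// subr_ge0.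
  have : q s * (E - 1) <= q 1 - q s.
    rewrite -(@ler_pM2l _ (2 * mu)) ?mulr_gt0//; lra.
  lra.
have fin4 : k0 <= mu ^+ 2 * q s.
  have := ineq2 s s0 s1 => h; have := ler_wpM2l (sqr_ge0 mu) h.
  rewrite (_ : mu ^+ 2 * (k0 * s ^+ 2) = k0 * (mu * s) ^+ 2); last by ring.
  by rewrite ms expr1n mulr1.
have E0 : 0 <= E by lra.
apply: (le_trans (ler_wpM2r E0 fin4)).
by rewrite -mulrA ler_wpM2l// sqr_ge0.
Qed.
End RauchOde.

Section JacobiFields.
Variables (R : realType) (n : nat) (M : ptopologicalType) (g : riemannian R n M).
Implicit Types (p q : M).
Local Notation V := 'rV[R]_n.

Lemma curv_cov p (x u v : V) : chart_img g p x -> curv (metric g p) x u v =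
  dchr (metric g p) x u v v - dchr (metric g p) x v u v + chr (metric g p) x u (chr (metric g p) x v v)
  - chr (metric g p) x v (chr (metric g p) x u v).
Proof.
move=> px; apply: (curv_chr (@chart_img_open R n M g p)) => //.
- by move=> ? ?; exact: metric_smooth.
- by move=> y; exact: Defs.metric_sym.
- by move=> y; exact: metric_inv_pos.
Qed.

Lemma derive_chart_spray p (s z : V * V) : chart_img g p s.1 -> 'D_z (spray (metric g p)) s =
  (z.2, - (dchr (metric g p) s.1 z.1 s.2 s.2 + 2 *: chr (metric g p) s.1 s.2 z.2)).
Proof.
move=> px; apply: (derive_spray (@chart_img_open R n M g p)) => //.
- by move=> ? ?; exact: metric_smooth.
- by move=> y; exact: Defs.metric_sym.
- by move=> y; exact: metric_inv_pos.
Qed.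

Lemma is_derive_chart_chr p (c X Y : R -> V) (t : R) (c' X' Y' : V) : chart_img g p (c t) ->
  is_derive t 1 c c' -> is_derive t 1 X X' -> is_derive t 1 Y Y' ->
  is_derive t 1 (fun s => chr (metric g p) (c s) (X s) (Y s))
  (dchr (metric g p) (c t) c' (X t) (Y t) + chr (metric g p) (c t) X' (Y t) + chr (metric g p) (c t) (X t) Y').
Proof.
move=> px; apply: (is_derive_chr (@chart_img_open R n M g p)) => //.
- by move=> ? ?; exact: metric_smooth.
- by move=> y; exact: Defs.metric_sym.
- by move=> y; exact: metric_inv_pos.
Qed.

Lemma chart_chrC p (x u v : V) : chart_img g p x -> chr (metric g p) x u v = chr (metric g p) x v u.
Proof.
move=> px; apply: (chr_sym (@chart_img_open R n M g p)) => //.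
by move=> y; exact: Defs.metric_sym.
Qed.

Lemma chart_dchrC p (x w u v : V) : chart_img g p x -> dchr (metric g p) x w u v = dchr (metric g p) x w v u.
Proof.
move=> px; apply: (dchr_sym (@chart_img_open R n M g p)) => //.
by move=> y; exact: Defs.metric_sym.
Qed.

Lemma chrNl (G : V -> 'M[R]_n) (y u v : V) : chr G y (- u) v = - chr G y u v.
Proof. by rewrite -scaleN1r -[v in LHS]scale1r chr_scale mulr1 scaleN1r. Qed.
Lemma chrDr (G : V -> 'M[R]_n) (y u v w : V) : chr G y u (v + w) = chr G y u v + chr G y u w.
Proof. by have := chr_linearr G y u 1 v w; rewrite !scale1r. Qed.
Lemma chr0 (G : V -> 'M[R]_n) (y u : V) : chr G y u 0 = 0.
Proof. by rewrite -(scale0r 0) -[u]scale1r chr_scale mulr0 !scale0r. Qed.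

(** Cleared of its denominator, the curvature bound also covers linearly dependent pairs, for which
    both sides vanish. This occurs for Jacobi fields tangent to the geodesic. *)
Lemma sectional_bound (c : R) p (u v : V) : sectional_curvature_le g (- c) ->
  bilin (metric g p (chart g p p)) (curv (metric g p) (chart g p p) u v) u <=
  - c * (bilin (metric g p (chart g p p)) u u * bilin (metric g p (chart g p p)) v v
         - bilin (metric g p (chart g p p)) u v ^+ 2).
Proof.
move=> Hc; set x := chart g p p; have px : chart_img g p x by apply: chart_img_chart; exact: chart_dom_center.
have sx := Defs.metric_sym px; have posx := metric_inv_pos px.
have [->|v0] := eqVneq v 0.
  have -> : curv (metric g p) x u 0 = 0.
    apply/rowP => l; rewrite !mxE big1// => i _; rewrite big1// => j _; rewrite big1// => k _.
    by rewrite !mxE mulr0.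
  by rewrite !bilinE_ mulr0 expr0n subrr mulr0.
have [[k ->]|ind] := pselect (exists k, u = k *: v).
  rewrite (curv_scale _ _ _ px) !bilinE_ (_ : k * (k * _) * _ - _ = 0) ?mulr0//; ring.
have D0 : 0 < bilin (metric g p x) u u * bilin (metric g p x) v v - bilin (metric g p x) u v ^+ 2.
  rewrite lt_def subr_ge0 bilin_cauchy_schwarz// andbT; apply/eqP => e0; apply: ind.
  have bv := posx v v0.
  exists (bilin (metric g p x) u v / bilin (metric g p x) v v).
  apply/eqP; rewrite -subr_eq0; apply/negPn/negP => /posx; rewrite !bilinE_ (bilinC v u sx) => h.
  have : 0 < (bilin (metric g p x) u u * bilin (metric g p x) v v - bilin (metric g p x) u v ^+ 2) / bilin (metric g p x) v v.
    move: h; congr (0 < _); field; by rewrite gt_eqF.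
  by rewrite e0 mul0r ltxx.
have := Hc p u v; rewrite /sectional_curvature sectional_curv -/x => /(_ _).
rewrite ler_pdivrMr//; apply.
apply/row_freeP; apply/row_freeP; apply: inj_row_free => z.
rewrite -[z]hsubmxK mul_row_col => hz.
have [l1 e1] : exists l1, lsubmx z = l1%:M by exists (lsubmx z 0 0); rewrite [LHS]mx11_scalar.
have [l2 e2] : exists l2, rsubmx z = l2%:M by exists (rsubmx z 0 0); rewrite [LHS]mx11_scalar.
move: hz; rewrite e1 e2 !mul_scalar_mx => hz.
have l10 : l1 = 0.
  apply/eqP/negPn/negP => n0; apply: ind; exists (- (l1^-1 * l2)).
  have : l1^-1 *: (l1 *: u + l2 *: v) = 0 by rewrite hz scaler0.
  rewrite scalerDr !scalerA mulVf// scale1r => /eqP; rewrite addr_eq0 => /eqP ->.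
  by rewrite scaleNr.
move: hz; rewrite l10 scale0r add0r => /eqP; rewrite scaler_eq0 (negPf v0) orbF => /eqP ->.
by rewrite !raddf0 row_mx0.
Qed.

(** The left-hand side is the second covariant derivative of J along a geodesic with velocity [xd],
    once J'' and x'' are replaced by their equations. So this is the invariant Jacobi equation. *)
Lemma jacobi_algebra p (x xd J Jd : V) : chart_img g p x ->
  - (dchr (metric g p) x J xd xd + 2 *: chr (metric g p) x xd Jd)
  + (dchr (metric g p) x xd xd J + chr (metric g p) x (- chr (metric g p) x xd xd) J + chr (metric g p) x xd Jd)
  + chr (metric g p) x xd (Jd + chr (metric g p) x xd J) = - curv (metric g p) x J xd.
Proof.
move=> px; rewrite (curv_cov _ _ px) chrNl chrDr (chart_chrC J (chr _ _ _ _) px) (chart_chrC J xd px).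
by rewrite (chart_dchrC xd J xd px); lmod R.
Qed.

Lemma bilin_congr (G : V -> 'M[R]_n) (y y' u u' v v' : V) : y = y' -> u = u' -> v = v' ->
  bilin (G y) u v = bilin (G y') u' v'.
Proof. by move=> -> -> ->. Qed.

(** The squared length of rho2 (d - l u) - beta (1 - l t) xd is nonnegative. This vector is rho2
    times the part of d - l u normal to [xd]; the curvature bound supplies the remaining term. *)
Lemma rauch_algebra (G : 'M[R]_n) (u d xd : V) (K c rho2 beta t l : R) : G^T = G ->
  (forall u, u != 0 -> 0 < bilin G u u) -> bilin G u xd = t * beta -> bilin G xd xd = rho2 ->
  bilin G d xd = beta -> 0 < rho2 -> K <= - c * (bilin G u u * bilin G xd xd - bilin G u xd ^+ 2) ->
  2 * l * (rho2 * (2 * bilin G u d) - beta ^+ 2 * (2 * t)) - 2 * l ^+ 2 * (rho2 * bilin G u u - beta ^+ 2 * (t * t))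
  + 2 * (c * rho2) * (rho2 * bilin G u u - beta ^+ 2 * (t * t)) <= rho2 * (2 * (bilin G d d - K)) - beta ^+ 2 * 2.
Proof.
move=> sG pG e1 e2 e3 r0; rewrite e1 e2 => hK.
have := bilin_ge0 (rho2 *: (d - l *: u) - (beta * (1 - l * t)) *: xd) pG.
rewrite !bilinE_ (bilinC d u sG) (bilinC xd d sG) (bilinC xd u sG) e1 e2 e3.
move: (bilin G u u) (bilin G u d) (bilin G d d) hK => uu ud dd hK bz.
have h : 0 <= rho2 * (dd - 2 * l * ud + l ^+ 2 * uu) - beta ^+ 2 * (1 - l * t) ^+ 2.
  rewrite -(pmulr_rge0 _ r0); apply: (le_trans bz); rewrite le_eqVlt; apply/orP; left; apply/eqP; ring.
have := ler_wpM2l (ltW r0) hK; lra.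
Qed.

Section Fields.
Variables (o : M) (geo : V -> R -> M).
Hypotheses (geo_geod : forall v (t : R), `|t| <= 2 -> geod g (geo v) t) (geo0 : forall v, geo v 0 = o)
  (geo_state0 : forall v, state g o (geo v) 0 = (chart g o o, v)).
Variables (v0 w : V).
Local Notation jac := (jacobi g geo v0).
Local Notation met p t := (metric g p (state g p (geo v0) t).1).

(** The covariant derivative of the Jacobi field along the geodesic, read in the chart. *)
Definition cov_jacobi p (t : R) : V :=
  (jac p w t).2 + chr (metric g p) (state g p (geo v0) t).1 (state g p (geo v0) t).2 (jac p w t).1.

Lemma jacobi_derivatives p (t : R) : `|t| <= 3 / 2 -> smooth_dep g geo v0 t -> chart_dom g p (geo v0 t) ->
  [/\ is_derive t 1 (fun s => bilin (met p s) (jac p w s).1 (jac p w s).1)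
        (2 * bilin (met p t) (jac p w t).1 (cov_jacobi p t)),
      is_derive t 1 (fun s => 2 * bilin (met p s) (jac p w s).1 (cov_jacobi p s))
        (2 * (bilin (met p t) (cov_jacobi p t) (cov_jacobi p t)
         - bilin (met p t) (curv (metric g p) (state g p (geo v0) t).1 (jac p w t).1 (state g p (geo v0) t).2) (jac p w t).1)) &
      is_derive t 1 (fun s => bilin (met p s) (jac p w s).1 (state g p (geo v0) s).2)
        (bilin (met p t) (cov_jacobi p t) (state g p (geo v0) t).2)].
Proof.
move=> t32 Qt pt; have Gt : geod g (geo v0) t by apply: geo_geod; lra.
have [_ /is_derive_pairE [Dx Dv]] := nbhs_singleton (geod_chart Gt pt).
have px : chart_img g p (state g p (geo v0) t).1 by exact: chart_img_chart.
have /is_derive_pairE [DJ DJ'] := is_derive_jacobi geo_geod w t32 Qt pt.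
have es := derive_chart_spray (jac p w t) px.
rewrite es in DJ DJ'.
have sx := Defs.metric_sym px.
set x := (state g p (geo v0) t).1 in px sx Dx Dv DJ DJ' *; set xd := (state g p (geo v0) t).2 in Dx Dv DJ DJ' *.
have Dchr := is_derive_chart_chr px Dx Dv DJ.
have DD := is_deriveD DJ' Dchr.
split.
- apply: (is_derive_ext _ _ (is_derive_metric px Dx DJ DJ)); first by [].
  by rewrite -/x [X in X + _]bilinC//; rewrite /cov_jacobi -/x -/xd /=; ring.
- apply: (is_derive_ext _ _ (is_deriveZ 2 (is_derive_metric px Dx DJ DD))); first by [].
  rewrite /GRing.scale /=; congr (_ * _); rewrite /cov_jacobi -/x -/xd /=; congr (_ + _).
  rewrite (bilinC (curv _ _ _ _) _ sx) -bilinNr; congr bilin.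
  exact: jacobi_algebra.
- apply: (is_derive_ext _ _ (is_derive_metric px Dx DJ Dv)); first by [].
  by rewrite /cov_jacobi /spray -/x -/xd /= addNr bilin0r addr0.
Qed.

Lemma chr0l (G : V -> 'M[R]_n) (y u : V) : chr G y 0 u = 0.
Proof. by rewrite -(scale0r 0) -[u]scale1r chr_scale mul0r !scale0r. Qed.

Local Notation G0 := (metric g o (chart g o o)).

Lemma near_geo_dom p (t : R) : 0 <= t <= 1 -> chart_dom g p (geo v0 t) ->
  \forall s \near t, [/\ chart_dom g p (geo v0 s), smooth_dep g geo v0 s & `|s| <= 3 / 2].
Proof.
move=> t01 pt; have Gt : geod g (geo v0) t.
  by apply: geo_geod; move: t01 => /andP[? ?]; rewrite ger0_norm//; lra.
have n1 : \forall s \near t, chart_dom g p (geo v0 s) by apply: (geod_continuous Gt); exact: chart_dom_nbhs.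
have n2 := smooth_dep_near geo_geod geo0 geo_state0 v0 t01.
have n3 : \forall s \near t, `|s| < 3 / 2 by apply: near_norm_lt; move: t01 => /andP[? ?]; rewrite ger0_norm//; lra.
apply: (filterS _ (filterI (filterI n1 n2) n3)) => s [[h1 h2] h3].
by split; [exact: h1|exact: h2|exact: ltW].
Qed.

(** The squared speed of [geo v] is the squared length of v at all times; differentiating this in v
    along w gives the claim. It is the infinitesimal form of the Gauss lemma. *)
Lemma cov_jacobi_speed p (t : R) : 0 <= t <= 1 -> chart_dom g p (geo v0 t) ->
  bilin (met p t) (cov_jacobi p t) (state g p (geo v0) t).2 = bilin G0 v0 w.
Proof.
move=> t01 pt; have oo := chart_dom_center g o; have io := chart_img_chart oo.
pose l (r : R) : V := v0 + r *: w.
have l0 : l 0 = v0 by rewrite /l scale0r addr0.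
have Dl : is_derive (0 : R) 1 l w by exact: is_derive_line.
have [dom C] := smooth_dep_all geo_geod geo0 geo_state0 t01 pt.
have C' : C11 (fun v => state g p (geo v) t) (l 0) by rewrite l0.
have /is_derive_pairE [D1 D2] := C11_comp_curve C' Dl.
rewrite l0 in D1 D2.
have px : chart_img g p ((fst \o ((fun v => state g p (geo v) t) \o l)) 0).
  by rewrite /= l0; exact: chart_img_chart.
have Da := is_derive_metric px D1 D2 D2.
have px0 : chart_img g p (state g p (geo v0) t).1 by exact: chart_img_chart.
have Do : is_derive (0 : R) 1 (fun r => bilin G0 (l r) (l r)) (2 * bilin G0 v0 w).
  have io' : chart_img g o ((fun _ : R => chart g o o) 0) by exact: io.
  apply: (is_derive_ext _ _ (is_derive_metric io' (is_derive_cst_fun (chart g o o) 0) Dl Dl)); first by [].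
  by rewrite /= l0 !chr0l !addr0 (bilinC w v0 (Defs.metric_sym io)); ring.
have cl : {for 0, continuous l} by exact: (is_derive_continuous Dl).
have dom' : nbhs (l 0) [set v | chart_dom g p (geo v t)] by rewrite l0; exact: dom.
have nl : \forall r \near (0 : R), chart_dom g p (geo (l r) t) by exact: (cl _ dom').
have t2 : `|t| <= 2 by move: t01 => /andP[? ?]; rewrite ger0_norm//; lra.
have t02 : 0 <= t <= 2 by move: t01 => /andP[? ?]; apply/andP; split; lra.
have Db : is_derive (0 : R) 1 (fun r => bilin G0 (l r) (l r))
  (bilin (met p t) (cov_jacobi p t) (state g p (geo v0) t).2 + bilin (met p t) (state g p (geo v0) t).2 (cov_jacobi p t)).
  apply: (is_derive_near_eq _ (is_derive_ext _ _ Da)).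
  - by apply: filterS nl => r pr; rewrite -(geo_gspeed2 geo_geod geo0 geo_state0 (l r) t02) (gspeed2_chart (geo_geod (l r) t2) pr); reflexivity.
  - by [].
  - by rewrite /= l0 /cov_jacobi (chart_chrC (state g p (geo v0) t).2 _ px0).
have := is_derive_unique Do Db; rewrite (bilinC (state g p (geo v0) t).2 _ (Defs.metric_sym px0)); lra.
Qed.

Lemma jacobi_chart_indep p q (t : R) : smooth_dep g geo v0 t -> `|t| <= 3 / 2 ->
  chart_dom g p (geo v0 t) -> chart_dom g q (geo v0 t) ->
  bilin (met p t) (jac p w t).1 (jac p w t).1 = bilin (met q t) (jac q w t).1 (jac q w t).1 /\
  bilin (met p t) (jac p w t).1 (state g p (geo v0) t).2 = bilin (met q t) (jac q w t).1 (state g q (geo v0) t).2.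
Proof.
move=> Q t32 pt qt; have t2 : `|t| <= 2 by lra.
have H := geod_chart (geo_geod v0 t2) pt.
have T := trans_dom_chart pt qt; have es := state_trans H qt.
have e1 : (state g q (geo v0) t).1 = trans g p q (chart g p (geo v0 t)) by rewrite transE.
have e2 : (state g q (geo v0) t).2 = 'D_((state g p (geo v0) t).2) (trans g p q) (chart g p (geo v0 t)) by rewrite es.
have ej := jacobi_trans w Q pt qt.
have b1 := bilin_trans (jac p w t).1 (jac p w t).1 T.
have b2 := bilin_trans (jac p w t).1 (state g p (geo v0) t).2 T.
split; first exact: (etrans b1 (bilin_congr (metric g q) (esym e1) (esym ej) (esym ej))).
exact: (etrans b2 (bilin_congr (metric g q) (esym e1) (esym ej) (esym e2))).
Qed.

(** The function q below is rho2 times the squared normal part of the Jacobi field: the pairing of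
    the field with the velocity is t beta. It satisfies the hypotheses of [rauch_growth] with mu^2 =
    c rho2. *)
Theorem rauch (c : R) p : 0 <= c -> sectional_curvature_le g (- c) -> 0 < bilin G0 v0 v0 ->
  chart_dom g p (geo v0 1) ->
  let F := bilin (met p 1) (jac p w 1).1 (jac p w 1).1 in
  let rho2 := bilin G0 v0 v0 in let k0 := bilin G0 w w * rho2 - bilin G0 v0 w ^+ 2 in
  k0 <= F * rho2 - bilin G0 v0 w ^+ 2 /\
  (1 <= Num.sqrt (c * rho2) -> k0 * expR (2 * Num.sqrt (c * rho2) - 2) <= c * rho2 * (F * rho2 - bilin G0 v0 w ^+ 2)).
Proof.
move=> c0 Hc rho0 p1 F rho2 k0.
pose beta := bilin G0 v0 w.
(* Each time uses its own chart, around [geo v0 t]. The quantities do not depend on the chart, so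
   they can be differentiated in a chart held fixed near the time in question. *)
pose f (t : R) := bilin (met (geo v0 t) t) (jac (geo v0 t) w t).1 (jac (geo v0 t) w t).1.
pose f1 (t : R) := 2 * bilin (met (geo v0 t) t) (jac (geo v0 t) w t).1 (cov_jacobi (geo v0 t) t).
pose f2 (t : R) := 2 * (bilin (met (geo v0 t) t) (cov_jacobi (geo v0 t) t) (cov_jacobi (geo v0 t) t)
  - bilin (met (geo v0 t) t) (curv (metric g (geo v0 t)) (state g (geo v0 t) (geo v0) t).1 (jac (geo v0 t) w t).1 (state g (geo v0 t) (geo v0) t).2) (jac (geo v0 t) w t).1).
pose b (t : R) := bilin (met (geo v0 t) t) (jac (geo v0 t) w t).1 (state g (geo v0 t) (geo v0) t).2.
have ct (t : R) : chart_dom g (geo v0 t) (geo v0 t) by exact: chart_dom_center.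
have z01 : 0 <= (0 : R) <= 1 by rewrite lexx ler01.
have o01 : 0 <= (1 : R) <= 1 by rewrite lexx ler01.
have t32 (t : R) : 0 <= t <= 1 -> `|t| <= 3 / 2 by move=> /andP[? ?]; rewrite ger0_norm//; lra.
have SD (t : R) : 0 <= t <= 1 -> smooth_dep g geo v0 t by exact: smooth_dep_all geo_geod geo0 geo_state0 _ _.
have Df q (t : R) : (\forall s \near t, [/\ chart_dom g q (geo v0 s), smooth_dep g geo v0 s & `|s| <= 3 / 2]) ->
    is_derive t 1 f (2 * bilin (met q t) (jac q w t).1 (cov_jacobi q t)).
  move=> nt; have [qt Qt t3] := nbhs_singleton nt; have [D _ _] := jacobi_derivatives t3 Qt qt.
  apply: (is_derive_near_eq _ D); apply: filterS nt => s [qs Qs s2].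
  by have [h _] := jacobi_chart_indep Qs s2 qs (ct s).
have Dff (t : R) : 0 <= t <= 1 -> is_derive t 1 f (f1 t).
  by move=> t01; apply: Df; exact: near_geo_dom.
have Df1 (t : R) : 0 <= t <= 1 -> is_derive t 1 f1 (f2 t).
  move=> t01; have [_ D _] := jacobi_derivatives (t32 t t01) (SD t t01) (ct t).
  have nnt : \forall s \near t, \forall r \near s, [/\ chart_dom g (geo v0 t) (geo v0 r), smooth_dep g geo v0 r & `|r| <= 3 / 2].
    by apply: nbhs_interior; exact: near_geo_dom.
  apply: (is_derive_near_eq _ D); apply: filterS nnt => s ns.
  have D1 := Df _ _ ns; have [_ Qs s3] := nbhs_singleton ns.
  have Gs : geod g (geo v0) s by apply: geo_geod; lra.
  have ns' : \forall r \near s, [/\ chart_dom g (geo v0 s) (geo v0 r), smooth_dep g geo v0 r & `|r| <= 3 / 2].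
    have cs : \forall r \near s, chart_dom g (geo v0 s) (geo v0 r) by apply: (geod_continuous Gs); exact: chart_dom_nbhs.
    by apply: (filterS _ (filterI ns cs)) => r [[_ h2 h3] h1]; split.
  exact: (is_derive_unique D1 (Df _ _ ns')).
have Db (t : R) : 0 <= t <= 1 -> is_derive t 1 b beta.
  move=> t01; have [_ _ D] := jacobi_derivatives (t32 t t01) (SD t t01) (ct t).
  rewrite (cov_jacobi_speed t01 (ct t)) in D.
  apply: (is_derive_near_eq _ D); apply: filterS (near_geo_dom t01 (ct t)) => s [qs Qs s2].
  by have [_ h] := jacobi_chart_indep Qs s2 qs (ct s).
have j0 : (jac (geo v0 0) w 0) = (0, w) by rewrite geo0 (jacobi0 geo_state0).
have j01 : (jac (geo v0 0) w 0).1 = 0 by rewrite j0.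
have bt (t : R) : 0 <= t <= 1 -> b t = t * beta.
  move=> /andP[t0 t1]; have b0 : b 0 = 0 by rewrite /b j01 bilin0l.
  have H : `|(b t - beta *: t) - (b 0 - beta *: 0)| <= 0 * (t - 0).
    apply: (@mean_value R R (fun r => b r - beta *: r) (fun=> 0) 0 t 0 t0) => r.
      move=> /andP[r0 rt]; have r01 : 0 <= r <= 1 by rewrite r0 (le_trans rt).
      apply: (is_derive_ext _ _ (is_deriveB (Db r r01) (is_deriveZ beta (is_derive_id r 1)))); first by [].
      by rewrite /GRing.scale /= mulr1 subrr.
    by rewrite normr0.
  move: H; rewrite b0 scaler0 subrr subr0 mul0r normr_le0 subr_eq0 => /eqP ->.
  by rewrite /GRing.scale /= mulrC.
pose mu := Num.sqrt (c * rho2).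
have cr0 : 0 <= c * rho2 by rewrite mulr_ge0// ltW.
have mu2 : mu ^+ 2 = c * rho2 by rewrite sqr_sqrtr.
pose q (t : R) := rho2 * f t - beta ^+ 2 * (t * t).
pose q1 (t : R) := rho2 * f1 t - beta ^+ 2 * (2 * t).
pose q2 (t : R) := rho2 * f2 t - beta ^+ 2 * 2.
have px (t : R) : chart_img g (geo v0 t) (state g (geo v0 t) (geo v0) t).1 by apply: chart_img_chart.
have speedE (t : R) : 0 <= t <= 1 -> bilin (met (geo v0 t) t) (state g (geo v0 t) (geo v0) t).2 (state g (geo v0 t) (geo v0) t).2 = rho2.
  move=> /andP[t0 t1]; have t02 : 0 <= t <= 2 by rewrite t0 (le_trans t1)// ler1n.
  exact: (geo_gspeed2 geo_geod geo0 geo_state0 v0 t02).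
have key := @rauch_growth R q q1 q2 mu k0 (sqrtr_ge0 _).
have [|||||||h1 h2] := key.
- move=> t t01; apply: (is_derive_ext _ _ (is_deriveB (is_deriveZ rho2 (Dff t t01)) (is_deriveZ (beta ^+ 2) (is_deriveM (is_derive_id t 1) (is_derive_id t 1))))); first by [].
  by rewrite /q1 /GRing.scale /=; ring.
- move=> t t01; apply: (is_derive_ext _ _ (is_deriveB (is_deriveZ rho2 (Df1 t t01)) (is_deriveZ (beta ^+ 2) (is_deriveZ 2 (is_derive_id t 1))))); first by [].
  by rewrite /q2 /GRing.scale /=; ring.
- move=> t l t01; rewrite mu2 /q /q1 /q2 /f /f1 /f2.
  have sb := sectional_bound (geo v0 t) (jac (geo v0 t) w t).1 (state g (geo v0 t) (geo v0) t).2 Hc.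
  have eb := bt t t01; have es := speedE t t01; have ed := cov_jacobi_speed t01 (ct t).
  have sx := Defs.metric_sym (px t); have posx := metric_inv_pos (px t).
  rewrite /b -/rho2 -/beta in eb es ed.
  exact: (rauch_algebra l sx posx eb es ed rho0 sb).
- move=> t t01; rewrite /q.
  have := bilin_cauchy_schwarz (jac (geo v0 t) w t).1 (state g (geo v0 t) (geo v0) t).2 (Defs.metric_sym (px t)) (metric_inv_pos (px t)).
  have eb := bt t t01; have es := speedE t t01; rewrite /b in eb; rewrite eb es -/(f t).
  rewrite subr_ge0; rewrite (mulrC rho2) => h; apply: le_trans h; rewrite le_eqVlt; apply/orP; left; apply/eqP; ring.
- by rewrite /q /f j01 bilin0l !mulr0 subrr.
- by rewrite /q1 /f1 j01 bilin0l !mulr0 subrr.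
- have e0 : f2 0 = 2 * bilin G0 w w.
    rewrite /f2 /cov_jacobi j01 chr0 addr0 bilin0r subr0 j0 /= geo0; reflexivity.
  by rewrite /q2 e0 /k0 -/beta; ring.
have fF : f 1 = F.
  have [h _] := jacobi_chart_indep (SD 1 o01) (t32 1 o01) (ct 1) p1; exact: h.
move: h1 h2; rewrite /q fF !mul1r mulr1 -/mu -/beta (mulrC rho2 F) mu2 => h1 h2.
by split; [exact: h1|exact: h2].
Qed.
End Fields.
End JacobiFields.

Section ExponentialMap.
Variables (R : realType) (n : nat) (M : ptopologicalType) (g : riemannian R n M).
Implicit Types (p q : M).
Local Notation V := 'rV[R]_n.

(** The backward half is the forward geodesic of [- v] run in reverse; local uniqueness at time 0
    makes the junction a geodesic. *)
Lemma complete_geod_symmetric (o : M) (v : V) (T : R) : complete_riemannian g ->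
  (forall x y, exists L, curve_length g x y L) -> 0 < T ->
  exists c, [/\ forall t : R, `|t| <= T -> geod g c t, c 0 = o & state g o c 0 = (chart g o o, v)].
Proof.
move=> cpl conn T0; have [c1 [G1 c10 s1]] := complete_geod cpl conn o v (ltW T0).
have [c2 [G2 c20 s2]] := complete_geod cpl conn o (- v) (ltW T0).
pose c2' t := c2 (-1 * t + 0).
have z : -1 * 0 + 0 = 0 :> R by ring.
have G2' (t : R) : - T <= t -> t <= 0 -> geod g c2' t.
  by move=> tT t0; apply: geod_affine; apply: G2; apply/andP; split; lra.
have z0T : 0 <= (0 : R) <= T by rewrite lexx ltW.
have G10 := G1 0 z0T; have G20 : geod g c2' 0 by apply: G2'; lra.
have G2z : geod g c2 (-1 * 0 + 0) by rewrite z; apply: G2.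
have oo := chart_dom_center g o.
have c20' : c2' 0 = o by rewrite /c2' z.
have e0 : c1 0 = c2' 0 by rewrite c20'.
have es : state g o c1 0 = state g o c2' 0.
  have oz : chart_dom g o (c2 (-1 * 0 + 0)) by rewrite z c20.
  have := state_affine G2z oz; rewrite z s2 /= scaleN1r opprK => h; rewrite s1; exact: esym h.
have es' : state g (c1 0) c1 0 = state g (c1 0) c2' 0 by rewrite c10.
have nr := geod_unique_local G10 G20 e0 es'.
pose c t := if 0 <= t then c1 t else c2' t.
have nc : \forall s \near (0 : R), c1 s = c s.
  by apply: filterS nr => s; rewrite /c; case: ifP.
exists c; split.
- move=> t; rewrite ler_norml => /andP[tT Tt].
  have [t0|t0|t0] := ltgtP t 0.
  + apply: (@geod_near_eq _ _ _ _ c2'); last by apply: G2' => //; exact: ltW.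
    by apply: filterS (near_lt t0) => s s0; rewrite /c leNgt s0.
  + apply: (@geod_near_eq _ _ _ _ c1); last by apply: G1; rewrite (ltW t0).
    by apply: filterS (near_gt t0) => s s0; rewrite /c ltW.
  + by rewrite t0; exact: (geod_near_eq nc G10).
- by rewrite /c lexx.
- by rewrite -s1; exact: esym (state_near_eq g o nc).
Qed.

(** The interface between geodesics and the rest of the proof. The Rauch field compares normal parts
    multiplied by the squared radius [rho2], which avoids dividing by it; the radius is asked to be
    at least 1 / sqrt(c). *)
Record exponential_map (c : R) (o : M) (e : V -> M) : Prop := ExponentialMap {
  exp0 : e 0 = o;
  exp_dom : forall v p, chart_dom g p (e v) -> \forall v' \near v, chart_dom g p (e v');
  exp_C11 : forall v p, chart_dom g p (e v) -> C11 (fun v => chart g p (e v)) v;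
  exp_expand : forall v w p, chart_dom g p (e v) -> let u := 'D_w (fun v => chart g p (e v)) v in
    bilin (metric g o (chart g o o)) w w <= bilin (metric g p (chart g p (e v))) u u;
  exp_gauss : forall v w p, chart_dom g p (e v) -> let u := 'D_w (fun v => chart g p (e v)) v in
    bilin (metric g o (chart g o o)) v w ^+ 2 <=
    bilin (metric g o (chart g o o)) v v * bilin (metric g p (chart g p (e v))) u u;
  exp_rauch : forall v w p, chart_dom g p (e v) -> let u := 'D_w (fun v => chart g p (e v)) v in
    let rho2 := bilin (metric g o (chart g o o)) v v in
    let b2 := bilin (metric g o (chart g o o)) v w ^+ 2 in
    1 <= Num.sqrt (c * rho2) ->
    (bilin (metric g o (chart g o o)) w w * rho2 - b2) * expR (2 * Num.sqrt (c * rho2) - 2) <=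
    c * rho2 * (bilin (metric g p (chart g p (e v))) u u * rho2 - b2);
  exp_radial : forall (v : V) (s t : R), 0 <= s <= 1 -> 0 <= t <= 1 ->
    curve_length g (e (s *: v)) (e (t *: v))
      (Num.sqrt (bilin (metric g o (chart g o o)) v v) * `|t - s|) }.

Theorem exponential_map_exists (c : R) (o : M) : complete_riemannian g ->
  (forall x y, exists L, curve_length g x y L) -> 0 <= c -> sectional_curvature_le g (- c) ->
  exists e, exponential_map c o e.
Proof.
move=> cpl conn c0 Hc.
have [geo Hgeo] : {geo : V -> R -> M & forall v, [/\ forall t : R, `|t| <= 2 -> geod g (geo v) t,
    geo v 0 = o & state g o (geo v) 0 = (chart g o o, v)]}.
  by apply: (@choice _ _ (fun v c => [/\ forall t : R, `|t| <= 2 -> geod g c t,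
    c 0 = o & state g o c 0 = (chart g o o, v)])) => v; exact: complete_geod_symmetric.
have GG v : forall t : R, `|t| <= 2 -> geod g (geo v) t by have [] := Hgeo v.
have G0 v : geo v 0 = o by have [] := Hgeo v.
have GS v : state g o (geo v) 0 = (chart g o o, v) by have [] := Hgeo v.
have o01 : 0 <= (1 : R) <= 1 by rewrite lexx ler01.
have z01 : 0 <= (0 : R) <= 1 by rewrite lexx ler01.
have SD v := smooth_dep_all GG G0 GS (v0 := v) o01.
have oo := chart_dom_center g o; have io := chart_img_chart oo.
have sG := Defs.metric_sym io; have pG := metric_inv_pos io.
have geo0 (t : R) : 0 <= t <= 1 -> geo 0 t = o.
  by move=> t01; rewrite -[X in geo X t](scale0r (0 : V)) (geo_scale GG G0 GS 0 z01 t01) mul0r G0.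
have jE v w p : chart_dom g p (geo v 1) -> (jacobi g geo v p w 1).1 = 'D_w (fun v => chart g p (geo v 1)) v.
  by move=> pv; have [_ h] := jacobi_fst w (@SD v) pv; exact: h.
(* The comparison theorem requires a nonzero initial velocity. At 0 the differential is the
   identity, because h w is mapped to the point of the geodesic of w at time h. *)
have D0 w : 'D_w (fun v => chart g o (geo v 1)) 0 = w.
  have o1 : chart_dom g o (geo 0 1) by rewrite geo0.
  have [C _] := jacobi_fst w (@SD 0) o1.
  have C' : C11 (fun v => chart g o (geo v 1)) (0 + (0 : R) *: w) by rewrite scale0r addr0.
  have D := C11_comp_curve C' (is_derive_line 0 w 0).
  have Gw : geod g (geo w) 0 by apply: GG; rewrite normr0.
  have ow : chart_dom g o (geo w 0) by rewrite G0.
  have [_ /is_derive_pairE [D2 _]] := nbhs_singleton (geod_chart Gw ow).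
  rewrite GS /= in D2.
  set u := 'D_w _ 0; suff : `|u - w| <= 0 by rewrite normr_le0 subr_eq0 => /eqP.
  rewrite scale0r addr0 -/u in D.
  apply/ler_addgt0Pr => _/posnumP[e]; rewrite add0r.
  have e2 : 0 < e%:num / 2 by rewrite divr_gt0.
  move/is_derive_eps: D => /(_ _ e2) [d1 d10 H1].
  move/is_derive_eps: D2 => /(_ _ e2) [d2 d20 H2].
  pose h := Num.min (Num.min d1 d2 / 2) 1.
  have dd : 0 < Num.min d1 d2 by rewrite lt_min d10.
  have h0 : 0 < h by rewrite lt_min divr_gt0//= ltr01.
  have hd : h < Num.min d1 d2 by rewrite (@le_lt_trans _ _ (Num.min d1 d2 / 2)) ?ge_min ?lexx//; lra.
  have h01 : 0 <= h <= 1 by rewrite ltW//= ge_min lexx orbT.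
  have hn : `|h| = h by rewrite gtr0_norm.
  have := H1 h; have := H2 h; rewrite hn; move: hd; rewrite lt_min => /andP[hd1 hd2].
  move=> /(_ hd2) B /(_ hd1) A.
  have eh : geo (0 + (0 + h *: 1) *: w) 1 = geo w (0 + h *: 1).
    by rewrite !add0r /GRing.scale /= mulr1 -/(GRing.scale h w) (geo_scale GG G0 GS w h01 o01) mulr1.
  have ez : geo (0 + (0 : R) *: w) 1 = geo w 0 by rewrite scale0r addr0 geo0// G0.
  rewrite /= eh ez in A; rewrite /= in B.
  rewrite -(ler_pM2l h0) -[X in X * `|_|]hn -normrZ.
  set y := chart g o (geo w (0 + h *: 1)) - chart g o (geo w 0) in A B.
  apply: (ler_norm_split (x := y - h *: w) (y := - (y - h *: u)) (a := e%:num / 2 * h) (b := e%:num / 2 * h)).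
  - by lmod R.
  - exact: B.
  - by rewrite normrN.
  - lra.
exists (fun v => geo v 1); split.
- by rewrite geo0.
- by move=> v p pv; have [h _] := SD v p pv; exact: h.
- by move=> v p pv; have [h _] := jacobi_fst 0 (@SD v) pv; exact: h.
- move=> v w p pv /=; set u := 'D_w _ v; have [v0|v0] := eqVneq v 0.
    have o1 : chart_dom g o (geo v 1) by rewrite v0 geo0.
    have t32 : `|1 : R| <= 3 / 2 by rewrite normr1; lra.
    have [h _] := jacobi_chart_indep GG w (@SD v) t32 pv o1.
    have eu := jE v w p pv; have eo := jE v w o o1; rewrite v0 D0 -v0 in eo.
    have h2 := bilin_congr (metric g p) (erefl (chart g p (geo v 1))) eu eu.
    have h3 := bilin_congr (metric g o) (erefl (chart g o (geo v 1))) eo eo.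
    have h4 := etrans (esym h2) (etrans h h3).
    by rewrite /u; rewrite h4 v0 geo0.
  have [h _] := rauch GG G0 GS w c0 Hc (pG v v0) pv.
  have eu := jE v w p pv; have h2 := bilin_congr (metric g p) (erefl (chart g p (geo v 1))) eu eu.
  move: h; rewrite h2 -/u => h; rewrite -(ler_pM2r (pG v v0)); lra.
- move=> v w p pv /=; set u := 'D_w _ v; have [v0|v0] := eqVneq v 0.
    by rewrite v0 !bilin0l expr0n mul0r.
  have [h _] := rauch GG G0 GS w c0 Hc (pG v v0) pv.
  have eu := jE v w p pv; have h2 := bilin_congr (metric g p) (erefl (chart g p (geo v 1))) eu eu.
  move: h; rewrite h2 -/u => h; have := bilin_cauchy_schwarz v w sG pG; lra.
- move=> v w p pv /=; set u := 'D_w _ v => mu1; have [v0|v0] := eqVneq v 0.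
    by move: mu1; rewrite v0 bilin0l mulr0 sqrtr0; lra.
  have [_ /(_ mu1) h] := rauch GG G0 GS w c0 Hc (pG v v0) pv.
  have eu := jE v w p pv; have h2 := bilin_congr (metric g p) (erefl (chart g p (geo v 1))) eu eu.
  by move: h; rewrite h2.
- move=> v s t s01 t01; rewrite !(geo_scale GG G0 GS)// !mulr1.
  have G (r : R) : 0 <= r <= 1 -> geod g (geo v) r by move=> /andP[? ?]; apply: GG; rewrite ger0_norm//; lra.
  have := geod_curve_length G s01 t01.
  by rewrite /gspeed2 G0 GS.
Qed.
End ExponentialMap.

Lemma local_lipschitz_continuous (R : realType) (V W : normedModType R) (f : V -> W) (x : V) (r K : R) :
  0 < r -> 0 < K -> (forall y, `|y - x| < r -> `|f y - f x| <= K * `|y - x|) -> {for x, continuous f}.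
Proof.
move=> r0 K0 H; apply/cvgrPdist_le => e e0; apply/near_normP.
exists (Num.min r (e / K)); first by rewrite lt_min r0 divr_gt0.
move=> y; rewrite lt_min => /andP[y1 y2]; rewrite distrC; apply: (le_trans (H y y1)).
by rewrite mulrC -ler_pdivlMr// ltW.
Qed.

(** * Bijectivity of the exponential map *)

Section Covering.
Variables (R : realType) (n : nat) (M : ptopologicalType) (g : riemannian R n M).
Implicit Types (p q : M).
Local Notation V := 'rV[R]_n.

Variables (c : R) (o : M) (e : V -> M).
Hypothesis E : exponential_map g c o e.

Lemma exp_continuous : continuous e.
Proof.
move=> v; have pp := chart_dom_center g (e v); have C := exp_C11 E pp.
have h : {for v, continuous (chart_inv g (e v) \o (fun v' => chart g (e v) (e v')))}.
  apply: continuous_comp; first exact: (C11_continuous C).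
  by apply: chart_inv_cont; exact: chart_img_chart.
apply: (cont_near_eq _ h); apply: filterS (exp_dom E pp) => v' pv'.
by rewrite /= chartK.
Qed.

Lemma exp_immersion v w p : chart_dom g p (e v) -> 'D_w (fun v => chart g p (e v)) v = 0 -> w = 0.
Proof.
move=> pv D0; have := exp_expand E w pv; rewrite /= D0 bilin0l => h.
apply/eqP/negPn/negP => w0.
by have := metric_inv_pos (chart_img_chart (chart_dom_center g o)) w0; rewrite ltNge h.
Qed.

(** The map expands lengths, so its differential is injective and the inverse function theorem
    applies in a chart; the inverse estimate makes the section continuous. *)
Lemma exp_local_section v : exists (W : set M) (s : M -> V) (rho : R),
  [/\ 0 < rho, nbhs (e v) W, s (e v) = v,
   forall x, W x -> [/\ e (s x) = x, `|s x - v| < rho & {for x, continuous s}] &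
   forall u u', `|u - v| < rho -> `|u' - v| < rho -> e u = e u' -> u = u'].
Proof.
set p := e v; have pp : chart_dom g p (e v) by exact: chart_dom_center.
have C := exp_C11 E pp; pose f v' := chart g p (e v').
have [s [rho [sig [K [rho0 sig0 K0 Hs Hinj]]]]] := inverse_function C (fun w => exp_immersion pp).
have /near_normP [r1 r10 Hr1] := exp_dom E pp.
pose rho' := Num.min rho r1; have rho'0 : 0 < rho' by rewrite lt_min rho0.
pose sig' := Num.min sig (rho' / K); have sig'0 : 0 < sig' by rewrite lt_min sig0 divr_gt0.
have vv : `|v - v| < rho by rewrite subrr normr0.
have close y : `|y - f v| < sig' -> [/\ `|s y - v| < rho', f (s y) = y & `|s y - v| < rho].
  rewrite lt_min => /andP[ys yK]; have [h1 h2] := Hs y ys.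
  split => //; apply: (le_lt_trans (Hinj _ _ h1 vv)).
  by rewrite h2 mulrC -ltr_pdivlMr.
have sv : s (f v) = v.
  have [|h1 h2 h3] := close (f v); first by rewrite subrr normr0.
  apply/eqP; rewrite -subr_eq0 -normr_le0; apply: (le_trans (Hinj _ _ h3 vv)).
  by move: h2; rewrite /f => ->; rewrite subrr normr0 mulr0.
exists [set x | chart_dom g p x /\ `|chart g p x - f v| < sig'], (s \o chart g p), rho'; split.
- exact: rho'0.
- apply: filterI; first exact: (chart_dom_nbhs pp).
  exact: (near_continuous_lt (chart_cont pp) sig'0).
- exact: sv.
- move=> x [px xs]; have [h1 h2 h3] := close _ xs; split.
  + have p1 : chart_dom g p (e (s (chart g p x))).
      by apply: Hr1; move: h1; rewrite lt_min => /andP[].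
    by rewrite /= -[LHS](chartK p1) -[RHS](chartK px); congr chart_inv.
  + exact: h1.
  + suff cs : {for chart g p x, continuous s} by exact: (continuous_comp (chart_cont px) cs).
    have d0 : 0 < sig' - `|chart g p x - f v| by rewrite subr_gt0.
    apply: (local_lipschitz_continuous d0 K0) => y y1.
    have [k1 k2 k3] := close y (dist_lt_trans y1).
    apply: (le_trans (Hinj _ _ k3 h3)).
    by move: k2 h2; rewrite /f => -> ->.
- move=> u u'; rewrite !lt_min => /andP[u1 u2] /andP[u3 u4] euu.
  by apply/eqP; rewrite -subr_eq0 -normr_le0; apply: (le_trans (Hinj _ _ u1 u3)); rewrite euu subrr normr0 mulr0.
Qed.

Lemma lift_near_eq (l1 l2 : R -> V) (t : R) : {for t, continuous l1} -> {for t, continuous l2} ->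
  (\forall s \near t, e (l1 s) = e (l2 s)) -> l1 t = l2 t -> \forall s \near t, l1 s = l2 s.
Proof.
move=> c1 c2 ee e12; have [W [s [rho [rho0 _ _ _ inj]]]] := exp_local_section (l1 t).
have n1 := near_continuous_lt c1 rho0; have n2 := near_continuous_lt c2 rho0.
rewrite -e12 in n2.
by apply: (filterS _ (filterI (filterI n1 n2) ee)) => r [[h1 h2] h3]; exact: inj.
Qed.

Lemma lift_unique (l1 l2 : R -> V) (T : R) :
  (forall t : R, 0 <= t <= T -> {for t, continuous l1} /\ {for t, continuous l2} /\
    \forall s \near t, e (l1 s) = e (l2 s)) -> l1 0 = l2 0 ->
  forall t : R, 0 <= t <= T -> l1 t = l2 t.
Proof.
move=> H e0; apply: real_propagation_on; first exact: e0.
move=> t tT; have [c1 [c2 ee]] := H t tT.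
have [et|net] := pselect (l1 t = l2 t).
  have /near_normP [d d0 Hd] := lift_near_eq c1 c2 ee et.
  by exists d; [exact: d0|move=> s s' _ s'd _ _ _; exact: Hd].
have /near_normP [d d0 Hd] := near_neq c1 c2 net.
by exists d; [exact: d0|move=> s s' sd _ _ _ es; have := Hd s sd; rewrite es eqxx].
Qed.

Lemma lift_unique_seg (l1 l2 : R -> V) (a b : R) :
  (forall x : R, 0 <= x <= 1 -> {for (b - a) * x + a, continuous l1} /\ {for (b - a) * x + a, continuous l2} /\
    \forall s \near (b - a) * x + a, e (l1 s) = e (l2 s)) -> l1 a = l2 a -> l1 b = l2 b.
Proof.
move=> H ea.
have ca (x : R) : {for x, continuous (fun y : R => (b - a) * y + a)}.
  by apply: cvgD; [apply: cvgM; [exact: cvg_cst|exact: cvg_id]|exact: cvg_cst].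
have := @lift_unique (fun x => l1 ((b - a) * x + a)) (fun x => l2 ((b - a) * x + a)) 1.
rewrite !mulr0 !add0r => /(_ _ ea 1); rewrite !mulr1 subrK; apply; last by rewrite ler01 lexx.
move=> x x01; have [h1 [h2 h3]] := H x x01; split.
  by apply: (@continuous_comp _ _ _ (fun y : R => (b - a) * y + a) l1).
split; first by apply: (@continuous_comp _ _ _ (fun y : R => (b - a) * y + a) l2).
exact: (@near_affine R (fun r => e (l1 r) = e (l2 r)) _ _ _ h3).
Qed.

Definition lifts (y : R -> M) (T : R) (l : R -> V) :=
  forall t : R, 0 <= t <= T -> {for t, continuous l} /\ \forall s \near t, e (l s) = y s.

(** The common frame of the two lifting results: real induction over the time reached, pasting a
    local lift [s'] to [l] at a time [s] close enough to t. Only the passage across t is left to the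
    caller. *)
Lemma lift_extend (y : R -> M) (v0 : V) : continuous y -> e v0 = y 0 ->
  (forall t : R, 0 < t -> t <= 1 ->
    (forall s : R, 0 <= s -> s < t -> exists2 l, lifts y s l & l 0 = v0) ->
    exists (s d : R) (l s' : R -> V), [/\ 0 <= s, s <= t, t < s + d, lifts y s l /\ l 0 = v0 &
      l s = s' s /\ forall r : R, `|r - s| < d -> {for r, continuous s'} /\ e (s' r) = y r]) ->
  exists2 l, lifts y 1 l & l 0 = v0.
Proof.
move=> cy e0 step.
have step0 : exists (s d : R) (l s' : R -> V), [/\ 0 <= s, s <= 0, 0 < s + d, lifts y s l /\ l 0 = v0 &
      l s = s' s /\ forall r : R, `|r - s| < d -> {for r, continuous s'} /\ e (s' r) = y r].
  have [W [s [rho [rho0 nW sv Hs inj]]]] := exp_local_section v0.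
  rewrite e0 in nW sv.
  have /near_normP [d d0 Hd] : \forall r \near (0 : R), W (y r) by exact: (cy 0 _ nW).
  have Hr (r : R) : `|r - 0| < d -> {for r, continuous (s \o y)} /\ e (s (y r)) = y r.
    move=> rd; have [h1 h2 h3] := Hs _ (Hd r rd); split; last exact: h1.
    by apply: continuous_comp; [exact: cy|exact: h3].
  exists 0, d, (s \o y), (s \o y); split; [exact: lexx|exact: lexx|by rewrite add0r| |by split].
  split; last exact: sv.
  move=> t /andP[t0 t1]; have -> : t = 0 by apply/eqP; rewrite eq_le t0 t1.
  split; first by have [|h _] := Hr 0; rewrite ?subrr ?normr0.
  by apply/near_normP; exists d => // r rd; have [] := Hr r rd.
suff H : forall t : R, 0 <= t -> t <= 1 -> exists2 l, lifts y t l & l 0 = v0 by apply: H.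
apply: (@real_induction _ (fun t => t <= 1 -> exists2 l, lifts y t l & l 0 = v0)) => t t0 Hs.
have [t1|] := boolP (t <= 1); last first.
  by move=> t1; exists 1; [exact: ltr01|move=> s ts _ s1; case/negP: t1; exact: le_trans s1].
have [s [d [l [s' [s0 st td [Hl l0] [ls Hs']]]]]] : exists (s d : R) (l s' : R -> V),
   [/\ 0 <= s, s <= t, t < s + d, lifts y s l /\ l 0 = v0 &
      l s = s' s /\ forall r : R, `|r - s| < d -> {for r, continuous s'} /\ e (s' r) = y r].
  have [->|tn] := eqVneq t 0; first exact: step0.
  apply: step => //; first by rewrite lt_def tn.
  by move=> s s0 st; apply: Hs => //; exact: (le_trans (ltW st)).
exists (s + d - t); first lra.
move=> T tT Td T1.
have dd : 0 < d by lra.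
pose L r := if r <= s then l r else s' r.
have ss : 0 <= s <= s by rewrite s0 lexx.
have [cls els] := Hl s ss.
have nr : \forall r \near s, l r = s' r.
  have [|cs' _] := Hs' s; first by rewrite subrr normr0.
  apply: (lift_near_eq cls cs' _ ls).
  have ns : \forall r \near s, `|r - s| < d by apply/near_normP; exists d.
  by apply: (filterS _ (filterI els ns)) => r [-> /Hs' [_ ->]].
have nL : \forall r \near s, l r = L r.
  by apply: filterS nr => r; rewrite /L; case: ifP.
exists L; last by rewrite /L s0.
move=> r /andP[r0 rT]; have [rs|rs|rs] := ltgtP r s.
- have n1 : \forall x \near r, l x = L x.
    by apply: filterS (near_lt rs) => x xs; rewrite /L ltW.
  have rs' : 0 <= r <= s by rewrite r0 ltW.
  have [cl el] := Hl r rs'; split; first exact: (cont_near_eq n1 cl).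
  by apply: (filterS _ (filterI n1 el)) => x [<-].
- have n1 : \forall x \near r, s' x = L x.
    by apply: filterS (near_gt rs) => x xs; rewrite /L leNgt xs.
  have n2 : \forall x \near r, `|x - s| < d.
    apply/near_normP; exists (s + d - r); first lra.
    by move=> x; rewrite !ltr_norml => /andP[? ?]; apply/andP; split; lra.
  have [|cs' _] := Hs' r; first by rewrite ger0_norm; lra.
  split; first exact: (cont_near_eq n1 cs').
  by apply: (filterS _ (filterI n1 n2)) => x [<- /Hs' []].
- rewrite rs; split; first exact: (cont_near_eq nL cls).
  by apply: (filterS _ (filterI nL els)) => x [<-].
Qed.

(** A local section at the lifted point serves all parameters close to [s0]: near one time the lifts
    coincide with it, by uniqueness, so continuity in the parameter passes between neighbouring
    times. *)
Lemma lift_family (S : topologicalType) (s0 : S) (H : R -> S -> M) (L : S -> R -> V) :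
  (\forall s \near s0, lifts (H^~ s) 1 (L s)) ->
  (forall t : R, 0 <= t <= 1 -> {for (t, s0), continuous (fun z : R * S => H z.1 z.2)}) ->
  {for s0, continuous (fun s => L s 0)} ->
  forall t : R, 0 <= t <= 1 -> {for s0, continuous (fun s => L s t)}.
Proof.
move=> HL HH L0; apply: real_propagation_on; first exact: L0.
move=> t t01; have Hl0 := nbhs_singleton HL; have [cL eL] := Hl0 t t01.
have [W [s [rho [rho0 nW sv Hs inj]]]] := exp_local_section (L s0 t).
have eW : e (L s0 t) = H t s0 by exact: nbhs_singleton eL.
rewrite eW in nW.
have [[A N] [/= /near_normP [d1 d10 Hd1] nN] HAN] := HH t t01 _ nW.
have /near_normP [d2 d20 Hd2] := near_continuous_lt cL rho0.
exists (Num.min d1 d2); first by rewrite lt_min d10.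
move=> t1 t2; rewrite !lt_min => /andP[t1d t1d'] /andP[t2d t2d'] t101 t201 P1.
have HW (r : R) s' : `|r - t| < d1 -> N s' -> W (H r s') by move=> /Hd1 Ar Ns; exact: (HAN (r, s')).
have near1 : \forall s' \near s0, `|L s' t1 - L s0 t| < rho.
  have d0 : 0 < rho - `|L s0 t1 - L s0 t| by rewrite subr_gt0; exact: Hd2.
  by apply: filterS (near_continuous_lt P1 d0) => s'; exact: dist_lt_trans.
have key : \forall s' \near s0, s (H t2 s') = L s' t2.
  apply: (filterS _ (filterI (filterI near1 nN) HL)) => s' [[h1 Ns'] lf].
  have e1 : L s' t1 = s (H t1 s').
    have [_ /nbhs_singleton el1] := lf t1 t101.
    have [k1 k2 _] := Hs _ (HW t1 s' t1d Ns').
    by apply: inj => //; rewrite k1.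
  apply: esym; apply: (@lift_unique_seg (L s') (fun r => s (H r s')) t1 t2 _ e1) => x x01.
  set r := (t2 - t1) * x + t1.
  have rd : `|r - t| < d1 by exact: convex_dist.
  have r01 : 0 <= r <= 1.
    by move: t101 t201 x01 => /andP[? ?] /andP[? ?] /andP[? ?]; rewrite /r; apply/andP; split; nra.
  have [cr er] := lf r r01.
  have [k1 k2 k3] := Hs _ (HW r s' rd Ns').
  split; first exact: cr.
  split.
    apply: continuous_comp; last exact: k3.
    apply: (cont_near_eq er); apply: continuous_comp; [exact: cr|exact: exp_continuous].
  have nr : \forall r' \near r, `|r' - t| < d1.
    have q0 : 0 < d1 - `|r - t| by rewrite subr_gt0.
    apply/near_normP; exists (d1 - `|r - t|) => // r'; exact: dist_lt_trans.
  apply: (filterS _ (filterI er nr)) => r' [-> r'd].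
  by have [-> _ _] := Hs _ (HW r' s' r'd Ns').
have cs : {for s0, continuous (fun s' => s (H t2 s'))}.
  have [_ _ k3] := Hs _ (HW t2 s0 t2d (nbhs_singleton nN)).
  apply: continuous_comp; last exact: k3.
  have := HH t2 t201 => h.
  apply: (@continuous_comp _ _ _ (fun s' => (t2, s')) (fun z : R * S => H z.1 z.2)); last exact: h.
  by apply: cont_pair; [exact: cvg_cst|exact: cvg_id].
exact: (cont_near_eq key cs).
Qed.
End Covering.

(** * Lifting of paths and homotopies *)

Section Bijectivity.
Variables (R : realType) (n : nat) (M : ptopologicalType) (g : riemannian R n M).
Implicit Types (p q : M).
Local Notation V := 'rV[R]_n.
Variables (c : R) (o : M) (e : V -> M).
Hypothesis E : exponential_map g c o e.

(* As e does not contract lengths, the lift of a C^1 curve is Lipschitz and extends by completeness of V. *)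
Lemma lift_speed q (l : R -> V) (t : R) (y' : V) : chart_dom g q (e (l t)) -> {for t, continuous l} ->
  is_derive t 1 (fun s => chart g q (e (l s))) y' ->
  exists2 l', is_derive t 1 l l' &
    bilin (metric g o (chart g o o)) l' l' <= bilin (metric g q (chart g q (e (l t)))) y' y'
    /\ 'D_l' (fun v => chart g q (e v)) (l t) = y'.
Proof.
move=> qt cl D.
have C := exp_C11 E qt.
have [l' Dl e'] := inverse_function_curve C (fun w => exp_immersion E qt) cl D.
exists l'; first exact: Dl.
by have := exp_expand E l' qt; rewrite /= e'.
Qed.

Lemma convex_ball (x y z : V) (r t : R) : 0 <= t <= 1 -> `|x - z| < r -> `|y - z| < r ->
  `|x + t *: (y - x) - z| < r.
Proof.
move=> /andP[t0 t1] xr yr.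
rewrite (_ : _ - z = (1 - t) *: (x - z) + t *: (y - z)); last by lmod R.
apply: (le_lt_trans (ler_normD _ _)); rewrite !normrZ (ger0_norm t0) ger0_norm ?subr_ge0//.
by have [->|tn] := eqVneq t 0; [lra|have : 0 < t by rewrite lt_def tn]; nra.
Qed.

Definition seg (x y : V) (t : R) : V := x + clamp01 t *: (y - x).

Lemma seg_cont2 (x : V) (t : R) (y : V) : {for (t, y), continuous (fun z : R * V => seg x z.2 z.1)}.
Proof.
have c1 : {for (t, y), continuous (fun z : R * V => clamp01 z.1)}.
  by apply: (@continuous_comp _ _ _ (@fst R V) (@clamp01 R)); [exact: cvg_fst|exact: clamp01_continuous].
have c2 : {for (t, y), continuous (fun z : R * V => z.2 - x)}.
  by apply: cvgB; [exact: cvg_snd|exact: cvg_cst].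
by apply: cvgD; [exact: cvg_cst|apply: cvgZ; [exact: c1|exact: c2]].
Qed.

Lemma geometric_small (a eps : R) : 0 < eps -> exists N, forall k, (N <= k)%N -> a / 2 ^+ k < eps.
Proof.
move=> eps0; exists (Num.trunc (a / eps)).+1 => k Nk.
rewrite ltr_pdivrMr ?exprn_gt0// -ltr_pdivrMl// mulrC.
apply: (lt_le_trans (truncnS_gt _)); apply: (@le_trans _ _ k%:R); first by rewrite ler_nat.
by rewrite -natrX ler_nat ltnW// ltn_expl.
Qed.

Lemma segment_lift q (r B : R) (x y v : V) : 0 < r -> 0 < B ->
  (forall z, `|z - chart g q q| < r -> chart_img g q z /\ forall v,
    `|v| ^+ 2 <= B * bilin (metric g q z) v v /\ bilin (metric g q z) v v <= B * `|v| ^+ 2) ->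
  `|x - chart g q q| < r -> `|y - chart g q q| < r -> e v = chart_inv g q x ->
  exists2 l, lifts e (fun t => chart_inv g q (seg x y t)) 1 l & l 0 = v.
Proof.
move=> r0 B0 HB xr yr ev.
have segr (t : R) : `|seg x y t - chart g q q| < r by apply: convex_ball => //; exact: clamp01_itv.
have imgs (t : R) : chart_img g q (seg x y t) by have [] := HB _ (segr t).
have cs : continuous (seg x y).
  move=> t; apply: (@continuous_comp _ _ _ (fun s => (s, y)) (fun z : R * V => seg x z.2 z.1)); last exact: seg_cont2.
  by apply: cont_pair; [exact: cvg_id|exact: cvg_cst].
have cy : continuous (fun t => chart_inv g q (seg x y t)).
  by move=> t; apply: continuous_comp; [exact: cs|exact: chart_inv_cont].
have seg0 : seg x y 0 = x by rewrite /seg clamp01_id ?lexx ?ler01// scale0r addr0.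
apply: (lift_extend E cy); first by rewrite ev seg0.
move=> t t0 t1 Hs.
have [C HC] : {C : R -> R -> V & forall s, 0 <= s -> s < t -> lifts e (fun t => chart_inv g q (seg x y t)) s (C s) /\ C s 0 = v}.
  apply: (@choice _ _ (fun s l => 0 <= s -> s < t -> lifts e (fun t => chart_inv g q (seg x y t)) s l /\ l 0 = v)) => s.
  have [st|st] := pselect (0 <= s /\ s < t); last by exists (fun=> v) => h1 h2; exfalso; apply: st.
  by case: st => h1 h2; have [l Hl l0] := Hs s h1 h2; exists l.
have oo := chart_dom_center g o; have io := chart_img_chart oo.
have [ro [Bo [ro0 Bo0 HBo]]] := metric_bounds io.
pose K := Num.sqrt (Bo * (B * `|y - x| ^+ 2)).
(* Times are kept strictly inside (0, 1), where the clamped segment is affine and hence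
   differentiable. *)
have lip (s a b : R) : 0 <= s -> s < t -> 0 < a -> a <= b -> b <= s -> `|C s b - C s a| <= K * (b - a).
  move=> s0 st a0 ab bs; have [Hl _] := HC s s0 st.
  have D (r' : R) : a <= r' <= b -> exists2 l', is_derive r' 1 (C s) l' & `|l'| <= K.
    move=> /andP[ar rb]; have r's : 0 <= r' <= s by apply/andP; split; lra.
    have [cl el] := Hl r' r's.
    have er := nbhs_singleton el.
    have qr : chart_dom g q (e (C s r')) by rewrite er; exact: chart_inv_dom.
    have nr : \forall z \near r', 0 <= z <= 1.
      have n1 : \forall z \near r', 0 < z by apply: near_gt; lra.
      have n2 : \forall z \near r', z < 1 by apply: near_lt; lra.
      by apply: (filterS _ (filterI n1 n2)) => z [/ltW h1 /ltW h2]; rewrite h1.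
    have D : is_derive r' 1 (fun z => chart g q (e (C s z))) (y - x).
      apply: (is_derive_near_eq _ (is_derive_line x (y - x) r')).
      apply: (filterS _ (filterI nr el)) => z [z01 ->].
      by rewrite chart_invK// /seg clamp01_id.
    have [l' Dl [hl _]] := lift_speed qr cl D.
    exists l' => //; apply: le_sqrt_sqr => //.
    have cc : `|chart g o o - chart g o o| < ro by rewrite subrr normr0.
    have [_ /(_ l') [h1 _]] := HBo _ cc; apply: (le_trans h1); rewrite ler_wpM2l ?(ltW Bo0)//.
    apply: (le_trans hl); rewrite er chart_invK//.
    by have [_ /(_ (y - x)) []] := HB _ (segr r').
  apply: (@mean_value R V (C s) ('D_1 (C s)) a b K ab) => r' rab.
    by have [l' [D1 D2] _] := D r' rab; split.
  by have [l' [_ ->] h] := D r' rab.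
have uniq (s s' : R) : 0 <= s -> s <= s' -> s' < t -> C s s = C s' s.
  move=> s0 ss s't; have [H1 z1] := HC s s0 (le_lt_trans ss s't).
  have [H2 z2] := HC s' (le_trans s0 ss) s't.
  apply: (@lift_unique R n M g c o e E (C s) (C s') s _ _ s); rewrite ?z1 ?z2 ?s0 ?lexx//.
  move=> a /andP[a0 as_]; have as1 : 0 <= a <= s by rewrite a0.
  have as2 : 0 <= a <= s' by rewrite a0 (le_trans as_).
  have [c1 e1] := H1 a as1; have [c2 e2] := H2 a as2.
  split; [exact: c1|split; first exact: c2].
  by apply: (filterS _ (filterI e1 e2)) => z [-> ->].
(* Times approach t geometrically, as [geo_complete_rV] requires, starting from t / 2 > 0. *)
pose u k := C (t - t / 2 / 2 ^+ k) (t - t / 2 / 2 ^+ k).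
have p2 k : 0 < 2 ^+ k :> R by rewrite exprn_gt0.
have p21 k : 1 <= 2 ^+ k :> R by rewrite exprn_ege1// ler1n.
have sk k : 0 < t - t / 2 / 2 ^+ k /\ t - t / 2 / 2 ^+ k < t.
  have h : 0 < t / 2 / 2 ^+ k by rewrite !divr_gt0.
  have h2 : t / 2 / 2 ^+ k <= t / 2 by rewrite ler_pdivrMr// ler_peMr// divr_ge0// ltW.
  split; lra.
have K0 : 0 <= K by exact: sqrtr_ge0.
have skS k : t - t / 2 / 2 ^+ k <= t - t / 2 / 2 ^+ k.+1.
  have h : 0 < t / 2 / 2 ^+ k by rewrite !divr_gt0.
  have -> : t / 2 / 2 ^+ k.+1 = (t / 2 / 2 ^+ k) / 2 by rewrite exprS; field; rewrite gt_eqF.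
  lra.
have [l Hl] : exists l, forall k, `|l - u k| <= 2 * (K * t) / 2 ^+ k.
  apply: (@geo_complete_rV R n) => k; have [a0 at_] := sk k; have [b0 bt] := sk k.+1.
  rewrite /u (uniq _ _ (ltW a0) (skS k) bt).
  apply: (le_trans (lip _ _ _ (ltW b0) bt a0 (skS k) (lexx _))).
  have h : 0 < t / 2 / 2 ^+ k by rewrite !divr_gt0.
  have -> : t / 2 / 2 ^+ k.+1 = (t / 2 / 2 ^+ k) / 2 by rewrite exprS; field; rewrite gt_eqF.
  rewrite -[leRHS]mulrA ler_wpM2l//.
  rewrite (_ : t / 2 ^+ k = (t / 2 / 2 ^+ k) * 2); last by field; rewrite gt_eqF.
  lra.
have ul : u @ \oo --> l.
  apply/cvgrPdist_lt => eps eps0.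
  have [N HN] : exists N, forall k, (N <= k)%N -> 2 * (K * t) / 2 ^+ k < eps.
    exact: geometric_small.
  exists N => // k Nk; exact: (le_lt_trans (Hl k) (HN k Nk)).
have eu k : e (u k) = chart_inv g q (seg x y (t - t / 2 / 2 ^+ k)).
  have [a0 at_] := sk k; have [H1 _] := HC _ (ltW a0) at_.
  have ss : 0 <= t - t / 2 / 2 ^+ k <= t - t / 2 / 2 ^+ k by rewrite ltW//= lexx.
  by have [_ h] := H1 _ ss; exact: nbhs_singleton h.
have skt : (fun k => t - t / 2 / 2 ^+ k) @ \oo --> t.
  apply/cvgrPdist_lt => eps eps0.
  have [N HN] := geometric_small (t / 2) eps0.
  by exists N => // k Nk; rewrite opprB addrC subrK gtr0_norm ?HN// !divr_gt0.
have el : e l = chart_inv g q (seg x y t).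
  have h1 : (e \o u) @ \oo --> e l by apply: continuous_cvg => //; exact: (exp_continuous E).
  have h2 : (e \o u) @ \oo --> chart_inv g q (seg x y t).
    rewrite (_ : e \o u = (fun s => chart_inv g q (seg x y s)) \o (fun k => t - t / 2 / 2 ^+ k)).
      exact: (cvg_comp _ _ skt (cy t)).
    by apply/funext => k; exact: eu.
  by apply: (cvg_unique (manifold_hausdorff g) h1 h2).
have [W [s [rho [rho0 nW sv HW inj]]]] := exp_local_section E l.
rewrite el in nW.
have /near_normP [d d0 Hd] : \forall z \near t, W (chart_inv g q (seg x y z)) by exact: (cy t _ nW).
have /cvgrPdist_lt /(_ rho rho0) [N1 _ HN1] := ul.
have /cvgrPdist_lt /(_ (d / 2)) [|N2 _ HN2] := skt; first by rewrite divr_gt0.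
pose k := maxn N1 N2.
have k1 : `|u k - l| < rho by rewrite distrC; apply: HN1; exact: leq_maxl.
have k2 : `|t - (t - t / 2 / 2 ^+ k)| < d / 2 by apply: HN2; exact: leq_maxr.
have [a0 at_] := sk k.
set a := t - t / 2 / 2 ^+ k in k2 a0 at_.
have ad : t < a + d / 2 by move: k2; rewrite ltr_norml => /andP[_]; lra.
exists a, (d / 2), (C a), (fun z => s (chart_inv g q (seg x y z))).
have Wr (z : R) : `|z - a| < d / 2 -> W (chart_inv g q (seg x y z)).
  move=> za; apply: Hd; apply: (le_lt_trans (ler_distD a _ _)); rewrite (distrC a); lra.
split; [exact: ltW|exact: ltW|exact: ad|exact: HC (ltW a0) at_|split].
  have aa : `|a - a| < d / 2 by rewrite subrr normr0 divr_gt0.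
  have [h1 h2 _] := HW _ (Wr a aa).
  have eua : e (C a a) = chart_inv g q (seg x y a) by exact: eu.
  by apply: inj; [exact: k1|exact: h2|rewrite h1].
move=> z za; have [h1 h2 h3] := HW _ (Wr z za); split; last exact: h1.
by apply: (continuous_comp (cy z)); exact: h3.
Qed.

(** The neighbourhood is chosen before the preimage: from any [v] over a chart ball, lifting the
    chart segments that start at [e v] gives a section over the whole ball, continuous by
    [lift_family]. This is the covering property. *)
Lemma uniform_section q : exists2 U : set M, nbhs q U & forall v, U (e v) ->
  exists2 s : M -> V, s (e v) = v & forall x, U x -> e (s x) = x /\ {for x, continuous s}.
Proof.
have qq := chart_dom_center g q; have iq := chart_img_chart qq.
have [r [B [r0 B0 HB]]] := metric_bounds iq.
exists [set x | chart_dom g q x /\ `|chart g q x - chart g q q| < r].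
  by apply: filterI; [exact: chart_dom_nbhs|exact: (near_continuous_lt (chart_cont qq) r0)].
move=> v [qv vr]; set x0 := chart g q (e v).
have ev : e v = chart_inv g q x0 by rewrite /x0 chartK.
pose H (t : R) (x : V) := chart_inv g q (seg x0 x t).
have [L HL] : {L : V -> R -> V & forall x, `|x - chart g q q| < r -> lifts e (H^~ x) 1 (L x) /\ L x 0 = v}.
  apply: (@choice _ _ (fun x l => `|x - chart g q q| < r -> lifts e (H^~ x) 1 l /\ l 0 = v)) => x.
  have [xr|xr] := pselect (`|x - chart g q q| < r); last by exists (fun=> v) => h; exfalso; apply: xr.
  by have [l Hl l0] := segment_lift r0 B0 HB vr xr ev; exists l.
have seg1 x : seg x0 x 1 = x by rewrite /seg clamp01_id ?ler01 ?lexx// scale1r addrC subrK.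
have o01 : 0 <= (1 : R) <= 1 by rewrite ler01 lexx.
exists (fun x => L (chart g q x) 1).
  rewrite -/x0; have [Hl l0] := HL x0 vr.
  apply: (@lift_unique R n M g c o e E (L x0) (fun=> v) 1 _ l0 1 o01) => t t01.
  have [cl el] := Hl t t01; split; first exact: cl.
  split; first exact: cvg_cst.
  by apply: filterS el => z ->; rewrite /H /seg subrr scaler0 addr0.
move=> x [qx xr]; have [Hl _] := HL _ xr; split.
  by have [_ /nbhs_singleton ->] := Hl 1 o01; rewrite /H seg1 chartK.
have nx : \forall y \near chart g q x, `|y - chart g q q| < r.
  apply/near_normP; exists (r - `|chart g q x - chart g q q|); first by rewrite subr_gt0.
  by move=> y; exact: dist_lt_trans.
suff cL : {for chart g q x, continuous (fun y => L y 1)} by exact: (continuous_comp (chart_cont qx) cL).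
apply: (lift_family E (H := H)) => //.
- by apply: filterS nx => y /HL [].
- move=> t t01; apply: (@continuous_comp _ _ _ (fun z : R * V => seg x0 z.2 z.1) (chart_inv g q)); first exact: seg_cont2.
  apply: chart_inv_cont; apply: (HB _ _).1; apply: convex_ball => //; exact: clamp01_itv.
- have cv : {for chart g q x, continuous (fun _ : V => v)} by exact: cst_continuous.
  by apply: (cont_near_eq _ cv); apply: filterS nx => y /HL [_ ->].
Qed.

(** A merely continuous path gives no bound on its lift; but wherever the lift is shortly before t,
    the section over the fixed neighbourhood of [y t] takes it across. *)
Lemma path_lift (y : R -> M) (v : V) : continuous y -> e v = y 0 -> exists2 l, lifts e y 1 l & l 0 = v.
Proof.
move=> cy e0; apply: (lift_extend E cy e0) => t t0 t1 Hs.
have [U nU HU] := uniform_section (y t).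
have /near_normP [d d0 Hd] : \forall z \near t, U (y z) by exact: (cy t _ nU).
pose s := Num.max 0 (t - d / 4).
have s0 : 0 <= s by rewrite le_max lexx.
have st : s < t by rewrite gt_max t0; lra.
have ts : t - d / 4 <= s by rewrite le_max lexx orbT.
have [l Hl l0] := Hs s s0 st.
have ss : 0 <= s <= s by rewrite s0 lexx.
have [_ /nbhs_singleton es] := Hl s ss.
have Uz (z : R) : `|z - s| < d / 2 -> U (y z).
  move=> zs; apply: Hd; apply: (le_lt_trans (ler_distD s _ _)).
  have : `|s - t| <= d / 4 by rewrite ler_norml; lra.
  lra.
have Us : U (e (l s)) by rewrite es; apply: Uz; rewrite subrr normr0 divr_gt0.
have [s' sl Hs'] := HU _ Us.
exists s, (d / 2), l, (s' \o y); split; [exact: s0|exact: ltW|lra|by split|split; first by rewrite /= -es].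
move=> z zs; have [h1 h2] := Hs' _ (Uz z zs); split; last exact: h1.
by apply: (continuous_comp (cy z)); exact: h2.
Qed.

Lemma clamp_path_continuous (f : R -> M) : {within `[0, 1], continuous f} -> continuous (f \o @clamp01 R).
Proof.
move=> cf t; have := clamp01_itv t => /andP[t0 t1].
have h : f @ within `[0, 1]%classic (nbhs (clamp01 t)) --> f (clamp01 t).
  by move/subspace_continuousP: cf; apply; rewrite /= in_itv /= t0.
move=> A /h HA; have HB : nbhs t (@clamp01 R @^-1` _) := @clamp01_continuous R t _ HA.
suff h2 : nbhs t ((f \o @clamp01 R) @^-1` A) by [].
by apply: filterS HB => z /=; apply; rewrite /= in_itv /=; exact: clamp01_itv.
Qed.

Lemma clamp_square_continuous (H : R * R -> M) : {within (`[0, 1] `*` `[0, 1])%classic, continuous H} ->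
  continuous (fun z : R * R => H (clamp01 z.1, clamp01 z.2)).
Proof.
move=> cH [t s]; have := clamp01_itv t => /andP[t0 t1]; have := clamp01_itv s => /andP[s0 s1].
have h : H @ within (`[0, 1] `*` `[0, 1])%classic (nbhs (clamp01 t, clamp01 s)) --> H (clamp01 t, clamp01 s).
  by move/subspace_continuousP: cH; apply; split; rewrite /= in_itv /= ?t0 ?s0.
have cc : {for (t, s), continuous (fun z : R * R => (clamp01 z.1, clamp01 z.2))}.
  apply: cont_pair.
    by apply: (@continuous_comp _ _ _ (@fst R R) (@clamp01 R)); [exact: cvg_fst|exact: clamp01_continuous].
  by apply: (@continuous_comp _ _ _ (@snd R R) (@clamp01 R)); [exact: cvg_snd|exact: clamp01_continuous].
move=> A /h HA; have HB : nbhs (t, s) ((fun z : R * R => (clamp01 z.1, clamp01 z.2)) @^-1` _) := cc _ HA.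
suff h2 : nbhs (t, s) ((fun z : R * R => H (clamp01 z.1, clamp01 z.2)) @^-1` A) by [].
by apply: filterS HB => z /=; apply; split; rewrite /= in_itv /=; exact: clamp01_itv.
Qed.

(** If u and v have the same image, the segment from u to v maps to a loop, and its contraction
    lifts with initial point u. The endpoints of the lifts form a continuous lift of a constant
    path, so they are constant; they run from v to u. *)
Theorem exp_bijective : simply_connected R M -> (forall x, exists v, e v = x) /\ injective e.
Proof.
move=> [pc sc]; have o01 : 0 <= (1 : R) <= 1 by rewrite ler01 lexx.
have z01 : 0 <= (0 : R) <= 1 by rewrite ler01 lexx.
split.
  move=> x; have [f [cf f0 f1]] := pc o x.
  have cy := clamp_path_continuous cf.
  have [|l Hl l0] := @path_lift (f \o @clamp01 R) 0 cy.
    by rewrite /= clamp01_id// f0 (exp0 E).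
  exists (l 1); have [_ /nbhs_singleton ->] := Hl 1 o01.
  by rewrite /= clamp01_id.
move=> u v euv; pose f (t : R) := e (u + t *: (v - u)).
have cl : continuous (fun t : R => u + t *: (v - u)).
  by move=> t; exact: (is_derive_continuous (is_derive_line u (v - u) t)).
have cf : {within `[0, 1], continuous f}.
  by apply: continuous_subspaceT => t; apply: (continuous_comp (cl t)); exact: (exp_continuous E).
have f0 : f 0 = e u by rewrite /f scale0r addr0.
have f1 : f 1 = e v by rewrite /f scale1r addrC subrK.
have [|H [cH H0 H1 Hl Hr]] := sc f cf; first by rewrite f0 f1.
pose Hc (t s : R) := H (clamp01 t, clamp01 s).
have cHc := clamp_square_continuous cH.
have cHs s : continuous (fun t => Hc t s).
  move=> t; apply: (@continuous_comp _ _ _ (fun t => (t, s)) (fun z : R * R => H (clamp01 z.1, clamp01 z.2))); last exact: cHc.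
  by apply: cont_pair; [exact: cvg_id|exact: cvg_cst].
have [L HL] : {L : R -> R -> V & forall s, lifts e (Hc^~ s) 1 (L s) /\ L s 0 = u}.
  apply: (@choice _ _ (fun s l => lifts e (Hc^~ s) 1 l /\ l 0 = u)) => s.
  have [|l h1 h2] := @path_lift (Hc^~ s) u (cHs s); last by exists l.
  by rewrite /Hc clamp01_id// Hl ?clamp01_itv// f0.
have cL1 (s : R) : {for s, continuous (fun s => L s 1)}.
  apply: (lift_family E (H := Hc) (s0 := s)) => //.
  - by apply: filterE => s'; have [] := HL s'.
  - by move=> t _; exact: cHc.
  - have e1 : (fun s' => L s' 0) = fun=> u by apply/funext => s'; have [] := HL s'.
    by rewrite e1; exact: cvg_cst.
have eL1 s : e (L s 1) = e u.
  have [Hl1 _] := HL s; have [_ /nbhs_singleton ->] := Hl1 1 o01.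
  by rewrite /Hc clamp01_id// Hr ?clamp01_itv// f0.
have e10 : L 1 1 = L 0 1.
  apply: (@lift_unique R n M g c o e E (fun s => L s 1) (fun=> L 0 1) 1 _ (erefl _) 1 o01) => t _.
  split; first exact: cL1.
  split; first exact: cvg_cst.
  by apply: filterE => z; rewrite !eL1.
have eL1u : L 1 1 = u.
  have [Hl1 l0] := HL 1.
  apply: (@lift_unique R n M g c o e E (L 1) (fun=> u) 1 _ l0 1 o01) => t t01.
  have [c1 e1] := Hl1 t t01; split; first exact: c1.
  split; first exact: cvg_cst.
  by apply: filterS e1 => z ->; rewrite /Hc (clamp01_id o01) H1 ?clamp01_itv// f0.
have eL0v : L 0 1 = v.
  have [Hl1 l0] := HL 0.
  have -> : v = u + clamp01 1 *: (v - u) by rewrite clamp01_id// scale1r addrC subrK.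
  have l0' : L 0 0 = u + clamp01 0 *: (v - u) by rewrite l0 clamp01_id// scale0r addr0.
  apply: (@lift_unique R n M g c o e E (L 0) (fun t => u + clamp01 t *: (v - u)) 1 _ l0' 1 o01) => t t01.
  have [c1 e1] := Hl1 t t01; split; first exact: c1.
  split.
    by apply: (@continuous_comp _ _ _ (@clamp01 R) (fun t : R => u + t *: (v - u))); [exact: clamp01_continuous|exact: cl].
  by apply: filterS e1 => z ->; rewrite /Hc (clamp01_id z01) H0 ?clamp01_itv.
by rewrite -eL1u e10 eL0v.
Qed.
End Bijectivity.

(** * Volume of small balls *)

Section LebesgueInt.
Local Open Scope ereal_scope.

(** The integral of a nonnegative function is a supremum over simple functions below it, so
    monotonicity holds without measurability, which is not established for the inner integrals of
    [lebesgue_int]. *)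
Lemma le_integral_ge0 d (T : measurableType d) (R : realType) (m : {measure set T -> \bar R}) (f1 f2 : T -> \bar R) :
  (forall x, 0 <= f1 x) -> (forall x, f1 x <= f2 x) -> \int[m]_x f1 x <= \int[m]_x f2 x.
Proof.
move=> f0 f12; have g0 x : 0 <= f2 x by exact: le_trans (f12 x).
rewrite !ge0_integralTE//; apply: le_ereal_sup => _ [h hf <-]; exists h => // x.
exact: le_trans (f12 x).
Qed.

Lemma lebesgue_int_ge0 (R : realType) n (f : 'rV[R]_n -> \bar R) : (forall x, 0 <= f x) -> 0 <= lebesgue_int f.
Proof.
elim: n f => [|n IH] f f0 /=; first exact: f0.
by apply: integral_ge0 => t _; apply: IH => y; exact: f0.
Qed.

Lemma le_lebesgue_int (R : realType) n (f1 f2 : 'rV[R]_n -> \bar R) : (forall x, 0 <= f1 x) ->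
  (forall x, f1 x <= f2 x) -> lebesgue_int f1 <= lebesgue_int f2.
Proof.
elim: n f1 f2 => [|n IH] f1 f2 f0 f12 /=; first exact: f12.
apply: le_integral_ge0 => t; first by apply: lebesgue_int_ge0 => y; exact: f0.
by apply: IH => y; [exact: f0|exact: f12].
Qed.

Lemma integral_indic_itv (R : realType) (a b k : R) : (a <= b)%R -> (0 <= k)%R ->
  \int[@lebesgue_measure R]_t (k * \1_(`]a, b[%classic) t)%:E = (k * (b - a))%:E.
Proof.
move=> ab k0.
transitivity (\int[@lebesgue_measure R]_(t in `]a, b[%classic) (cst k%:E t)).
  rewrite [RHS]integral_mkcond; apply: eq_integral => t _.
  by rewrite /patch indicE; case: ifP => _; rewrite ?mulr1 ?mulr0.
rewrite integral_cst//= lebesgue_measure_itv /= lte_fin.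
case: ltP => [_|ba]; first by rewrite EFinM EFinB.
have -> : (b - a = 0)%R by apply/eqP; rewrite subr_eq0 eq_le ab ba.
by rewrite mule0 mulr0.
Qed.
End LebesgueInt.

Section Ellipsoid.
Variable R : realType.

Lemma bilin_block n (a : 'M[R]_1) (b : 'rV[R]_n) (b' : 'cV[R]_n) (G : 'M[R]_n) (s t : R) (y z : 'rV[R]_n) :
  bilin (block_mx a b b' G : 'M[R]_(1 + n)) (row_mx s%:M y) (row_mx t%:M z) =
  s * a 0 0 * t + t * (y *m b') 0 0 + s * (b *m z^T) 0 0 + bilin G y z.
Proof.
rewrite /bilin mul_row_block tr_row_mx mul_row_col tr_scalar_mx mul_mx_scalar !mul_scalar_mx.
have mD (A B : 'M[R]_1) : (A + B) 0 0 = A 0 0 + B 0 0 by rewrite mxE.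
have mZ (k : R) (A : 'M[R]_1) : (k *: A) 0 0 = k * A 0 0 by rewrite mxE.
by rewrite mulmxDl -scalemxAl !(mD, mZ); ring.
Qed.

(** By slicing, with induction on the dimension; the constant [c] must not depend on the form. The
    factor [k] is carried inside so that constants never have to be pulled out of iterated
    integrals. *)
Lemma ellipsoid_volume n : exists2 c : R, 0 < c & forall (G : 'M[R]_n) (x0 : 'rV[R]_n) (k eta : R),
  G^T = G -> (forall u, u != 0 -> 0 < bilin G u u) -> 0 <= k -> 0 < eta ->
  0 < \det G /\ ((k * c * eta ^+ n / Num.sqrt (\det G))%:E <=
   lebesgue_int (fun x => (k * \1_([set x | bilin G (x - x0) (x - x0) < eta ^+ 2]) x)%:E))%E.
Proof.
elim: n => [|n [c c0 IH]].
  exists 1 => // G x0 k eta _ _ k0 eta0; rewrite det_mx00 ltr01; split => //=.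
  rewrite expr0 sqrtr1 divr1 !mulr1 lee_fin indicE mem_set ?mulr1//=.
  by rewrite bilinE big_ord0 exprn_gt0.
exists (c * Num.sqrt 2 / Num.sqrt 2 ^+ n).
  by rewrite divr_gt0 ?mulr_gt0 ?exprn_gt0 ?sqrtr_gt0.
move=> G x0 k eta sG pG k0 eta0.
pose G1 : 'M[R]_(1 + n) := G.
pose a := ulsubmx G1; pose b := ursubmx G1; pose b' := dlsubmx G1; pose G' := drsubmx G1.
have pG1 (u : 'rV[R]_(1 + n)) : u != 0 -> 0 < bilin G1 u u by exact: pG.
have GE : G1 = block_mx a b b' G' by rewrite submxK.
have [ta tb tG] : [/\ a^T = a, b' = b^T & G'^T = G'].
  have h : G1^T = G1 := sG; rewrite GE tr_block_mx in h; have [h1 h2 h3 h4] := eq_block_mx h.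
  by split => //; rewrite -h2.
have pG' u : u != 0 -> 0 < bilin G' u u.
  move=> u0; have := pG1 (row_mx (0 : R)%:M u).
  have -> : bilin G1 (row_mx (0 : R)%:M u) (row_mx (0 : R)%:M u) = bilin G' u u.
    rewrite GE bilin_block.
    by rewrite !mul0r !add0r.
  apply; apply: contra_neq u0 => /(congr1 (@rsubmx R 1 1 n)); rewrite row_mxKr => ->; exact: linear0.
have [dG' _] := IH G' 0 0 1 tG pG' (lexx 0) ltr01.
have uG' := bilin_unitmx tG pG'.
pose v := b *m invmx G'.
(* The Schur complement: by [key] the form is s t^2 plus the form [G'] at a sheared vector, so the
   slice at t is a translated ellipsoid, and det G = s det G'. *)
pose s := a 0 0 - (v *m b') 0 0.
have key (t : R) (y : 'rV[R]_n) : bilin G1 (row_mx t%:M y) (row_mx t%:M y) =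
    s * t ^+ 2 + bilin G' (y + t *: v) (y + t *: v).
  rewrite GE bilin_block !bilinE_ /s.
  have vG : v *m G' = b by rewrite /v mulmxKV.
  have e1 z : bilin G' v z = (b *m z^T) 0 0 by rewrite /bilin vG.
  have tc (x1 x2 : 'rV[R]_n) : (x1 *m x2^T) 0 0 = (x2 *m x1^T) 0 0.
    by rewrite !mxE; apply: eq_bigr => i _; rewrite !mxE mulrC.
  have e2 z : bilin G' z v = (z *m b') 0 0 by rewrite (bilinC z v tG) e1 tb tc.
  rewrite !e1 e2; have -> : (b *m v^T) 0 0 = (v *m b') 0 0 by rewrite tb tc.
  have -> : (b *m y^T) 0 0 = (y *m b') 0 0 by rewrite tb tc.
  ring.
have s0 : 0 < s.
  have := pG1 (row_mx 1%:M (- v)); rewrite key scale1r addNr bilin0l addr0 expr1n mulr1; apply.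
  by apply/eqP => /(congr1 (@lsubmx R 1 1 n)); rewrite row_mxKl => /matrixP /(_ 0 0); rewrite !mxE eqxx => /eqP; rewrite oner_eq0.
have dE : \det G1 = s * \det G'.
  have e : block_mx 1%:M (- v) 0 1%:M *m G1 = block_mx s%:M 0 b' G'.
    rewrite GE mulmx_block !mul1mx !mul0mx !add0r !mulNmx.
    congr block_mx; last by rewrite /v mulmxKV// subrr.
    by apply/matrixP => i j; rewrite !ord1 !mxE /s !mxE eqxx.
  have := congr1 determinant e; rewrite det_mulmx det_ublock !det1 !mul1r det_lblock det_scalar1.
  by move=> <-.
have dG : 0 < \det G1 by rewrite dE mulr_gt0.
split => //.
pose t0 : R := lsubmx (x0 : 'rV[R]_(1 + n)) 0 0; pose y0 := rsubmx (x0 : 'rV[R]_(1 + n)).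
have x0E : x0 = row_mx t0%:M y0 :> 'rV[R]_(1 + n).
  apply: (etrans (esym (hsubmxK (x0 : 'rV[R]_(1 + n))))); congr row_mx; exact: mx11_scalar.
(* For |t - t0| < tau the first square takes less than half of eta^2, and the slice of radius eta /
   sqrt(2) takes the other half. *)
pose tau := eta / Num.sqrt (2 * s); have tau0 : 0 < tau by rewrite divr_gt0// sqrtr_gt0 mulr_gt0.
have s2 : 0 < Num.sqrt 2 :> R by rewrite sqrtr_gt0.
have eta2 : 0 < eta / Num.sqrt 2 by rewrite divr_gt0.
pose k1 := k * c * (eta / Num.sqrt 2) ^+ n / Num.sqrt (\det G').
have k10 : 0 <= k1 by rewrite divr_ge0 ?sqrtr_ge0// !mulr_ge0 ?exprn_ge0 ?(ltW c0) ?(ltW eta2).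
rewrite [leRHS]/=.
have -> : (k * (c * Num.sqrt 2 / Num.sqrt 2 ^+ n) * eta ^+ n.+1 / Num.sqrt (\det G)) =
   k1 * ((t0 + tau) - (t0 - tau)).
  rewrite [\det G]dE sqrtrM ?(ltW s0)// /k1 /tau sqrtrM// expr_div_n exprS.
  have e2 : Num.sqrt 2 * Num.sqrt 2 = 2 :> R by rewrite -expr2 sqr_sqrtr.
  rewrite (_ : t0 + _ - _ = (eta / (Num.sqrt 2 * Num.sqrt s)) * (Num.sqrt 2 * Num.sqrt 2)); last by rewrite e2; ring.
  field; do ?(apply/andP; split); rewrite ?gt_eqF ?exprn_gt0 ?sqrtr_gt0//.
rewrite -integral_indic_itv//; last by lra.
apply: le_integral_ge0 => t; first by rewrite lee_fin mulr_ge0.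
rewrite indicE; case: (boolP (t \in _)) => [|_]; last first.
  by rewrite mulr0; apply: lebesgue_int_ge0 => y; rewrite lee_fin mulr_ge0.
rewrite inE /= in_itv /= => /andP[t1 t2]; rewrite mulr1.
have [_ h] := IH G' (y0 - (t - t0) *: v) k (eta / Num.sqrt 2) tG pG' k0 eta2.
apply: (le_trans h); apply: le_lebesgue_int => y; first by rewrite lee_fin mulr_ge0.
rewrite lee_fin ler_wpM2l// !indicE ler_nat.
case: (boolP (y \in _)) => //; rewrite inE /= => hy; rewrite mem_set//=.
have -> : (row_mx t%:M y : 'rV[R]_(1 + n)) - x0 = row_mx (t - t0)%:M (y - y0) :> 'rV[R]_(1 + n).
  have e3 : (row_mx t%:M y : 'rV[R]_(1 + n)) - row_mx t0%:M y0 = row_mx (t - t0)%:M (y - y0).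
    by rewrite opp_row_mx add_row_mx raddfB.
  exact: (etrans (congr1 (fun z : 'rV[R]_(1 + n) => row_mx t%:M y - z) x0E) e3).
rewrite [bilin _ _ _]key.
have tt : s * (t - t0) ^+ 2 < eta ^+ 2 / 2.
  have : (t - t0) ^+ 2 < tau ^+ 2.
    rewrite -real_normK ?num_real// ltr_pXn2r ?nnegrE// ?(ltW tau0)// ltr_norml; lra.
  rewrite /tau expr_div_n sqr_sqrtr; last by rewrite mulr_ge0// ltW.
  rewrite ltr_pdivlMr ?mulr_gt0//; lra.
have h2 : bilin G' (y - y0 + (t - t0) *: v) (y - y0 + (t - t0) *: v) < eta ^+ 2 / 2.
  have -> : y - y0 + (t - t0) *: v = y - (y0 - (t - t0) *: v) by rewrite opprB addrA addrAC.
  by move: hy; rewrite expr_div_n sqr_sqrtr.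
lra.
Qed.
End Ellipsoid.

Section SmallBalls.
Variables (R : realType) (n : nat) (M : ptopologicalType) (g : riemannian R n M).
Variable mu : {sigma_finite_measure set (g_sigma_algebraType (@open M)) -> \bar R}.
Hypothesis hmu : riemannian_volume g mu.
Local Notation V := 'rV[R]_n.
Local Notation borelM := (g_sigma_algebraType (@open M)).

Lemma open_measurable_manifold (A : set borelM) : open (A : set M) -> measurable A.
Proof. by move=> oA; apply: sub_sigma_algebra. Qed.

(** Uniform densities live on sets of finite measure. Along an exhaustion by such sets the measure
    converges from below, so an arbitrarily small loss suffices. *)
Lemma sigma_finite_trim (A : set borelM) (a b : R) : measurable A -> (a%:E <= mu A)%E -> b < a ->
  exists B : set borelM, [/\ measurable B, B `<=` A, (b%:E <= mu B)%E & (mu B < +oo)%E].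
Proof.
move=> mA aA ba.
have /sigma_finiteP [F [FT ndF Ffin]] := sigma_finiteT mu.
have mF k : measurable (A `&` F k) by apply: measurableI => //; have [] := Ffin k.
have [[k bk]|nk] := pselect (exists k, (b%:E <= mu (A `&` F k))%E).
  exists (A `&` F k); split => //.
  have [mFk] := Ffin k; apply: le_lt_trans; apply: le_measure; rewrite ?inE//.
have UA : \bigcup_k (A `&` F k) = A by rewrite -setI_bigcupr -FT setIT.
have ndA : nondecreasing_seq (fun k => A `&` F k).
  by move=> i j ij; apply/subsetPset; apply: setIS; apply/subsetPset; exact: ndF.
have mU : measurable (\bigcup_k (A `&` F k)) by rewrite UA.
have cv := nondecreasing_cvg_mu (mu := mu) mF mU ndA; rewrite UA in cv.
have : (mu A <= b%:E)%E.
  rewrite -(cvg_lim (@ereal_hausdorff R) cv); apply: lime_le; first by apply/cvg_ex; exists (mu A).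
  by apply: nearW => k; rewrite leNgt; apply/negP => h; apply: nk; exists k; exact: ltW.
by move=> /(le_trans aA); rewrite lee_fin leNgt ba.
Qed.

(** With the factors 4, lengths measured by the metric at the centre at most double and the volume
    density at least halves. The tolerance [e] on the entries changes the form by at most n^2 e
    |v|^2, which is less than three times the form at the centre unless v vanishes. *)
Lemma metric_compare p : exists2 r : R, 0 < r & forall y : V, `|y - chart g p p| < r ->
  [/\ chart_img g p y, forall v, bilin (metric g p y) v v <= 4 * bilin (metric g p (chart g p p)) v v &
    \det (metric g p (chart g p p)) <= 4 * \det (metric g p y)].
Proof.
set x := chart g p p; have ix : chart_img g p x by apply: chart_img_chart; exact: chart_dom_center.
have [r1 [B [r10 B0 HB]]] := metric_bounds ix.
have [_ [Hx]] : chart_img g p x /\ ((forall v, `|v| ^+ 2 <= B * bilin (metric g p x) v v) /\ True).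
  have [|h1 h2] := HB x; first by rewrite subrr normr0.
  by split => //; split => // v; have [] := h2 v.
move=> _.
have gC i j : C11 (fun z => metric g p z i j : R) x.
  by apply: (C11_metric (@chart_img_open R n M g p) _ _ _ ix); move=> ? ?; exact: metric_smooth.
have pd : 0 < \det (metric g p x).
  have [c c0 H] := ellipsoid_volume R n.
  by have [h _] := H (metric g p x) 0 0 1 (Defs.metric_sym ix) (metric_inv_pos ix) (lexx 0) ltr01.
pose e := 3 / (B * (n%:R * n%:R + 1)).
have nn : 0 < n%:R * n%:R + 1 :> R by rewrite ltr_wpDl// mulr_ge0.
have e0 : 0 < e by rewrite divr_gt0// mulr_gt0.
have N1 : \forall y \near x, forall i j, `|metric g p y i j - metric g p x i j| < e.
  apply: (@filter_forall _ _ _ (nbhs x)) => i; apply: (@filter_forall _ _ _ (nbhs x)) => j.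
  exact: (near_continuous_lt (C11_continuous (gC i j)) e0).
have d0 : 0 < 3 / 4 * \det (metric g p x) by rewrite mulr_gt0.
have N2 := near_continuous_lt (C11_continuous (C11_det gC)) d0.
have /near_normP [r r0 Hr] : \forall y \near x, (forall i j, `|metric g p y i j - metric g p x i j| < e) /\
  `|\det (metric g p y) - \det (metric g p x)| < 3 / 4 * \det (metric g p x) by apply: filterI.
exists (Num.min r r1); first by rewrite lt_min r0.
move=> y; rewrite lt_min => /andP[yr yr1]; have [h1 h2] := Hr y yr.
split.
- by have [] := HB y yr1.
- move=> v.
  have -> : bilin (metric g p y) v v = bilin (metric g p x) v v + bilin (metric g p y - metric g p x) v v.
    by rewrite /bilin mulmxBr mulmxBl !mxE; ring.
  have : bilin (metric g p y - metric g p x) v v <= 3 * bilin (metric g p x) v v.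
    apply: (@le_trans _ _ (\sum_(i < n) \sum_(j < n) e * `|v| ^+ 2)).
      rewrite bilinE; apply: ler_sum => i _; apply: ler_sum => j _.
      apply: (le_trans (ler_norm _)); rewrite !normrM (_ : _ * _ * _ = `|(metric g p y - metric g p x) i j| * (`|v 0 i| * `|v 0 j|)); last by ring.
      apply: ler_pM => //; first by rewrite !mxE ltW.
      by rewrite expr2; apply: ler_pM => //; exact: coord_le_norm.
    have -> : \sum_(i < n) \sum_(j < n) e * `|v| ^+ 2 = n%:R * n%:R * (e * `|v| ^+ 2).
      rewrite (eq_bigr (fun=> n%:R * (e * `|v| ^+ 2))) => [|i _]; last first.
        by rewrite sumr_const card_ord -[LHS]mulr_natl.
      by rewrite sumr_const card_ord -[LHS]mulr_natl mulrA.
    apply: (@le_trans _ _ ((n%:R * n%:R + 1) * (e * (B * bilin (metric g p x) v v)))).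
      have a1 : 0 <= n%:R * n%:R :> R by rewrite mulr_ge0.
      have a2 : 0 <= e * `|v| ^+ 2 by rewrite mulr_ge0 ?(ltW e0)// exprn_ge0.
      have a3 : n%:R * n%:R <= n%:R * n%:R + 1 :> R by rewrite lerDl.
      have a4 : e * `|v| ^+ 2 <= e * (B * bilin (metric g p x) v v) by rewrite ler_wpM2l ?(ltW e0).
      exact: (ler_pM a1 a2 a3 a4).
    rewrite le_eqVlt; apply/orP; left; apply/eqP; rewrite /e; field.
    by rewrite !gt_eqF.
  lra.
- by move: h2; rewrite ltr_norml => /andP[]; lra.
Qed.

(** [curve_length] is directed, so curves towards q and away from q are both recorded; a
    concatenation through q uses one of each. *)
Definition small_ball (kappa delta : R) (q : M) := exists A : set borelM,
  [/\ measurable A, ((kappa * delta ^+ n)%:E <= mu A)%E, (mu A < +oo)%E &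
    forall z : M, A z -> (exists2 L, curve_length g z q L & L < delta) /\
                         (exists2 L, curve_length g q z L & L < delta)].

(** The set is an ellipsoid of the metric at p, of radius d / 8. The density sqrt(det) cancels the
    determinant in its Euclidean volume, so [kappa] is the same for all p. The factor 4 is a loss of
    2 in the density and of 2 in the trimming. Uniformity for q near p prepares a compactness
    argument. *)
Lemma small_balls : exists2 kappa : R, 0 < kappa & forall p : M,
  \forall q \near p & d \near (0 : R)^'+, small_ball kappa d q.
Proof.
have [c c0 Hc] := ellipsoid_volume R n.
exists (c / 4 / 8 ^+ n); first by rewrite !divr_gt0 ?exprn_gt0.
move=> p; set x0 := chart g p p; set G := metric g p x0.
have pp := chart_dom_center g p.
have ix : chart_img g p x0 by exact: chart_img_chart.
have sG : G^T = G by exact: Defs.metric_sym ix.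
have pG : forall u, u != 0 -> 0 < bilin G u u by exact: metric_inv_pos ix.
have [r r0 Hr] := metric_compare p.
have [r1 [B [r10 B0 HB]]] := metric_bounds ix.
have Hx v : `|v| ^+ 2 <= B * bilin G v v.
  by have [|_ h] := HB x0; [rewrite subrr normr0|have [] := h v].
have [dG _] := Hc G 0 0 1 sG pG (lexx 0) ltr01.
have key (q : M) (d : R) : 0 < d -> chart_dom g p q -> `|chart g p q - x0| < r / 2 ->
    Num.sqrt B * d < r / 2 -> small_ball (c / 4 / 8 ^+ n) d q.
  move=> d0 pq qr dr; set x' := chart g p q.
  pose eta := d / 8; have eta0 : 0 < eta by rewrite divr_gt0.
  pose S := [set x : V | bilin G (x - x') (x - x') < eta ^+ 2].
  have Sball x : S x -> `|x - x'| <= Num.sqrt B * eta.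
    move=> Sx; rewrite -[eta]ger0_norm ?(ltW eta0)// -sqrtr_sqr -sqrtrM ?(ltW B0)//.
    apply: le_sqrt_sqr => //; apply: (le_trans (Hx _)); rewrite ler_wpM2l ?(ltW B0)//.
    exact: ltW.
  have sB := sqrtr_ge0 B.
  have Sr (x : V) : `|x - x'| <= Num.sqrt B * eta -> `|x - x0| < r.
    move=> h; apply: (@le_lt_trans _ _ (`|x - x'| + `|x' - x0|)); first exact: ler_distD.
    have : Num.sqrt B * eta <= Num.sqrt B * d by rewrite ler_wpM2l// /eta; lra.
    move: qr; rewrite -/x'; lra.
  pose A0 : set borelM := [set z | chart_dom g p z /\ S (chart g p z)].
  have oA : open (A0 : set M).
    rewrite openE => z [pz Sz]; apply: filterI; first exact: chart_dom_nbhs.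
    have cS : {for z, continuous (fun z => bilin G (chart g p z - x') (chart g p z - x'))}.
      have Db : {for chart g p z, continuous (fun x : V => bilin G (x - x') (x - x'))}.
        have cc i : C11 (fun x : V => x 0 i - x' 0 i) (chart g p z).
          apply: C11_add; last exact: C11_cst.
          exact: (C11_coord i (C11_id (chart g p z))).
        have -> : (fun x : V => bilin G (x - x') (x - x')) =
            (fun x : V => \sum_i \sum_j (x 0 i - x' 0 i) * G i j * (x 0 j - x' 0 j)).
          by apply/funext => x; rewrite bilinE; apply: eq_bigr => i _; apply: eq_bigr => j _; rewrite !mxE.
        apply: C11_continuous; apply: C11_sum => i _; apply: C11_sum => j _; apply: C11_mul; last exact: cc.
        by apply: C11_mul; [exact: cc|exact: C11_cst].
      by apply: (@continuous_comp _ _ _ (chart g p) (fun x : V => bilin G (x - x') (x - x'))); [exact: chart_cont|exact: Db].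
    have e0 : 0 < eta ^+ 2 - bilin G (chart g p z - x') (chart g p z - x') by rewrite subr_gt0.
    apply: filterS (near_continuous_lt cS e0) => y; rewrite /S /= ltr_norml; lra.
  have mA := open_measurable_manifold oA.
  have lb : ((c / 2 * eta ^+ n)%:E <= mu A0)%E.
    rewrite (@hmu p A0 mA); last by move=> z [].
    pose k := Num.sqrt (\det G) / 2.
    have k0 : 0 <= k by rewrite divr_ge0 ?sqrtr_ge0.
    have [_ h] := Hc G x' k eta sG pG k0 eta0.
    have -> : c / 2 * eta ^+ n = k * c * eta ^+ n / Num.sqrt (\det G).
      by rewrite /k; field; rewrite gt_eqF// sqrtr_gt0.
    apply: (le_trans h); apply: le_lebesgue_int => x; first by rewrite lee_fin mulr_ge0.
    rewrite lee_fin !indicE; case: (boolP (x \in [set x | _])) => [|_]; last by rewrite mulr0 mulr_ge0 ?sqrtr_ge0.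
    rewrite inE => Sx; have xr := Sr x (Sball x Sx); have [imx _ hd] := Hr x xr.
    have -> : (x \in chart g p @` A0).
      rewrite inE; exists (chart_inv g p x); last exact: chart_invK.
      by split; [exact: chart_inv_dom|rewrite chart_invK].
    rewrite !mulr1 /k ler_pdivrMr// -(@ger0_norm _ 2)// -sqrtr_sqr mulrC -sqrtrM ?sqr_ge0//.
    by rewrite ler_wsqrtr// (_ : 2 ^+ 2 = 4)//; ring.
  have [|A [mA1 sA lA fA]] := @sigma_finite_trim A0 (c / 2 * eta ^+ n) (c / 4 * eta ^+ n) mA lb.
    by rewrite ltr_pM2r ?exprn_gt0//; lra.
  exists A; split => //.
    apply: le_trans lA; rewrite lee_fin /eta expr_div_n le_eqVlt; apply/orP; left; apply/eqP.
    by field; rewrite gt_eqF// exprn_gt0.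
  move=> z /sA [pz Sz]; set x := chart g p z in Sz.
  have xx : `|x' - x'| <= Num.sqrt B * eta by rewrite subrr normr0 mulr_ge0// ltW.
  have qform (k : R) : bilin G (k *: (x - x')) (k *: (x - x')) = k ^+ 2 * bilin G (x - x') (x - x').
    by rewrite !bilinE_; ring.
  have seg (a b : V) (j : R) : b - a = j *: (x - x') -> j ^+ 2 = 1 ->
     (forall t : R, 0 <= t <= 1 -> exists2 k : R, a + t *: (b - a) = x' + k *: (x - x') & 0 <= k <= 1) ->
     exists2 L, curve_length g (chart_inv g p a) (chart_inv g p b) L & L < d.
    move=> ba j2 H.
    have [||L cl Le] := @chart_segment R n M g p a b (2 * eta).
    - by rewrite mulr_ge0// ltW.
    - move=> t t01; have [k -> k01] := H t t01.
      have [|imx hm _] := Hr (x' + k *: (x - x')).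
        apply: Sr; rewrite addrAC subrr add0r normrZ; apply: le_trans (Sball x Sz).
        by case/andP: k01 => k0 k1; rewrite ger0_norm// ler_piMl.
      split => //; rewrite ba; apply: (le_trans (hm _)).
      rewrite qform j2 mul1r exprMn (_ : 2 ^+ 2 = 4); last by ring.
      by rewrite ler_wpM2l// ltW.
    by exists L => //; apply: (le_lt_trans Le); rewrite /eta; lra.
  split.
    rewrite -(chartK pz) -(chartK pq); apply: (seg x x' (-1)).
    - by rewrite scaleN1r opprB.
    - by rewrite sqrrN expr1n.
    - move=> t /andP[t0 t1]; exists (1 - t); last by apply/andP; split; lra.
      by lmod R.
  rewrite -(chartK pz) -(chartK pq); apply: (seg x' x 1).
  - by rewrite scale1r.
  - by rewrite expr1n.
  - by move=> t t01; exists t.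
pose d0 := r / 2 / (Num.sqrt B + 1).
have sB1 : 0 < Num.sqrt B + 1 by rewrite ltr_wpDl ?sqrtr_ge0.
have d00 : 0 < d0 by rewrite divr_gt0// divr_gt0.
exists ([set q | chart_dom g p q /\ `|chart g p q - x0| < r / 2], [set d : R | 0 < d < d0]) => /=.
  split.
    apply: filterI; first exact: chart_dom_nbhs.
    by apply: (near_continuous_lt (chart_cont pp)); rewrite divr_gt0.
  near=> d; apply/andP; split; near: d; [exact: nbhs_right_gt|exact: nbhs_right_lt].
move=> [q d] /= [[pq qr] /andP[dd0 dd]]; apply: key => //.
move: dd; rewrite /d0 ltr_pdivlMr//; lra.
Unshelve. all: by end_near. Qed.
End SmallBalls.

(** * Packing by polar coordinates *)

Section Logarithm.
Variables (R : realType) (n : nat) (M : ptopologicalType) (g : riemannian R n M).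
Local Notation V := 'rV[R]_n.
Variables (c : R) (o : M) (e : V -> M) (log : M -> V).
Hypotheses (E : exponential_map g c o e) (logK : cancel log e) (expK : cancel e log).
Local Notation G0 := (metric g o (chart g o o)).

Lemma log_continuous : continuous log.
Proof.
move=> x; have [W [s [rho [rho0 nW sv HW inj]]]] := exp_local_section E (log x).
rewrite logK in nW sv.
have [_ _ cs] := HW _ (nbhs_singleton nW).
apply: (cont_near_eq _ cs); apply: filterS nW => y /HW [h _ _].
by rewrite -[in RHS]h expK.
Qed.

Lemma log_derive (y : R -> M) (t : R) : C1_at g y t ->
  exists2 l', is_derive t 1 (log \o y) l' &
    speed g y t = Num.sqrt (bilin (metric g (y t) (chart g (y t) (e (log (y t)))))
      ('D_l' (fun v => chart g (y t) (e v)) (log (y t))) ('D_l' (fun v => chart g (y t) (e v)) (log (y t)))).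
Proof.
move=> C; have ct := chart_dom_center g (y t); have [nr _] := C1_at_chart C ct.
have [_ [D cy]] := nbhs_singleton nr.
have cl : {for t, continuous (log \o y)}.
  by apply: continuous_comp; [exact: cy|exact: log_continuous].
have ct' : chart_dom g (y t) (e ((log \o y) t)) by rewrite /= logK.
have D' : is_derive t 1 (fun s => chart g (y t) (e ((log \o y) s))) ('D_1 (chart g (y t) \o y) t).
  by apply: (is_derive_ext _ _ D) => // s; rewrite /= logK.
have [l' Dl [_ e']] := lift_speed E ct' cl D'.
exists l'; first exact: Dl.
rewrite (speed_chart ct cy D) /speed2 logK; congr Num.sqrt.
exact: (bilin_congr (metric g (y t)) (erefl _) (esym e') (esym e')).
Qed.

Let N2 v := bilin G0 v v.
Let io : chart_img g o (chart g o o). Proof. by apply: chart_img_chart; exact: chart_dom_center. Qed.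
Let sG := Defs.metric_sym io.
Let pG := metric_inv_pos io.

Lemma is_derive_form (l : R -> V) (t : R) (l' : V) : is_derive t 1 l l' ->
  is_derive t 1 (fun s => bilin G0 (l s) (l s)) (2 * bilin G0 (l t) l').
Proof.
move=> D; have io' : chart_img g o ((fun _ : R => chart g o o) t) by exact: io.
apply: (is_derive_ext _ _ (is_derive_metric io' (is_derive_cst_fun (chart g o o) t) D D)); first by [].
by rewrite /= !chr0l !addr0 (bilinC l' _ sG); ring.
Qed.

Lemma is_derive_sqrt_comp (f : R -> R) (t f' : R) : 0 < f t -> is_derive t 1 f f' ->
  is_derive t 1 (fun s => Num.sqrt (f s)) (f' / (2 * Num.sqrt (f t))).
Proof.
move=> f0 D; apply: (is_derive_ext _ _ (@is_derive1_comp R Num.sqrt f t _ _ (is_derive1_sqrt f0) D)) => //.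
by rewrite mulrC.
Qed.

Lemma ratio_le_sqrt (b N F S S2 : R) : 0 <= F -> 0 < S -> S ^+ 2 = S2 -> S2 = 1 + N -> b ^+ 2 <= N * F ->
  `|(0 + 2 * b) / (2 * S)| <= Num.sqrt F.
Proof.
move=> F0 S0 eS eS2 h; apply: le_sqrt_sqr; first by [].
rewrite add0r (_ : 2 * b / (2 * S) = b / S); last by field; rewrite gt_eqF.
rewrite real_normK ?num_real// expr_div_n ler_pdivrMr ?exprn_gt0// eS eS2.
by apply: (le_trans h); rewrite mulrC ler_wpM2l// lerDr.
Qed.

(** The scalar part of [direction_lip]: [F] is a squared speed, [ll] the squared length of the
    lifted velocity, [ww] that of its part normal to the ray, [rr] the radius. The last hypothesis
    is the Rauch bound, and radii [rr] are relaxed to their lower bound [R1]. *)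
Lemma ratio_le_expR (sc R1 rr w B ww F b ll : R) : 0 <= sc -> 0 < rr -> 0 <= F -> 0 < B -> 0 <= ww ->
  R1 <= rr -> w ^+ 2 <= B * ww -> ww * rr ^+ 2 = ll * rr ^+ 2 - b ^+ 2 ->
  (ll * rr ^+ 2 - b ^+ 2) * expR (2 * (sc * rr) - 2) <= sc ^+ 2 * rr ^+ 2 * (F * rr ^+ 2 - b ^+ 2) ->
  `|w / rr| <= Num.sqrt (B * sc ^+ 2) * expR (1 - sc * R1) * Num.sqrt F.
Proof.
move=> c0 rr0 F0 B0 w0 Rt wi ww_ h; set X := expR (2 * _ - 2) in h.
have X0 : 0 < X by exact: expR_gt0.
have r2 : 0 < rr ^+ 2 by exact: exprn_gt0.
have wF : ww * X <= sc ^+ 2 * (rr ^+ 2 * F).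
  rewrite -(ler_pM2r r2) mulrAC ww_; apply: (le_trans h).
  have b2 := sqr_ge0 b.
  rewrite (_ : sc ^+ 2 * (rr ^+ 2 * F) * rr ^+ 2 = sc ^+ 2 * rr ^+ 2 * (F * rr ^+ 2)); last by ring.
  by apply: ler_wpM2l; [rewrite mulr_ge0 ?sqr_ge0|rewrite gerBl].
rewrite -(ler_pXn2r (ltn0Sn 1)) ?nnegrE ?normr_ge0 ?mulr_ge0 ?sqrtr_ge0 ?expR_ge0//.
have B2 : 0 <= B * sc ^+ 2 by rewrite mulr_ge0 ?sqr_ge0// ltW.
rewrite real_normK ?num_real// expr_div_n ler_pdivrMr// !exprMn !sqr_sqrtr//.
have Y : 1 <= expR (1 - sc * R1) ^+ 2 * X.
  rewrite -expRM_natl -expRD -[leLHS]expR0 ler_expR.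
  have : sc * R1 <= sc * rr by rewrite ler_wpM2l.
  lra.
apply: (le_trans wi); rewrite -(ler_pM2r X0).
set Z := expR _ ^+ 2 in Y *.
apply: (@le_trans _ _ (B * (sc ^+ 2 * (rr ^+ 2 * F)))); first by rewrite -mulrA ler_wpM2l// ltW.
rewrite (_ : B * sc ^+ 2 * Z * F * rr ^+ 2 * X = B * (sc ^+ 2 * (rr ^+ 2 * F)) * (Z * X)); last by ring.
by rewrite ler_peMr// mulr_ge0 ?(ltW B0)// mulr_ge0 ?sqr_ge0// mulr_ge0// ltW.
Qed.

Lemma is_derive_quot (a f : R -> R) (t a' f' : R) : f t != 0 -> is_derive t 1 a a' -> is_derive t 1 f f' ->
  is_derive t 1 (fun s => a s / f s) ((a' - f' / f t * a t) / f t).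
Proof.
move=> f0 Da Df; have Dv := is_deriveV f0 Df.
apply: (is_derive_ext _ _ (is_deriveM Da Dv)); first by move=> s.
by rewrite /GRing.scale /= -exprVn; field.
Qed.

(* Smoothing the radius at o makes it 1-Lipschitz everywhere. *)
Definition radius1 (x : M) : R := Num.sqrt (1 + bilin G0 (log x) (log x)).

(** The derivative along a curve is the pairing of log with its velocity over the smoothed radius;
    the Gauss inequality bounds it by the speed. *)
Lemma radius1_lip : speed_lip g (fun=> True) 1 radius1.
Proof.
move=> y t C _; have [l' D es] := log_derive C.
have N0 : 0 <= N2 (log (y t)) by exact: bilin_ge0.
have Df := is_deriveD (is_derive_cst_fun (1 : R) t) (is_derive_form D).
have f0 : 0 < 1 + bilin G0 (log (y t)) (log (y t)) by rewrite ltr_wpDr.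
have := @is_derive_sqrt_comp (fun s => 1 + bilin G0 (log (y s)) (log (y s))) t _ f0 Df => Ds.
exists ((0 + 2 * bilin G0 (log (y t)) l') / (2 * Num.sqrt (1 + bilin G0 (log (y t)) (log (y t))))); first exact: Ds.
rewrite mul1r es.
have ct : chart_dom g (y t) (e (log (y t))) by rewrite logK; exact: chart_dom_center.
have := exp_gauss E l' ct; rewrite /=.
set u := 'D_l' _ (log (y t)); set F := bilin (metric g (y t) _) u u => h.
have F0 : 0 <= F by apply: bilin_ge0; apply: metric_inv_pos; exact: chart_img_chart.
set S := Num.sqrt (1 + _); have S0 : 0 < S by rewrite sqrtr_gt0.
exact: (ratio_le_sqrt F0 S0 (sqr_sqrtr (ltW f0)) (erefl _) h).
Qed.

Definition direction (i : 'I_n) (x : M) : R := log x 0 i / Num.sqrt (bilin G0 (log x) (log x)).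

(** The derivative of a unit direction is the part [w] of the lifted velocity normal to the ray,
    divided by the radius. On normal parts the exponential map expands exponentially, so motion of
    bounded speed in [M] turns the direction very slowly. *)
Lemma direction_lip (i : 'I_n) (B R1 : R) : 0 < B -> 0 <= c -> (forall v : V, `|v| ^+ 2 <= B * bilin G0 v v) ->
  1 <= Num.sqrt c * R1 ->
  speed_lip g (fun x => R1 <= Num.sqrt (bilin G0 (log x) (log x))) (Num.sqrt (B * c) * expR (1 - Num.sqrt c * R1)) (direction i).
Proof.
move=> B0 c0 HB cR1 y t C Rt; have [l' D es] := log_derive C.
set l := log (y t) in Rt es *.
have R10 : 0 < R1.
  rewrite ltNge; apply/negP => R1n; have : Num.sqrt c * R1 <= 0 by rewrite mulr_ge0_le0// sqrtr_ge0.
  by move=> /(le_trans cR1); rewrite ler10.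
set rr := Num.sqrt (bilin G0 l l) in Rt; have rr0 : 0 < rr by exact: lt_le_trans Rt.
have N0 : 0 < bilin G0 l l by rewrite -sqrtr_gt0.
have rr2 : rr ^+ 2 = bilin G0 l l by exact: (sqr_sqrtr (ltW N0)).
have Dr := @is_derive_sqrt_comp (fun s => bilin G0 (log (y s)) (log (y s))) t _ N0 (is_derive_form D).
have rn : rr != 0 by rewrite gt_eqF.
have Di : is_derive t 1 (fun s => log (y s) 0 i) (l' 0 i) by exact: (is_derive_coord i D).
have Dd := @is_derive_quot (fun s => log (y s) 0 i) (fun s => Num.sqrt (bilin G0 (log (y s)) (log (y s)))) t _ _ rn Di Dr.
pose b := bilin G0 l l'.
pose w := l' - (b / rr ^+ 2) *: l.
exists (w 0 i / rr).
  apply: (is_derive_ext _ _ Dd); first by move=> s.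
  have -> : w 0 i = l' 0 i - (b / rr ^+ 2) * l 0 i by rewrite /w !mxE.
  rewrite -/l -/rr -/b.
  by move: (l 0 i) (l' 0 i) (b) => a1 a2 a3; field.
have ct : chart_dom g (y t) (e l) by rewrite /l logK; exact: chart_dom_center.
have sE : Num.sqrt (c * bilin G0 l l) = Num.sqrt c * rr by exact: sqrtrM.
have mu1 : 1 <= Num.sqrt (c * bilin G0 l l).
  by rewrite sE; apply: (le_trans cR1); rewrite ler_wpM2l ?sqrtr_ge0.
have h := exp_rauch E l' ct mu1.
rewrite es; move: h; set u := 'D_l' _ l; set F := bilin (metric g (y t) _) u u; rewrite sE -rr2 -/b => h.
have F0 : 0 <= F by apply: bilin_ge0; apply: metric_inv_pos; exact: chart_img_chart.
have w2 : bilin G0 w w * rr ^+ 2 = bilin G0 l' l' * rr ^+ 2 - b ^+ 2.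
  have -> : bilin G0 w w = bilin G0 l' l' - (b / rr ^+ 2) * b - (b / rr ^+ 2) * b + (b / rr ^+ 2) * (b / rr ^+ 2) * rr ^+ 2.
    rewrite /w; move: (b / rr ^+ 2) => k; rewrite rr2 /b !bilinDl !bilinDr !bilinNl !bilinNr !bilinZl !bilinZr (bilinC l' l sG).
    move: (bilin G0 l l) (bilin G0 l l') (bilin G0 l' l') => a1 a2 a3; ring.
  by move: (bilin G0 l' l') (b) => a1 a2; field.
have wi : w 0 i ^+ 2 <= B * bilin G0 w w.
  apply: le_trans (HB w); rewrite -(real_normK (num_real (w 0 i))).
  by apply: lerXn2r; rewrite ?nnegrE; [exact: normr_ge0|exact: normr_ge0|exact: coord_le_norm].
have wge : 0 <= bilin G0 w w by exact: bilin_ge0.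
have sc2 : Num.sqrt c ^+ 2 = c by exact: sqr_sqrtr.
have H := ratio_le_expR (sqrtr_ge0 c) rr0 F0 B0 wge Rt wi w2; rewrite sc2 in H.
exact: (H h).
Qed.
End Logarithm.

Lemma finite_union_measure (R : realType) d (T : measurableType d) (mu : {measure set T -> \bar R}) (I : finType)
  (A : I -> set T) (b : R) : (forall i, measurable (A i)) -> trivIset [set: I] A ->
  (forall i, (b%:E <= mu (A i))%E) -> (forall i, (mu (A i) < +oo)%E) ->
  exists U : set T, [/\ measurable U, (#|I|%:R * b)%:E <= mu U, mu U < +oo & forall z, U z -> exists i, A i z]%E.
Proof.
move=> mA tA lA fA; pose F (i : 'I_#|I|) := A (enum_val i).
have mF i : measurable (F i) by exact: mA.
have tF : trivIset [set: 'I_#|I|] F.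
  move=> i j _ _ h; apply: enum_val_inj; exact: (tA _ _ Logic.I Logic.I h).
have mU := measure_bigsetU_ord mu xpredT mF tF.
exists (\big[setU/set0]_(i < #|I|) F i); split.
- by apply: bigsetU_measurable => i _; exact: mF.
- rewrite mU; apply: (@le_trans _ _ (\sum_(i < #|I|) b%:E)%E); last by apply: lee_sum => i _; exact: lA.
  by rewrite sumEFin lee_fin sumr_const card_ord mulr_natl.
- by rewrite mU; apply/lte_sum_pinfty => i _; exact: fA.
- elim/big_ind: _ => [//|X Y HX HY z [/HX|/HY] //|i _ z h]; by exists (enum_val i).
Qed.

Lemma natr_dist_ge1 (R : numDomainType) (a b : nat) : a != b -> 1 <= `|a%:R - b%:R : R|.
Proof.
wlog: a b / (a < b)%N => [H ab|ab _].
  by have [/H|/H|e] := ltngtP a b; [exact|rewrite distrC eq_sym; exact|rewrite e eqxx in ab].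
by rewrite distrC -natrB ?(ltnW ab)// normr_nat ler1n subn_gt0.
Qed.

Section Packing.
Variables (R : realType) (n : nat) (M : ptopologicalType) (g : riemannian R n.+1 M).
Variable mu : {sigma_finite_measure set (g_sigma_algebraType (@open M)) -> \bar R}.
Local Notation V := 'rV[R]_n.+1.
Variables (c : R) (o : M) (e : V -> M) (log : M -> V).
Hypotheses (E : exponential_map g c o e) (logK : cancel log e) (expK : cancel e log) (c0 : 0 < c).
Local Notation G0 := (metric g o (chart g o o)).
Let io : chart_img g o (chart g o o). Proof. by apply: chart_img_chart; exact: chart_dom_center. Qed.
Let sG := Defs.metric_sym io.
Let pG := metric_inv_pos io.

(** The image of a closed ball of tangent vectors is compact. The threshold [d0] depends on r in an
    uncontrolled way. *)
Lemma uniform_small_balls (kappa r : R) :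
  (forall p : M, \forall q \near p & d \near (0 : R)^'+, small_ball g mu kappa d q) ->
  exists2 d0 : R, 0 < d0 & forall v : V, `|v| <= r -> forall d, 0 < d < d0 -> small_ball g mu kappa d (e v).
Proof.
move=> H; pose K := [set v : V | `|v| <= r].
have cK : compact K.
  apply: bounded_closed_compact.
    exists r; split; first exact: num_real.
    by move=> k rk v /= vr; exact: le_trans vr (ltW rk).
  have -> : K = (fun v : V => `|v|) @^-1` [set x | x <= r] by [].
  apply: preimage_closed; last exact: closed_le.
  by move=> v _; exact: norm_continuous.
have ce : compact (e @` K).
  apply: continuous_compact => //; apply: continuous_subspaceT => v; exact: (exp_continuous E).
have := (compact_near_coveringP _).1 ce R (0 : R)^'+ (fun d q => small_ball g mu kappa d q) _.
move=> /(_ _ (fun x _ => H x)) [] // d0 /= d00 Hd.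
exists d0 => // v vr d /andP[dp dd]; apply: (Hd d _ dp); last by exists v.
by rewrite /ball_ /= sub0r normrN gtr0_norm.
Qed.

Variable B : R.
Hypotheses (B1 : 1 <= B) (HB : forall v : V, `|v| ^+ 2 <= B * bilin G0 v v)
  (HB' : forall v : V, bilin G0 v v <= B * `|v| ^+ 2).
Let B0 : 0 < B. Proof. exact: lt_le_trans ltr01 B1. Qed.

Lemma radius1_bounds (x : M) (s : R) : bilin G0 (log x) (log x) = s ^+ 2 -> 1 <= s ->
  s <= radius1 g o log x <= 2 * s /\ radius1 g o log x ^+ 2 = 1 + s ^+ 2.
Proof.
move=> xs s1; have s0 : 0 <= s by exact: le_trans ler01 s1.
have q0 : 0 <= 1 + s ^+ 2 by rewrite addr_ge0 ?sqr_ge0.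
rewrite /radius1 xs; split; last exact: sqr_sqrtr.
have rE := sqr_sqrtr q0; have r0 := sqrtr_ge0 (1 + s ^+ 2).
apply/andP; split; rewrite -ler_sqr ?nnegrE ?mulr_ge0// rE; first by rewrite lerDr.
by rewrite exprMn; have := lerXn2r 2 ler01 s0 s1; rewrite !expr2; lra.
Qed.

(** Beyond radius 1 the smoothed radius lies between the radius and its double, so passing from one
    to the other costs a factor 2. *)
Lemma radial_separation (x x' : M) (s s' L : R) :
  bilin G0 (log x) (log x) = s ^+ 2 -> bilin G0 (log x') (log x') = s' ^+ 2 -> 1 <= s -> 1 <= s' ->
  curve_length g x x' L -> `|s - s'| <= 2 * L.
Proof.
move=> xs xs' s1 s1' cl.
have := curve_lip_global ler01 (radius1_lip E logK expK) cl; rewrite mul1r.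
have [/andP[a1 a2] a3] := radius1_bounds xs s1; have [/andP[b1 b2] b3] := radius1_bounds xs' s1'.
move: a1 a2 a3 b1 b2 b3; set p := radius1 _ _ _ x; set q := radius1 _ _ _ x' => a1 a2 a3 b1 b2 b3.
move=> h; have s0 : 0 < s by exact: lt_le_trans ltr01 s1.
have s0' : 0 < s' by exact: lt_le_trans ltr01 s1'.
have ss : 0 < s + s' by exact: addr_gt0.
have eq : (s - s') * (s + s') = (p - q) * (p + q).
  have : p ^+ 2 - q ^+ 2 = s ^+ 2 - s' ^+ 2 by rewrite a3 b3; ring.
  by move=> H; rewrite -subr_sqr -H subr_sqr.
have := congr1 Num.norm eq; rewrite !normrM (gtr0_norm ss) (gtr0_norm (_ : 0 < p + q)); last first.
  by apply: (lt_le_trans ss); exact: lerD.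
move=> {}eq; rewrite -(ler_pM2r ss) eq.
apply: (@le_trans _ _ (L * (p + q))); first by apply: ler_wpM2r => //; exact: le_trans (ltW ss) (lerD a1 b1).
rewrite -mulrA [2 * _]mulrC -mulrA ler_wpM2l ?(curve_length_ge0 cl)//.
by rewrite mulrDl ![_ * 2]mulrC; exact: lerD.
Qed.

(** A curve of length at most 1 from radius at least r keeps the smoothed radius above r - 1, hence
    the true radius above r - 2, where [direction_lip] applies. *)
Lemma angular_lip (r L : R) (x x' : M) (s : R) (i : 'I_n.+1) :
  3 <= r -> 1 <= Num.sqrt c * (r - 2) -> bilin G0 (log x) (log x) = s ^+ 2 -> r <= s ->
  curve_length g x x' L -> L <= 1 ->
  `|direction g o log i x - direction g o log i x'| <= Num.sqrt (B * c) * expR (1 - Num.sqrt c * (r - 2)) * L.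
Proof.
move=> r3 cr xs rs cl L1; have s1 : 1 <= s by apply: le_trans rs; lra.
apply: (@curve_lip _ _ _ g _ (radius1 g o log) _ (r - 1) _ (radius1_lip E logK expK) _ _ _ _ cl).
- by rewrite mulr_ge0 ?sqrtr_ge0 ?expR_ge0.
- move=> y t C h; apply: (direction_lip E logK expK i B0 (ltW c0) HB cr C).
  have q0 := bilin_ge0 (log (y t)) pG; move: h; rewrite /radius1; move: (bilin G0 _ _) q0 => q q0 h.
  have r2 : 0 <= r - 2 by lra.
  rewrite -ler_sqr ?nnegrE ?sqrtr_ge0// sqr_sqrtr//.
  have r1 : 0 <= r - 1 by lra.
  have q1 : 0 <= 1 + q by rewrite addr_ge0.
  move: h; rewrite -(ler_sqr r1 (sqrtr_ge0 _)) (sqr_sqrtr q1) !expr2 => h; nra.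
- have [/andP[h _] _] := radius1_bounds xs s1; lra.
Qed.

(** Directions are parametrized projectively: the vector (1, y) is normalized to length [s]. The
    factor [p] is the inverse of its length before scaling by [s], bounded below because all its
    entries are at most 1. *)
Lemma grid_vector (s : R) (y : 'I_n -> R) : 1 <= s -> (forall i, 0 <= y i <= 1) ->
  exists v : V, exists p : R, [/\ bilin G0 v v = s ^+ 2, v 0 ord0 / s = p,
    forall i, v 0 (lift ord0 i) / s = y i * p & 1 <= Num.sqrt B * p].
Proof.
move=> s1 Hy; have s0 : 0 < s by exact: lt_le_trans ltr01 s1.
pose u : V := \row_j oapp y 1 (unlift ord0 j).
have u0 : u 0 ord0 = 1 by rewrite mxE unlift_none.
have ui i : u 0 (lift ord0 i) = y i by rewrite mxE liftK.
have u1 : 1 <= `|u| by rewrite -[leLHS]normr1 -u0; exact: coord_le_norm.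
have u1' : `|u| <= 1.
  apply: rV_norm_le => // j; rewrite mxE; case: unliftP => [i _|_] /=; last by rewrite normr1.
  by have /andP[a b] := Hy i; rewrite ger0_norm.
have N1 : 1 <= B * bilin G0 u u by apply: le_trans (HB u); rewrite exprn_ege1.
have N2 : 0 < bilin G0 u u by rewrite -(pmulr_rgt0 _ B0); exact: lt_le_trans ltr01 N1.
pose N := Num.sqrt (bilin G0 u u); have N0 : 0 < N by rewrite sqrtr_gt0.
have NE : N ^+ 2 = bilin G0 u u by exact: sqr_sqrtr (ltW N2).
have Nn : N != 0 by rewrite gt_eqF.
have sn : s != 0 by rewrite gt_eqF.
exists ((s / N) *: u), N^-1; split.
- by rewrite bilinZl bilinZr -NE; field.
- by rewrite mxE u0; field; rewrite Nn.
- by move=> i; rewrite mxE ui; field; rewrite Nn.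
- rewrite ler_pdivlMr// mul1r -ler_sqr ?nnegrE ?sqrtr_ge0 ?(ltW N0)// NE sqr_sqrtr ?(ltW B0)//.
  apply: (le_trans (HB' u)); rewrite ler_piMr ?(ltW B0)//; exact: exprn_ile1.
Qed.

(** Two directions carry different normalizing factors p and q; the distinguished coordinate
    compares these factors, after which the other coordinates yield y. *)
Lemma angle_recover (y y' p q delta b : R) : 0 < b -> 1 <= b * p -> 0 <= y' <= 1 -> `|p - q| <= delta ->
  `|y * p - y' * q| <= delta -> `|y - y'| <= 2 * b * delta.
Proof.
move=> b0 bp /andP[y0 y1] h0 h1; have p0 : 0 < p by rewrite -(pmulr_rgt0 _ b0); exact: lt_le_trans ltr01 bp.
have h : `|y - y'| * p <= 2 * delta.
  rewrite -{1}(gtr0_norm p0) -normrM (_ : (y - y') * p = (y * p - y' * q) - y' * (p - q)); last by ring.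
  apply: (le_trans (ler_normB _ _)); rewrite normrM (ger0_norm y0).
  have : y' * `|p - q| <= `|p - q| by rewrite ler_piMl.
  lra.
apply: (@le_trans _ _ (b * (`|y - y'| * p))).
  by rewrite mulrCA ler_peMr.
rewrite (_ : 2 * b * delta = b * (2 * delta)); last by ring.
by rewrite ler_pM2l.
Qed.

Lemma exp_radial_center (w : V) :
  curve_length g (e w) o (Num.sqrt (bilin G0 w w)) /\ curve_length g o (e w) (Num.sqrt (bilin G0 w w)).
Proof.
have i0 : 0 <= (0 : R) <= 1 by rewrite lexx ler01.
have i1 : 0 <= (1 : R) <= 1 by rewrite lexx ler01.
have a1 := exp_radial E w i1 i0; have a2 := exp_radial E w i0 i1.
by move: a1 a2; rewrite scale1r scale0r (exp0 E) subr0 sub0r normrN normr1 mulr1.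
Qed.

Lemma truncn_half (x : R) : 2 <= x -> x / 2 <= (Num.trunc x)%:R <= x.
Proof.
move=> x2; have x0 : 0 <= x by exact: le_trans x2.
by have /andP[a b] := truncn_itv x0; rewrite a andbT; move: b; rewrite -natr1; lra.
Qed.

Lemma packing (kappa : R) : 0 < kappa ->
  (forall p : M, \forall q \near p & d \near (0 : R)^'+, small_ball g mu kappa d q) ->
  exists2 C5 : R, 0 < C5 & exists r0 : R, forall r, r0 <= r ->
    exists A : set (g_sigma_algebraType (@open M)),
    [/\ measurable A, ((C5 * expR (Num.sqrt c * r) ^+ n)%:E <= mu A)%E, (mu A < +oo)%E &
    forall z z' : M, A z -> A z' -> exists2 L, curve_length g z z' L & L <= 2 * r + 4].
Proof.
move=> kappa0 Hsb; pose sc := Num.sqrt c; have sc0 : 0 < sc by rewrite sqrtr_gt0.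
pose b := Num.sqrt B; have b0 : 0 < b by rewrite sqrtr_gt0.
(* The angular Lipschitz constant at radius r - 2 is [k1] divided by exp(sc r), so [k1] is its part
   free of r. *)
pose k1 := Num.sqrt (B * c) * expR (1 + 2 * sc).
have k10 : 0 < k1 by rewrite mulr_gt0 ?expR_gt0// sqrtr_gt0 mulr_gt0.
have k1def : Num.sqrt (B * c) * expR (1 + 2 * sc) = k1 by [].
clearbody k1.
exists (kappa / 8 / (8 * b * k1) ^+ n).
  apply: divr_gt0; first exact: divr_gt0.
  by apply: exprn_gt0; rewrite !mulr_gt0.
exists (3 + sc^-1) => r r0.
have r3 : 3 <= r by apply: le_trans r0; rewrite lerDl invr_ge0 ltW.
have cr : 1 <= sc * (r - 2).
  rewrite mulrC -ler_pdivrMr// mul1r; lra.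
pose k := Num.sqrt (B * c) * expR (1 - sc * (r - 2)).
have k0 : 0 < k by rewrite mulr_gt0 ?expR_gt0// sqrtr_gt0 mulr_gt0.
have kE : k = k1 / expR (sc * r).
  rewrite /k -k1def -mulrA -expRN -expRD; congr (_ * expR _); ring.
have kdef : Num.sqrt (B * c) * expR (1 - sc * (r - 2)) = k by [].
clearbody k.
have [d0 d00 Hd0] := uniform_small_balls (b * (r + 1)) Hsb.
(* The bounds ensure that small balls of radius d exist, and that the radial step 4 d and the
   angular step [eps] are at most 1/2, so that truncating the number of steps loses at most a factor
   2. *)
pose d := Num.min (d0 / 2) (Num.min (1 / 8) (1 / (8 * b * k))).
have bk0 : 0 < 8 * b * k by rewrite !mulr_gt0.
have d_gt0 : 0 < d by rewrite !lt_min !divr_gt0.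
have dd0 : d < d0.
  have : d <= d0 / 2 by rewrite ge_min lexx.
  by move=> /le_lt_trans; apply; rewrite ltr_pdivrMr// ltr_pMr// ltr1n.
have d8 : d <= 1 / 8 by rewrite !ge_min lexx orbT.
have dk : d <= 1 / (8 * b * k) by rewrite !ge_min lexx !orbT.
(* Centres joined by a curve of length L < 2 d have directions within k L, which [angle_recover]
   turns into less than 2 b k (2 d) = eps for the grid coordinates. *)
pose eps := 4 * b * k * d.
have eps0 : 0 < eps by rewrite !mulr_gt0.
have eps2 : eps <= 1 / 2.
  move: dk; rewrite ler_pdivlMr// /eps => h.
  rewrite (_ : 4 * b * k * d = d * (8 * b * k) / 2); [lra|by field].
pose Kc := Num.trunc (1 / (4 * d)); pose J := Num.trunc (1 / eps).
have d40 : 0 < 4 * d by rewrite mulr_gt0.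
have /andP[K1 K2] : 1 / (4 * d) / 2 <= Kc%:R <= 1 / (4 * d).
  by apply: truncn_half; rewrite ler_pdivlMr//; lra.
have /andP[J1 J2] : 1 / eps / 2 <= J%:R <= 1 / eps.
  by apply: truncn_half; rewrite ler_pdivlMr//; lra.
pose T := ('I_Kc * {ffun 'I_n -> 'I_J})%type.
(* Radii are 4 d apart because [radial_separation] loses a factor 2 on curves shorter than 2 d; all
   of them lie in [r, r + 1]. *)
pose s (t : T) := r + 4 * d * (t.1 : nat)%:R.
pose y (t : T) i := (t.2 i : nat)%:R * eps.
have sr t : r <= s t <= r + 1.
  rewrite /s lerDl mulr_ge0 ?(ltW d40)//= lerD2l mulrC -ler_pdivlMr//.
  by apply: le_trans K2; rewrite ler_nat ltnW.
have s1 t : 1 <= s t by have /andP[h _] := sr t; lra.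
have y01 t i : 0 <= y t i <= 1.
  rewrite /y mulr_ge0 ?(ltW eps0)//= -ler_pdivlMr//.
  by apply: le_trans J2; rewrite ler_nat ltnW.
have /choice [v Hv] := fun t => grid_vector (s1 t) (y01 t).
have Nv t : bilin G0 (v t) (v t) = s t ^+ 2 by have [p []] := Hv t.
have /choice [A HA] : forall t, small_ball g mu kappa d (e (v t)).
  move=> t; apply: Hd0; last by rewrite d_gt0.
  have st0 : 0 <= s t by exact: le_trans (s1 t).
  have /andP[_ sr1] := sr t.
  apply: (@le_trans _ _ (b * s t)); last by rewrite ler_pM2l.
  rewrite -ler_sqr ?nnegrE ?normr_ge0 ?mulr_ge0 ?(ltW b0)//.
  by apply: (le_trans (HB _)); rewrite exprMn -Nv sqr_sqrtr// ltW.
have xs t : bilin G0 (log (e (v t))) (log (e (v t))) = s t ^+ 2 by rewrite expK.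
have dir t i : direction g o log i (e (v t)) = v t 0 i / s t.
  by rewrite /direction expK Nv sqrtr_sqr ger0_norm// (le_trans _ (s1 t)).
have sep t t' L : curve_length g (e (v t)) (e (v t')) L -> L < 2 * d -> t = t'.
  move=> cl Ld; have /andP[rt _] := sr t.
  have L0 := curve_length_ge0 cl.
  have L1 : L <= 1 by lra.
  have ta : t.1 = t'.1.
    apply/val_inj/eqP => /=; apply: contraTT (radial_separation (xs t) (xs t') (s1 t) (s1 t') cl) => ne.
    rewrite -ltNge /s (_ : _ - _ = 4 * d * ((t.1 : nat)%:R - (t'.1 : nat)%:R)); last by ring.
    rewrite normrM gtr0_norm// (lt_le_trans (_ : _ < 4 * d))//; first by lra.
    rewrite ler_peMr ?(ltW d40)//; exact: natr_dist_ge1.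
  have tb : t.2 = t'.2.
    apply/ffunP => i; apply/val_inj/eqP => /=.
    have [p [_ pE pi bp]] := Hv t; have [q [_ qE qi _]] := Hv t'.
    have kL : k * L < k * (2 * d) by rewrite ltr_pM2l.
    have lip j := angular_lip j r3 cr (xs t) rt cl L1; rewrite kdef in lip.
    have hp : `|p - q| <= k * L by rewrite -pE -qE -!dir.
    have hi : `|y t i * p - y t' i * q| <= k * L by rewrite -pi -qi -!dir.
    have H := angle_recover b0 bp (y01 t' i) hp hi.
    apply/negPn/negP => ne; have := natr_dist_ge1 R ne.
    rewrite -(ler_pM2r eps0) mul1r -{2}(gtr0_norm eps0) -normrM mulrBl => /le_trans /(_ H).
    apply/negP; rewrite -ltNge /eps (_ : 4 * b * k * d = 2 * b * (k * (2 * d))); last by ring.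
    by rewrite ltr_pM2l// mulr_gt0.
  by rewrite [t]surjective_pairing [t']surjective_pairing ta tb.
have tA : trivIset [set: T] A.
  move=> t t' _ _ [z [At At']].
  have [_ _ _ /(_ z At) [_ [L cl Ld]]] := HA t.
  have [_ _ _ /(_ z At') [[L' cl' Ld'] _]] := HA t'.
  apply: (sep t t' (L + L') (curve_length_cat cl cl')); lra.
have [|||U [mU lU fU sU]] := finite_union_measure (b := kappa * d ^+ n.+1) (mu := mu) (A := A) _ tA.
- by move=> t; have [] := HA t.
- by move=> t; have [] := HA t.
- by move=> t; have [] := HA t.
exists U; split => //.
  apply: le_trans lU; rewrite lee_fin.
  (* At least 1 / (8 d) radii and 1 / (2 eps) values for each of the n angles: the n + 1 factors d
     in the volume of a ball are absorbed, and d disappears from the bound. *)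
  rewrite card_prod card_ffun !card_ord natrM natrX.
  have JD : expR (sc * r) / (8 * b * k1) <= J%:R * d.
    apply: (@le_trans _ _ (1 / eps / 2 * d)); last by rewrite ler_pM2r.
    rewrite le_eqVlt; apply/orP; left; apply/eqP; rewrite /eps kE.
    have e0 : expR (sc * r) != 0 by rewrite gt_eqF// expR_gt0.
    by move: (expR _) e0 => S S0; field; rewrite S0 !gt_eqF.
  have KD : 1 / 8 <= Kc%:R * d.
    apply: (@le_trans _ _ (1 / (4 * d) / 2 * d)); last by rewrite ler_pM2r.
    by rewrite le_eqVlt; apply/orP; left; apply/eqP; field; rewrite gt_eqF.
  have W0 : 0 <= expR (sc * r) / (8 * b * k1) by rewrite divr_ge0 ?expR_ge0// ltW// !mulr_gt0.
  have JDn : (expR (sc * r) / (8 * b * k1)) ^+ n <= (J%:R * d) ^+ n.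
    by apply: lerXn2r => //; rewrite nnegrE mulr_ge0 ?(ltW d_gt0).
  have W0n : 0 <= (expR (sc * r) / (8 * b * k1)) ^+ n by rewrite exprn_ge0.
  rewrite (_ : kappa / 8 / _ * _ = kappa * (1 / 8 * (expR (sc * r) / (8 * b * k1)) ^+ n)); last first.
    rewrite expr_div_n; have : (8 * b * k1) ^+ n != 0 by rewrite gt_eqF// exprn_gt0// !mulr_gt0.
    by move: (_ ^+ n) (_ ^+ n) => X Z Z0; field.
  rewrite (_ : _ * (kappa * _) = kappa * (Kc%:R * d * (J%:R * d) ^+ n)); last by rewrite exprMn exprS; ring.
  by rewrite ler_pM2l//; apply: ler_pM => //; lra.
move=> z z' /sU [t At] /sU [t' At'].
have [_ _ _ /(_ z At) [[L cl Ld] _]] := HA t.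
have [_ _ _ /(_ z' At') [_ [L' cl' Ld']]] := HA t'.
have [ra _] := exp_radial_center (v t); have [_ rb] := exp_radial_center (v t').
have st0 u : 0 <= s u by exact: le_trans (s1 u).
move: ra rb; rewrite !Nv !sqrtr_sqr !ger0_norm// => ra rb.
exists (L + (s t + (s t' + L'))).
  by do !(apply: curve_length_cat; first by eassumption); exact: cl'.
have /andP[_ h1] := sr t; have /andP[_ h2] := sr t'; lra.
Qed.
End Packing.

(** * Energy of uniform densities *)

Section UniformDensity.
Local Open Scope ereal_scope.

Lemma integral_patch_cst (R : realType) d (T : measurableType d) (nu : {measure set T -> \bar R}) (S : set T)
  (k s : R) : measurable S -> nu S = s%:E -> \int[nu]_x (cst k%:E \_ S) x = (k * s)%:E.
Proof. by move=> mS nS; rewrite -integral_mkcond integral_cst// nS -EFinM. Qed.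

(* F need not be measurable: h o d is not assumed to be. *)
Lemma integral_le_cst (R : realType) d (T : measurableType d) (nu : {measure set T -> \bar R}) (S : set T)
  (F : T -> \bar R) (c s : R) : measurable S -> nu S = s%:E -> (forall x, ~ S x -> F x = 0) ->
  (forall x, S x -> F x <= c%:E) -> \int[nu]_x F^\+ x < +oo /\ \int[nu]_x F x <= (c * s)%:E.
Proof.
move=> mS nS F0 Fc.
have cst_int (k : R) := integral_patch_cst k mS nS.
have neg0 : 0 <= \int[nu]_x F^\- x by apply: integral_ge0 => x _; exact: funeneg_ge0.
have [c0|c0] := leP 0%R c.
  have h : \int[nu]_x F^\+ x <= (c * s)%:E.
    rewrite -cst_int; apply: le_integral_ge0 => x; first exact: funepos_ge0.
    rewrite patchE funeposE; case: ifPn => [|xS]; first by rewrite inE => /Fc h; rewrite ge_max h lee_fin.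
    by rewrite F0 ?maxxx//; move/negP: xS; rewrite inE.
  split; first by apply: (le_lt_trans h); rewrite ltry.
  by rewrite integralE -[leRHS]adde0; apply: leeD => //; rewrite oppe_le0.
have P0 x : F^\+ x = 0.
  rewrite funeposE; apply/max_idPr; have [Sx|/F0 ->//] := pselect (S x).
  by apply: (le_trans (Fc _ Sx)); rewrite lee_fin ltW.
have i0 : \int[nu]_x F^\+ x = 0 by apply: integral0_eq => x _; exact: P0.
split; first by rewrite i0 ltry.
rewrite integralE i0 add0e leeNl -EFinN -mulNr -cst_int; apply: le_integral_ge0 => x.
  by rewrite patchE; case: ifP => // _; rewrite lee_fin oppr_ge0 ltW.
rewrite patchE; case: ifPn => [|_]; last exact: funeneg_ge0.
by rewrite inE => /Fc h; rewrite funenegE le_max EFinN leeN2 h.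
Qed.

Variables (R : realType) (n : nat) (M : ptopologicalType) (g : riemannian R n M).
Local Notation borelM := (g_sigma_algebraType (@open M)).
Variable mu : {sigma_finite_measure set borelM -> \bar R}.
Variable h : R -> \bar R.

Lemma geodesic_dist_ge0 (x y : M) L : curve_length g x y L -> (0 <= geodesic_dist g x y)%R.
Proof.
move=> cl; apply: lb_le_inf; first by exists L.
by move=> K; exact: curve_length_ge0.
Qed.

(** Both densities are bounded above by constants on a set of finite measure and vanish outside it,
    so their positive parts have finite integrals. This makes the energy well defined, though
    possibly -oo. *)
Lemma uniform_density (A : set borelM) (m b : R) : measurable A -> mu A = m%:E -> (0 < m)%R ->
  (forall z z', A z -> A z' -> h (geodesic_dist g z z') <= b%:E) ->
  exists sigma : borelM -> R, [/\ ac_density mu sigma, energy_defined g mu h sigma &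
    energy g mu h sigma <= (- ln m + b / 2)%:E].
Proof.
move=> mA Am m0 hb; pose sigma := fun x : borelM => (\1_A x / m)%R : R.
have sA x : A x -> sigma x = (m^-1)%R by move=> Ax; rewrite /sigma indicE mem_set// mul1r.
have sN x : ~ A x -> sigma x = 0%R by move=> Ax; rewrite /sigma indicE memNset// mul0r.
have m1 : (0 < m^-1)%R by rewrite invr_gt0.
have e0 x : ~ A x -> entropy_density sigma x = 0 by move=> /sN; rewrite /entropy_density => ->; rewrite mul0r.
have eA x : A x -> entropy_density sigma x <= (m^-1 * ln m^-1)%:E.
  by move=> /sA; rewrite /entropy_density => ->.
have [e1 e2] := integral_le_cst mA Am e0 eA.
have mAA : measurable (A `*` A) by exact: measurableX.
have AAm : (mu \x mu) (A `*` A) = (m * m)%:E by rewrite EFinM -Am; exact: product_measure1E.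
have i0 z : ~ (A `*` A) z -> interaction_density g h sigma z = 0.
  move=> Az; rewrite /interaction_density.
  suff -> : (sigma z.1 * sigma z.2)%R = 0%R by rewrite mule0.
  have [A1|/sN ->] := pselect (A z.1); last by rewrite mul0r.
  have [A2|/sN ->] := pselect (A z.2); last by rewrite mulr0.
  by case: Az.
have iA z : (A `*` A) z -> interaction_density g h sigma z <= (b * (m^-1 * m^-1))%:E.
  move=> [A1 A2]; rewrite /interaction_density (sA _ A1) (sA _ A2) [leRHS]EFinM.
  by apply: lee_wpmul2r; [rewrite lee_fin ltW// mulr_gt0|exact: hb].
have [i1 i2] := integral_le_cst mAA AAm i0 iA.
have mn : m != 0%R by rewrite gt_eqF.
exists sigma; split.
- split.
  + by apply: measurable_funM => //; exact: measurable_indic.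
  + by move=> x; have [/sA ->|/sN ->] := pselect (A x); rewrite ?lexx ?ltW.
  + rewrite (_ : \int[mu]_x _ = \int[mu]_x (cst (m^-1)%:E \_ A) x).
      by rewrite (integral_patch_cst _ mA Am) mulVf.
    apply: eq_integral => x _; rewrite patchE; case: ifPn => [/set_mem/sA ->//|xA].
    by rewrite sN// => /mem_set; exact/negP.
- split; [by left|by left|].
  apply: ltpinfty_adde_def; rewrite inE.
    by apply: (le_lt_trans e2); rewrite ltry.
  apply: (@le_lt_trans _ _ ((2^-1)%:E * (b * (m^-1 * m^-1) * (m * m))%:E)); last by rewrite -EFinM ltry.
  by apply: lee_wpmul2l => //; rewrite lee_fin.
- rewrite /energy EFinD; apply: leeD.
    apply: (le_trans e2); rewrite lee_fin lnV ?posrE//; rewrite le_eqVlt; apply/orP; left; apply/eqP.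
    by rewrite mulrN mulNr mulrAC mulVf// mul1r.
  apply: (@le_trans _ _ ((2^-1)%:E * (b * (m^-1 * m^-1) * (m * m))%:E)).
    by apply: lee_wpmul2l => //; rewrite lee_fin.
  by rewrite -EFinM lee_fin le_eqVlt; apply/orP; left; apply/eqP; field.
Qed.

(** The entropy part decreases with the measure and the interaction increases with the distance, so
    a lower bound m for the measure and an upper bound D for the lengths are enough. *)
Lemma minimizer_energy_le (rho : borelM -> R) :
  (forall s t, (0 <= s)%R -> (s <= t)%R -> h s <= h t) -> global_minimizer g mu h rho ->
  exists E0 : R, forall (A : set borelM) (D m b : R), measurable A -> m%:E <= mu A -> mu A < +oo -> (0 < m)%R ->
    (forall z z', A z -> A z' -> exists2 L, curve_length g z z' L & (L <= D)%R) -> h D <= b%:E ->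
    (E0 <= - ln m + b / 2)%R.
Proof.
move=> hnd [_ _ fE mE]; exists (fine (energy g mu h rho)) => A D m b mA lA fA m0 HD hb.
have fin : mu A \is a fin_num by rewrite ge0_fin_numE.
have Am : mu A = (fine (mu A))%:E by rewrite fineK.
have mm : (m <= fine (mu A))%R by rewrite -lee_fin -Am.
have [|sigma [ac df le]] := uniform_density (b := b) mA Am (lt_le_trans m0 mm).
  move=> z z' Az Az'; have [L cl LD] := HD z z' Az Az'.
  by apply: le_trans hb; apply: hnd; [exact: geodesic_dist_ge0 cl|exact: le_trans (dist_le cl) LD].
rewrite -lee_fin fineK//; apply: (le_trans (mE _ ac df)); apply: (le_trans le).
by rewrite lee_fin lerD2r lerN2 ler_ln ?posrE// (lt_le_trans m0).
Qed.
End UniformDensity.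

(** The upper limit is an infimum of suprema over sets of the filter, so one of these suprema is
    below +oo; the maximum with 0 makes it a real number even if it is -oo. *)
Lemma limf_esup_ltP (R : realType) (T : choiceType) (X : filteredType T) (f : X -> \bar R) (F : set (set X)) :
  Filter F -> (limf_esup f F < +oo)%E -> exists C : R, F [set x | (f x <= C%:E)%E].
Proof.
move=> FF; rewrite limf_esupE => /ereal_inf_lt [_ [V FV <-]] h.
pose C := fine (Order.max 0%E (ereal_sup [set f x | x in V])).
exists C; apply: filterS FV => x Vx /=.
rewrite /C fineK; last by rewrite ge0_fin_numE ?le_max ?lexx// gt_max h ltry.
by rewrite le_max; apply/orP; right; apply: ereal_sup_ubound; exists x.
Qed.

Lemma not_all_lower_bound (R : realType) (a C E0 x0 : R) : 0 < a -> ~ (forall x, x0 <= x -> E0 <= C - a * x).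
Proof.
move=> a0 H; have := H (Num.max x0 ((C - E0) / a + 1)); rewrite le_max lexx => /(_ isT).
apply/negP; rewrite -ltNge ltrBlDr -ltrBlDl mulrC -ltr_pdivrMr// lt_max; apply/orP; right.
by rewrite ltrDl.
Qed.

Theorem theorem2p1 (R : realType) (n : nat) (M : ptopologicalType)
  (g : riemannian R n M)
  (mu : {sigma_finite_measure set (g_sigma_algebraType (@open M)) -> \bar R})
  (cM : R) (h : R -> \bar R)
  (hM : cartan_hadamard g)
  (hmu : riemannian_volume g mu)
  (hcM : 0 < cM)
  (hK : sectional_curvature_le g (- cM))
  (h_lt_oo : forall t : R, 0 <= t -> (h t < +oo)%E)
  (h_nondecreasing : forall s t : R, 0 <= s -> s <= t -> (h s <= h t)%E)
  (h_lsc : lower_semicontinuous (h : subspace `[0, +oo[ -> \bar R))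
  (h_growth :
    (exists2 A1 : R, 2 * n%:R < A1 &
       (limf_esup (fun t : R => h t - (A1 * ln t)%:E) (0 : R)^'+ < +oo)%E) \/
    (exists2 A2 : R, A2 < n%:R - 1 &
       (limf_esup (fun t : R => h t - (A2 * Num.sqrt cM * t)%:E)
          (pinfty_nbhs R) < +oo)%E)) :
  ~ exists rho : g_sigma_algebraType (@open M) -> R, global_minimizer g mu h rho.
Proof.
move=> [rho /(minimizer_energy_le h_nondecreasing) [E0 HE]].
have [kappa kappa0 Hk] := small_balls hmu.
pose o : M := point.
have [d0 d00 Hd0] : exists2 d0 : R, 0 < d0 & forall d, 0 < d < d0 -> small_ball g mu kappa d o.
  have [[P Q] /= [oP oQ] PQ] := Hk o; have [d0 /= d00 Hd0] := oQ.
  exists d0 => // d /andP[dp dd]; apply: (PQ (o, d)); split => /=; first exact: nbhs_singleton.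
  by apply: Hd0 => //; rewrite /ball_ /= sub0r normrN gtr0_norm.
have ball_bound (d D b : R) : 0 < d < d0 -> 2 * d <= D -> (h D <= b%:E)%E -> E0 <= - ln (kappa * d ^+ n) + b / 2.
  move=> dd dD hb; have [A [mA lA fA HA]] := Hd0 d dd.
  have d1 : 0 < d by have /andP[] := dd.
  apply: (HE A D) => //; first by rewrite mulr_gt0// exprn_gt0.
  move=> z z' /HA [[L cl Ld] _] /HA [_ [L' cl' Ld']].
  exists (L + L'); first exact: curve_length_cat cl cl'.
  lra.
case: h_growth => [[A1 An /limf_esup_ltP [C [d1 /= d10 Hd1]]]|[A2 An /limf_esup_ltP [C [T [_ HT]]]]].
  have a0 : 0 < A1 / 2 - n%:R by lra.
  pose m := Num.min (d0 / 2) (d1 / 4).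
  have m0 : 0 < m by rewrite lt_min !divr_gt0.
  (* With balls of radius exp(- x) the bound on the energy is affine in x, of slope n - A1 / 2 <
     0. *)
  apply: (@not_all_lower_bound R _ (- ln kappa + (A1 * ln 2 + C) / 2) E0 (- ln m) a0) => x mx.
  have xm : expR (- x) <= m by rewrite -[leRHS](lnK m0) ler_expR lerNl.
  have x0 : 0 < expR (- x) by exact: expR_gt0.
  move: xm; rewrite le_min => /andP[xm1 xm2].
  have h1 : E0 <= - ln (kappa * expR (- x) ^+ n) + (A1 * ln (2 * expR (- x)) + C) / 2.
    apply: (ball_bound _ (2 * expR (- x))) => //; first by rewrite x0 /=; lra.
    rewrite EFinD addeC -leeBlDr//; apply: Hd1; last by rewrite mulr_gt0.
    by rewrite /ball_ /= sub0r normrN gtr0_norm ?mulr_gt0//; lra.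
  move: h1; rewrite !lnM ?posrE ?exprn_gt0// lnXn// expRK -mulr_natl; lra.
have sc0 : 0 < Num.sqrt cM by rewrite sqrtr_gt0.
have [A20|A20] := ltP A2 0.
  pose d := d0 / 2; have dd : 0 < d < d0 by rewrite divr_gt0//= ltr_pdivrMr// ltr_pMr// ltr1n.
  have a0 : 0 < - (A2 * Num.sqrt cM) / 2 by rewrite divr_gt0// -mulNr mulr_gt0// oppr_gt0.
  (* The ball stays fixed and only the bound x on its diameter grows: by monotonicity [h] at small
     distances is at most h(x), which tends to -oo. *)
  apply: (@not_all_lower_bound R _ (- ln (kappa * d ^+ n) + C / 2) E0 (Num.max (2 * d) (T + 1)) a0) => x.
  rewrite ge_max => /andP[x1 x2].
  have := ball_bound d x (A2 * Num.sqrt cM * x + C) dd x1; rewrite EFinD addeC -leeBlDr// => H.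
  have /H : (h x - (A2 * Num.sqrt cM * x)%:E <= C%:E)%E by apply: HT; lra.
  lra.
(* [packing] singles out one coordinate. Dimension 0 is impossible here, since it would force A2 <
   -1; from now on the dimension is n + 1. *)
case: n g mu hM hmu hK HE Hk An {h_lt_oo h_lsc ball_bound Hd0} => [|n] g mu [cg sg _] hmu hK HE Hk An.
  by move: An; rewrite sub0r => /(le_lt_trans A20); rewrite oppr_gt0 ltr10.
have [e E] := exponential_map_exists o cg (fun x y => manifold_connected g sg x y) (ltW hcM) hK.
have [surj inj] := exp_bijective E sg; have [log logK] := choice surj.
have expK : cancel e log by move=> v; apply: inj; exact: logK.
have [r1 [B [r10 B0 HB]]] := metric_bounds (chart_img_chart (chart_dom_center g o)).
have [_ HB0] : chart_img g o (chart g o o) /\ forall v, `|v| ^+ 2 <= B * bilin (metric g o (chart g o o)) v v /\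
    bilin (metric g o (chart g o o)) v v <= B * `|v| ^+ 2 by apply: HB; rewrite subrr normr0.
pose B' := Num.max 1 B.
have BB' : B <= B' by rewrite le_max lexx orbT.
have B1 : 1 <= B' by rewrite le_max lexx.
have HB1 v : `|v| ^+ 2 <= B' * bilin (metric g o (chart g o o)) v v.
  have [h1 _] := HB0 v; apply: (le_trans h1); apply: ler_wpM2r => //.
  by rewrite -(pmulr_rge0 _ B0); apply: le_trans h1; exact: sqr_ge0.
have HB2 v : bilin (metric g o (chart g o o)) v v <= B' * `|v| ^+ 2.
  by have [_ h2] := HB0 v; apply: (le_trans h2); apply: ler_wpM2r => //; exact: sqr_ge0.
have [C5 C50 [r0 Hr]] := packing E logK expK hcM B1 HB1 HB2 kappa0 Hk.
have nA : n.+1%:R - 1 = n%:R :> R by rewrite -natr1 addrK.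
rewrite nA in An.
have a0 : 0 < (n%:R - A2) * Num.sqrt cM by rewrite mulr_gt0// subr_gt0.
(* The entropy contributes - n sqrt(c) r and half the interaction at distance 2 r + 4 contributes A2
   sqrt(c) r, up to constants. *)
apply: (@not_all_lower_bound R _ (- ln C5 + (A2 * Num.sqrt cM * 4 + C) / 2) E0 (Num.max r0 (`|T| + 1)) a0) => r.
rewrite ge_max => /andP[rr0 rT].
have [A [mA lA fA HA]] := Hr r rr0.
have Tr : T < 2 * r + 4 by have := ler_norm T; have := normr_ge0 T; lra.
have := HE A (2 * r + 4) _ (A2 * Num.sqrt cM * (2 * r + 4) + C) mA lA fA _ HA.
rewrite mulr_gt0 ?exprn_gt0 ?expR_gt0// EFinD addeC -leeBlDr// => /(_ isT (HT _ Tr)).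
rewrite lnM ?posrE ?exprn_gt0 ?expR_gt0// lnXn ?expR_gt0// expRK -mulr_natl; lra.
Qed.
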